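(* Let $(X,\mathcal{X},\mu,T)$ be an invertible ergodic measure preserving system and let $p_1,\ldots,p_k$ be rationally independent integer polynomials with highest degree $d$. Let $f_0,f_1,\ldots,f_k\in L^\infty(\mu)$ and, for $n\in\mathbb{N}$, let $$a_n=\int f_0\cdot T^{p_1(n)}f_1\cdot\ldots\cdot T^{p_k(n)}f_k\ d\mu.$$ Then $\{a_n\}_{n\in\mathbb{N}}$ is the sum of a $d$-step nilsequence and a sequence that converges to zero in uniform density. Moreover, the $d$-step nilsequence can be chosen to be of the form $b_n=\phi(S^ne)$, where $S\colon G^d\to G^d$ is a unipotent affine transformation, $G$ is a compact abelian group, $\phi\colon G^d\to\mathbb{C}$ is continuous, and $e$ is the identity element of $G^d$.
   Context: A measure preserving system is a quadruple $(X,\mathcal{X},\mu,T)$ where $(X,\mathcal{X},\mu)$ is a probability space and $T\colon X\to X$ is measurable with $\mu(T^{-1}A)=\mu(A)$ for all $A\in\mathcal{X}$. $T$ acts on functions by $Tf=f\circ T$. The system is ergodic if every $f\in L^\infty(\mu)$ with $Tf=f$ is ($\mu$-a.e.) constant. An integer polynomial is a polynomial taking integer values on the integers. A family $p_1,\ldots,p_k$ of integer polynomials is rationally independent if every nontrivial integer combination of them is not constant. $\mathbb{N}=\{1,2,\ldots\}$. For an integer $m\ge 1$, an $m$-step nilmanifold is a quotient $X=G/\Gamma$ where $G$ is an $m$-step nilpotent Lie group and $\Gamma$ is a discrete cocompact subgroup. If $\phi\colon X\to\mathbb{C}$ is continuous, $a\in G$ and $x_0\in X$, the sequence $\{\phi(a^nx_0)\}_{n\in\mathbb{N}}$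 is a basic $m$-step nilsequence. An $m$-step nilsequence is a uniform limit of basic $m$-step nilsequences. A bounded complex sequence $\{a_n\}_{n\in\mathbb{N}}$ converges (tends) to zero in uniform density if $\lim_{N-M\to\infty}\frac{1}{N-M}\sum_{n=M}^{N-1}|a_n|=0$ (uniformly in $M\in\mathbb{N}$). An affine transformation of a compact abelian group $K$ (written additively) is a map $x\mapsto Ax+b$ with $A$ a continuous automorphism of $K$ and $b\in K$; it is unipotent if $A$ is unipotent, i.e. $(A-\mathrm{Id})^m=0$ for some $m\in\mathbb{N}$. *)

(* Defs.v *)
From HB Require Import structures.
From mathcomp Require Import all_boot all_order all_algebra.
From mathcomp Require Import archimedean generic_quotient complex.
From mathcomp Require Import all_classical all_reals all_analysis.

Set Implicit Arguments.
Unset Strict Implicit.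
Unset Printing Implicit Defensive.

Import Order.TTheory GRing.Theory Num.Theory.
Import numFieldNormedType.Exports.

Local Open Scope classical_set_scope.
Local Open Scope ring_scope.
Local Open Scope complex_scope.

Section Systems.
Context {disp : measure_display} {X : measurableType disp} {R : realType}.
Variable mu : probability X R.

Definition measure_preserving (T : X -> X) : Prop :=
  measurable_fun [set: X] T /\
  forall A : set X, measurable A -> mu (T @^-1` A) = mu A.

Definition invertible_system (T Tinv : X -> X) : Prop :=
  [/\ measure_preserving T, measurable_fun [set: X] Tinv,
      cancel T Tinv & cancel Tinv T].

(* The library only has real-valued L^oo; elements are represented by actual
   functions, and equality in L^oo is equality mu-almost everywhere. *)
Definition complex_Linfty (f : X -> R[i]) : Prop :=
  [/\ measurable_fun [set: X] (fun x => complex.Re (f x)),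
      measurable_fun [set: X] (fun x => complex.Im (f x)) &
      exists M : R, {ae mu, forall x, `|f x| <= M%:C}].

Definition ergodic (T : X -> X) : Prop :=
  forall f : X -> R[i], complex_Linfty f ->
    {ae mu, forall x, f (T x) = f x} ->
    exists c : R[i], {ae mu, forall x, f x = c}.

Definition complex_integral (f : X -> R[i]) : R[i] :=
  (\int[mu]_x complex.Re (f x)) +i* (\int[mu]_x complex.Im (f x)).

End Systems.

Definition iterz (X : Type) (T Tinv : X -> X) (z : int) : X -> X :=
  match z with
  | Posz n => iter n T
  | Negz n => iter n.+1 Tinv
  end.

Section IntegerPolynomials.
Context {R : realType}.

Definition integer_polynomial (p : {poly R}) : Prop :=
  forall z : int, p.[z%:~R] \is a Num.int.

(* For an integer polynomial the floor is the exact value. *)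
Definition poly_val (p : {poly R}) (n : nat) : int := Num.floor p.[n%:R].

Definition rationally_independent (k : nat) (p : 'I_k -> {poly R}) : Prop :=
  forall c : 'I_k -> int, (exists i, c i != 0) ->
    ~ exists r : R, \sum_(i < k) p i *~ c i = r%:P.

Definition highest_degree (k : nat) (p : 'I_k -> {poly R}) : nat :=
  \max_(i < k) (size (p i)).-1.

Definition correlation {disp : measure_display} {X : measurableType disp}
    (mu : probability X R) (T Tinv : X -> X) (k : nat) (p : 'I_k -> {poly R})
    (f0 : X -> R[i]) (f : 'I_k -> X -> R[i]) (n : nat) : R[i] :=
  complex_integral mu (fun x =>
    f0 x * \prod_(i < k) f i (iterz T Tinv (poly_val (p i) n) x)).

End IntegerPolynomials.

(* Sequences indexed by {1, 2, ...} are functions on nat whose value at 0 is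
   never looked at. *)
Definition null_in_uniform_density {R : realType} (a : nat -> R[i]) : Prop :=
  (exists M : R, forall n, (1 <= n)%N -> `|a n| <= M%:C) /\
  forall eps : R, 0 < eps -> exists L : nat, forall M N : nat,
    (1 <= M)%N -> (M < N)%N -> (L <= N - M)%N ->
    ((N - M)%:R)^-1 * \sum_(M <= n < N) `|a n| < eps%:C.

HB.mixin Record isTopologicalGroup G of Topological G & Group G := {
  mulg_continuous : continuous (fun x : G * G => (x.1 * x.2)%g);
  invg_continuous : continuous (fun x : G => x^-1%g)
}.

#[short(type="topologicalGroupType")]
HB.structure Definition TopologicalGroup :=
  {G of Topological G & Group G & isTopologicalGroup G}.

Section Smooth.
Context {R : realType} {m n : nat}.
Implicit Types (U : set 'rV[R]_m) (f : 'rV[R]_m -> 'rV[R]_n).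

(* Only meaningful for U open. *)
Fixpoint Ck_on (k : nat) U f : Prop :=
  (forall x, U x -> {for x, continuous f}) /\
  if k is k'.+1 then
    forall i : 'I_m, (forall x, U x -> derivable f x (delta_mx 0 i)) /\
                     Ck_on k' U ('D_(delta_mx 0 i) f)
  else True.

Definition smooth_on U f : Prop := forall k, Ck_on k U f.

End Smooth.

Section LieGroups.
Variables (R : realType) (G : topologicalGroupType).

Record chart (n : nat) := Chart {
  chart_dom : set G;
  chart_map : G -> 'rV[R]_n;
  chart_inv : 'rV[R]_n -> G
}.

Definition chart_img n (c : chart n) : set 'rV[R]_n :=
  chart_map c @` chart_dom c.

Definition is_chart n (c : chart n) : Prop :=
  [/\ open (chart_dom c), open (chart_img c),
      forall x, chart_dom c x -> chart_inv c (chart_map c x) = x,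
      forall x, chart_dom c x -> {for x, continuous (chart_map c)} &
      forall y, chart_img c y -> {for y, continuous (chart_inv c)}].

Definition smooth_atlas n (A : set (chart n)) : Prop :=
  [/\ forall c, A c -> is_chart c,
      forall x : G, exists2 c, A c & chart_dom c x &
      forall c c', A c -> A c' ->
        smooth_on [set y | chart_img c y /\ chart_dom c' (chart_inv c y)]
                  (fun y => chart_map c' (chart_inv c y))].

Definition smooth_mulg n (A : set (chart n)) : Prop :=
  forall c1 c2 c3, A c1 -> A c2 -> A c3 ->
    let prod (z : 'rV[R]_(n + n)) : G :=
      (chart_inv c1 (lsubmx z) * chart_inv c2 (rsubmx z))%g in
    smooth_on [set z | [/\ chart_img c1 (lsubmx z), chart_img c2 (rsubmx z)
                         & chart_dom c3 (prod z)]]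
              (fun z => chart_map c3 (prod z)).

Definition smooth_invg n (A : set (chart n)) : Prop :=
  forall c c', A c -> A c' ->
    let inv (y : 'rV[R]_n) : G := ((chart_inv c y)^-1)%g in
    smooth_on [set y | chart_img c y /\ chart_dom c' (inv y)]
              (fun y => chart_map c' (inv y)).

(* Finite-dimensional real Lie groups, not necessarily connected; the manifold
   is Hausdorff and second countable, and dimension 0 is allowed. *)
Definition is_lie_group : Prop :=
  [/\ hausdorff_space G, @second_countable G &
      exists n (A : set (chart n)),
        [/\ smooth_atlas A, smooth_mulg A & smooth_invg A]].

End LieGroups.

Section Nilpotent.
Variable G : groupType.

Definition generated_subgroup (A : set G) : set G :=
  [set x | forall H : groupClosed G, (forall a, A a -> a \in H) -> x \in H].

(* lower_central i is the (i+1)-st term of the lower central series. *)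
Fixpoint lower_central (i : nat) : set G :=
  if i is i'.+1 then
    generated_subgroup
      [set commg xy.1 xy.2 | xy in lower_central i' `*` [set: G]]
  else [set: G].

Definition nilpotent_of_step (m : nat) : Prop :=
  lower_central m = [set 1%g].

End Nilpotent.

Section Cosets.
Variables (G : topologicalGroupType) (Gamma : groupClosed G).
Local Open Scope quotient_scope.

Definition same_coset : rel G := fun x y => (x^-1 * y)%g \in Gamma.

Lemma same_coset_equiv : equiv_class_of same_coset.
Proof.
split=> [x|x y|y x z]; rewrite /same_coset.
- by rewrite mulVg gpred1.
- by rewrite -gpredV invgM invgK.
- by move=> xy yz; have := gpredM _ _ xy yz; rewrite mulgA mulgK.
Qed.

Canonical same_coset_equiv_rel := EquivRelPack same_coset_equiv.

(* G / Gamma, the space of left cosets g Gamma. *)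
Definition coset_space : topologicalType :=
  quotient_topology {eq_quot same_coset_equiv_rel}.

Definition coset_act (a : G) (x : coset_space) : coset_space :=
  \pi_({eq_quot same_coset_equiv_rel}) (a * repr x)%g.

Lemma coset_actE (a g : G) :
  coset_act a (\pi_({eq_quot same_coset_equiv_rel}) g) =
  \pi_({eq_quot same_coset_equiv_rel}) (a * g)%g.
Proof.
apply/eqmodP; rewrite /= /same_coset invgM -mulgA mulKg.
have /eqmodP : repr (\pi_({eq_quot same_coset_equiv_rel}) g) =
  g %[mod {eq_quot same_coset_equiv_rel}] by rewrite reprK.
by [].
Qed.

Definition discrete_subgroup : Prop :=
  forall g : G, g \in Gamma ->
    exists2 U : set G, open U & U `&` [set` Gamma] = [set g].

Definition is_nilmanifold (R : realType) (m : nat) : Prop :=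
  [/\ is_lie_group R G, nilpotent_of_step G m, discrete_subgroup &
      compact [set: coset_space]].

End Cosets.

(* R[i]^o carries the topology of the modulus; the bare type complex R has no
   topology attached. *)
Section Nilsequences.
Context {R : realType}.

Definition basic_nilsequence (m : nat) (b : nat -> R[i]) : Prop :=
  exists (G : topologicalGroupType) (Gamma : groupClosed G)
         (phi : coset_space Gamma -> R[i]) (a : G) (x0 : coset_space Gamma),
    [/\ is_nilmanifold Gamma R m, continuous (phi : _ -> R[i]^o) &
        forall n, (1 <= n)%N -> b n = phi (coset_act (a ^+ n)%g x0)].

Definition nilsequence (m : nat) (b : nat -> R[i]) : Prop :=
  exists c : nat -> nat -> R[i],
    (forall j, basic_nilsequence m (c j)) /\
    forall eps : R, 0 < eps ->
      \forall j \near \oo, forall n, (1 <= n)%N -> `|b n - c j n| < eps%:C.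

End Nilsequences.

Section UnipotentAffine.
Variable K : topologicalZmodType.

Definition continuous_automorphism (A : K -> K) : Prop :=
  [/\ {morph A : x y / x + y}, continuous A &
      exists B : K -> K, [/\ cancel A B, cancel B A & continuous B]].

Definition unipotent (A : K -> K) : Prop :=
  exists2 m : nat, (1 <= m)%N & forall x, iter m (fun y => A y - y) x = 0.

Definition unipotent_affine (S : K -> K) : Prop :=
  exists (A : K -> K) (b : K),
    [/\ continuous_automorphism A, unipotent A & forall x, S x = A x + b].

End UnipotentAffine.

(* G ^ d with pointwise addition and the product topology. *)
Section PowerGroup.
Variables (G : topologicalZmodType) (d : nat).

Definition power_group : Type := prod_topology (fun _ : 'I_d => G).

HB.instance Definition _ := Topological.copy power_group
  (prod_topology (fun _ : 'I_d => G)).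
HB.instance Definition _ := GRing.Zmodule.copy power_group ('I_d -> G).

Lemma power_group_sub_continuous :
  continuous (fun x : power_group * power_group => x.1 - x.2).
Proof.
move=> x; apply/cvg_sup => i; move: x.
apply/(@continuousP _ (initial_topology (fun f : 'I_d -> G => f i))).
move=> _ [B oB <-].
suff sub_i : continuous
    (fun x : power_group * power_group => x.1 i - x.2 i).
  by have /continuousP/(_ _ oB) := sub_i.
have proj_i : continuous (fun f : power_group => f i).
  exact: (@proj_continuous _ (fun _ : 'I_d => G) i).
move=> x.
apply: (@continuous_comp _ _ _
  (fun x : power_group * power_group => (x.1 i, x.2 i))
  (fun y : G * G => y.1 - y.2)); last exact: sub_continuous.
apply: cvg_pair => /=.
- apply: (@continuous_comp _ _ _ fst (fun f : power_group => f i)).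
    exact: cvg_fst.
  exact: proj_i.
- apply: (@continuous_comp _ _ _ snd (fun f : power_group => f i)).
    exact: cvg_snd.
  exact: proj_i.
Qed.

HB.instance Definition _ :=
  PreTopologicalNmodule_isTopologicalZmodule.Build power_group
    power_group_sub_continuous.

End PowerGroup.

(* Main.v *)
Require Import Defs.
From HB Require Import structures.
From mathcomp Require Import all_boot all_order all_algebra.
From mathcomp Require Import archimedean generic_quotient complex.
From mathcomp Require Import all_classical all_reals all_analysis.
From mathcomp Require Import measurable_realfun.
From mathcomp Require Import ring lra zify.

(** Call a function an eigenfunction if it is unimodular and invariant up to a
    constant.  The theorem has an ergodic half and a topological half.

    Ergodic half.  If one of the functions is orthogonal to all eigenfunctions
    then the correlation tends to zero in uniform density.  Granting this, replace
    each function by its projection on the closed algebra spanned by the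
    eigenfunctions: the correlation changes by a null sequence, and on the
    projections it is a uniform limit of sums of phases e(sum_i alpha_i p_i(n))
    ([projection], [decomposition]).

    Why eigenfunctions suffice ([eigenfunctions_characteristic]).  The statement
    proved is quantitative: if an average of a product of iterates along affinely
    independent polynomials, twisted by phases, is large, then each function
    correlates with an eigenfunction, with a bound that is uniform in the functions.
    It is proved by induction on the number of functions.
    - The van der Corput inequality and PET induction bound such averages by
      iterated difference means of one function ([control]).
    - A function of a large average may be replaced by the dual function, a limit of
      averages of products of iterates of the others ([dual_function]).  So we may
      assume that one function [F] is of this form, and that some difference mean of
      [F] is large.
    - Degree lowering ([degree_lowering]): a large difference mean of order [t + 2]
      says, by the inverse theorem for order two ([inverse_theorem]), that many
      derivatives of [F] correlate with eigenfunctions.  Unfolding one factor [F] in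
      each derivative as an average, the Cauchy-Schwarz inequality on boxes
      ([box_cauchy_schwarz]) produces averages of one function less, twisted by the
      eigenvalues.  By induction their functions may be taken to be eigenfunctions,
      so they are polynomial phases, and Weyl's theorem with the independence of the
      polynomials shows that the eigenvalues are roots of unity of bounded order
      ([order_bound_of_correlates]).  Only boundedly many eigenfunctions occur, so
      one of them serves a positive proportion of the derivatives and disappears in
      a further Cauchy-Schwarz inequality: the difference mean of order [t + 1] is
      large.
    - Repeating this, [F] correlates with an eigenfunction, which can be moved onto
      another function, leaving an average of one function less.
    Projections and dual functions are obtained as closest points in convex sets.
    This half only uses the algebra of bounded functions with its integral and
    shifts ([system]); the square of a system is another instance, on the product
    space, where correlations in modulus become correlations.

    Topological half.  By Newton's expansion the phases are the numbers
    e(sum_j beta_j C(n, j)) with [1 <= j <= d].  Let [G] be the product of circles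
    indexed by all real frequencies.  The unipotent affine map of [G ^ d] sending
    [(x_1, x_2, ...)] to [(x_1 + g, x_2 + x_1, x_3 + x_2, ...)], where [g] is the tuple
    of all phases at time one, moves 0 through the tuples of multiples [C(n, j) g]
    ([Kaffine_orbit]), so a sum of phases is a continuous function of the orbit point;
    clamping the increments of a rapidly convergent sequence of such sums yields a
    continuous function on [G ^ d] with the limit as its values on the orbit
    ([clamp_extension], [affine_realization]).  For the nilsequence, a sum of [J]
    phases is read off from the orbit of a translation on the quotient of a
    semidirect product of the integers with a vector space of dimension [J d], on
    which they act by a unipotent integer matrix, modulo its integer points
    ([newton_sum_basic]). *)

Set Implicit Arguments.
Unset Strict Implicit.
Unset Printing Implicit Defensive.

Import Order.TTheory GRing.Theory Num.Theory.
Import numFieldNormedType.Exports.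

Local Open Scope classical_set_scope.
Local Open Scope ring_scope.
Local Open Scope complex_scope.

(** * Moduli of complex numbers *)

Section Modulus.
Variable R : realType.
Implicit Types (z w : R[i]).

Definition cab z : R := Num.sqrt (complex.Re z ^+ 2 + complex.Im z ^+ 2).

Lemma normcab z : `|z| = (cab z)%:C.
Proof. exact: normc_def. Qed.

Lemma cab_ge0 z : 0 <= cab z.
Proof. exact: sqrtr_ge0. Qed.

Lemma cabM z w : cab (z * w) = cab z * cab w.
Proof. by apply: complexI; rewrite rmorphM /= -!normcab normrM. Qed.

Lemma cabD z w : cab (z + w) <= cab z + cab w.
Proof. by rewrite -lecR rmorphD /= -!normcab ler_normD. Qed.

Lemma cabN z : cab (- z) = cab z.
Proof. by apply: complexI; rewrite -!normcab normrN. Qed.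

Lemma cab0 : cab 0 = 0.
Proof. by apply: complexI; rewrite -!normcab normr0. Qed.

Lemma cab1 : cab 1 = 1.
Proof. by apply: complexI; rewrite -!normcab normr1. Qed.

Lemma cabJ z : cab (conjc z) = cab z.
Proof. by apply: complexI; rewrite -!normcab normcJ. Qed.

Lemma cab_real (x : R) : cab x%:C = `|x|.
Proof. by rewrite /cab /= expr0n addr0 sqrtr_sqr. Qed.

Lemma cab_eq0 z : (cab z == 0) = (z == 0).
Proof. by rewrite -(inj_eq (@complexI R)) -normcab normr_eq0. Qed.

Lemma cab_Re z : `|complex.Re z| <= cab z.
Proof. by rewrite -lecR -normcab normc_ge_Re. Qed.

Lemma cab_Im z : `|complex.Im z| <= cab z.
Proof. by rewrite /cab -sqrtr_sqr ler_wsqrtr // lerDr sqr_ge0. Qed.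

Lemma Re_mul z w : complex.Re (z * w) =
  complex.Re z * complex.Re w - complex.Im z * complex.Im w.
Proof. by case: z w => a b [c d]. Qed.

Lemma Im_mul z w : complex.Im (z * w) =
  complex.Re z * complex.Im w + complex.Im z * complex.Re w.
Proof. by case: z w => a b [c d]. Qed.

Lemma ReD z w : complex.Re (z + w) = complex.Re z + complex.Re w.
Proof. by case: z w => a b [c d]. Qed.

Lemma ReN z : complex.Re (- z) = - complex.Re z.
Proof. by case: z. Qed.

Lemma ReJ z : complex.Re (conjc z) = complex.Re z.
Proof. by case: z. Qed.

Lemma conj_real (x : R) : (conjc (x%:C)) = x%:C.
Proof. by rewrite /= oppr0. Qed.

Lemma conjM z w : (conjc (z * w)) = (conjc z) * (conjc w).
Proof. exact: (rmorphM (@conjc R)). Qed.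

Lemma conj_sum I (r : seq I) P (F : I -> R[i]) :
  (conjc (\sum_(i <- r | P i) F i)) = \sum_(i <- r | P i) (conjc (F i)).
Proof. exact: (rmorph_sum (@conjc R)). Qed.

Lemma Re_sum I (r : seq I) P (F : I -> R[i]) :
  complex.Re (\sum_(i <- r | P i) F i) = \sum_(i <- r | P i) complex.Re (F i).
Proof. by apply: big_morph => // -[? ?] [? ?]. Qed.

Lemma ReZ (x : R) z : complex.Re (x%:C * z) = x * complex.Re z.
Proof. by rewrite Re_mul mul0r subr0. Qed.

Lemma mulJc z : z * (conjc z) = (cab z ^+ 2)%:C.
Proof. by rewrite rmorphXn /= -normcab sqr_normc. Qed.

Lemma Jmulc z : (conjc z) * z = (cab z ^+ 2)%:C.
Proof. by rewrite mulrC mulJc. Qed.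

Lemma Re_le z : complex.Re z <= cab z.
Proof. exact: le_trans (ler_norm _) (cab_Re z). Qed.

Lemma cabX z n : cab (z ^+ n) = cab z ^+ n.
Proof. by elim: n => [|n IH]; rewrite ?expr0 ?cab1 // !exprS cabM IH. Qed.

Lemma cab_sum I (r : seq I) P (F : I -> R[i]) :
  cab (\sum_(i <- r | P i) F i) <= \sum_(i <- r | P i) cab (F i).
Proof.
elim/big_rec2: _ => [|i y x _ H]; first by rewrite cab0.
exact: le_trans (cabD _ _) (lerD _ H).
Qed.

Lemma cabB z w : cab (z - w) <= cab z + cab w.
Proof. by rewrite -(cabN w) cabD. Qed.

Lemma cab_tri z w : cab z <= cab w + cab (z - w).
Proof. by rewrite -{1}(subrK w z) addrC; exact: cabD. Qed.

Lemma cabV z : cab z^-1 = (cab z)^-1.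
Proof. by apply: complexI; rewrite -normcab normfV normcab fmorphV /=. Qed.

(** Rotating a number onto its modulus; at zero any rotation will do. *)
Definition phase z : R[i] := if z == 0 then 1 else (conjc z) / (cab z)%:C.

Lemma cab_phase z : cab (phase z) = 1.
Proof.
rewrite /phase; case: eqP => [_|/eqP z0]; first exact: cab1.
apply: complexI; rewrite cabM cabJ cabV cab_real ger0_norm ?cab_ge0 //.
by rewrite divff // cab_eq0.
Qed.

Lemma phaseM z : phase z * z = (cab z)%:C.
Proof.
rewrite /phase; case: eqP => [->|/eqP z0]; first by rewrite mulr0 cab0.
rewrite mulrAC Jmulc rmorphXn /= expr2 mulfK //.
by rewrite (inj_eq (@complexI R)) cab_eq0.
Qed.

Lemma unim_mulJ z : cab z = 1 -> z * (conjc z) = 1.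
Proof. by move=> h; rewrite mulJc h expr1n. Qed.

Lemma unim_inv z : cab z = 1 -> z^-1 = (conjc z).
Proof.
move=> h; have z0 : z != 0 by rewrite -cab_eq0 h oner_eq0.
by apply: (mulfI z0); rewrite divff // unim_mulJ.
Qed.

Lemma cab_sqr z : cab z ^+ 2 = complex.Re z ^+ 2 + complex.Im z ^+ 2.
Proof. by rewrite sqr_sqrtr // addr_ge0 ?sqr_ge0. Qed.

Lemma cab_le_ReIm z : cab z <= `|complex.Re z| + `|complex.Im z|.
Proof.
rewrite -(@ler_pXn2r _ 2) ?nnegrE ?addr_ge0 ?cab_ge0 // cab_sqr sqrrD.
rewrite !real_normK ?num_real // -addrA [X in _ <= _ + X]addrC.
by rewrite addrA lerDl mulrn_wge0 // mulr_ge0.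
Qed.

Lemma cab_nat n : cab n%:R = n%:R.
Proof. by rewrite -(rmorph_nat (real_complex R)) cab_real ger0_norm. Qed.

End Modulus.

(** * Systems *)

(** The argument only uses the algebra of bounded functions of a measure
    preserving system, with its conjugation, integral, Koopman operators and
    uniform bounds.  This interface lets the same lemmas serve a system and its
    square. *)
Record system (R : realType) := System {
  alg :> comPzRingType;
  cst : {rmorphism R[i] -> alg};
  cj : {rmorphism alg -> alg};
  T : int -> {rmorphism alg -> alg};
  E : {additive alg -> R[i]};
  bd : R -> alg -> Prop;
  cjK : forall f, cj (cj f) = f;
  cj_cst : forall c, cj (cst c) = cst (conjc c);
  T0 : forall f, T 0 f = f;
  TD : forall a b f, T (a + b) f = T a (T b f);
  T_cst : forall a c, T a (cst c) = cst c;
  T_cj : forall a f, T a (cj f) = cj (T a f);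
  E_cst : forall c f, E (cst c * f) = c * E f;
  E1 : E 1 = 1;
  E_cj : forall f, E (cj f) = (conjc (E f));
  E_T : forall a f, E (T a f) = E f;
  E_pos : forall f, 0 <= complex.Re (E (f * cj f));
  bd_ge0 : forall M f, bd M f -> 0 <= M;
  bd_cst : forall c, bd (cab c) (cst c);
  bdD : forall a b f g, bd a f -> bd b g -> bd (a + b) (f + g);
  bdM : forall a b f g, bd a f -> bd b g -> bd (a * b) (f * g);
  bd_le : forall a b f, a <= b -> bd a f -> bd b f;
  bd_cj : forall a f, bd a f -> bd a (cj f);
  bd_T : forall a n f, bd a f -> bd a (T n f);
  bd_ex : forall f, exists a, bd a f;
  E_bd : forall M f g, bd M f ->
    complex.Re (E (f * g * cj (f * g))) <= M ^+ 2 * complex.Re (E (g * cj g))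
}.

Arguments cst {R s}. Arguments cj {R s}. Arguments T {R s}. Arguments E {R s}.
Arguments bd {R s}.

Section SystemTheory.
Variables (R : realType) (S : system R).
Implicit Types (f g h : S) (c : R[i]).

Lemma E_D f g : E (f + g) = E f + E g. Proof. exact: raddfD. Qed.

Lemma E_B f g : E (f - g) = E f - E g. Proof. exact: raddfB. Qed.

Lemma E_N f : E (- f) = - E f. Proof. exact: raddfN. Qed.

Lemma E_0 : E (0 : S) = 0. Proof. exact: raddf0. Qed.

Lemma E_sum I (r : seq I) P (F : I -> S) :
  E (\sum_(i <- r | P i) F i) = \sum_(i <- r | P i) E (F i).
Proof. exact: raddf_sum. Qed.

Definition n2 f : R := complex.Re (E (f * cj f)).

Lemma n2_ge0 f : 0 <= n2 f. Proof. exact: E_pos. Qed.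

Lemma E_cstr c : E (cst c : S) = c.
Proof. by rewrite -[cst c]mulr1 E_cst E1 mulr1. Qed.

Lemma E_real f : E (f * cj f) = (n2 f)%:C.
Proof.
have h : (conjc (E (f * cj f))) = E (f * cj f).
  by rewrite -E_cj rmorphM /= cjK mulrC.
rewrite /n2; move: h; case: (E (f * cj f)) => a b /= [] h.
have -> : b = 0 by lra.
by [].
Qed.

Lemma n2N f : n2 (- f) = n2 f.
Proof. by rewrite /n2 rmorphN mulrNN. Qed.

Lemma n2_cj f : n2 (cj f) = n2 f.
Proof. by rewrite /n2 cjK mulrC. Qed.

Lemma n2_T a f : n2 (T a f) = n2 f.
Proof. by rewrite /n2 -T_cj -rmorphM E_T. Qed.

Lemma n2_cst c f : n2 (cst c * f) = cab c ^+ 2 * n2 f.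
Proof.
rewrite /n2 rmorphM /= cj_cst.
have -> : cst c * f * (cst (conjc c) * cj f) = cst (c * conjc c) * (f * cj f).
  by rewrite rmorphM; ring.
by rewrite E_cst mulJc ReZ.
Qed.

Lemma n2_0 : n2 0 = 0.
Proof. by rewrite /n2 mul0r E_0. Qed.

Lemma n2D f g : n2 (f + g) = n2 f + n2 g + 2 * complex.Re (E (f * cj g)).
Proof.
rewrite /n2.
have -> : (f + g) * cj (f + g) = f * cj f + g * cj g + (f * cj g + cj (f * cj g)).
  by rewrite !rmorphD rmorphM /= cjK; ring.
rewrite !E_D !ReD E_cj ReJ; ring.
Qed.

Lemma n2B f g : n2 (f - g) = n2 f + n2 g - 2 * complex.Re (E (f * cj g)).
Proof. by rewrite n2D n2N rmorphN mulrN E_N ReN mulrN. Qed.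

Lemma cauchy_schwarz f g : cab (E (f * cj g)) ^+ 2 <= n2 f * n2 g.
Proof.
set z := E (f * cj g).
have H (t : R) : 0 <= n2 f - 2 * t * cab z ^+ 2 + t ^+ 2 * cab z ^+ 2 * n2 g.
  have := n2_ge0 (f - cst (t%:C * z) * g).
  rewrite n2B n2_cst rmorphM /= cj_cst.
  have -> : f * (cst (conjc (t%:C * z)) * cj g) = cst (conjc (t%:C * z)) * (f * cj g) by ring.
  rewrite E_cst -/z conjM conj_real -(mulrA t%:C) Jmulc ReZ /= cabM cab_real.
  by rewrite exprMn real_normK ?num_real //; lra.
have [g0|g0] := eqVneq (n2 g) 0.
  rewrite g0 mulr0; move: H; rewrite g0 => H.
  have n0 := n2_ge0 f.
  case: (lerP (cab z ^+ 2) 0) => // z0.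
  have := H ((n2 f + 1) / cab z ^+ 2).
  rewrite mulr0 addr0 -mulrA divfK ?gt_eqF //; lra.
have gp : 0 < n2 g by rewrite lt_def g0 n2_ge0.
have := H (n2 g)^-1.
have -> : n2 f - 2 * (n2 g)^-1 * cab z ^+ 2 + (n2 g)^-1 ^+ 2 * cab z ^+ 2 * n2 g
   = n2 f - cab z ^+ 2 / n2 g by field.
by rewrite subr_ge0 ler_pdivrMr.
Qed.

Lemma n2_bd M f g : bd M f -> n2 (f * g) <= M ^+ 2 * n2 g.
Proof. exact: E_bd. Qed.

Lemma n2_1 : n2 1 = 1.
Proof. by rewrite /n2 rmorph1 mulr1 E1. Qed.

Lemma n2_le M f : bd M f -> n2 f <= M ^+ 2.
Proof. by move=> h; have := n2_bd 1 h; rewrite mulr1 n2_1 mulr1. Qed.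

Lemma bd_one : bd 1 (1 : S).
Proof. by have := bd_cst S 1; rewrite cab1 rmorph1. Qed.

Lemma bd1M f g : bd 1 f -> bd 1 g -> bd 1 (f * g).
Proof. by move=> hf hg; have := bdM hf hg; rewrite mulr1. Qed.

Lemma bd_cstle c : cab c <= 1 -> bd 1 (cst c : S).
Proof. by move=> h; apply: bd_le h (bd_cst _ _). Qed.

Lemma bdN M f : bd M f -> bd M (- f).
Proof.
move=> h; have := bdM (bd_cst S (-1)) h.
by rewrite cabN cab1 mul1r rmorphN rmorph1 mulN1r.
Qed.

Lemma bdB a b f g : bd a f -> bd b g -> bd (a + b) (f - g).
Proof. by move=> hf hg; apply: bdD hf (bdN hg). Qed.

Lemma bd0 : bd 0 (0 : S).
Proof. by have := bd_cst S 0; rewrite cab0 rmorph0. Qed.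

Lemma bd_sum I (r : seq I) (P : pred I) (F : I -> S) (M : I -> R) :
  (forall i, P i -> bd (M i) (F i)) ->
  bd (\sum_(i <- r | P i) M i) (\sum_(i <- r | P i) F i).
Proof.
move=> h; elim/big_rec2: _ => [|i y x Pi H]; first exact: bd0.
exact: bdD (h _ Pi) H.
Qed.

Lemma bd1_prod I (r : seq I) (P : pred I) (F : I -> S) :
  (forall i, P i -> bd 1 (F i)) -> bd 1 (\prod_(i <- r | P i) F i).
Proof.
move=> h; elim/big_rec: _ => [|i x Pi H]; first exact: bd_one.
exact: bd1M (h _ Pi) H.
Qed.

Lemma cs_bd f g : bd 1 g -> cab (E (f * g)) ^+ 2 <= n2 f.
Proof.
move=> h; have := cauchy_schwarz f (cj g); rewrite cjK => /le_trans; apply.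
by apply: ler_piMr; rewrite ?n2_ge0 // n2_cj; have := n2_le h; rewrite expr1n.
Qed.

Lemma cab_E M f : bd M f -> cab (E f) <= M.
Proof.
move=> h; have := cs_bd f bd_one; rewrite mulr1 => /le_trans/(_ (n2_le h)).
by rewrite ler_pXn2r ?nnegrE ?cab_ge0 ?(bd_ge0 h).
Qed.

(** Equality almost everywhere, expressed by testing against all functions. *)
Definition sim f g := forall h, E (f * h) = E (g * h).

Lemma n2_sim f g : n2 (f - g) = 0 -> sim f g.
Proof.
move=> h k; apply/eqP; rewrite -subr_eq0 -E_B -mulrBl.
have := cauchy_schwarz (f - g) (cj k); rewrite cjK h mul0r.
rewrite real_exprn_even_le0 ?num_real //=; first by rewrite cab_eq0.
Qed.

Lemma sim_refl f : sim f f. Proof. by []. Qed.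

Lemma sim_sym f g : sim f g -> sim g f.
Proof. by move=> h k; rewrite h. Qed.

Lemma sim_trans f g h : sim f g -> sim g h -> sim f h.
Proof. by move=> h1 h2 k; rewrite h1 h2. Qed.

Lemma simM f g f' g' : sim f f' -> sim g g' -> sim (f * g) (f' * g').
Proof. by move=> h1 h2 k; rewrite -mulrA h1 mulrCA h2 mulrCA mulrA. Qed.

Lemma sim_T a f g : sim f g -> sim (T a f) (T a g).
Proof.
move=> h k; have e : k = T a (T (- a) k) by rewrite -TD subrr T0.
by rewrite e -!rmorphM !E_T.
Qed.

Lemma sim_cj f g : sim f g -> sim (cj f) (cj g).
Proof.
by move=> h k; rewrite -{1 2}(cjK k) -!rmorphM !E_cj h.
Qed.

Lemma sim_E f g : sim f g -> E f = E g.
Proof. by move=> h; have := h 1; rewrite !mulr1. Qed.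

Lemma sim_prod I (r : seq I) (P : pred I) (F G : I -> S) :
  (forall i, P i -> sim (F i) (G i)) ->
  sim (\prod_(i <- r | P i) F i) (\prod_(i <- r | P i) G i).
Proof.
move=> h; elim/big_rec2: _ => // i x y Pi H; exact: simM (h _ Pi) H.
Qed.

Lemma T_N a f : T (- a) (T a f) = f.
Proof. by rewrite -TD addrC subrr T0. Qed.

Lemma T_C a b f : T a (T b f) = T b (T a f).
Proof. by rewrite -!TD addrC. Qed.

(** Functions are only determined almost everywhere, which the interface sees
    as [sim]; in an ergodic system every eigenfunction has constant modulus and
    can be normalised in this way. *)
Definition eig (l : R[i]) (x : S) :=
  [/\ cab l = 1, bd 1 x, sim (T 1 x) (cst l * x) & sim (x * cj x) 1].

Lemma eig1 : eig 1 1.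
Proof.
split; rewrite ?cab1 ?rmorph1 ?mul1r //; exact: bd_one.
Qed.

Lemma eigM l m x y : eig l x -> eig m y -> eig (l * m) (x * y).
Proof.
move=> [l1 bx ex ux] [m1 by_ ey uy]; split.
- by rewrite cabM l1 m1 mulr1.
- exact: bd1M.
- rewrite !rmorphM /= mulrACA; exact: simM.
- by rewrite rmorphM mulrACA -[1]mulr1; apply: simM.
Qed.

Lemma eig_cj l x : eig l x -> eig (conjc l) (cj x).
Proof.
move=> [l1 bx ex ux]; split; rewrite ?cabJ //; first exact: bd_cj.
- by rewrite T_cj -cj_cst -rmorphM; apply: sim_cj.
- by rewrite cjK mulrC.
Qed.

Lemma eig_prod I (r : seq I) (P : pred I) (l : I -> R[i]) (F : I -> S) :
  (forall i, P i -> eig (l i) (F i)) ->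
  eig (\prod_(i <- r | P i) l i) (\prod_(i <- r | P i) F i).
Proof.
move=> h; elim/big_rec2: _ => [|i x y Pi H]; first exact: eig1.
exact: eigM (h _ Pi) H.
Qed.

Lemma eig_Tn l x n : eig l x -> sim (T n x) (cst (l ^ n) * x).
Proof.
move=> [l1 bx ex ux].
have l0 : l != 0 by rewrite -cab_eq0 l1 oner_eq0.
have pos m : sim (T (Posz m) x) (cst (l ^+ m) * x).
  elim: m => [|m IH]; first by rewrite T0 expr0 rmorph1 mul1r.
  rewrite intS TD; apply: sim_trans (sim_T 1 IH) _.
  by rewrite rmorphM /= T_cst exprSr rmorphM -mulrA; apply: simM.
case: n => n; first exact: pos.
rewrite (_ : l ^ Negz n = (l ^+ n.+1)^-1) // NegzE.
have h := sim_T (- (Posz n.+1)) (pos n.+1).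
rewrite T_N rmorphM /= T_cst in h.
have e : T (- (Posz n.+1)) x = cst (l ^+ n.+1)^-1 * (cst (l ^+ n.+1) * T (- (Posz n.+1)) x).
  by rewrite mulrA -rmorphM mulVf ?expf_neq0 // rmorph1 mul1r.
by rewrite e; apply: simM => //; apply: sim_sym.
Qed.

(** The integral is invariant, so it is multiplied by the eigenvalue. *)
Lemma eig_E0 l x : eig l x -> l != 1 -> E x = 0.
Proof.
move=> [l1 bx ex ux] l_neq1; have := sim_E ex.
rewrite E_T E_cst => /eqP; rewrite -subr_eq0 -{1}[E x]mul1r -mulrBl mulf_eq0.
by rewrite subr_eq0 eq_sym (negbTE l_neq1) => /eqP.
Qed.

End SystemTheory.

(** * Averages over long intervals *)

Section Averages.
Variable R : realType.
Implicit Types (a : nat -> R[i]) (e : R).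

(** Uniform density asks for windows in arbitrary position; fixing one bound [e]
    at a time replaces upper limits by explicit inequalities, which stay uniform
    in the functions that define [a]. *)
Definition Ub a e := exists L0 : nat, forall M L : nat, (L0 <= L)%N ->
  cab (\sum_(i < L) a (M + i)%N) <= e * L%:R.

Lemma Ub_le a e e' : e <= e' -> Ub a e -> Ub a e'.
Proof.
move=> ee [L0 h]; exists L0 => M L hL.
by apply: le_trans (h M L hL) _; rewrite ler_wpM2r.
Qed.

Lemma Ub_ext a b e : a =1 b -> Ub a e -> Ub b e.
Proof.
move=> ab [L0 h]; exists L0 => M L hL.
by have := h M L hL; rewrite (eq_bigr (fun i : 'I_L => b (M + i)%N)) // => i _.
Qed.

Lemma Ub_cst c e : cab c <= e -> Ub (fun=> c) e.
Proof.
move=> h; exists 0%N => M L _; rewrite sumr_const card_ord -[c *+ L]mulr_natr cabM.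
by rewrite cab_nat ler_wpM2r.
Qed.

Lemma Ub_bd a e : (forall n, cab (a n) <= e) -> Ub a e.
Proof.
move=> h; exists 0%N => M L _; apply: le_trans (cab_sum _ _ _) _.
apply: le_trans (ler_sum _ (fun i _ => h _)) _.
by rewrite sumr_const card_ord mulr_natr.
Qed.

Lemma UbM a c e : cab c <= 1 -> Ub a e -> Ub (fun n => c * a n) e.
Proof.
move=> hc [L0 h]; exists L0 => M L hL; rewrite -mulr_sumr cabM.
by apply: le_trans (h M L hL); rewrite ler_piMl ?cab_ge0.
Qed.

Lemma cauchy_sum I (r : seq I) (P : pred I) (w x : I -> R) :
  (forall i, P i -> 0 <= w i) ->
  (\sum_(i <- r | P i) w i * x i) ^+ 2 <=
  (\sum_(i <- r | P i) w i) * (\sum_(i <- r | P i) w i * x i ^+ 2).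
Proof.
move=> w0; set A := \sum_(i <- r | P i) w i * x i.
set W := \sum_(i <- r | P i) w i; set Q := \sum_(i <- r | P i) w i * x i ^+ 2.
have H t : 0 <= Q - 2 * t * A + t ^+ 2 * W.
  have -> : Q - 2 * t * A + t ^+ 2 * W =
     \sum_(i <- r | P i) w i * (x i - t) ^+ 2.
    rewrite /Q /A /W !mulr_sumr -sumrB -big_split /=.
    by apply: eq_bigr => i _; ring.
  by apply: sumr_ge0 => i /w0 wi; rewrite mulr_ge0 ?sqr_ge0.
have W0 : 0 <= W by apply: sumr_ge0.
have [Wz|Wn] := eqVneq W 0.
  rewrite Wz mul0r; move: H; rewrite Wz => H.
  have Q0 : 0 <= Q by apply: sumr_ge0 => i /w0 wi; rewrite mulr_ge0 ?sqr_ge0.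
  have [->|An] := eqVneq A 0; first by rewrite expr0n.
  have := H ((Q + 1) / (2 * A)); rewrite mulr0 addr0.
  have -> : Q - 2 * ((Q + 1) / (2 * A)) * A = -1 by field.
  by lra.
have Wp : 0 < W by rewrite lt_def Wn.
have := H (A / W).
have -> : Q - 2 * (A / W) * A + (A / W) ^+ 2 * W = Q - A ^+ 2 / W by field.
by rewrite subr_ge0 ler_pdivrMr // mulrC.
Qed.

Lemma sqr_sum_le n (x : 'I_n -> R) :
  (\sum_(i < n) x i) ^+ 2 <= n%:R * \sum_(i < n) x i ^+ 2.
Proof.
have := @cauchy_sum _ (index_enum 'I_n) predT (fun=> 1) x (fun _ _ => ler01).
under eq_bigr do rewrite mul1r.
rewrite sumr_const card_ord => /le_trans; apply.
by under eq_bigr do rewrite mul1r.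
Qed.

Lemma sum_shift a (hb : forall n, cab (a n) <= 1) s M L :
  cab (\sum_(i < L) a (M + i)%N - \sum_(i < L) a (M + i + s)%N) <= 2 * s%:R.
Proof.
elim: s => [|s IH].
  by under [X in _ - X]eq_bigr do rewrite addn0; rewrite mulr0 subrr cab0.
have -> : \sum_(i < L) a (M + i)%N - \sum_(i < L) a (M + i + s.+1)%N =
  (\sum_(i < L) a (M + i)%N - \sum_(i < L) a (M + i + s)%N)
  + (\sum_(i < L) a (M + i + s)%N - \sum_(i < L) a (M + i + s.+1)%N) by ring.
apply: le_trans (cabD _ _) _; rewrite -[s.+1%:R]natr1 mulrDr mulr1; apply: lerD => //.
have -> : \sum_(i < L) a (M + i + s)%N - \sum_(i < L) a (M + i + s.+1)%N =
   a (M + s)%N - a (M + L + s)%N.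
  elim: L {IH} => [|L IHL]; first by rewrite !big_ord0 addn0 !subrr.
  rewrite !big_ord_recr /= opprD addrACA IHL.
  have -> : (M + L + s.+1 = M + L.+1 + s)%N by lia.
  by ring.
apply: le_trans (cabB _ _) _.
have := hb (M + s)%N; have := hb (M + L + s)%N; lra.
Qed.

End Averages.

Section VanDerCorput.
Variables (R : realType) (S : system R).

(** Comparing [v] with its translates by a fixed finite set of shifts already
    controls its means; keeping the shifts bounded is what makes every later
    estimate uniform in the functions. *)
Lemma van_der_corput (J M0 : nat) (g : S) (v : nat -> S)
    (e : nat -> nat -> R) (eps : R) :
  (0 < J)%N -> 0 < eps -> bd 1 g -> (forall n, bd 1 (v n)) ->
  (forall i j, (i < J)%N -> (j < J)%N ->
     Ub (fun n => E (v (n + M0 * i)%N * cj (v (n + M0 * j)%N))) (e i j)) ->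
  \sum_(i < J) \sum_(j < J) e i j < eps ^+ 2 * J%:R ^+ 2 ->
  Ub (fun n => E (g * v n)) eps.
Proof.
move=> J0 e0 bg bv hU he.
have [L0 hL0] : exists L0 : nat, forall M L i j, (L0 <= L)%N -> (i < J)%N -> (j < J)%N ->
  cab (\sum_(n < L) E (v (M + n + M0 * i)%N * cj (v (M + n + M0 * j)%N))) <= e i j * L%:R.
  have /choice[f hf] : forall ij : 'I_J * 'I_J, exists L1 : nat, forall M L,
    (L1 <= L)%N -> cab (\sum_(n < L) E (v (M + n + M0 * ij.1)%N *
        cj (v (M + n + M0 * ij.2)%N))) <= e ij.1 ij.2 * L%:R.
    by move=> [i j] /=; apply: hU.
  exists (\max_ij f ij) => M L i j hL hi hj.
  apply: (hf (Ordinal hi, Ordinal hj)); apply: leq_trans hL.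
  exact: leq_bigmax.
set K := \sum_(i < J) \sum_(j < J) e i j in he.
have Jp : (0 : R) < J%:R by rewrite ltr0n.
pose th := Num.sqrt (Num.max K 0) / J%:R.
have th0 : 0 <= th by rewrite divr_ge0 ?sqrtr_ge0 // ltW.
have the : th < eps.
  rewrite ltr_pdivrMr // -(@ltr_pXn2r _ 2) ?nnegrE ?sqrtr_ge0 //; last first.
    by rewrite ltW // mulr_gt0.
  rewrite sqr_sqrtr ?le_max ?lexx ?orbT // exprMn gt_max he /=.
  by rewrite mulr_gt0 // exprn_gt0.
have thK : K <= (th * J%:R) ^+ 2.
  by rewrite divfK ?gt_eqF // sqr_sqrtr ?le_max ?lexx ?orbT.
pose L1 := Num.truncn (2 * M0%:R * J%:R / (eps - th)).
exists (maxn L0 L1.+1) => M L; rewrite geq_max => /andP[hL hL1].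
have hL1' : 2 * M0%:R * J%:R <= (eps - th) * L%:R.
  have d0 : 0 < eps - th by rewrite subr_gt0.
  rewrite -ler_pdivrMl // mulrC.
  apply: le_trans (_ : L1.+1%:R <= _); last by rewrite ler_nat.
  apply: ltW; rewrite truncnS_gt //.
set A := \sum_(i < L) _.
(* the window average of [v] is compared with that of the sum [w] of its
   translates; the square of the latter expands into the given correlations *)
pose w n := \sum_(i < J) v (n + M0 * i)%N.
have bgv n : cab (E (g * v n)) <= 1.
  by apply: cab_E; apply: bd1M.
have h1 : J%:R * cab A <= cab (\sum_(n < L) E (g * w (M + n)%N)) + 2 * M0%:R * J%:R ^+ 2.
  have -> : \sum_(n < L) E (g * w (M + n)%N) =
     \sum_(i < J) \sum_(n < L) E (g * v (M + n + M0 * i)%N).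
    rewrite exchange_big /=; apply: eq_bigr => n _.
    by rewrite mulr_sumr E_sum.
  have -> : J%:R * cab A = cab (\sum_(i < J) A).
    by rewrite sumr_const card_ord -[A *+ J]mulr_natl cabM cab_nat.
  apply: le_trans (cab_tri _ (\sum_(i < J) \sum_(n < L) E (g * v (M + n + M0 * i)%N))) _.
  rewrite lerD2l -sumrB; apply: le_trans (cab_sum _ _ _) _.
  have bnd (i : 'I_J) : cab (A - \sum_(n < L) E (g * v (M + n + M0 * i)%N)) <= 2 * M0%:R * J%:R.
    apply: le_trans (sum_shift (a := fun n => E (g * v n)) bgv (M0 * i) M L) _.
    by rewrite -mulrA ler_wpM2l // -natrM ler_nat leq_mul // ltnW.
  apply: le_trans (ler_sum _ (fun i _ => bnd i)) _.
  by rewrite sumr_const card_ord -[X in X <= _]mulr_natr expr2 mulrA.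
have h2 : cab (\sum_(n < L) E (g * w (M + n)%N)) ^+ 2 <= (th * J%:R * L%:R) ^+ 2.
  have s1 : cab (\sum_(n < L) E (g * w (M + n)%N)) ^+ 2 <=
      (\sum_(n < L) cab (E (g * w (M + n)%N))) ^+ 2.
    by rewrite lerXn2r ?nnegrE ?cab_ge0 ?sumr_ge0 ?cab_sum // => i _; apply: cab_ge0.
  apply: le_trans s1 _; apply: le_trans (sqr_sum_le _) _.
  rewrite exprMn [X in _ <= _ * X]expr2 mulrCA [X in _ <= X]mulrC -mulrA [X in _ <= X]mulrC.
  rewrite -mulrA [X in _ <= X]mulrC -mulrA.
  rewrite ler_wpM2l //.
  have s2 : \sum_(n < L) cab (E (g * w (M + n)%N)) ^+ 2 <= \sum_(n < L) n2 (w (M + n)%N).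
    by apply: ler_sum => n _; rewrite mulrC; apply: cs_bd.
  apply: le_trans s2 _.
  have -> : \sum_(n < L) n2 (w (M + n)%N) = complex.Re (\sum_(i < J) \sum_(j < J)
      \sum_(n < L) E (v (M + n + M0 * i)%N * cj (v (M + n + M0 * j)%N))).
    rewrite -Re_sum; congr (complex.Re _).
    under [RHS]eq_bigr do rewrite exchange_big /=.
    rewrite exchange_big /=; apply: eq_bigr => n _.
    rewrite /w rmorph_sum mulr_suml E_sum; apply: eq_bigr => i _.
    by rewrite mulr_sumr E_sum.
  apply: le_trans (Re_le _) _; apply: le_trans (cab_sum _ _ _) _.
  apply: le_trans (_ : \sum_(i < J) \sum_(j < J) e i j * L%:R <= _).
    apply: ler_sum => i _; apply: le_trans (cab_sum _ _ _) _.
    by apply: ler_sum => j _; apply: hL0.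
  under eq_bigr do rewrite -mulr_suml.
  by rewrite -mulr_suml ler_wpM2r.
have h3 : cab (\sum_(n < L) E (g * w (M + n)%N)) <= th * J%:R * L%:R.
  by move: h2; rewrite ler_pXn2r ?nnegrE ?cab_ge0 // !mulr_ge0 // ltW.
rewrite -(ler_pM2l Jp); apply: le_trans h1 _.
apply: le_trans (lerD h3 (lexx _)) _.
have : J%:R * (2 * M0%:R * J%:R) <= J%:R * ((eps - th) * L%:R) by rewrite ler_pM2l.
lra.
Qed.

(** The diagonal contributes [1 / J]; any uniform bound off the diagonal
    survives. *)
Lemma van_der_corput_unif (J M0 : nat) (g : S) (v : nat -> S) (eps : R) :
  0 < eps -> 4 <= eps ^+ 2 * J%:R -> bd 1 g -> (forall n, bd 1 (v n)) ->
  (forall i j, (i < J)%N -> (j < J)%N -> i != j ->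
     Ub (fun n => E (v (n + M0 * i)%N * cj (v (n + M0 * j)%N))) (eps ^+ 2 / 4)) ->
  Ub (fun n => E (g * v n)) eps.
Proof.
move=> e0 hJ bg bv hU.
have J0 : (0 < J)%N.
  by case: J hJ {hU} => //; rewrite mulr0 => /(lt_le_trans (ltr0n _ 4)); rewrite ltxx.
have Jp : (0 : R) < J%:R by rewrite ltr0n.
apply: (van_der_corput (e := fun i j => eps ^+ 2 / 4 + (i == j)%:R) J0 e0 bg bv (M0 := M0)).
  move=> i j hi hj; case: eqP => [->|/eqP ij].
    apply: (@Ub_le _ _ 1); first by rewrite lerDr divr_ge0 ?sqr_ge0.
    by apply: Ub_bd => n; apply: cab_E; apply: bd1M => //; apply: bd_cj.
  by rewrite addr0; apply: hU.
under eq_bigr => i _.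
  rewrite big_split /= sumr_const card_ord (bigD1 i) //= eqxx.
  rewrite big1 ?addr0; last by move=> j ji; rewrite eq_sym -val_eqE in ji; rewrite (negbTE ji).
  over.
rewrite sumr_const card_ord -[X in X < _]mulr_natr -[X in (X + _) * _ < _]mulr_natr.
set q := eps ^+ 2 in hJ *; set j := (J%:R : R) in hJ Jp *.
have h1 : 4 * j <= q * j * j by rewrite ler_pM2r.
have -> : (true%:R : R) = 1 by [].
lra.
Qed.

End VanDerCorput.

(** * A mean on bounded sequences *)

Section Mean.
Variable R : realType.

(** Limits of means over [0, H) along a fixed ultrafilter: finitely many
    sequences always share a common good [H]. *)
Lemma mean_exists : exists mean : (nat -> R) -> R,
  forall (I : finType) (a : I -> nat -> R) (e : R) (H0 : nat),
    (forall i n, `|a i n| <= 1) -> 0 < e ->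
    exists H : nat, [/\ (H0 <= H)%N, (0 < H)%N &
      forall i, `|\sum_(h < H) a i h - mean (a i) * H%:R| <= e * H%:R].
Proof.
(* along an ultrafilter every bounded sequence converges, so one filter serves
   all sequences at once *)
have [U [UU hU]] := ultraFilterLemma (F := \oo) _.
pose s (a : nat -> R) (H : nat) : R := (\sum_(h < H) a h) / H%:R.
have lims a : (forall n, `|a n| <= 1) ->
    exists p : R, forall e, 0 < e -> U [set H | `|s a H - p| <= e].
  move=> ha.
  have sb H : s a H \in `[-1, 1].
    rewrite in_itv /= -ler_norml normrM normfV normr_nat.
    case: H => [|H]; first by rewrite invr0 mulr0.
    rewrite ler_pdivrMr ?ltr0n // mul1r; apply: le_trans (ler_norm_sum _ _ _) _.
    apply: le_trans (ler_sum _ (fun i _ => ha _)) _.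
    by rewrite sumr_const card_ord.
  have := @segment_compact R (-1) 1 (s a @ U) _.
  case.
    change (U [set H | s a H \in `[-1, 1]]).
    by apply: filterS (@filterT _ U _) => H _; apply: sb.
  move=> p [_ cl]; exists p => e e0.
  have [//|uc] := in_ultra_setVsetC [set H | `|s a H - p| <= e] UU.
  exfalso.
  have [] := cl (~` [set y | `|y - p| <= e]) (ball p e) uc (nbhsx_ballx p e e0).
  move=> y [/= ny]; rewrite /ball /= distrC => py; apply: ny; exact: ltW.
have /choice[m hm] : forall a, exists p : R,
    (forall n, `|a n| <= 1) -> forall e, 0 < e -> U [set H | `|s a H - p| <= e].
  move=> a; have [/lims[p hp]|n] := pselect (forall n, `|a n| <= 1); first by exists p.
  by exists 0.
exists m => I a e H0 ha e0.
have hI : U [set H | forall i, i \in enum I -> `|s (a i) H - m (a i)| <= e].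
  elim: (enum I) => [|i r IH]; first by apply: filterS (@filterT _ U _) => H _ i.
  apply: filterS (filterI (hm _ (ha i) _ e0) IH) => H [h1 h2] k.
  by rewrite in_cons => /predU1P[->//|]; apply: h2.
have hH : U [set H | (maxn H0 1 <= H)%N] by apply: hU; exists (maxn H0 1).
have [H [h1 h2]] := @filter_ex _ U _ _ (filterI hI hH).
exists H; move: h2; rewrite /= geq_max => /andP[h2 h3]; split=> // i.
have := h1 i (mem_enum _ _).
have Hp : (0 : R) < H%:R by rewrite ltr0n.
rewrite -(ler_pM2r Hp); apply: le_trans.
by rewrite -{2}(gtr0_norm Hp) -normrM mulrBl /s divfK // gt_eqF.
Qed.

Definition mean : (nat -> R) -> R := projT1 (cid mean_exists).

Lemma meanP (I : finType) (a : I -> nat -> R) (e : R) (H0 : nat) :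
  (forall i n, `|a i n| <= 1) -> 0 < e ->
  exists H : nat, [/\ (H0 <= H)%N, (0 < H)%N &
    forall i, `|\sum_(h < H) a i h - mean (a i) * H%:R| <= e * H%:R].
Proof. exact: (projT2 (cid mean_exists)). Qed.

Lemma meanP1 (a : nat -> R) (e : R) (H0 : nat) :
  (forall n, `|a n| <= 1) -> 0 < e ->
  exists H : nat, [/\ (H0 <= H)%N, (0 < H)%N &
    `|\sum_(h < H) a h - mean a * H%:R| <= e * H%:R].
Proof.
move=> ha e0; have [H [h1 h2 h3]] := @meanP unit (fun=> a) e H0 (fun _ => ha) e0.
by exists H; split=> //; apply: (h3 tt).
Qed.

Lemma mean_le (a b : nat -> R) : (forall n, `|a n| <= 1) ->
  (forall n, `|b n| <= 1) -> (forall n, a n <= b n) -> mean a <= mean b.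
Proof.
move=> ha hb ab; apply/ler_addgt0Pr => e e0.
have [|H [_ Hp hH]] := @meanP bool (fun i => if i then a else b) (e / 2) 0 _ (divr_gt0 e0 (ltr0n _ 2)).
  by case.
have := hH true; have := hH false => /=; rewrite !ler_norml.
have : \sum_(h < H) a h <= \sum_(h < H) b h by apply: ler_sum.
move=> h1 /andP[h2 h3] /andP[h4 h5].
have Hp' : (0 : R) < H%:R by rewrite ltr0n.
rewrite -(ler_pM2r Hp'); lra.
Qed.

Lemma mean_cst (c : R) : `|c| <= 1 -> mean (fun=> c) = c.
Proof.
move=> hc; apply/eqP; rewrite eq_sym -subr_eq0 -normr_le0; apply/ler_addgt0Pl => e e0.
have [H [_ Hp]] := @meanP1 (fun=> c) e 0 (fun=> hc) e0.
have Hp' : (0 : R) < H%:R by rewrite ltr0n.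
rewrite sumr_const card_ord -[c *+ H]mulr_natr -mulrBl normrM normr_nat ler_pM2r //.
by rewrite addr0.
Qed.

Lemma mean_norm (a : nat -> R) : (forall n, `|a n| <= 1) -> `|mean a| <= 1.
Proof.
move=> ha; rewrite ler_norml; apply/andP; split.
  rewrite -(@mean_cst (-1)) ?normrN ?normr1 //; apply: mean_le => // n.
    by rewrite normrN normr1.
  by have := ha n; rewrite ler_norml => /andP[].
rewrite -(@mean_cst 1) ?normr1 //; apply: mean_le => // n.
  by rewrite normr1.
exact: le_trans (ler_norm _) (ha n).
Qed.

End Mean.

(** * Exponential phases *)

Section Phases.
Variable R : realType.
Implicit Types (x y : R) (P : {poly R}).

Definition ex x : R[i] := cos (pi *+ 2 * x) +i* sin (pi *+ 2 * x).

Lemma exD x y : ex (x + y) = ex x * ex y.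
Proof.
rewrite /ex mulrDr cosD sinD; apply/eqP; rewrite eq_complex /=; apply/andP.
by split; apply/eqP; ring.
Qed.

Lemma ex0 : ex 0 = 1.
Proof. by rewrite /ex mulr0 cos0 sin0. Qed.

Lemma cab_ex x : cab (ex x) = 1.
Proof. by rewrite /cab /= cos2Dsin2 sqrtr1. Qed.

Lemma exN x : ex (- x) = conjc (ex x).
Proof. by rewrite /ex mulrN cosN sinN. Qed.

Lemma exB x y : ex (x - y) = ex x * conjc (ex y).
Proof. by rewrite exD exN. Qed.

Lemma ex1 : ex 1 = 1.
Proof. by rewrite /ex mulr1 cos2pi sin2pi. Qed.

Lemma exMn x n : ex (x *+ n) = ex x ^+ n.
Proof. by elim: n => [|n IH]; rewrite ?mulr0n ?ex0 // mulrS exD IH exprS. Qed.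

Lemma exMz x (m : int) : ex (x * m%:~R) = ex x ^ m.
Proof.
case: m => n; first by rewrite mulr_natr exMn.
rewrite (_ : ex x ^ Negz n = (ex x ^+ n.+1)^-1) // NegzE mulrNz mulrN exN.
by rewrite -exMn unim_inv ?cab_ex // -[x *+ n.+1]mulr_natr.
Qed.

Lemma ex_int x : x \is a Num.int -> ex x = 1.
Proof. by move=> /intrP[m ->]; rewrite -[m%:~R]mul1r exMz ex1 exp1rz. Qed.

Lemma ex_eq1 x : ex x = 1 -> x \is a Num.int.
Proof.
move=> h; rewrite intrEfloor -subr_eq0.
have h' : ex (x - (Num.floor x)%:~R) = 1.
  by rewrite exB h ex_int ?intr_int // conjc1 mulr1.
have /andP[f1 f2] := floor_itv x.
set y := x - _ in h'.
have y0 : 0 <= y by rewrite subr_ge0.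
have y1 : y < 1 by rewrite /y ltrBlDr addrC -intrD1.
suff -> : (Num.floor x)%:~R - x = - y.
  rewrite oppr_eq0; move: h' => [] hc hs; apply/negbNE/negP => yn.
  have yp : 0 < y by rewrite lt_def yn.
  have pp := pi_gt0 R.
  have [yl|yl|yl] := ltrgtP y (1 / 2).
  - have := @sin_gt0_pi R (pi *+ 2 * y); rewrite hs ltxx => H.
    by suff /H : 0 < pi *+ 2 * y < pi by []; rewrite mulr2n; apply/andP; split; nra.
  - have := @sin_gt0_pi R (pi *+ 2 * y - pi).
    rewrite sinB hs mul0r sinpi mulr0 subr0 ltxx => H.
    by suff /H : 0 < pi *+ 2 * y - pi < pi by []; rewrite mulr2n; apply/andP; split; nra.
  - move: hc; rewrite yl.
    have -> : pi *+ 2 * (1 / 2) = pi :> R by rewrite mulr2n; lra.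
    rewrite cospi; lra.
by rewrite /y opprB.
Qed.

Lemma ex_surj (z : R[i]) : cab z = 1 -> exists x, ex x = z.
Proof.
case: z => a b h; have h2 : a ^+ 2 + b ^+ 2 = 1 by have := cab_sqr (a +i* b); rewrite h expr1n.
have ha : -1 <= a <= 1 by apply/andP; split; nra.
have pp : pi *+ 2 != 0 :> R by rewrite mulrn_eq0 /= gt_eqF // pi_gt0.
have hs : sin (acos a) = `|b|.
  by rewrite sin_acos // -sqrtr_sqr; congr Num.sqrt; lra.
have hc : cos (acos a) = a by apply: acosK; rewrite in_itv.
have [b0|b0] := lerP 0 b.
  exists (acos a / (pi *+ 2)); rewrite /ex mulrC divfK // hc hs ger0_norm //.
exists (- (acos a / (pi *+ 2))).
by rewrite /ex mulrN mulrC divfK // cosN sinN hc hs ltr0_norm // opprK.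
Qed.

(** A sequence reproduced by a shift up to a factor other than 1 has small
    means. *)
Lemma Ub_shift (a : nat -> R[i]) (l : R[i]) s eps :
  0 < eps -> l != 1 -> (forall n, cab (a n) <= 1) ->
  (forall n, a (n + s)%N = l * a n) -> Ub a eps.
Proof.
move=> e0 l1 ab al; have c0 : 0 < cab (1 - l).
  by rewrite lt_def cab_ge0 andbT cab_eq0 subr_eq0 eq_sym.
exists (Num.truncn (2 * s%:R / (cab (1 - l) * eps))).+1 => M L hL.
have h := sum_shift ab s M L.
have e : \sum_(i < L) a (M + i + s)%N = l * \sum_(i < L) a (M + i)%N.
  by rewrite mulr_sumr; apply: eq_bigr => i _; apply: al.
rewrite e -{1}[\sum_(i < L) a (M + i)%N]mul1r -mulrBl cabM in h.
rewrite -(ler_pM2l c0); apply: le_trans h _.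
rewrite mulrA -ler_pdivrMl ?mulr_gt0 // mulrC.
apply: le_trans (ltW (truncnS_gt _)) _; by rewrite ler_nat.
Qed.

Lemma size_exp_XaddC (c : R) n : size (('X + c%:P) ^+ n) = n.+1.
Proof. by rewrite -(opprK c) polyCN size_exp_XsubC. Qed.

Lemma coef_XaddC_exp (c : R) n : (('X + c%:P) ^+ n)`_n = 1 /\
  (('X + c%:P) ^+ n.+1)`_n = c * n.+1%:R.
Proof.
have top m : (('X + c%:P) ^+ m)`_m = 1.
  have := monic_exp m (monicXaddC c); rewrite monicE lead_coefE.
  by rewrite size_exp_XaddC => /eqP.
split; first exact: top.
elim: n => [|n IH]; first by rewrite expr1 coefD coefX coefC /= add0r mulr1.
rewrite exprSr mulrDr coefD coefMX /= IH coefMC top -[n.+2%:R]natr1; ring.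
Qed.

Definition shp P c := P \Po ('X + c%:P).

Lemma size_shift P c : size (shp P c) = size P.
Proof. by rewrite /shp size_comp_poly2 // size_XaddC. Qed.

Lemma coef_shift P c d : (size P <= d.+2)%N ->
  (shp P c)`_d = P`_d + P`_d.+1 * c * d.+1%:R.
Proof.
move=> sP; rewrite /shp /comp_poly (horner_coef_wide (n := d.+2)) ?size_map_polyC //.
rewrite coef_sum !big_ord_recr /= !coef_map /= !coefCM (coef_XaddC_exp c d).1 (coef_XaddC_exp c d).2 big1 ?add0r.
  by rewrite mulr1 mulrA.
move=> i _; rewrite coef_map coefCM [X in _ * X]nth_default ?mulr0 // size_exp_XaddC //.
Qed.

Lemma size_shiftB P a b d : (size P <= d.+2)%N ->
  (size (shp P a - shp P b)%R <= d.+1)%N.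
Proof.
move=> sP; apply/leq_sizeP => j dj; rewrite coefB.
have [jd|jd] := leqP d.+2 j.
  by rewrite !nth_default ?size_shift ?subr0 // (leq_trans sP).
have -> : j = d.+1 by lia.
have z : P`_d.+2 = 0 by rewrite nth_default.
have sP' : (size P <= d.+3)%N by apply: leq_trans sP _.
by rewrite !(coef_shift _ sP') z !mul0r !addr0 subrr.
Qed.

Lemma horner_shift P (c x : R) : (shp P c).[x] = P.[x + c].
Proof. by rewrite /shp horner_comp !hornerE. Qed.

Lemma int_mulr x y : x \is a Num.int -> y \is a Num.int -> x * y \is a Num.int.
Proof. exact: rpredM. Qed.

End Phases.

Section Weyl.
Variables (R : realType) (S : system R).
Implicit Types (P : {poly R}).

Lemma Ub_scalar (u : nat -> R[i]) e :
  Ub (fun n => E (1 * cst (u n) : S)) e -> Ub u e.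
Proof. by apply: Ub_ext => n; rewrite mul1r E_cstr. Qed.

(** Differencing lowers the degree and multiplies the leading coefficient by a
    bounded nonzero integer. *)
Lemma weyl_top d (eps : R) : 0 < eps -> exists2 O : nat, (0 < O)%N &
  forall P, (size P <= d.+2)%N -> ~ Ub (fun n => ex P.[n%:R]) eps ->
  exists2 o : nat, (0 < o <= O)%N & P`_d.+1 * o%:R \is a Num.int.
Proof.
elim: d eps => [|d IH] eps e0.
  exists 1%N => // P sP nU; exists 1%N => //; rewrite mulr1.
  apply/ex_eq1/eqP/negbNE/negP => /eqP h; apply: nU.
  apply: (@Ub_shift _ _ (ex P`_1) 1) => //; first exact/eqP.
    by move=> n; rewrite cab_ex.
  move=> n; rewrite -exD; congr ex.
  rewrite !(horner_coef_wide _ sP) !big_ord_recr !big_ord0 /= !expr0 !expr1.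
  by rewrite natrD; ring.
have [K1 O0 hO] := IH _ (divr_gt0 (exprn_gt0 2 e0) (ltr0n _ 4)).
pose J := (Num.truncn (4 / eps ^+ 2)).+1.
exists (K1 * d.+2 * J)%N; first by rewrite !muln_gt0 O0.
move=> P sP nU.
have hJ : 4 <= eps ^+ 2 * J%:R.
  rewrite mulrC -ler_pdivrMr ?exprn_gt0 //; exact: ltW (truncnS_gt _).
pose Q i j := shp P i%:R - shp P j%:R.
have sQ i j : (size (Q i j) <= d.+2)%N by apply: size_shiftB.
have [i [j [hi hj ij hU]]] : exists i j, [/\ (i < J)%N, (j < J)%N, i != j &
    ~ Ub (fun n => ex (Q i j).[n%:R]) (eps ^+ 2 / 4)].
  apply: contrapT => H; apply: nU; apply: Ub_scalar.
  apply: (van_der_corput_unif (J := J) (M0 := 1) (v := fun n => cst (ex P.[n%:R]))) => //.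
  - exact: bd_one.
  - by move=> n; apply: bd_cstle; rewrite cab_ex.
  move=> i j hi hj ij; apply: contrapT => H'; apply: H; exists i, j; split=> //.
  move=> H''; apply: H'; apply: Ub_ext H'' => n.
  rewrite cj_cst -rmorphM E_cstr /Q hornerD hornerN !horner_shift exB.
  by rewrite !mul1n !natrD.
have [r /andP[r0 rO] hint] := hO _ (sQ i j) hU.
have ij0 : (0 < `|i%:Z - j%:Z|)%N by rewrite absz_gt0 subr_eq0 eqz_nat.
exists (r * d.+2 * `|(i%:Z - j%:Z)%R|)%N.
  rewrite !muln_gt0 r0 ij0 /= leq_mul ?leq_mul //; lia.
have : (Q i j)`_d.+1 = P`_d.+2 * d.+2%:R * (i%:Z - j%:Z)%:~R.
  by rewrite coefB !coef_shift // rmorphB /=; ring.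
move=> e; rewrite e in hint.
have -> : P`_d.+2 * (r * d.+2 * `|(i%:Z - j%:Z)%R|)%:R =
   P`_d.+2 * d.+2%:R * (i%:Z - j%:Z)%:~R * r%:R * (sgz (i%:Z - j%:Z))%:~R.
  rewrite !natrM.
  have -> : (`|(i%:Z - j%:Z)%R|)%:R = (i%:Z - j%:Z)%:~R * (sgz (i%:Z - j%:Z))%:~R :> R.
    by rewrite -rmorphM /= mulrC -abszEsg.
  ring.
by rewrite int_mulr // intr_int.
Qed.

Lemma int_factor (x : R) (a b : nat) : (a %| b)%N ->
  x * a%:R \is a Num.int -> x * b%:R \is a Num.int.
Proof.
move=> /dvdnP[q ->] h; rewrite natrM mulrCA int_mulr // natr_int.
Qed.

(** Once the leading coefficient has bounded denominator the leading monomial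
    only contributes a periodic factor, so all coefficients follow by
    descending degree. *)
Lemma weyl_full d p (eps : R) : (0 < p)%N -> 0 < eps ->
  exists2 O : nat, (0 < O)%N &
  forall P (v : nat -> R[i]), (size P <= d.+1)%N ->
    (forall n, cab (v n) = 1) -> (forall n, v (n + p)%N = v n) ->
    ~ Ub (fun n => ex P.[n%:R] * v n) eps ->
    forall j, (0 < j)%N -> P`_j * O%:R \is a Num.int.
Proof.
elim: d p => [|d IH] p p0 e0.
  exists 1%N => // P v sP _ _ _ j j0.
  by rewrite nth_default ?mul0r ?rpred0 // (leq_trans sP).
(* the leading coefficient, by differencing along multiples of the period *)
have [W1 W10 hW1] : exists2 W1 : nat, (0 < W1)%N & forall P v, (size P <= d.+2)%N ->
    (forall n, cab (v n) = 1) -> (forall n, v (n + p)%N = v n) ->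
    ~ Ub (fun n => ex P.[n%:R] * v n) eps -> P`_d.+1 * W1%:R \is a Num.int.
  case: d {IH} => [|d].
    exists p => // P v sP v1 vp nU; apply/ex_eq1/eqP/negbNE/negP => /eqP h; apply: nU.
    apply: (@Ub_shift _ _ (ex (P`_1 * p%:R)) p) => //; first exact/eqP.
      by move=> n; rewrite cabM cab_ex v1 mulr1.
    move=> n; rewrite vp mulrA -exD; congr (ex _ * _).
    rewrite !(horner_coef_wide _ sP) !big_ord_recr !big_ord0 /= !expr0 !expr1.
    by rewrite natrD; ring.
  have e40 := divr_gt0 (exprn_gt0 2 e0) (ltr0n R 4).
  have [K1 O0 hO] := weyl_top d e40.
  pose J := (Num.truncn (4 / eps ^+ 2)).+1.
  exists (K1`! * d.+2 * p * J`!)%N; first by rewrite !muln_gt0 !fact_gt0 p0.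
  move=> P v sP v1 vp nU.
  have vpm n m : v (n + p * m)%N = v n.
    by elim: m => [|m IHm]; rewrite ?muln0 ?addn0 // mulnS addnCA addnC vp.
  have hJ : 4 <= eps ^+ 2 * J%:R.
    rewrite mulrC -ler_pdivrMr ?exprn_gt0 //; exact: ltW (truncnS_gt _).
  pose Q i j := shp P (p * i)%:R - shp P (p * j)%:R.
  have sQ i j : (size (Q i j) <= d.+2)%N by apply: size_shiftB.
  have [i [j [hi hj ij hU]]] : exists i j, [/\ (i < J)%N, (j < J)%N, i != j &
      ~ Ub (fun n => ex (Q i j).[n%:R]) (eps ^+ 2 / 4)].
    apply: contrapT => H; apply: nU; apply: Ub_scalar.
    apply: (van_der_corput_unif (J := J) (M0 := p)
        (v := fun n => cst (ex P.[n%:R] * v n))) => //.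
    - exact: bd_one.
    - by move=> n; apply: bd_cstle; rewrite cabM v1 cab_ex mulr1.
    move=> i j hi hj ij; apply: contrapT => H'; apply: H; exists i, j; split=> //.
    move=> H''; apply: H'; apply: Ub_ext H'' => n.
    rewrite cj_cst -rmorphM E_cstr /Q hornerD hornerN !horner_shift exB conjM !vpm.
    by rewrite mulrACA unim_mulJ // mulr1 !natrD.
  have [r /andP[r0 rO] hint] := hO _ (sQ i j) hU.
  have e : (Q i j)`_d.+1 = P`_d.+2 * d.+2%:R * p%:R * (i%:Z - j%:Z)%:~R.
    by rewrite coefB !coef_shift // rmorphB /= !natrM; ring.
  rewrite e in hint.
  have ij0 : (0 < `|i%:Z - j%:Z|)%N by rewrite absz_gt0 subr_eq0 eqz_nat.
  have od : (r %| K1`!)%N by apply: dvdn_fact; rewrite r0.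
  have jd : (`|(i%:Z - j%:Z)%R| %| J`!)%N by apply: dvdn_fact; rewrite ij0 /=; lia.
  case/dvdnP: od => r' ->; case/dvdnP: jd => j' ->.
  have -> : P`_d.+2 * (r' * r * d.+2 * p * (j' * `|(i%:Z - j%:Z)%R|))%:R =
     (P`_d.+2 * d.+2%:R * p%:R * (i%:Z - j%:Z)%:~R * r%:R)
      * (sgz (i%:Z - j%:Z) * r'%:Z * j'%:Z)%:~R.
    rewrite !natrM !rmorphM /=.
    have -> : (`|(i%:Z - j%:Z)%R|)%:R = (i%:Z - j%:Z)%:~R * (sgz (i%:Z - j%:Z))%:~R :> R.
      by rewrite -rmorphM /= mulrC -abszEsg.
    ring.
  by rewrite int_mulr // intr_int.
have pW : (0 < p * W1)%N by rewrite muln_gt0 p0.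
(* the leading monomial now has period [p * W1] up to an integer, and is
   absorbed in the periodic factor *)
have [W2 W20 hW2] := IH _ pW e0.
exists (W1 * W2)%N; first by rewrite muln_gt0 W10.
move=> P v sP v1 vp nU.
have top := hW1 P v sP v1 vp nU.
set c := P`_d.+1 in top.
pose P' := P - c *: 'X^(d.+1).
pose v' n := ex (c * n%:R ^+ d.+1) * v n.
have sP' : (size P' <= d.+1)%N.
  apply/leq_sizeP => j dj; rewrite coefB coefZ coefXn.
  case: eqP => [->|jd]; first by rewrite mulr1 subrr.
  by rewrite mulr0 subr0 nth_default // (leq_trans sP) //; lia.
have vpm n m : v (n + p * m)%N = v n.
  by elim: m => [|m IHm]; rewrite ?muln0 ?addn0 // mulnS addnCA addnC vp.
move=> j j0; have [jd|jd] := ltnP d.+1 j.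
  by rewrite nth_default ?mul0r ?rpred0 // (leq_trans sP).
have [->|jd'] := eqVneq j d.+1.
  by apply: int_factor top; rewrite dvdn_mulr.
have -> : P`_j = P'`_j.
  by rewrite coefB coefZ coefXn (negbTE jd') mulr0 subr0.
apply: (@int_factor _ W2); first by rewrite dvdn_mull.
apply: (hW2 P' v') => //.
- by move=> n; rewrite cabM v1 cab_ex mulr1.
- move=> n; rewrite /v' vpm; congr (_ * _).
  apply/eqP; rewrite -subr_eq0.
  have -> : ex (c * (n + p * W1)%:R ^+ d.+1) =
     ex (c * n%:R ^+ d.+1) * ex (c * (n + p * W1)%:R ^+ d.+1 - c * n%:R ^+ d.+1).
    by rewrite -exD; congr ex; ring.
  rewrite [X in _ * X]ex_int ?mulr1 ?subrr //.
  rewrite -mulrBr subrXX mulrC -mulrA.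
  have -> : (n + p * W1)%:R - n%:R = p%:R * W1%:R :> R by rewrite natrD natrM; ring.
  set s := \sum_(i < _) _.
  have -> : p%:R * W1%:R * (s * c) = c * W1%:R * (p%:R * s) by ring.
  rewrite int_mulr // int_mulr // ?natr_int //.
  by apply: rpred_sum => i _; rewrite rpredM ?rpredX ?natr_int.
- move=> H; apply: nU; apply: Ub_ext H => n.
  rewrite /v' mulrA -exD; congr (ex _ * _).
  by rewrite /P' hornerD hornerN hornerZ hornerXn; ring.
Qed.

End Weyl.

(** * Iterated difference means *)

Section Seminorms.
Variables (R : realType) (S : system R).
Implicit Types (f g : S).

(** They play the role of the uniformity seminorms: no powers are taken, so that
    an average of [Us s] over derivatives is [Us s.+1] by definition. *)
Fixpoint Us (s : nat) f : R :=
  if s is s'.+1 then mean (fun h => Us s' (f * T (Posz h) (cj f)))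
  else cab (E f).

Lemma bd1_diff f a : bd 1 f -> bd 1 (f * T a (cj f)).
Proof. by move=> h; apply: bd1M => //; apply/bd_T/bd_cj. Qed.

Lemma Us_bd s f : bd 1 f -> 0 <= Us s f <= 1.
Proof.
elim: s f => [|s IH] f bf /=; first by rewrite cab_ge0 (cab_E bf).
have h n := IH _ (bd1_diff (Posz n) bf).
have n1 n : `|Us s (f * T (Posz n) (cj f))| <= 1.
  by have /andP[h0 h1] := h n; rewrite ger0_norm.
rewrite (le_trans (ler_norm _) (mean_norm n1)) andbT.
rewrite -[0](@mean_cst R 0) ?normr0 //; apply: mean_le => // n; rewrite ?normr0 //.
by case/andP: (h n).
Qed.

Lemma Us_norm s f : bd 1 f -> `|Us s f| <= 1.
Proof. by move=> /(Us_bd s)/andP[h0 h1]; rewrite ger0_norm. Qed.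

Lemma Us_T s a f : Us s (T a f) = Us s f.
Proof.
elim: s f => [|s IH] f /=; first by rewrite E_T.
congr mean; apply/funext => h.
by rewrite T_cj T_C -!T_cj -rmorphM IH T_cj.
Qed.

Lemma Us_cj s f : Us s (cj f) = Us s f.
Proof.
elim: s f => [|s IH] f /=; first by rewrite E_cj cabJ.
by congr mean; apply/funext => h; rewrite T_cj -rmorphM IH.
Qed.

Lemma Us_diffN s f (a : int) : Us s (f * T (- a) (cj f)) = Us s (f * T a (cj f)).
Proof.
rewrite -(Us_T s a (f * T (- a) (cj f))) rmorphM /= -TD subrr T0 -Us_cj.
by rewrite rmorphM /= cjK T_cj mulrC.
Qed.

Lemma Us_diff2 s f (a b : int) :
  Us s (T a f * T b (cj f)) = Us s (f * T (b - a) (cj f)).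
Proof.
rewrite -(Us_T s a (f * _)) rmorphM /= -TD; congr (Us s (_ * T _ _)).
by rewrite addrC subrK.
Qed.

Lemma Us_diff_abs s f (a : int) :
  Us s (f * T a (cj f)) = Us s (f * T (Posz `|a|%N) (cj f)).
Proof. by case: a => n //=; rewrite NegzE Us_diffN. Qed.

Lemma sum_nat_ext (g : nat -> R) m n : (forall i, 0 <= g i) -> (m <= n)%N ->
  \sum_(0 <= i < m) g i <= \sum_(0 <= i < n) g i.
Proof.
move=> g0 mn; rewrite (big_cat_nat (n := m) (p := n)) //= lerDl.
by apply: sumr_ge0.
Qed.

Lemma sum_absdiff (g : nat -> R) J h : (forall i, 0 <= g i) -> (h < J)%N ->
  \sum_(k < J) g `|(h%:Z - k%:Z)%R|%N <= 2 * \sum_(l < J) g l.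
Proof.
move=> g0 hJ; rewrite -(big_mkord predT (fun k => g `|(h%:Z - k%:Z)%R|%N)).
rewrite -(big_mkord predT g) (big_cat_nat (n := h.+1) (p := J)) //= mulr2n mulrDl !mul1r.
apply: lerD.
  rewrite big_nat_rev /= add0n; apply: le_trans (sum_nat_ext g0 hJ).
  rewrite [X in X <= _]big_nat [X in _ <= X]big_nat.
  apply: ler_sum => i /andP[_ hi].
  by rewrite (_ : `|_|%N = i) //; lia.
rewrite -[h.+1]add1n big_addn.
apply: le_trans (sum_nat_ext g0 (leq_subr h J)).
have [J1|J1] := leqP (J - h) 1; first by rewrite big_geq // sumr_ge0.
rewrite [X in _ <= X](big_cat_nat (n := 1)) //; last by lia.
rewrite /= ler_wpDl ?sumr_ge0 //.
by apply: ler_sum_nat => i _; rewrite (_ : `|_|%N = i) //; lia.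
Qed.

(** Sampling the shifts along the multiples of [a] costs at most a factor
    [|a|]. *)
Lemma Us_sample (s : nat) (f : S) (a : int) (eta : R) (J0 : nat) :
  a != 0 -> bd 1 f -> 0 < eta ->
  exists J : nat, [/\ (J0 <= J)%N, (0 < J)%N & forall s', (s' <= s)%N ->
    \sum_(i < J) \sum_(j < J) Us s' (f * T (a * (j%:Z - i%:Z)) (cj f)) <=
      (2 * `|a|%:~R * Us s'.+1 f + eta) * J%:R ^+ 2].
Proof.
move=> a0 bf e0; set A := (`|a|%N); have A0 : (0 < A)%N by rewrite absz_gt0.
have AR : `|a|%:~R = A%:R :> R by rewrite /A -abszE.
have Ap : (0 : R) < A%:R by rewrite ltr0n.
pose e := eta / (8 * A%:R).
have ep : 0 < e by rewrite divr_gt0 // mulr_gt0.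
pose J1 := (Num.truncn (4 * A%:R * (1 + e) / eta)).+1.
have [|H [hH Hp hm]] := @meanP R 'I_s.+1 (fun i m => Us i (f * T (Posz m) (cj f))) e
   (A * (maxn J0 J1).+1)%N _ ep.
  by move=> i n; apply/Us_norm/bd1_diff.
pose J := (H %/ A)%N.
have hJ : ((maxn J0 J1).+1 <= J)%N by rewrite leq_divRL // mulnC.
have J0p : (0 < J)%N by apply: leq_trans hJ.
exists J; split=> //; first by apply: leq_trans hJ; rewrite ltnW // ltnS leq_maxl.
move=> s' hs; set g := fun m => Us s' (f * T (Posz m) (cj f)).
have g0 m : 0 <= g m by case/andP: (Us_bd s' (bd1_diff (Posz m) bf)).
have Jp : (0 : R) < J%:R by rewrite ltr0n.
have h1 : \sum_(i < J) \sum_(j < J) Us s' (f * T (a * (j%:Z - i%:Z)) (cj f)) <=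
    J%:R * (2 * \sum_(l < J) g (A * l)%N).
  apply: le_trans (_ : \sum_(i < J) (2 * \sum_(l < J) g (A * l)%N) <= _); last first.
    by rewrite sumr_const card_ord -[X in X <= _]mulr_natl.
  apply: ler_sum => i _.
  apply: le_trans (sum_absdiff (g := fun l => g (A * l)%N) _ (ltn_ord i)) => //.
  apply: ler_sum => j _; rewrite Us_diff_abs /g.
  by rewrite (_ : `|_|%N = (A * `|(i%:Z - j%:Z)%R|)%N) // abszM distnC.
apply: le_trans h1 _.
have h2 : \sum_(l < J) g (A * l)%N <= \sum_(m < H) g m.
  apply: le_trans (_ : \sum_(0 <= m < (A * J)) g m <= _); last first.
    rewrite -(big_mkord predT g); apply: sum_nat_ext => //.
    by rewrite mulnC leq_trunc_div.
  elim: J {hJ J0p Jp} => [|K IH]; first by rewrite big_ord0 muln0 big_geq.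
  rewrite big_ord_recr /= mulnS addnC (big_cat_nat (n := (A * K)%N)) ?leq_addr //=.
  apply: lerD => //; rewrite big_ltn; last by rewrite -addn1 leq_add2l.
  by rewrite lerDl sumr_ge0.
have hs1 : (s' < s.+1)%N by [].
have := hm (Ordinal hs1) => /=.
rewrite -/g ler_norml => /andP[_ h3].
have h4 : (H%:R : R) <= A%:R * J%:R + A%:R.
  by rewrite -natrM -natrD ler_nat /J mulnC; have := ltn_ceil H A0; lia.
have Jb : 4 * A%:R * (1 + e) <= eta * J%:R.
  rewrite [X in _ <= X]mulrC -ler_pdivrMr //.
  apply: le_trans (ltW (truncnS_gt _)) _; rewrite ler_nat.
  by apply: leq_trans hJ; rewrite ltnW // ltnS leq_maxr.
have eA : 8 * A%:R * e = eta by rewrite /e mulrC divfK // gt_eqF // mulr_gt0.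
set m := mean g in h3 *.
have m01 : 0 <= m <= 1 by apply: (Us_bd s'.+1 bf).
case/andP: m01 => m0 m1.
have h5 : \sum_(l < J) g (A * l)%N <= (m + e) * (A%:R * J%:R + A%:R).
  apply: le_trans h2 _; apply: le_trans (_ : (m + e) * H%:R <= _); first lra.
  by rewrite ler_wpM2l // addr_ge0 // ltW.
have h6 : J%:R * (2 * ((m + e) * (A%:R * J%:R + A%:R))) <=
   (2 * A%:R * m + eta) * J%:R ^+ 2.
  have -> : J%:R * (2 * ((m + e) * (A%:R * J%:R + A%:R))) =
    (2 * A%:R * m + 2 * A%:R * e) * J%:R ^+ 2 + 2 * A%:R * (m + e) * J%:R by ring.
  have : 2 * A%:R * (m + e) * J%:R <= 2 * A%:R * (1 + e) * J%:R.
    by rewrite ler_wpM2r ?(ltW Jp) // ler_wpM2l ?mulr_ge0 ?(ltW Ap) // lerD2r.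
  have : 2 * (2 * A%:R * (1 + e)) * J%:R <= eta * J%:R * J%:R.
    by rewrite ler_wpM2r ?(ltW Jp) //; lra.
  have : 0 < eta * J%:R ^+ 2 by rewrite mulr_gt0 // exprn_gt0.
  rewrite -eA; lra.
apply: le_trans h6; rewrite ler_wpM2l ?(ltW Jp) // ler_wpM2l //.
Qed.

End Seminorms.

(** * Polynomial iterates *)

Section IntegerValued.
Variable R : realType.
Implicit Types (P Q : {poly R}).

Lemma ip_nat P n : integer_polynomial P -> P.[n%:R] \is a Num.int.
Proof. by move=> h; have := h (Posz n). Qed.

Lemma ipB P Q : integer_polynomial P -> integer_polynomial Q ->
  integer_polynomial (P - Q).
Proof. by move=> hP hQ z; rewrite hornerD hornerN rpredB. Qed.

Lemma ip_shp P (h : nat) : integer_polynomial P -> integer_polynomial (shp P h%:R).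
Proof.
move=> hP z; rewrite horner_shift.
by have := hP (z + Posz h); rewrite intrD.
Qed.

Lemma tvE P n : integer_polynomial P -> (poly_val P n)%:~R = P.[n%:R].
Proof. by move=> hP; apply/eqP; rewrite -intrEfloor ip_nat. Qed.

Lemma tvB P Q n : integer_polynomial P -> integer_polynomial Q ->
  poly_val (P - Q) n = poly_val P n - poly_val Q n.
Proof.
move=> hP hQ; apply: (@intr_inj R); rewrite rmorphB /= !tvE //; last exact: ipB.
by rewrite hornerD hornerN.
Qed.

Lemma tv_shp P (h n : nat) : poly_val (shp P h%:R) n = poly_val P (n + h).
Proof. by rewrite /poly_val horner_shift natrD. Qed.

Lemma tv_const P n m : (size P <= 1)%N -> poly_val P n = poly_val P m.
Proof. by move=> /size1_polyC ->; rewrite /poly_val !hornerC. Qed.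

Definition slope P : int := poly_val P 1 - poly_val P 0.

Lemma tv_lin P n h : integer_polynomial P -> (size P <= 2)%N ->
  poly_val P (n + h) = slope P * Posz h + poly_val P n.
Proof.
move=> hP sP; apply: (@intr_inj R).
rewrite rmorphD rmorphM rmorphB /= !tvE // !(horner_coef_wide _ sP).
rewrite !big_ord_recr !big_ord0 /= !expr0 !expr1 natrD; ring.
Qed.

Lemma slope_neq0 P : integer_polynomial P -> size P = 2%N -> slope P != 0.
Proof.
move=> hP sP; apply/eqP => h.
have : P`_1 = 0.
  have : (slope P)%:~R = 0 :> R by rewrite h.
  have sP' : (size P <= 2)%N by rewrite sP.
  rewrite rmorphB /= !tvE // !(horner_coef_wide _ sP').
  rewrite !big_ord_recr !big_ord0 /= !expr0 !expr1; lra.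
move=> p1; have : lead_coef P = 0 by rewrite lead_coefE sP.
by move/eqP; rewrite lead_coef_eq0 -size_poly_eq0 sP.
Qed.

Lemma lead_shp P c : lead_coef (shp P c) = lead_coef P.
Proof.
by rewrite /shp lead_coef_comp ?size_XaddC // lead_coefXaddC expr1n mulr1.
Qed.

Lemma shpB P Q c : shp (P - Q) c = shp P c - shp Q c.
Proof. by rewrite /shp comp_polyB. Qed.

Lemma shp_shp P a b : shp (shp P a) b = shp P (b + a).
Proof.
rewrite /shp -comp_polyA comp_polyD comp_polyX comp_polyC polyCD.
by rewrite addrA.
Qed.

Lemma size_shp_diff P a b : (2 < size P)%N -> a != b ->
  size (shp P a - shp P b) = (size P).-1.
Proof.
move=> sP ab; have [d sd] : exists d, size P = d.+3.
  by case: (size P) sP => [|[|[|d]]] // _; exists d.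
rewrite sd /=; apply/eqP; rewrite eqn_leq; apply/andP; split.
  by apply: size_shiftB; rewrite sd.
apply: contraTT isT; rewrite -ltnNge ltnS => h.
have : (shp P a - shp P b)`_d.+1 = 0 by rewrite nth_default.
rewrite coefB !coef_shift ?sd // => /eqP.
have -> : P`_d.+1 + P`_d.+2 * a * d.+2%:R - (P`_d.+1 + P`_d.+2 * b * d.+2%:R) =
  P`_d.+2 * (a - b) * d.+2%:R by ring.
rewrite !mulf_eq0 subr_eq0 (negbTE ab) pnatr_eq0 orbF orbF.
have := lead_coef_eq0 P; rewrite lead_coefE sd /= => ->.
by rewrite -size_poly_eq0 sd.
Qed.

Lemma size_sub_gt P Q : (size Q < size P)%N ->
  size (P - Q) = size P /\ lead_coef (P - Q) = lead_coef P.
Proof. by move=> h; rewrite size_polyDl ?lead_coefDl ?size_polyN. Qed.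

Lemma size_sub_neq P Q : size P = size Q -> lead_coef P != lead_coef Q ->
  size (P - Q) = size P /\ lead_coef (P - Q) = lead_coef P - lead_coef Q.
Proof.
move=> s l; have e : (P - Q)`_(size P).-1 = lead_coef P - lead_coef Q.
  by rewrite coefB !lead_coefE -s.
have s1 : size (P - Q) = size P.
  apply/eqP; rewrite eqn_leq (leq_trans (size_polyD _ _)) ?size_polyN ?s ?maxnn //=.
  have [z|] := posnP (size Q); first by rewrite z.
  move=> p; rewrite leqNgt; apply: contra l => h.
  have := e; rewrite nth_default; first by move/esym/eqP; rewrite subr_eq0.
  by rewrite -ltnS s prednK.
by split=> //; rewrite lead_coefE s1.
Qed.

Lemma size_sub_eq P Q : size P = size Q -> lead_coef P = lead_coef Q ->
  (0 < size P)%N -> (size (P - Q)%R < size P)%N.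
Proof.
move=> s l p; have e : (P - Q)`_(size P).-1 = 0.
  by rewrite coefB -{2}(prednK p) s /= -!lead_coefE -s -lead_coefE l subrr.
rewrite -(prednK p) ltnS; apply/leq_sizeP => j.
rewrite leq_eqVlt => /predU1P[<-//|h].
by rewrite nth_default // (leq_trans (size_polyD _ _)) // size_polyN -s maxnn; lia.
Qed.

Lemma size_sub_le P Q n : (size P <= n)%N -> (size Q <= n)%N ->
  (size (P - Q)%R <= n)%N.
Proof.
by move=> h1 h2; rewrite (leq_trans (size_polyD _ _)) // size_polyN geq_max h1.
Qed.

(** The degree of [P (x + h) - Q (x + h')] only drops for one value of
    [h - h']. *)
Lemma shift_separation P (Qs : seq {poly R}) : (2 < size P)%N ->
  exists2 M0 : nat, (0 < M0)%N & forall i j, i != j -> forall Q, Q \in Qs ->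
    (1 < size (shp P (M0 * i)%:R - shp Q (M0 * j)%:R)%R)%N.
Proof.
move=> sP.
suff [m m0 hm] : exists2 m : nat, (0 < m)%N & forall h h' : nat,
    (m <= `|(h%:Z - h'%:Z)%R|)%N ->
    forall Q, Q \in Qs -> (1 < size (shp P h%:R - shp Q h'%:R)%R)%N.
  exists m => // i j ij; apply: hm; rewrite !PoszM -mulrBr abszM absz_nat.
  by rewrite leq_pmulr // absz_gt0 subr_eq0 eqz_nat.
elim: Qs => [|Q Qs [m m0 hm]]; first by exists 1%N.
suff [m' m'0 hm'] : exists2 m' : nat, (0 < m')%N & forall h h' : nat,
    (m' <= `|(h%:Z - h'%:Z)%R|)%N -> (1 < size (shp P h%:R - shp Q h'%:R)%R)%N.
  exists (maxn m m'); first by rewrite leq_max m0.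
  move=> h h'; rewrite geq_max => /andP[h1 h2] Q'.
  by rewrite in_cons => /predU1P[->|]; [apply: hm'|apply: hm].
(* two bad pairs with different gaps would make a difference of two translates
   of [P] constant *)
have [[h0 [h0' bad]]|good] := pselect (exists h h' : nat,
    (size (shp P h%:R - shp Q h'%:R)%R <= 1)%N); last first.
  exists 1%N => // h h' _; rewrite ltnNge; apply/negP => H; apply: good.
  by exists h, h'.
exists (`|(h0%:Z - h0'%:Z)%R|).+1 => // h h' hh; rewrite ltnNge; apply/negP => bad'.
have b1 : (size (shp (shp P h%:R - shp Q h'%:R) h0'%:R -
    shp (shp P h0%:R - shp Q h0'%:R) h'%:R)%R <= 1)%N.
  by apply: size_sub_le; rewrite size_shift.
have := @size_shp_diff P (h0'%:R + h%:R) (h'%:R + h0%:R) sP.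
rewrite -!natrD eqr_nat => /(_ _)/wrap[]; first by apply/eqP; lia.
move: b1; rewrite !shpB !shp_shp (addrC h0'%:R h'%:R) -!natrD.
have -> : shp P (h0' + h)%:R - shp Q (h' + h0')%:R -
   (shp P (h' + h0)%:R - shp Q (h' + h0')%:R) =
   shp P (h0' + h)%:R - shp P (h' + h0)%:R by ring.
by move=> + e; rewrite e; lia.
Qed.

End IntegerValued.

Section PolynomialAverages.
Variables (R : realType) (S : system R).
Implicit Types (f g : S) (P Q q : {poly R}) (Qs : seq {poly R}).

Fixpoint bdL (L : seq ({poly R} * S)) : Prop :=
  if L is x :: L' then bd 1 x.2 /\ bdL L' else True.

Lemma bdL_cat L L' : bdL L -> bdL L' -> bdL (L ++ L').
Proof. by elim: L => //= x L IH [h1 h2] h3; split=> //; apply: IH. Qed.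

Lemma bdL_map (F : {poly R} * S -> {poly R} * S) L :
  (forall x, bd 1 x.2 -> bd 1 (F x).2) -> bdL L -> bdL (map F L).
Proof. by move=> hF; elim: L => //= x L IH [h1 h2]; split; [apply: hF|apply: IH]. Qed.

Lemma bdL_filter (p : pred ({poly R} * S)) L : bdL L -> bdL (seq.filter p L).
Proof. by elim: L => //= x L IH [h1 h2]; case: ifP => _ /=; [split|]; auto. Qed.

Lemma bdL_prod p (F : {poly R} * S -> S) L : bdL L ->
  (forall x, bd 1 x.2 -> bd 1 (F x)) -> bd 1 (\prod_(x <- L | p x) F x).
Proof.
move=> + hF; elim: L => [|x L IH] /=; first by rewrite big_nil => _; apply: bd_one.
move=> [h1 h2]; rewrite big_cons; case: ifP => _; last exact: IH.
by apply: bd1M; [apply: hF|apply: IH].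
Qed.

Notation Tp P n := (T (poly_val P n)).

(** Means along the iterates [P], [Qs] are small as soon as the function
    carried by [P] has small iterated difference means; the thresholds depend on
    the polynomials only. *)
Definition seminorm_control P Qs := forall eps : R, 0 < eps ->
  exists (s : nat) (delta : R), 0 < delta /\
  forall (g0 g : S) (L : seq ({poly R} * S)), map fst L = Qs ->
    bd 1 g0 -> bd 1 g -> bdL L -> (forall s', (s' <= s)%N -> Us s' g <= delta) ->
    Ub (fun n => E (g0 * (Tp P n g * \prod_(x <- L) Tp x.1 n x.2))) eps.

Definition derP P q (h h' : nat) := shp P h%:R - shp q h'%:R.

Definition derQ P Qs q (h h' : nat) :=
  (shp P h'%:R - shp q h'%:R) :: [seq shp Q h%:R - shp q h'%:R | Q <- Qs]
    ++ [seq shp Q h'%:R - shp q h'%:R | Q <- Qs].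

Lemma bdTp P n f : bd 1 f -> bd 1 (Tp P n f).
Proof. exact: bd_T. Qed.

(** The differencing step of PET induction: translating the correlations of two
    shifts by [q] turns the family into its derived family, in which the
    function of [P] still occurs. *)
Lemma control_derive P Qs q M0 :
  integer_polynomial P -> (forall Q, Q \in Qs -> integer_polynomial Q) ->
  integer_polynomial q ->
  (forall i j, i != j -> seminorm_control (derP P q (M0 * i) (M0 * j))
     (derQ P Qs q (M0 * i) (M0 * j))) ->
  seminorm_control P Qs.
Proof.
move=> iP iQ iq hder eps e0.
have e40 : 0 < eps ^+ 2 / 4 by rewrite divr_gt0 ?exprn_gt0.
pose J := (Num.truncn (4 / eps ^+ 2)).+1.
have hJ : 4 <= eps ^+ 2 * J%:R.
  rewrite mulrC -ler_pdivrMr ?exprn_gt0 //; exact: ltW (truncnS_gt _).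
have /choice[sd hsd] : forall ij : 'I_J * 'I_J, exists sd : nat * R, 0 < sd.2 /\
   (ij.1 != ij.2 -> forall (g0 g : S) (L : seq ({poly R} * S)),
    map fst L = derQ P Qs q (M0 * ij.1) (M0 * ij.2) ->
    bd 1 g0 -> bd 1 g -> bdL L -> (forall s', (s' <= sd.1)%N -> Us s' g <= sd.2) ->
    Ub (fun n => E (g0 * (Tp (derP P q (M0 * ij.1) (M0 * ij.2)) n g
       * \prod_(x <- L) Tp x.1 n x.2))) (eps ^+ 2 / 4)).
  move=> [i j] /=; case: (eqVneq i j) => [_|ij]; first by exists (0%N, 1).
  by have [s [dl [d0 h]]] := hder i j ij _ e40; exists (s, dl).
exists (\max_ij (sd ij).1), (\big[Num.min/1]_ij (sd ij).2); split.
  by apply/bigmin_gtP; split=> // ij _; case: (hsd ij).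
move=> g0 g L hL bg0 bg bL hU.
apply: (van_der_corput_unif (J := J) (M0 := M0)) => //.
  move=> n; apply: bd1M; first exact: bdTp.
  by apply: bdL_prod => // x; apply: bdTp.
move=> i j hi hj ij; set h := (M0 * i)%N; set h' := (M0 * j)%N.
have [_ /(_ ij)] := hsd (Ordinal hi, Ordinal hj); rewrite /= -/h -/h'.
pose sh k (c : S -> S) (x : {poly R} * S) := (shp x.1 k%:R - shp q h'%:R, c x.2).
pose L' := (shp P h'%:R - shp q h'%:R, cj g) :: map (sh h id) L ++ map (sh h' cj) L.
move=> /(_ 1 g L' _ (bd_one _) bg _ _)/wrap[].
- rewrite /L' /derQ /= map_cat -!map_comp -hL -!map_comp.
  by congr (_ :: _ ++ _); apply: eq_map.
- rewrite /L' /=; split; first exact: bd_cj.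
  by apply: bdL_cat; apply: bdL_map => // x; apply: bd_cj.
- move=> s' hs; apply: le_trans (hU s' _) _.
    apply: leq_trans hs _; exact: (leq_bigmax (F := fun ij => (sd ij).1)).
  exact: bigmin_le_cond.
apply: Ub_ext => n; rewrite -[RHS](E_T (- poly_val q (n + h')%N)) mul1r.
congr (E _); rewrite /L' big_cons big_cat !big_map /= /sh /=.
have ish x : integer_polynomial x -> forall k, T (poly_val (shp x k%:R - shp q h'%:R) n)
     = (fun f => T (- poly_val q (n + h')%N) (T (poly_val x (n + k)%N) f)) :> (S -> S).
  move=> ix k; apply/funext => f.
  by rewrite (tvB n (ip_shp k ix) (ip_shp h' iq)) !tv_shp addrC TD.
have iL x : List.In x L -> integer_polynomial x.1.
  move=> xL; apply: iQ; rewrite -hL; elim: L xL {hL bL L'} => //= y L IH [->|/IH].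
    by rewrite mem_head.
  by rewrite in_cons orbC => ->.
have prodE k (c : {rmorphism S -> S}) :
   \prod_(x <- L) T (poly_val (shp x.1 k%:R - shp q h'%:R) n) (c x.2) =
   T (- poly_val q (n + h')%N) (\prod_(x <- L) T (poly_val x.1 (n + k)%N) (c x.2)).
  elim: L iL {hL bL L'} => [|x L IH] iL; first by rewrite !big_nil rmorph1.
  rewrite !big_cons rmorphM IH; last by move=> y yL; apply: iL; right.
  by rewrite (congr1 (fun F => F (c x.2)) (ish _ (iL x (or_introl erefl)) k)).
rewrite (prodE h idfun) (prodE h' cj) /derP.
rewrite (congr1 (fun F => F g) (ish P iP h)) (congr1 (fun F => F (cj g)) (ish P iP h')).
rewrite -!rmorphM /=; congr (T _ _).
rewrite !rmorphM /= rmorph_prod.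
have -> : \prod_(x <- L) T (poly_val x.1 (n + h')%N) (cj x.2) =
   \prod_(i <- L) cj (T (poly_val i.1 (n + h')%N) i.2).
  by apply: eq_bigr => x _; rewrite T_cj.
rewrite T_cj /=; ring.
Qed.

(** Constant iterates do not depend on [n] and belong to the fixed function. *)
Lemma control_filter P Qs :
  seminorm_control P (seq.filter (fun Q => 1 < size Q)%N Qs) -> seminorm_control P Qs.
Proof.
move=> H eps e0; have [s [dl [d0 h]]] := H eps e0; exists s, dl; split=> //.
move=> g0 g L hL bg0 bg bL hU.
pose p := fun x : {poly R} * S => (1 < size x.1)%N.
pose g0' := g0 * \prod_(x <- L | ~~ p x) Tp x.1 0 x.2.
have := h g0' g (seq.filter p L) _ _ bg (bdL_filter p bL) hU.
move=> /(_ _ _)/wrap[].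
- by rewrite -hL /p; elim: (L) => //= x l IHl; case: ifP => _ /=; rewrite IHl.
- by apply: bd1M => //; apply: bdL_prod => // x; apply: bdTp.
apply: Ub_ext => n; congr (E _); rewrite big_filter [in RHS](bigID p) /=.
have -> : \prod_(i <- L | ~~ p i) Tp i.1 n i.2 = \prod_(i <- L | ~~ p i) Tp i.1 0 i.2.
  by apply: eq_bigr => x; rewrite /p -leqNgt => hs; rewrite (tv_const n 0 hs).
by rewrite /g0'; ring.
Qed.

End PolynomialAverages.

(** * Control by difference means *)

Section Control.
Variables (R : realType) (S : system R).
Implicit Types (f g : S) (P Q q : {poly R}) (Qs : seq {poly R}).

Notation Tp P n := (T (poly_val P n)).

(** Having the largest degree, and not differing from the others by constants, is
    what survives differencing and keeps the function of [P] in sight. *)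
Definition nice P Qs := [/\ integer_polynomial P,
  forall Q, Q \in Qs -> integer_polynomial Q, (1 < size P)%N &
  forall Q, Q \in Qs -> (size Q <= size P)%N && (1 < size (P - Q)%R)%N].

(** One differencing step for a family of degree one: translating by the
    shifts merges the two copies of each function. *)
Lemma linear_step (a : int) (g0 g : S) (v : nat -> S) (eps d1 : R) (s1 : nat) :
  a != 0 -> 0 < eps -> 0 < d1 -> bd 1 g0 -> bd 1 g -> (forall n, bd 1 (v n)) ->
  (forall i j, Ub (fun n => E (v (n + i)%N * cj (v (n + j)%N)))
     (eps ^+ 2 / 4 +
      d1^-1 * \sum_(s' < s1.+1) Us s' (g * T (a * (j%:Z - i%:Z)) (cj g)))) ->
  (forall s', (s' <= s1.+1)%N -> Us s' g <=
     eps ^+ 2 / 4 * (d1 / (s1.+1%:R * (2 * `|a|%:~R + 1)))) ->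
  Ub (fun n => E (g0 * v n)) eps.
Proof.
move=> a0 e0 d10 bg0 bg bv hv hU.
(* the threshold is chosen so that the sampled means contribute exactly half of
   the room that the van der Corput inequality leaves *)
set dl := eps ^+ 2 / 4 * _ in hU.
have A0 : 0 <= `|a|%:~R :> R by rewrite ler0z.
have dl0 : 0 < dl.
  rewrite !mulr_gt0 ?invr_gt0 ?exprn_gt0 // mulr_gt0 ?ltr0n //; lra.
have [J [_ J0 hJ]] := Us_sample s1 0 a0 bg dl0.
have J2 : (0 : R) < J%:R ^+ 2 by rewrite exprn_gt0 // ltr0n.
apply: (van_der_corput (J := J) (M0 := 1) (e := fun i j => eps ^+ 2 / 4 +
      d1^-1 * \sum_(s' < s1.+1) Us s' (g * T (a * (j%:Z - i%:Z)) (cj g)))) => //.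
  by move=> i j _ _; apply: Ub_ext (hv i j) => n; rewrite !mul1n.
under eq_bigr do rewrite big_split /= sumr_const card_ord -mulr_sumr exchange_big.
rewrite big_split /= sumr_const card_ord -mulr_sumr exchange_big /=.
have hs : \sum_(s' < s1.+1) \sum_(i < J) \sum_(j < J)
   Us s' (g * T (a * (j%:Z - i%:Z)) (cj g)) <=
   s1.+1%:R * ((2 * `|a|%:~R + 1) * dl * J%:R ^+ 2).
  apply: le_trans (_ : \sum_(s' < s1.+1) ((2 * `|a|%:~R + 1) * dl * J%:R ^+ 2) <= _).
    apply: ler_sum => s' _; apply: le_trans (hJ s' _) _; first by rewrite -ltnS.
    apply: ler_wpM2r; first exact: ltW.
    rewrite [X in _ <= X]mulrDl mul1r lerD2r ler_wpM2l ?mulr_ge0 //.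
    by apply: hU; rewrite ltnS -ltnS.
  by rewrite sumr_const card_ord -[X in X <= _]mulr_natl.
have e1 : eps ^+ 2 / 4 *+ J *+ J = eps ^+ 2 / 4 * J%:R ^+ 2.
  by rewrite -mulrnA -[LHS]mulr_natr natrM expr2.
rewrite e1.
have h2 : d1^-1 * (s1.+1%:R * ((2 * `|a|%:~R + 1) * dl * J%:R ^+ 2)) =
   eps ^+ 2 / 4 * J%:R ^+ 2.
  rewrite /dl; field; rewrite ?gt_eqF //=; lra.
apply: le_lt_trans (_ : eps ^+ 2 / 4 * J%:R ^+ 2 + eps ^+ 2 / 4 * J%:R ^+ 2 < _); last first.
  have : 0 < eps ^+ 2 * J%:R ^+ 2 by rewrite mulr_gt0 // exprn_gt0.
  lra.
by rewrite lerD2l -h2 ler_wpM2l // ?invr_ge0 ?(ltW d10).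
Qed.

Lemma Tp_lin P n h f : integer_polynomial P -> (size P <= 2)%N ->
  Tp P (n + h)%N f = Tp P n (T (slope P * Posz h) f).
Proof. by move=> iP sP; rewrite tv_lin // addrC TD. Qed.

(** For degree one the shifted functions recombine after differencing, so the
    number of polynomials decreases while the order of the means goes up. *)
Lemma control_linear P Qs : nice P Qs -> size P = 2%N -> seminorm_control S P Qs.
Proof.
move en : (size Qs) => N; elim: N Qs en P => [|N IH] [|Q0 Qs] //= en P [iP iQ P1 hQ] sP eps e0.
  have a0 := slope_neq0 iP sP.
  exists 1%N, (eps ^+ 2 / 4 * (1 / (1 * (2 * `|slope P|%:~R + 1)))); split.
    have A0 : 0 <= `|slope P|%:~R :> R by rewrite ler0z.
    by rewrite !mulr_gt0 ?invr_gt0 ?exprn_gt0 ?divr_gt0 // ?mul1r; lra.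
  move=> g0 g [|x L] // _ bg0 bg _ hU.
  apply: (@linear_step (slope P) g0 g _ eps 1 0 a0 e0 ltr01) => //.
  - by move=> n; rewrite big_nil mulr1; apply: bd_T.
  move=> i j; apply: (@Ub_le _ _ (0 + Us 0 (g * T (slope P * (j%:Z - i%:Z)) (cj g)))).
    by rewrite big_ord1 invr1 mul1r lerD2r divr_ge0 ?sqr_ge0.
  rewrite add0r; apply: Ub_bd => n; rewrite !big_nil !mulr1.
  by rewrite !Tp_lin ?sP // -T_cj -rmorphM E_T -T_cj mulrBr -Us_diff2.
have iQ0 : integer_polynomial Q0 by apply: iQ; rewrite mem_head.
have /andP[sQ0 nQ0] := hQ Q0 (mem_head _ _).
have e40 : 0 < eps ^+ 2 / 4 by rewrite divr_gt0 ?exprn_gt0.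
have nice' : nice (P - Q0) [seq Q - Q0 | Q <- Qs].
  split=> //; first exact: ipB.
    by move=> _ /mapP[Q hq ->]; apply: ipB => //; apply: iQ; rewrite in_cons hq orbT.
  move=> _ /mapP[Q hq ->].
  have /andP[sQ nQ] : (size Q <= size P)%N && (1 < size (P - Q)%R)%N.
    by apply: hQ; rewrite in_cons hq orbT.
  rewrite opprB addrA subrK nQ andbT.
  by move: sQ sQ0; rewrite sP => sQ sQ0; apply: leq_trans nQ0; apply: size_sub_le.
have sP' : size (P - Q0) = 2%N.
  by apply/eqP; rewrite eqn_leq nQ0 andbT -sP size_sub_le.
have en' : size [seq Q - Q0 | Q <- Qs] = N by rewrite size_map; case: en.
have [s1 [d1 [d10 H]]] := IH _ en' _ nice' sP' _ e40.
have a0 := slope_neq0 iP sP.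
exists s1.+1, (eps ^+ 2 / 4 * (d1 / (s1.+1%:R * (2 * `|slope P|%:~R + 1)))); split.
  have A0 : 0 <= `|slope P|%:~R :> R by rewrite ler0z.
  by rewrite !mulr_gt0 ?invr_gt0 ?exprn_gt0 // mulr_gt0 ?ltr0n //; lra.
move=> g0 g [|[Q0' f0] L] //= [eQ hL] bg0 bg [bf0 bL] hU; rewrite {Q0'}eQ.
apply: (@linear_step (slope P) g0 g _ eps d1 s1 a0 e0 d10) => //.
  move=> n; apply: bd1M; first exact: bd_T.
  rewrite big_cons; apply: bd1M; first exact: bd_T.
  by apply: bdL_prod => // x; apply: bd_T.
move=> i j.
pose g' := T (slope P * Posz i) g * T (slope P * Posz j) (cj g).
have Ug s' : Us s' g' = Us s' (g * T (slope P * (j%:Z - i%:Z)) (cj g)).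
  by rewrite /g' Us_diff2 mulrBr.
have bg' : bd 1 g' by apply: bd1M; apply: bd_T => //; apply: bd_cj.
have U0 s' : 0 <= Us s' g' by case/andP: (Us_bd s' bg').
have e4 : 0 <= eps ^+ 2 / 4 by apply: ltW.
have bv n : bd 1 (Tp P n g * \prod_(x <- (Q0, f0) :: L) Tp x.1 n x.2).
  apply: bd1M; first exact: bd_T.
  rewrite big_cons; apply: bd1M; first exact: bd_T.
  by apply: bdL_prod => // x; apply: bd_T.
have [hs|/existsNP[s' /not_implyP[hs /negP]]] :=
   pselect (forall s', (s' <= s1)%N -> Us s' g' <= d1); last first.
  rewrite -ltNge => hs'; apply: (@Ub_le _ _ 1); last first.
    by apply: Ub_bd => n; apply: cab_E; apply: bd1M => //; apply: bd_cj.
  apply: le_trans (_ : d1^-1 * Us s' g' <= _).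
    by rewrite mulrC ler_pdivlMr // mul1r ltW.
  rewrite -[X in X <= _]add0r lerD // ler_wpM2l ?invr_ge0 ?(ltW d10) //.
  have hs2 : (s' < s1.+1)%N by [].
  rewrite Ug (bigD1 (Ordinal hs2)) //= lerDl; apply: sumr_ge0 => k _.
  by rewrite -Ug.
apply: (@Ub_le _ _ (eps ^+ 2 / 4)).
  rewrite lerDl mulr_ge0 ?invr_ge0 ?(ltW d10) //.
  by apply: sumr_ge0 => k _; rewrite -Ug.
pose L' := [seq (x.1 - Q0, T (slope x.1 * Posz i) x.2 * T (slope x.1 * Posz j) (cj x.2)) | x <- L].
pose g0' := T (slope Q0 * Posz i) f0 * T (slope Q0 * Posz j) (cj f0).
have := H g0' g' L'.
move=> /(_ _ _ bg' _ hs)/wrap[].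
- by rewrite /L' -hL -!map_comp; apply: eq_map.
- by apply: bd1M; apply: bd_T => //; apply: bd_cj.
- apply: (@bdL_map R S (fun x => (x.1 - Q0, T (slope x.1 * Posz i) x.2 * T (slope x.1 * Posz j) (cj x.2)))) => // x bx.
  by apply: bd1M; apply: bd_T => //; apply: bd_cj.
apply: Ub_ext => n; rewrite -(E_T (poly_val Q0 n)) rmorphM /=; congr (E _).
have sh x : integer_polynomial x -> forall f, T (poly_val Q0 n) (Tp (x - Q0) n f) = Tp x n f.
  by move=> ix f; rewrite -TD tvB // addrC subrK.
rewrite rmorphM /= sh // !big_cons /= !rmorphM /= rmorph_prod big_map.
rewrite !Tp_lin ?sP // -?sP //.
rewrite !rmorph_prod.
have iL x : List.In x L -> integer_polynomial x.1 /\ (size x.1 <= 2)%N.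
  move=> xL; have xQ : x.1 \in Q0 :: Qs.
    rewrite -hL in_cons; apply/orP; right.
    elim: L xL {hL bL bv hU L'} => //= y L IHL [->|/IHL]; first by rewrite mem_head.
    by rewrite in_cons orbC => ->.
  by split; [exact: iQ|rewrite -sP; case/andP: (hQ _ xQ)].
have -> : \prod_(x <- L) T (poly_val Q0 n) (Tp (x.1 - Q0) n
     (T (slope x.1 * Posz i) x.2 * T (slope x.1 * Posz j) (cj x.2))) =
   (\prod_(x <- L) Tp x.1 (n + i)%N x.2) * \prod_(x <- L) cj (Tp x.1 (n + j)%N x.2).
  rewrite -big_split /=; elim: L iL {hL bL bv hU L'} => [|x L IHL] iL.
    by rewrite !big_nil.
  rewrite !big_cons IHL; last by move=> y yL; apply: iL; right.
  have [ix sx] := iL x (or_introl erefl).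
  by rewrite sh // !Tp_lin // rmorphM /= !T_cj.
rewrite !T_cj; ring.
Qed.

(** The measure of complexity for PET induction; only the number of distinct
    leading coefficients matters, because polynomials sharing one are lowered
    simultaneously by subtracting any of them. *)
Definition weight (fam : seq {poly R}) (r : nat) : nat :=
  size (undup [seq lead_coef Q | Q <- [seq Q : {poly R} <- fam | size Q == r.+1]]).

Definition lexlt (D : nat) (u v : nat -> nat) := exists r : nat,
  [/\ (1 <= r <= D)%N, (u r < v r)%N & forall j, (r < j <= D)%N -> (u j <= v j)%N].

(** Only finitely many degrees are compared, so the order is well founded although
    the lower degrees may grow. *)
Lemma lex_ind D (Pr : (nat -> nat) -> Prop) :
  (forall v, (forall u, lexlt D u v -> Pr u) -> Pr v) -> forall v, Pr v.
Proof.
elim: D Pr => [|D IHD] Pr H.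
  by move=> v; apply: H => u [r [/andP[h1 h2]]]; lia.
suff st n : (forall v, (v D.+1 < n)%N -> Pr v) -> forall v, v D.+1 = n -> Pr v.
  suff : forall n v, (v D.+1 < n)%N -> Pr v by move=> h v; exact: (h (v D.+1).+1).
  elim=> // n IHn v; rewrite ltnS leq_eqVlt => /predU1P[|]; last exact: IHn.
  exact: st.
move=> hlt; apply: IHD => v IH vn; apply: H => u [r [/andP[r1 rD] ur uj]].
have [rD'|rD'] := eqVneq r D.+1.
  by apply: hlt; rewrite -vn -rD'.
have rD2 : (r <= D)%N by rewrite -ltnS ltn_neqAle rD' rD.
have := uj D.+1; rewrite ltnSn andbT ltnS => /(_ rD2).
rewrite leq_eqVlt vn => /predU1P[e|]; last exact: hlt.
apply: IH => //; exists r; split=> //; first by rewrite r1.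
by move=> j /andP[h1 h2]; apply: uj; rewrite h1 ltnW.
Qed.

Lemma weight_in (fam : seq {poly R}) r (x : R) :
  (x \in undup [seq lead_coef Q | Q <- [seq Q : {poly R} <- fam | size Q == r.+1]]) <->
  exists Q, [/\ Q \in fam, size Q = r.+1 & lead_coef Q = x].
Proof.
rewrite mem_undup; split.
  by move=> /mapP[Q]; rewrite mem_filter => /andP[/eqP sQ Qf] ->; exists Q.
move=> [Q [Qf sQ lQ]]; apply/mapP; exists Q => //.
by rewrite mem_filter sQ eqxx.
Qed.

Lemma derQ_in P Qs q h h' A : A \in derP P q h h' :: derQ P Qs q h h' ->
  exists B k, B \in P :: Qs /\ A = shp B k%:R - shp q h'%:R.
Proof.
rewrite /derQ !in_cons mem_cat => /or4P[/eqP->|/eqP->|/mapP[Q hQ ->]|/mapP[Q hQ ->]].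
- by exists P, h; rewrite mem_head.
- by exists P, h'; rewrite mem_head.
- by exists Q, h; rewrite in_cons hQ orbT.
- by exists Q, h'; rewrite in_cons hQ orbT.
Qed.

Lemma derive_nice P Qs q h h' : nice P Qs -> q \in P :: Qs ->
  (2 < size P)%N -> h != h' ->
  (forall Q, Q \in Qs -> (1 < size (shp P h%:R - shp Q h'%:R)%R)%N) ->
  (1 < size (derP P q h h'))%N ->
  (forall A, A \in derQ P Qs q h h' -> (size A <= size (derP P q h h'))%N) ->
  nice (derP P q h h') (derQ P Qs q h h').
Proof.
move=> [iP iQ P1 hQ] qin sP hh hM s1 sle.
have iall B : B \in P :: Qs -> integer_polynomial B.
  by rewrite in_cons => /predU1P[->//|]; apply: iQ.
have iq := iall _ qin.
split=> //.
- by apply: ipB; apply: ip_shp.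
- move=> A hA; have [|B [k [Bin ->]]] := @derQ_in P Qs q h h' A.
    by rewrite in_cons hA orbT.
  by apply: ipB; apply: ip_shp => //; apply: iall.
move=> A hA; rewrite sle //= /derP.
have sub B k : shp P h%:R - shp q h'%:R - (shp B k%:R - shp q h'%:R) =
   shp P h%:R - shp B k%:R by ring.
move: hA; rewrite /derQ in_cons mem_cat => /or3P[/eqP->|/mapP[Q Qin ->]|/mapP[Q Qin ->]];
  rewrite sub.
- rewrite size_shp_diff //; last by rewrite eqr_nat.
  by case: (size P) sP => [|[|[]]].
- by rewrite -shpB size_shift; case/andP: (hQ _ Qin).
- exact: hM.
Qed.

(** PET induction: differencing with a polynomial chosen of least degree among
    those not sharing the top term of [P] keeps the family nice and removes one
    leading coefficient, until all degrees are one. *)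
Theorem control P Qs : nice P Qs -> seminorm_control S P Qs.
Proof.
suff main : forall D w P Qs, nice P Qs -> (size P <= D.+1)%N ->
    (forall r, (0 < r)%N -> weight (P :: Qs) r = w r) -> seminorm_control S P Qs.
  by move=> h; apply: (main (size P) (weight (P :: Qs))).
move=> D w; elim/(@lex_ind D): w => w IH {}P {}Qs hn sD hw.
apply: control_filter; set Q2 := [seq Q <- Qs | _].
have hn2 : nice P Q2.
  case: hn => iP iQ P1 hQ; split=> // Q; rewrite mem_filter => /andP[_]; [exact: iQ|exact: hQ].
have hw2 r : (0 < r)%N -> weight (P :: Q2) r = w r.
  move=> r0; rewrite -hw // /weight /= -filter_predI.
  rewrite (@eq_filter _ _ (fun Q : {poly R} => size Q == r.+1)) //.
  by move=> Q /=; case: eqP => //= ->; rewrite ltnS r0.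
have nc Q : Q \in Q2 -> (1 < size Q)%N by rewrite mem_filter => /andP[].
clearbody Q2; clear hn hw Qs; move: Q2 hn2 hw2 nc => Qs hn hw nc.
have [iP iQ P1 hQ] := hn.
have [s2|s2] := eqVneq (size P) 2%N; first exact: control_linear.
have sP : (2 < size P)%N by rewrite ltn_neqAle eq_sym s2 P1.
have [M0 M00 hM] := shift_separation Qs sP.
have ncA A : A \in P :: Qs -> (1 < size A)%N by rewrite in_cons => /predU1P[->//|/nc].
have leA A : A \in P :: Qs -> (size A <= size P)%N.
  by rewrite in_cons => /predU1P[->//|/hQ/andP[]].
have ss A k : size (shp A k%:R) = size A by rewrite size_shift.
pose equiv (Q : {poly R}) := (size Q == size P) && (lead_coef Q == lead_coef P).
have [hne|hall] := boolP (has (fun Q => ~~ equiv Q) Qs); last first.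
  (* every polynomial shares the top term of [P], which is subtracted *)
  have eqA A : A \in P :: Qs -> size A = size P /\ lead_coef A = lead_coef P.
    rewrite in_cons => /predU1P[->//|hA].
    move: hall; rewrite -all_predC => /allP/(_ _ hA); rewrite /= negbK.
    by case/andP => /eqP-> /eqP->.
  apply: (control_derive (q := P) (M0 := M0)) => // i j ij.
  have hh : M0 * i != M0 * j by rewrite eqn_pmul2l.
  have sp' : size (derP P P (M0 * i) (M0 * j)) = (size P).-1.
    by rewrite size_shp_diff // eqr_nat.
  have lt A : A \in derP P P (M0 * i) (M0 * j) :: derQ P Qs P (M0 * i) (M0 * j) ->
      (size A < size P)%N.
    move=> /derQ_in[B [k [/eqA[sB lB] ->]]].
    have := @size_sub_eq R (shp B k%:R) (shp P (M0 * j)%:R).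
    rewrite !ss !lead_shp sB lB; apply=> //; exact: ltn_trans P1.
  have nice' : nice (derP P P (M0 * i) (M0 * j)) (derQ P Qs P (M0 * i) (M0 * j)).
    apply: derive_nice => //; first exact: mem_head.
    - by move=> Q Qin; apply: hM.
    - by rewrite sp'; case: (size P) sP => [|[|[]]].
    - move=> A Ain; have := lt A; rewrite in_cons Ain orbT sp' => /(_ isT).
      by case: (size P).
  apply: (IH (weight (derP P P (M0 * i) (M0 * j) :: derQ P Qs P (M0 * i) (M0 * j)))) => //.
    exists (size P).-1; have w0 : forall r, ((size P).-1 <= r)%N ->
        weight (derP P P (M0 * i) (M0 * j) :: derQ P Qs P (M0 * i) (M0 * j)) r = 0%N.
      move=> r hr; apply/eqP; rewrite size_eq0 -[_ == _]negbK; apply/negP => /eqP.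
      case E0 : (undup _) => [|x l] // _.
      have : x \in x :: l by rewrite mem_head.
      rewrite -E0 => /weight_in[A [/lt]]; lia.
    split.
    - by case: (size P) sP sD => [|[|[|n]]] //= _; rewrite ltnS.
    - rewrite w0 // -hw; last by case: (size P) sP => [|[|[]]].
      rewrite lt0n size_eq0; apply/eqP => E0.
      have : lead_coef P \in ([::] : seq R) by rewrite -E0; apply/weight_in; exists P;
        rewrite mem_head prednK // (ltn_trans _ P1).
      by [].
    - by move=> k /andP[h1 _]; rewrite w0 // ltnW.
  by rewrite sp' (leq_trans (leq_pred _)).
(* otherwise subtract one of least degree among those with another top term *)
have [q [qin nq qmin]] : exists q, [/\ q \in Qs, ~~ equiv q &
    forall Q, Q \in Qs -> ~~ equiv Q -> (size q <= size Q)%N].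
  have ex : exists n, has (fun Q : {poly R} => ~~ equiv Q && (size Q == n)) Qs.
    by case/hasP: hne => Q Qin nQ; exists (size Q); apply/hasP; exists Q; rewrite ?nQ ?eqxx.
  case: (ex_minnP ex) => n /hasP[q qin /andP[nq /eqP sq]] hmin.
  exists q; split=> // Q Qin nQ; rewrite sq; apply: hmin; apply/hasP; exists Q => //.
  by rewrite nQ eqxx.
have qA : q \in P :: Qs by rewrite in_cons qin orbT.
have qP : size q = size P -> lead_coef P != lead_coef q.
  by move=> e; move: nq; rewrite /equiv e eqxx eq_sym.
apply: (control_derive (q := q) (M0 := M0)) => //; first exact: iQ.
move=> i j ij; have hh : M0 * i != M0 * j by rewrite eqn_pmul2l.
have sp' : size (derP P q (M0 * i) (M0 * j)) = size P.
  have [e|e] := eqVneq (size q) (size P).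
    have := @size_sub_neq R (shp P (M0 * i)%:R) (shp q (M0 * j)%:R).
    by rewrite !ss !lead_shp => /(_ (esym e) (qP e))[].
  have lq : (size q < size P)%N by rewrite ltn_neqAle e leA.
  by have := @size_sub_gt R (shp P (M0 * i)%:R) (shp q (M0 * j)%:R); rewrite !ss => /(_ lq)[].
have nice' : nice (derP P q (M0 * i) (M0 * j)) (derQ P Qs q (M0 * i) (M0 * j)).
  apply: derive_nice => //.
  - by move=> Q Qin; apply: hM.
  - by rewrite sp'.
  - move=> A Ain; have [|B [k [Bin ->]]] := @derQ_in P Qs q (M0 * i) (M0 * j) A.
      by rewrite in_cons Ain orbT.
    by rewrite sp'; apply: size_sub_le; rewrite ss leA.
have sq1 : (1 < size q)%N := nc _ qin.
apply: (IH (weight (derP P q (M0 * i) (M0 * j) :: derQ P Qs q (M0 * i) (M0 * j)))) => //.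
  exists (size q).-1; split.
  - have := leA _ qA; case: (size q) sq1 => [|[|n]] //= _ h.
    by rewrite -ltnS (leq_trans h) // (leq_trans sD).
  - rewrite -hw; last by case: (size q) sq1 => [|[]].
    set U1 := undup [seq lead_coef Q | Q <- [seq Q : {poly R} <- P :: Qs | size Q == (size q).-1.+1]].
    have qU : lead_coef q \in U1.
      by apply/weight_in; exists q; rewrite prednK // (ltn_trans _ sq1).
    apply: (@leq_ltn_trans (size [seq x - lead_coef q | x <- rem (lead_coef q) U1])).
      apply: uniq_leq_size; first exact: undup_uniq.
      move=> x /weight_in[A [Ain sA lA]]; have [B [k [Bin e]]] := derQ_in Ain.
      rewrite prednK in sA; last exact: ltn_trans sq1.
      have sB : size B = size q.
        have [hB|hB|//] := ltngtP (size B) (size q).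
          exfalso; have : ~~ equiv B.
            by rewrite /equiv negb_and neq_ltn (leq_trans hB (leA _ qA)).
          move: Bin; rewrite in_cons => /predU1P[BP|Bin nB].
            by move: hB; rewrite BP ltnNge leA.
          by have := qmin _ Bin nB; rewrite leqNgt hB.
        have := @size_sub_gt R (shp B k%:R) (shp q (M0 * j)%:R); rewrite !ss => /(_ hB)[].
        by rewrite -e sA => e'; move: hB; rewrite e' ltnn.
      have lB : lead_coef B != lead_coef q.
        apply/eqP => lB.
        have := @size_sub_eq R (shp B k%:R) (shp q (M0 * j)%:R).
        rewrite !ss !lead_shp sB lB -e sA ltnn => h.
        by apply: (@negP true) => //; apply/negP; rewrite -(h erefl erefl (ltn_trans _ sq1)).
      have := @size_sub_neq R (shp B k%:R) (shp q (M0 * j)%:R).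
      rewrite !ss !lead_shp -e => /(_ sB lB)[_ hl].
      apply/mapP; exists (lead_coef B); last by rewrite -lA hl.
      rewrite (rem_filter _ (undup_uniq _)) mem_filter; apply/andP; split; first exact: lB.
      by apply/weight_in; exists B; rewrite prednK // (ltn_trans _ sq1).
    rewrite size_map size_rem // ltn_predL; by case: (U1) qU.
  - move=> r /andP[hr rD]; rewrite -hw; last by apply: leq_ltn_trans hr.
    apply: uniq_leq_size; first exact: undup_uniq.
    move=> x /weight_in[A [Ain sA lA]]; have [B [k [Bin e]]] := derQ_in Ain.
    have hqr : (size q <= r)%N by move: hr; case: (size q) sq1.
    have sB : (size q < size B)%N.
      rewrite ltnNge; apply/negP => hB.
      have : (size A <= size q)%N by rewrite e; apply: size_sub_le; rewrite ss.
      by rewrite sA; lia.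
    have := @size_sub_gt R (shp B k%:R) (shp q (M0 * j)%:R).
    rewrite !ss !lead_shp -e => /(_ sB)[e1 e2].
    by apply/weight_in; exists B; split; rewrite -?e1 -?e2.
by rewrite sp'.
Qed.

End Control.

(** * Closest points and dual functions *)

Section DualFunctions.
Variables (R : realType) (S : system R).
Implicit Types (f g F G : S).

(** Completeness of the unit ball for the quadratic mean, in the form of bounded
    limits. *)
Definition complete_system := forall f : nat -> S, (forall n, bd 1 (f n)) ->
  (forall e, 0 < e -> exists N : nat, forall m n, (N <= m)%N -> (N <= n)%N ->
     n2 (f m - f n) <= e) ->
  exists2 g, bd 1 g & forall e, 0 < e -> exists N : nat, forall n, (N <= n)%N ->
     n2 (f n - g) <= e.

Lemma n2_tri (t : R) f g : 0 < t ->
  n2 (f + g) <= (1 + t) * n2 f + (1 + t^-1) * n2 g.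
Proof.
move=> t0; have := n2_ge0 (cst t%:C * f - g).
rewrite n2B n2_cst cab_real real_normK ?num_real // -mulrA E_cst ReZ => h.
rewrite n2D; set r := complex.Re _ in h *.
have h2 : 2 * r <= t * n2 f + t^-1 * n2 g.
  rewrite -(ler_pM2l t0) mulrDr mulrA (mulrA t t^-1) divff ?gt_eqF // mul1r.
  lra.
lra.
Qed.

Lemma n2_le_lim f g (a : R) : (forall e, 0 < e -> exists h, n2 h <= a /\ n2 (f - g - h) <= e) ->
  n2 (f - g) <= a.
Proof.
move=> H; have a0 : 0 <= a.
  by have [h [h1 _]] := H 1 ltr01; apply: le_trans h1; apply: n2_ge0.
apply/ler_addgt0Pr => e e0.
pose t := e / (2 * (a + 1)).
have t0 : 0 < t by rewrite divr_gt0 // mulr_gt0 // ltr_wpDl.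
have [|h [h1 h2]] := H (e / (2 * (1 + t^-1))).
  by rewrite divr_gt0 // mulr_gt0 // ltr_wpDr ?invr_ge0 ?ltr01 // ltW.
have -> : f - g = h + (f - g - h) by ring.
apply: le_trans (n2_tri _ _ t0) _.
have p : 0 < 1 + t^-1 by rewrite ltr_wpDr ?invr_ge0 ?ltr01 // ltW.
have k1 : (1 + t^-1) * n2 (f - g - h) <= e / 2.
  apply: le_trans (ler_wpM2l (ltW p) h2) _.
  move: p; set q := 1 + t^-1 => p; have q0 : q != 0 by rewrite gt_eqF.
  have -> : q * (e / (2 * q)) = e / 2 by field.
  exact: lexx.
have k2 : (1 + t) * n2 h <= (1 + t) * a by rewrite ler_wpM2l // addr_ge0 // ltW.
have k3 : t * a <= e / 2.
  rewrite /t invfM mulrA mulrAC -[X in _ <= X]mulr1 -mulrA ler_wpM2l ?divr_ge0 ?(ltW e0) //.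
  by rewrite ler_pdivrMr ?mul1r ?lerDl // ltr_wpDl.
lra.
Qed.

Hypothesis hC : complete_system.

(** Almost minimising sequences of midpoint-convex sets are Cauchy, by the
    parallelogram law. *)
Lemma closest_point f (C : nat -> S -> Prop) :
  (forall j k G, (j <= k)%N -> C k G -> C j G) -> (forall j, exists G, C j G) ->
  (forall j G G', C j G -> C j G' -> C j (cst (2^-1)%:C * (G + G'))) ->
  (forall j G, C j G -> bd 1 G) ->
  exists F, [/\ bd 1 F,
    forall e j, 0 < e -> exists2 G, C j G & n2 (F - G) <= e &
    forall G, (forall j, C j G) -> n2 (f - F) <= n2 (f - G)].
Proof.
move=> mono ne mid bC.
pose A j := [set r : R | exists2 G, C j G & r = n2 (f - G)].
have A0 j : A j !=set0 by have [G hG] := ne j; exists (n2 (f - G)), G.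
have Al j : lbound (A j) 0 by move=> r [G _ ->]; apply: n2_ge0.
have Ai j : has_inf (A j) by split; [apply: A0|exists 0; apply: Al].
pose d j := inf (A j).
have dlb j G : C j G -> d j <= n2 (f - G).
  by move=> hG; apply: ge_inf; [exists 0; apply: Al|exists G].
have [Mf hMf] := bd_ex f.
have dle j : d j <= (Mf + 1) ^+ 2.
  have [G hG] := ne j; apply: le_trans (dlb j G hG) _.
  by apply: n2_le; apply: bdB => //; apply: bC hG.
have dmono j k : (j <= k)%N -> d j <= d k.
  move=> jk; apply: lb_le_inf; first exact: A0.
  by move=> r [G hG ->]; apply: dlb; apply: mono hG.
pose D := [set d j | j in [set: nat]].
have Ds : has_sup D.
  by split; [exists (d 0), 0%N|exists ((Mf + 1) ^+ 2) => _ [j _ <-]; apply: dle].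
have dsup j : d j <= sup D by apply: sup_upper_bound => //; exists j.
have /choice[G hG] : forall j, exists G, C j G /\ n2 (f - G) <= d j + j.+1%:R^-1.
  move=> j; have jp : (0 : R) < j.+1%:R^-1 by rewrite invr_gt0 ltr0n.
  have [r [G CG ->] hr] := inf_adherent jp (Ai j).
  by exists G; split=> //; apply: ltW.
(* midpoints compete for the infimum as well *)
have par j k : (j <= k)%N ->
    n2 (G j - G k) <= 2 * (d k - d j) + 2 * j.+1%:R^-1 + 2 * k.+1%:R^-1.
  move=> jk; have [Cj hj] := hG j; have [Ck hk] := hG k.
  have hm := dlb j _ (mid j _ _ Cj (mono j k _ jk Ck)).
  have par_e : n2 (G j - G k) + 4 * n2 (f - cst (2^-1)%:C * (G j + G k)) =
      2 * n2 (f - G j) + 2 * n2 (f - G k).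
    have -> : G j - G k = (f - G k) - (f - G j) by ring.
    have -> : f - cst (2^-1)%:C * (G j + G k) = cst (2^-1)%:C * ((f - G k) + (f - G j)).
      have h : cst (2^-1)%:C * (f + f) = f :> S.
        have -> : f + f = cst 2 * f by rewrite rmorph_nat; ring.
        rewrite mulrA -rmorphM -(rmorph_nat (real_complex R) 2) -rmorphM.
        by rewrite mulVf ?pnatr_eq0 // !rmorph1 mul1r.
      by rewrite -{1}h; ring.
    set a := f - G k; set b := f - G j.
    rewrite n2_cst cab_real ger0_norm ?invr_ge0 // (n2B a) (n2D a) exprVn; by field.
  by move: par_e hj hk hm; move: (j.+1%:R^-1) (k.+1%:R^-1) (n2 _) (n2 _) (n2 _) (n2 _) => *; lra.
have [|e e0|F bF hF] := hC (f := G).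
- by move=> n; case: (hG n) => /bC.
- have e8 : 0 < e / 8 by rewrite divr_gt0.
  have [_ [j0 _ <-] hj0] := sup_adherent e8 Ds.
  pose K := (Num.truncn (8 / e)).+1.
  exists (maxn j0 K).
  have inv n : (maxn j0 K <= n)%N -> n.+1%:R^-1 <= e / 8.
    move=> hn; rewrite -[e / 8]invrK lef_pV2 ?posrE ?invr_gt0 ?ltr0n //.
    rewrite invf_div; apply: le_trans (ltW (truncnS_gt _)) _.
    by rewrite ler_nat; apply: leq_trans (leqnSn n); apply: leq_trans hn; apply: leq_maxr.
  have main m n : (maxn j0 K <= m)%N -> (m <= n)%N -> n2 (G m - G n) <= e.
    move=> hm mn; have hn := leq_trans hm mn.
    apply: le_trans (par m n mn) _.
    have := inv _ hm; have := inv _ hn; have := dsup n.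
    have := dmono j0 m (leq_trans (leq_maxl _ _) hm).
    by move: (m.+1%:R^-1) (n.+1%:R^-1) => *; lra.
  move=> m n hm hn; case/orP: (leq_total m n) => mn; first exact: main.
  by rewrite -n2N opprB; apply: main.
exists F; split=> //.
- move=> e j e0; have [N hN] := hF e e0.
  exists (G (maxn j N)); first by apply: mono (leq_maxl j N) _; case: (hG (maxn j N)).
  by rewrite -n2N opprB; apply: hN; apply: leq_maxr.
move=> G' hG'; apply/ler_addgt0Pr => e e0; apply: n2_le_lim => e' e'0.
have [N hN] := hF e' e'0.
pose k := maxn N (Num.truncn e^-1).
exists (f - G k); split.
  apply: le_trans (proj2 (hG k)) _; apply: lerD; first exact: dlb.
  rewrite -[e]invrK lef_pV2 ?posrE ?invr_gt0 ?ltr0n //.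
  apply: le_trans (ltW (truncnS_gt _)) _.
  by rewrite ler_nat ltnS leq_maxr.
have -> : f - F - (f - G k) = G k - F by ring.
by apply: hN; apply: leq_maxl.
Qed.

(** A finitely supported probability on the integers, with unimodular phases;
    [long L0] says that it averages over windows of length at least [L0]. *)
Definition wt := seq (R * (R[i] * nat)).

Definition probability_wt (W : wt) :=
  [/\ forall x, List.In x W -> 0 <= x.1 /\ cab x.2.1 = 1 &
      \sum_(x <- W) x.1 = 1].

Definition long (L0 : nat) (W : wt) := forall (z : nat -> R[i]) (e : R),
  (forall M L, (L0 <= L)%N -> cab (\sum_(i < L) z (M + i)%N) <= e * L%:R) ->
  cab (\sum_(x <- W) x.1%:C * z x.2.2) <= e /\
  cab (\sum_(x <- W) (x.1%:C * conjc x.2.1) * z x.2.2) <= e.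

Definition combination (W : wt) (w : nat -> S) : S :=
  \sum_(x <- W) cst (x.1%:C * x.2.1) * cj (w x.2.2).

Lemma big_In (I V : Type) (r : seq I) (op : V -> V -> V) (x0 : V) (F1 F2 : I -> V) :
  (forall x, List.In x r -> F1 x = F2 x) ->
  \big[op/x0]_(x <- r) F1 x = \big[op/x0]_(x <- r) F2 x.
Proof.
elim: r => [|x r IH] h; first by rewrite !big_nil.
rewrite !big_cons h ?IH //=; first by move=> y hy; apply: h; right.
by left.
Qed.

Lemma bd_combination W w : probability_wt W -> (forall n, bd 1 (w n)) ->
  bd 1 (combination W w).
Proof.
move=> [hW h1] bw; rewrite -h1 /combination.
elim: W hW {h1} => [|x W IH] hW; first by rewrite !big_nil; apply: bd0.
rewrite !big_cons; apply: bdD; last by apply: IH => y hy; apply: hW; right.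
have [x0 x1] := hW x (or_introl erefl).
have := bdM (bd_cst S (x.1%:C * x.2.1)) (bd_cj (bw x.2.2)).
by rewrite cabM x1 cab_real ger0_norm // !mulr1.
Qed.

(** The dual function of [f]: a bounded limit of long averages of the conjugate
    weights that keeps the correlation with [f], and against which every
    function with small weighted means is small. *)
Lemma dual_function f (w : nat -> S) (eps : R) :
  0 < eps -> bd 1 f -> (forall n, bd 1 (w n)) -> ~ Ub (fun n => E (f * w n)) eps ->
  exists F, [/\ bd 1 F, eps <= complex.Re (E (f * cj F)),
    forall kappa L0, 0 < kappa -> exists W, [/\ probability_wt W, long L0 W &
       n2 (F - combination W w) <= kappa] &
    forall g e, Ub (fun n => E (g * w n)) e -> cab (E (g * cj F)) <= e].
Proof.
move=> e0 bf bw nU.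
pose C (j : nat) (G : S) := exists W, [/\ probability_wt W, long j W,
  G = combination W w & eps <= complex.Re (E (f * cj G))].
(* the closest point to 0 in the decreasing convex sets of long averages that keep
   the correlation *)
have [F [bF hF _]] : exists F, [/\ bd 1 F,
    forall e j, 0 < e -> exists2 G, C j G & n2 (F - G) <= e &
    forall G, (forall j, C j G) -> n2 (0 - F) <= n2 (0 - G)].
  apply: closest_point.
  - move=> j k G jk [W [h1 h2 h3 h4]]; exists W; split=> // z e hz.
    by apply: h2 => M L kL; apply: hz; apply: leq_trans kL.
  - move=> j; have [M [L [hL hbig]]] : exists M L, (j.+1 <= L)%N /\
        eps * L%:R < cab (\sum_(i < L) E (f * w (M + i)%N)).
      apply: contrapT => H; apply: nU; exists j.+1 => M L hL.
      rewrite leNgt; apply/negP => H'; apply: H; exists M, L; split=> //.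
    set s := \sum_(i < L) _ in hbig.
    have Lp : (0 : R) < L%:R by rewrite ltr0n; apply: leq_trans hL.
    pose th := conjc (phase s).
    pose W : wt := [seq (L%:R^-1, (th, M + i)%N) | i <- iota 0 L].
    have sumW (V : nmodType) (F : R * (R[i] * nat) -> V) : \sum_(x <- W) F x =
        \sum_(i < L) F (L%:R^-1, (th, M + i)%N).
      by rewrite big_map -{1}(subn0 L) -/(index_iota 0 L) big_mkord.
    have th1 : cab th = 1 by rewrite cabJ cab_phase.
    exists (combination W w), W; split=> //.
    + split; first by move=> x /List.in_map_iff[i [<- _]] /=; rewrite invr_ge0 ltW.
      by rewrite sumW sumr_const card_ord -[LHS]mulr_natr mulVf ?gt_eqF.
    + move=> z e hz; have h := hz M L (ltnW hL).
      have h' : cab (L%:R^-1%:C * \sum_(i < L) z (M + i)%N) <= e.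
        by rewrite cabM cab_real ger0_norm ?invr_ge0 ?(ltW Lp) // mulrC ler_pdivrMr.
      rewrite !sumW /= -!mulr_sumr; split=> //.
      by rewrite mulrAC cabM cabJ th1 mulr1.
    + have -> : E (f * cj (combination W w)) = L%:R^-1%:C * (phase s * s).
        rewrite /combination rmorph_sum mulr_sumr E_sum sumW /s !mulr_sumr.
        apply: eq_bigr => i _; rewrite rmorphM /= cjK cj_cst.
        by rewrite mulrCA E_cst conjM conj_real /th conjcK mulrA.
      rewrite phaseM ReZ /= mulrC ler_pdivlMr //; exact: ltW.
  - move=> j G G' [W [[W0 W1] h2 h3 h4]] [W' [[W0' W1'] h2' h3' h4']].
    have hf : 0 <= 2^-1 :> R by rewrite invr_ge0.
    pose hv (x : R * (R[i] * nat)) := (2^-1 * x.1, x.2).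
    exists (map hv W ++ map hv W'); split.
    + split.
        move=> x /List.in_app_iff[] /List.in_map_iff[y [<- hy]] /=;
          [have [] := W0 y hy|have [] := W0' y hy] => y0 y1; split=> //; exact: mulr_ge0.
      by rewrite big_cat !big_map /= -!mulr_sumr W1 W1' mulr1; lra.
    + move=> z e hz; have [a1 a2] := h2 z e hz; have [b1 b2] := h2' z e hz.
      rewrite !big_cat !big_map /=.
      have dv (F : R * (R[i] * nat) -> R[i]) (V : wt) :
        \sum_(x <- V) (2^-1 * x.1)%:C * F x = (2^-1)%:C * \sum_(x <- V) x.1%:C * F x.
        by rewrite mulr_sumr; apply: eq_bigr => x _; rewrite rmorphM mulrA.
      have c2 x : cab ((2^-1)%:C * x) = 2^-1 * cab x :> R.
        by rewrite cabM cab_real ger0_norm.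
      split.
        by rewrite !dv; apply: le_trans (cabD _ _) _; rewrite !c2; lra.
      have as2 V : \sum_(x <- V) (2^-1 * x.1)%:C * conjc x.2.1 * z x.2.2 =
          (2^-1)%:C * \sum_(x <- V) x.1%:C * conjc x.2.1 * z x.2.2.
        by rewrite mulr_sumr; apply: eq_bigr => x _; rewrite rmorphM; ring.
      by rewrite !as2; apply: le_trans (cabD _ _) _; rewrite !c2; lra.
    + rewrite h3 h3' /combination big_cat !big_map mulrDr !mulr_sumr.
      by congr (_ + _); apply: eq_bigr => x _; rewrite /hv /= mulrA -rmorphM mulrA -rmorphM.
    + rewrite rmorphM rmorphD /= cj_cst mulrCA E_cst mulrDr E_D conj_real ReZ ReD; lra.
  - by move=> j G [W [h1 h2 -> _]]; apply: bd_combination.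
have lim g (a : R) : 0 < a -> bd 1 g -> exists d, 0 < d /\ forall G, n2 (F - G) <= d ->
    cab (E (g * cj F) - E (g * cj G)) <= a.
  move=> a0 bg; exists (a ^+ 2); split; first by rewrite exprn_gt0.
  move=> G hG; rewrite -E_B -mulrBr -rmorphB.
  rewrite -(@ler_pXn2r _ 2) ?nnegrE ?cab_ge0 ?(ltW a0) //.
  by rewrite mulrC; apply: le_trans (cs_bd _ bg) _; rewrite n2_cj.
exists F; split=> //.
- apply/ler_addgt0Pr => a a0; have [d [d0 hd]] := lim f a a0 bf.
  have [G [W [_ _ _ hG]] nG] := hF d 0%N d0.
  apply: le_trans hG _; rewrite -lerBlDl.
  apply: le_trans (hd G nG); apply: le_trans (cab_Re _).
  by rewrite ReD ReN distrC; apply: ler_norm.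
- move=> k L0 k0; have [G [W [h1 h2 h3 _]] nG] := hF k L0 k0.
  by exists W; rewrite -h3.
- move=> g e [L0 hg]; have [Mg hMg] := bd_ex g.
  apply/ler_addgt0Pr => a a0.
  have M0 : 0 < Mg + 1 by rewrite ltr_wpDl // (bd_ge0 hMg).
  have bg' : bd 1 (cst (Mg + 1)^-1%:C * g).
    apply: bd_le (bdM (bd_cst S _) hMg).
    by rewrite cab_real ger0_norm ?invr_ge0 ?(ltW M0) // mulrC ler_pdivrMr // mul1r lerDl.
  have [d [d0 hd]] := lim _ (a / (Mg + 1)) (divr_gt0 a0 M0) bg'.
  have [G [W [h1 h2 h3 _]] nG] := hF d L0 d0.
  have := hd G nG; rewrite -!mulrA !E_cst -mulrBr cabM cab_real.
  rewrite ger0_norm ?invr_ge0 ?(ltW M0) // mulrC ler_pM2r ?invr_gt0 // => hd'.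
  apply: le_trans (cab_tri _ (E (g * cj G))) _; apply: lerD hd'.
  have [_] := h2 (fun n => E (g * w n)) _ hg; rewrite h3 /combination rmorph_sum mulr_sumr E_sum.
  congr (cab _ <= _); apply: eq_bigr => x _.
  by rewrite rmorphM /= cjK cj_cst mulrCA E_cst conjM conj_real.
Qed.

End DualFunctions.

(** * Averages over boxes *)

Section BoxAverages.
Variable R : realType.
Implicit Types (phi : nat -> R) (psi : seq nat -> R) (Hs : seq nat).

Definition avg (H : nat) phi : R := (\sum_(h < H) phi h) / H%:R.

Lemma avg_le H phi phi' : (forall h, (h < H)%N -> phi h <= phi' h) ->
  avg H phi <= avg H phi'.
Proof. by move=> h; rewrite ler_wpM2r ?invr_ge0 //; apply: ler_sum => i _; apply: h. Qed.

Lemma eq_avg H phi phi' : phi =1 phi' -> avg H phi = avg H phi'.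
Proof. by move=> h; congr (_ / _); apply: eq_bigr => i _. Qed.

Lemma avg_exchange H H' (f : nat -> nat -> R) :
  avg H (fun h => avg H' (f h)) = avg H' (fun h' => avg H (fun h => f h h')).
Proof. by rewrite /avg -!mulr_suml exchange_big /= mulrAC. Qed.

Lemma avg_sum (I : Type) (r : seq I) H (f : I -> nat -> R) :
  avg H (fun h => \sum_(x <- r) f x h) = \sum_(x <- r) avg H (f x).
Proof. by rewrite /avg exchange_big /= mulr_suml. Qed.

Lemma avgZ H (c : R) phi : avg H (fun h => c * phi h) = c * avg H phi.
Proof. by rewrite /avg -mulr_sumr mulrA. Qed.

Lemma avgD H phi phi' : avg H (fun h => phi h + phi' h) = avg H phi + avg H phi'.
Proof. by rewrite /avg big_split mulrDl. Qed.

Lemma avg_cst H (c : R) : (0 < H)%N -> avg H (fun=> c) = c.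
Proof. by move=> H0; rewrite /avg sumr_const card_ord -[c *+ H]mulr_natr mulfK // pnatr_eq0 -lt0n. Qed.

Lemma avg_cst_le H (c : R) : 0 <= c -> avg H (fun=> c) <= c.
Proof.
move=> c0; case: H => [|H]; first by rewrite /avg big_ord0 mul0r.
by rewrite avg_cst.
Qed.

Lemma avg_ge0 H phi : (forall h, 0 <= phi h) -> 0 <= avg H phi.
Proof. by move=> h; rewrite mulr_ge0 ?invr_ge0 // sumr_ge0. Qed.

Lemma avg_sqr H phi : avg H phi ^+ 2 <= avg H (fun h => phi h ^+ 2).
Proof.
case: H => [|H]; first by rewrite /avg !big_ord0 !mul0r expr0n.
rewrite /avg expr_div_n ler_pdivrMr ?exprn_gt0 ?ltr0n //.
by rewrite [X in _ / _ * X]expr2 mulrA divfK ?pnatr_eq0 // mulrC sqr_sum_le.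
Qed.

Lemma avg_pow t H phi : avg H phi ^+ (2 ^ t) <= avg H (fun h => phi h ^+ (2 ^ t)).
Proof.
elim: t phi => [|t IH] phi; first by under [in X in _ <= X]eq_avg do rewrite expn0 expr1; rewrite expn0 expr1.
under [in X in _ <= X]eq_avg do rewrite expnS exprM.
rewrite expnS exprM; apply: le_trans (IH (fun h => phi h ^+ 2)); apply: lerXn2r (avg_sqr _ _).
  by rewrite nnegrE sqr_ge0.
by rewrite nnegrE avg_ge0 // => h; rewrite sqr_ge0.
Qed.

(** Averages over boxes, and over pairs of points of a box; nesting them one
    coordinate at a time matches the way the Cauchy-Schwarz inequality is
    iterated. *)
Fixpoint bavg Hs psi : R :=
  if Hs is H :: Hs' then avg H (fun h => bavg Hs' (fun hs => psi (h :: hs)))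
  else psi [::].

Fixpoint pavg Hs (f : seq nat -> seq nat -> R) : R :=
  if Hs is H :: Hs' then avg H (fun h => avg H (fun h' =>
    pavg Hs' (fun hs hs' => f (h :: hs) (h' :: hs'))))
  else f [::] [::].

Definition inbox (Hs hs : seq nat) := all2 ltn hs Hs.

Lemma size_inbox Hs hs : inbox Hs hs -> size hs = size Hs.
Proof. by rewrite /inbox; elim: hs Hs => [|h hs IH] [|H Hs] //= /andP[_ /IH->]. Qed.

Lemma bavg_le Hs psi psi' : (forall hs, inbox Hs hs -> psi hs <= psi' hs) ->
  bavg Hs psi <= bavg Hs psi'.
Proof.
elim: Hs psi psi' => [|H Hs IH] psi psi' h /=; first exact: h.
by apply: avg_le => k hk; apply: IH => hs hhs; apply: h; rewrite /inbox /= hk.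
Qed.

Lemma eq_bavg Hs psi psi' : psi =1 psi' -> bavg Hs psi = bavg Hs psi'.
Proof. by move=> /funext->. Qed.

Lemma bavg_avg Hs H (f : nat -> seq nat -> R) :
  bavg Hs (fun hs => avg H (f^~ hs)) = avg H (fun h => bavg Hs (f h)).
Proof.
elim: Hs f => [|K Hs IH] f //=.
rewrite avg_exchange; apply: eq_avg => k; exact: (IH (fun h hs => f h (k :: hs))).
Qed.

Lemma bavgZ Hs (c : R) psi : bavg Hs (fun hs => c * psi hs) = c * bavg Hs psi.
Proof. by elim: Hs psi => [|H Hs IH] psi //=; rewrite -avgZ; apply: eq_avg => h; rewrite IH. Qed.

Lemma bavgD Hs psi psi' :
  bavg Hs (fun hs => psi hs + psi' hs) = bavg Hs psi + bavg Hs psi'.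
Proof.
by elim: Hs psi psi' => [|H Hs IH] psi psi' //=; rewrite -avgD; apply: eq_avg => h; rewrite IH.
Qed.

Lemma bavg_sum (I : Type) (r : seq I) Hs (f : I -> seq nat -> R) :
  bavg Hs (fun hs => \sum_(x <- r) f x hs) = \sum_(x <- r) bavg Hs (f x).
Proof.
elim: Hs f => [|H Hs IH] f //=; rewrite -avg_sum; apply: eq_avg => h.
exact: (IH (fun x hs => f x (h :: hs))).
Qed.

Lemma bavg_cst Hs (c : R) : all (ltn 0) Hs -> bavg Hs (fun=> c) = c.
Proof.
elim: Hs => [|H Hs IH] //= /andP[H0 h].
by rewrite -[RHS](avg_cst c H0); apply: eq_avg => k; apply: IH.
Qed.

Lemma bavg_cst_le Hs (c : R) : 0 <= c -> bavg Hs (fun=> c) <= c.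
Proof.
move=> c0; elim: Hs => [|H Hs IH] //=.
by apply: le_trans (avg_cst_le H c0); apply: avg_le.
Qed.

Lemma bavg_ge0 Hs psi : (forall hs, 0 <= psi hs) -> 0 <= bavg Hs psi.
Proof. by elim: Hs psi => [|H Hs IH] psi h //=; apply: avg_ge0 => k; apply: IH. Qed.

Lemma bavg_sqr Hs psi : bavg Hs psi ^+ 2 <= bavg Hs (fun hs => psi hs ^+ 2).
Proof.
elim: Hs psi => [|H Hs IH] psi //=.
by apply: le_trans (avg_sqr _ _) _; apply: avg_le => k _; apply: IH.
Qed.

Lemma bavg_gt Hs psi (c : R) : 0 <= c -> c < bavg Hs psi ->
  exists2 hs, inbox Hs hs & c < psi hs.
Proof.
move=> c0 h; apply: contrapT => H; move: h; rewrite ltNge => /negP; apply.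
apply: le_trans (bavg_cst_le Hs c0); apply: bavg_le => hs hhs.
by rewrite leNgt; apply/negP => h; apply: H; exists hs.
Qed.

Lemma pavg_le Hs f f' :
  (forall hs hs', inbox Hs hs -> inbox Hs hs' -> f hs hs' <= f' hs hs') ->
  pavg Hs f <= pavg Hs f'.
Proof.
elim: Hs f f' => [|H Hs IH] f f' h /=; first exact: h.
apply: avg_le => k hk; apply: avg_le => k' hk'; apply: IH => hs hs' i1 i2.
by apply: h; rewrite /inbox /= ?hk ?hk'.
Qed.

Lemma pavg_bavg Hs f :
  pavg Hs f = bavg Hs (fun hs' => bavg Hs (fun hs => f hs hs')).
Proof.
elim: Hs f => [|H Hs IH] f //=; rewrite avg_exchange; apply: eq_avg => k'.
rewrite (bavg_avg Hs H (fun k hs' => bavg Hs (fun hs => f (k :: hs) (k' :: hs')))).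
by apply: eq_avg => k; rewrite IH.
Qed.

Lemma inbox_bound Hs (f : seq nat -> nat) :
  exists N, forall hs, inbox Hs hs -> (f hs <= N)%N.
Proof.
elim: Hs f => [|H Hs IH] f.
  by exists (f [::]) => -[|h hs].
have /choice[N hN] := fun h => IH (fun hs => f (h :: hs)).
exists (\max_(h < H) N h) => -[|h hs] //= /andP[hh hhs].
by apply: leq_trans (hN h hs hhs) _; apply: (leq_bigmax (Ordinal hh)).
Qed.

(** The same with the limiting means, for which coordinates cannot be exchanged:
    hence the finite boxes. *)
Fixpoint mavg (t : nat) psi : R :=
  if t is t'.+1 then mean (fun h => mavg t' (fun hs => psi (h :: hs)))
  else psi [::].

Lemma mavg_norm t psi : (forall hs, `|psi hs| <= 1) -> `|mavg t psi| <= 1.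
Proof. by elim: t psi => [|t IH] psi h //=; apply: mean_norm => n; apply: IH. Qed.

Lemma mavg_rcons t psi :
  mavg t.+1 psi = mavg t (fun hs => mean (fun h => psi (rcons hs h))).
Proof.
elim: t psi => [|t IH] psi //.
rewrite -[LHS]/(mean (fun h => mavg t.+1 (fun hs => psi (h :: hs)))).
by congr mean; apply/funext => h; rewrite IH.
Qed.

(** Iterated means are simultaneously approximated, for finitely many functions,
    by averages over one box. *)
Lemma box_approx (I : finType) t (psi : I -> seq nat -> R) (e : R) :
  (forall i hs, `|psi i hs| <= 1) -> 0 < e ->
  exists Hs, [/\ size Hs = t, all (ltn 0) Hs &
    forall i, `|bavg Hs (psi i) - mavg t (psi i)| <= e].
Proof.
elim: t I psi e => [|t IH] I psi e h e0.
  by exists [::]; split=> // i; rewrite subrr normr0 ltW.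
have e2 : 0 < e / 2 by rewrite divr_gt0.
have [|H [_ H0 hH]] := @meanP R I (fun i h => mavg t (fun hs => psi i (h :: hs))) _ 0 _ e2.
  by move=> i n; apply: mavg_norm.
have [|Hs [sHs pHs hHs]] := IH (I * 'I_H)%type (fun x hs => psi x.1 (nat_of_ord x.2 :: hs)) _ _ e2.
  by move=> i hs; apply: h.
exists (H :: Hs); split=> /=; rewrite ?sHs ?H0 // => i.
have HR : (0 : R) < H%:R by rewrite ltr0n.
have h1 := hH i.
have h2 : `|avg H (fun h => bavg Hs (fun hs => psi i (h :: hs))) -
   avg H (fun h => mavg t (fun hs => psi i (h :: hs)))| <= e / 2.
  rewrite /avg -mulrBl -sumrB normrM normfV (ger0_norm (ltW HR)) ler_pdivrMr //.
  apply: le_trans (ler_norm_sum _ _ _) _.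
  apply: le_trans (ler_sum _ (fun k _ => hHs (i, k))) _.
  by rewrite sumr_const card_ord -[(e / 2) *+ H]mulr_natr.
have h3 : `|avg H (fun h => mavg t (fun hs => psi i (h :: hs))) -
   mavg t.+1 (psi i)| <= e / 2.
  by rewrite -(ler_pM2r HR) -{1}(gtr0_norm HR) -normrM mulrBl /avg divfK ?gt_eqF.
rewrite -(subrKA (avg H (fun h => mavg t (fun hs => psi i (h :: hs))))).
by apply: le_trans (ler_normD _ _) _; rewrite [e]splitr; apply: lerD.
Qed.

End BoxAverages.

(** * Multiplicative derivatives and the Cauchy-Schwarz inequality on boxes *)

Section Boxes.
Variables (R : realType) (S : system R).
Implicit Types (f g u : S) (hs : seq nat) (X Th : seq nat -> S).

Fixpoint Dl hs f : S :=
  if hs is h :: hs' then Dl hs' (f * T (Posz h) (cj f)) else f.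

(** The derivative in which one of the factors [f], the one with the largest
    shift, is replaced by [u]. *)
Fixpoint Dt hs f u : S :=
  if hs is h :: hs' then Dl hs' f * T (Posz h) (cj (Dt hs' f u)) else u.

(** The derivative along the differences of two points of a box. *)
Fixpoint Dp hs hs' u : S :=
  match hs, hs' with
  | h :: ks, h' :: ks' => Dp ks ks' (T (Posz h) (cj u) * T (Posz h') u)
  | _, _ => u
  end.

Fixpoint Xp hs hs' X : S :=
  match hs, hs' with
  | h :: ks, h' :: ks' => Xp ks ks' (fun k => X (h :: k) * cj (X (h' :: k)))
  | _, _ => X [::]
  end.

Lemma Dl_T hs a f : Dl hs (T a f) = T a (Dl hs f).
Proof. by elim: hs f => [|h hs IH] f //=; rewrite T_cj T_C -!T_cj -rmorphM T_cj IH. Qed.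

Lemma Dl_cj hs f : Dl hs (cj f) = cj (Dl hs f).
Proof. by elim: hs f => [|h hs IH] f //=; rewrite T_cj -rmorphM IH. Qed.

Lemma DlM hs f g : Dl hs (f * g) = Dl hs f * Dl hs g.
Proof. by elim: hs f g => [|h hs IH] f g //=; rewrite -IH !rmorphM mulrACA. Qed.

Lemma bd_Dl hs f : bd 1 f -> bd 1 (Dl hs f).
Proof. by elim: hs f => [|h hs IH] f bf //=; apply/IH/bd1_diff. Qed.

Lemma Dl_cons h hs f : Dl (h :: hs) f = Dl hs f * T (Posz h) (cj (Dl hs f)).
Proof. by rewrite /= DlM Dl_T Dl_cj. Qed.

Lemma Dl_rcons h hs f : Dl (rcons hs h) f = Dl hs f * T (Posz h) (cj (Dl hs f)).
Proof. by elim: hs f => [|k hs IH] f //=; rewrite IH. Qed.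

Lemma Us_mavg s f : Us s f = mavg s (fun hs => cab (E (Dl hs f))).
Proof. by elim: s f => [|s IH] f //=; congr mean; apply/funext => h; rewrite IH. Qed.

Lemma Dt_T hs a f u : Dt hs (T a f) (T a u) = T a (Dt hs f u).
Proof. by elim: hs => [|h hs IH] //=; rewrite Dl_T IH rmorphM /= -T_cj (T_C a). Qed.

Lemma Dt_cj hs f u : Dt hs (cj f) (cj u) = cj (Dt hs f u).
Proof. by elim: hs => [|h hs IH] //=; rewrite Dl_cj IH T_cj -rmorphM. Qed.

Lemma DtM hs f g u v : Dt hs (f * g) (u * v) = Dt hs f u * Dt hs g v.
Proof. by elim: hs => [|h hs IH] //=; rewrite DlM IH !rmorphM mulrACA. Qed.

Lemma Dtt hs f : Dt hs f f = Dl hs f.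
Proof. by elim: hs => [|h hs IH]; rewrite ?Dl_cons //= IH. Qed.

Lemma Dt_sum (I : Type) (r : seq I) (om : I -> R) (u : I -> S) hs f :
  Dt hs f (\sum_(x <- r) cst (om x)%:C * u x) =
  \sum_(x <- r) cst (om x)%:C * Dt hs f (u x).
Proof.
elim: hs => [|h hs IH] //=; rewrite IH !rmorph_sum mulr_sumr; apply: eq_bigr => x _.
by rewrite !rmorphM cj_cst conj_real T_cst mulrCA.
Qed.

Lemma n2_Dt hs f u v : bd 1 f -> n2 (Dt hs f u - Dt hs f v) <= n2 (u - v).
Proof.
move=> bf; elim: hs => [|h hs IH] //=; rewrite -mulrBr -!rmorphB.
apply: le_trans (n2_bd _ (bd_Dl hs bf)) _.
by rewrite expr1n mul1r n2_T n2_cj.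
Qed.

Lemma Dp_T hs hs' a u : Dp hs hs' (T a u) = T a (Dp hs hs' u).
Proof.
by elim: hs hs' u => [|h hs IH] [|h' hs'] u //=; rewrite -IH rmorphM -T_cj !(T_C a).
Qed.

Lemma Dp_cj hs hs' u : Dp hs hs' (cj u) = cj (Dp hs hs' u).
Proof.
by elim: hs hs' u => [|h hs IH] [|h' hs'] u //=; rewrite -IH rmorphM -!T_cj.
Qed.

Lemma DpM hs hs' u v : Dp hs hs' (u * v) = Dp hs hs' u * Dp hs hs' v.
Proof.
by elim: hs hs' u v => [|h hs IH] [|h' hs'] u v //=; rewrite -IH !rmorphM mulrACA.
Qed.

Lemma Dp_prod hs hs' (I : Type) (r : seq I) (P : pred I) (u : I -> S) :
  Dp hs hs' (\prod_(i <- r | P i) u i) = \prod_(i <- r | P i) Dp hs hs' (u i).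
Proof.
have Dp1 : Dp hs hs' 1 = 1.
  by elim: hs hs' => [|h hs IH] [|h' hs'] //=; rewrite !rmorph1 mulr1.
by apply: big_morph => // x y; apply: DpM.
Qed.

Lemma bd_Dp hs hs' u : bd 1 u -> bd 1 (Dp hs hs' u).
Proof.
elim: hs hs' u => [|h hs IH] [|h' hs'] u bu //=.
by apply: IH; apply: bd1M; apply: bd_T => //; apply: bd_cj.
Qed.

(** Unimodular constants disappear as soon as one derivative is taken. *)
Lemma Dp_cst hs hs' (c : R[i]) : hs != [::] -> size hs = size hs' -> cab c = 1 ->
  Dp hs hs' (cst c) = 1 :> S.
Proof.
case: hs hs' => [|h hs] [|h' hs'] //= _ _ c1.
rewrite cj_cst !T_cst -rmorphM Jmulc c1 expr1n !rmorph1.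
by elim: hs hs' => [|k hs IH] [|k' hs'] //=; rewrite !rmorph1 mulr1.
Qed.

Lemma XpM hs hs' X Y : Xp hs hs' (fun k => X k * Y k) = Xp hs hs' X * Xp hs hs' Y.
Proof.
elim: hs hs' X Y => [|h hs IH] [|h' hs'] X Y //=; rewrite -IH; congr Xp.
by apply/funext => k; rewrite rmorphM mulrACA.
Qed.

Lemma Xp_cj hs hs' X : Xp hs hs' (fun k => cj (X k)) = cj (Xp hs hs' X).
Proof.
elim: hs hs' X => [|h hs IH] [|h' hs'] X //=; rewrite -IH; congr Xp.
by apply/funext => k; rewrite rmorphM.
Qed.

Lemma bd_Xp hs hs' X : (forall k, bd 1 (X k)) -> bd 1 (Xp hs hs' X).
Proof.
elim: hs hs' X => [|h hs IH] [|h' hs'] X bX //=; apply: IH => k.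
by apply: bd1M => //; apply: bd_cj.
Qed.

(** Functions on the box that split off factors not depending on the first
    coordinate, repeatedly; these are lost in the Cauchy-Schwarz inequality. *)
Fixpoint Low (n : nat) Th : Prop :=
  if n is n'.+1 then exists (g : seq nat -> S) (Th' : nat -> seq nat -> S),
    [/\ forall hs, bd 1 (g hs), forall h, Low n' (Th' h) &
        forall h hs, Th (h :: hs) = g hs * Th' h hs]
  else Th [::] = 1.

Lemma Low1 n : Low n (fun=> 1).
Proof.
elim: n => [|n IH] //=; exists (fun=> 1), (fun _ _ => 1).
by split=> // *; rewrite ?mulr1 //; apply: bd_one.
Qed.

Lemma LowM n Th Th' : Low n Th -> Low n Th' -> Low n (fun hs => Th hs * Th' hs).
Proof.
elim: n Th Th' => [|n IH] Th Th' /=; first by move=> -> ->; rewrite mulr1.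
move=> [g [A [bg hA eA]]] [g' [A' [bg' hA' eA']]].
exists (fun hs => g hs * g' hs), (fun h hs => A h hs * A' h hs); split.
- by move=> hs; apply: bd1M.
- by move=> h; apply: IH.
- by move=> h hs; rewrite eA eA' mulrACA.
Qed.

Lemma Low_cj n Th : Low n Th -> Low n (fun hs => cj (Th hs)).
Proof.
elim: n Th => [|n IH] Th /=; first by move=> ->; rewrite rmorph1.
move=> [g [A [bg hA eA]]].
exists (fun hs => cj (g hs)), (fun h hs => cj (A h hs)); split.
- by move=> hs; apply: bd_cj.
- by move=> h; apply: IH.
- by move=> h hs; rewrite eA rmorphM.
Qed.

(** Fixing one of the two points, the product over the cube of a family of
    functions is the family itself, up to lower factors. *)
Lemma Xp_low hs' X : (forall hs, bd 1 (X hs)) -> exists2 Th, Low (size hs') Th &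
  forall hs, size hs = size hs' -> Xp hs hs' X = X hs * Th hs.
Proof.
elim: hs' X => [|h' hs' IH] X bX.
  by exists (fun=> 1) => // -[|//] _; rewrite mulr1.
have /choice[A hA] : forall h, exists Th, Low (size hs') Th /\
    forall hs, size hs = size hs' -> Xp hs hs' (fun k => X (h :: k)) = X (h :: hs) * Th hs.
  move=> h; have [|A hA eA] := IH (fun k => X (h :: k)) => //.
  by exists A.
pose g hs := Xp hs hs' (fun k => cj (X (h' :: k))).
exists (fun hs => if hs is h :: ks then g ks * A h ks else 1).
  exists g, A; split=> // [hs|h]; last by case: (hA h).
  by apply: bd_Xp => k; apply: bd_cj.
case=> [|h hs] //= [sz]; rewrite XpM -/(g hs); case: (hA h) => _ -> //.
by rewrite -mulrA [g hs * _]mulrC.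
Qed.

Lemma Re_sumZ (I : Type) (r : seq I) (om : I -> R) (z : I -> R[i]) :
  \sum_(x <- r) om x * complex.Re (z x) =
  complex.Re (\sum_(x <- r) (om x)%:C * z x).
Proof. by rewrite Re_sum; apply: eq_bigr => x _; rewrite ReZ. Qed.

Lemma n2_avg H (Z : nat -> S) : n2 (cst H%:R^-1%:C * \sum_(h < H) Z h) =
  avg H (fun h => avg H (fun h' => complex.Re (E (Z h * cj (Z h'))))).
Proof.
rewrite n2_cst cab_real ger0_norm ?invr_ge0 // /n2 rmorph_sum mulr_suml E_sum Re_sum.
rewrite /avg -mulr_suml expr2 mulrC mulrA; congr (_ * _ * _).
by apply: eq_bigr => h _; rewrite mulr_sumr E_sum Re_sum.
Qed.

(** One application of the Cauchy-Schwarz inequality per coordinate: the factors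
    not depending on that coordinate disappear and the others are doubled.  The
    weights [om] allow [u] to be one term of an average. *)
Theorem box_cauchy_schwarz (I : Type) (r : seq I) (om : I -> R) (u : I -> S)
    f Hs X Th : (forall x, 0 <= om x) -> \sum_(x <- r) om x = 1 -> bd 1 f ->
  Low (size Hs) Th ->
  bavg Hs (fun hs => \sum_(x <- r) om x *
     complex.Re (E (Dt hs f (u x) * Th hs * X hs))) ^+ (2 ^ size Hs) <=
  pavg Hs (fun hs hs' => cab (\sum_(x <- r) (om x)%:C *
     E (Dp hs hs' (u x) * Xp hs hs' X))).
Proof.
move=> om0 om1; elim: Hs u f X Th => [|H Hs IH] u f X Th bf lTh.
  rewrite expn0 expr1 /= Re_sumZ; apply: le_trans (Re_le _) _.
  rewrite (eq_bigr (fun x => (om x)%:C * E (u x * X [::]))) // => x _.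
  by rewrite (lTh : Th [::] = 1) mulr1.
case: lTh => g [A [bg lA eA]].
(* the part of the product that depends on the first coordinate *)
pose Z hs x h := T (Posz h) (cj (Dt hs f (u x))) * A h hs * X (h :: hs).
pose Y hs x := cst H%:R^-1%:C * \sum_(h < H) Z hs x h.
pose b h h' := bavg Hs (fun hs => \sum_(x <- r) om x *
   complex.Re (E (Z hs x h * cj (Z hs x h')))).
set B := bavg (H :: Hs) _.
have hB : B = bavg Hs (fun hs => \sum_(x <- r) om x *
    complex.Re (E (Dl hs f * g hs * Y hs x))).
  rewrite /B /= -bavg_avg; apply: eq_bavg => hs; rewrite avg_sum.
  apply: eq_bigr => x _; rewrite avgZ; congr (_ * _).
  rewrite /Y mulrCA E_cst ReZ /avg [LHS]mulrC; congr (_ * _).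
  rewrite mulr_sumr E_sum Re_sum.
  apply: eq_bigr => h _; rewrite eA /Z; congr (complex.Re (E _)); ring.
have B2 : B ^+ 2 <= avg H (fun h => avg H (fun h' => b h h')).
  rewrite hB; apply: le_trans (bavg_sqr _ _) _.
  have -> : avg H (fun h => avg H (fun h' => b h h')) =
      bavg Hs (fun hs => \sum_(x <- r) om x * n2 (Y hs x)).
    have ptw hs : \sum_(x <- r) om x * n2 (Y hs x) = avg H (fun h => avg H (fun h' =>
        \sum_(x <- r) om x * complex.Re (E (Z hs x h * cj (Z hs x h'))))).
      under eq_bigr do rewrite n2_avg -avgZ.
      rewrite -avg_sum; apply: eq_avg => h.
      by under eq_bigr do rewrite -avgZ; rewrite -avg_sum.
    under [in RHS]eq_bavg do rewrite ptw.
    rewrite (bavg_avg Hs H (fun h hs => avg H (fun h' => \sum_(x <- r) om x *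
      complex.Re (E (Z hs x h * cj (Z hs x h')))))); apply: eq_avg => h.
    by rewrite -bavg_avg.
  apply: bavg_le => hs _; apply: le_trans (cauchy_sum r _ (fun x _ => om0 x)) _.
  rewrite om1 mul1r; apply: ler_sum => x _; rewrite ler_wpM2l //.
  have bD : bd 1 (Dl hs f * g hs) by apply: bd1M => //; apply: bd_Dl.
  rewrite mulrC; apply: le_trans (cs_bd (Y hs x) bD).
  rewrite -[X in X <= _]real_normK ?num_real //.
  by rewrite ler_pXn2r ?nnegrE ?cab_ge0 // cab_Re.
rewrite /= expnS exprM.
apply: le_trans (_ : avg H (fun h => avg H (fun h' => b h h' ^+ (2 ^ size Hs))) <= _).
  apply: le_trans (_ : (avg H (fun h => avg H (fun h' => b h h'))) ^+ (2 ^ size Hs) <= _).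
    have b0 := le_trans (sqr_ge0 B) B2.
    by apply: lerXn2r B2; rewrite nnegrE ?sqr_ge0.
  apply: le_trans (avg_pow _ _ _) _; apply: avg_le => h _; exact: avg_pow.
apply: avg_le => h _; apply: avg_le => h' _.
have bf' : bd 1 (T (Posz h) (cj f) * T (Posz h') f).
  by apply: bd1M; apply: bd_T => //; apply: bd_cj.
apply: le_trans (IH (fun x => T (Posz h) (cj (u x)) * T (Posz h') (u x)) _
  (fun k => X (h :: k) * cj (X (h' :: k))) _ bf' (LowM (lA h) (Low_cj (lA h')))).
rewrite le_eqVlt; apply/orP; left; apply/eqP; congr (_ ^+ _).
apply: eq_bavg => hs; apply: eq_bigr => x _; congr (_ * complex.Re (E _)).
rewrite /Z DtM !Dt_T !Dt_cj !rmorphM /= -T_cj cjK; ring.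
Qed.

(** Differences of two points of an interval cover each value at most twice as
    often as the interval does, up to translation and conjugation. *)
Lemma pavg_Dp Hs f (F : S -> R) : (forall u, 0 <= F u) ->
  (forall a u, F (T a u) = F u) -> (forall u, F (cj u) = F u) ->
  pavg Hs (fun hs hs' => F (Dp hs hs' f)) <=
  2 ^+ size Hs * bavg Hs (fun hs => F (Dl hs f)).
Proof.
move=> F0 FT Fc; elim: Hs f => [|H Hs IH] f; first by rewrite expr0 mul1r.
rewrite [X in X <= _]/= [bavg _ _]/=.
apply: le_trans (_ : 2 * avg H (fun l => pavg Hs (fun hs hs' =>
    F (Dp hs hs' (f * T (Posz l) (cj f))))) <= _); last first.
  rewrite exprS -mulrA ler_wpM2l // -avgZ; apply: avg_le => l _; exact: IH.
pose G (l : nat) := pavg Hs (fun hs hs' => F (Dp hs hs' (f * T (Posz l) (cj f)))).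
have G0 l : 0 <= G l.
  by rewrite /G pavg_bavg; apply: bavg_ge0 => hs'; apply: bavg_ge0.
have e (h h' : nat) : pavg Hs (fun hs hs' => F (Dp hs hs'
    (T (Posz h) (cj f) * T (Posz h') f))) = G `|(h%:Z - h'%:Z)%R|%N.
  congr pavg; apply/funext => hs; apply/funext => hs'.
  have -> : T (Posz h) (cj f) * T (Posz h') f =
      T (Posz h') (f * T (h%:Z - h'%:Z) (cj f)).
    by rewrite rmorphM -TD addrC subrK mulrC.
  rewrite Dp_T FT; case: (h%:Z - h'%:Z) => n //.
  rewrite NegzE -(FT n.+1%:Z) -Dp_T rmorphM -TD subrr T0 -Fc -Dp_cj.
  by rewrite rmorphM /= cjK T_cj mulrC.
under [X in X <= _]eq_avg => h do (under eq_avg => h' do rewrite e).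
rewrite -[2 * _]mul1r; case: H => [|H]; first by rewrite /avg !big_ord0 !mul0r !mulr0.
rewrite mul1r -[X in _ <= X](avg_cst _ (ltn0Sn H)); apply: avg_le => h hh.
rewrite /avg mulrA ler_wpM2r ?invr_ge0 //; exact: sum_absdiff.
Qed.

End Boxes.

(** * Correlation with eigenfunctions *)

Section RootsOfUnity.
Variable R : realType.

Definition zeta (Q j x : nat) : R[i] := ex (j%:R * x%:R / Q%:R).

Lemma zetaX Q j x : zeta Q j x = zeta Q j 1 ^+ x.
Proof. by rewrite /zeta -exMn; congr ex; rewrite -[_ *+ x]mulr_natr; ring. Qed.

Lemma zeta_sum Q x y : (x < Q)%N -> (y < Q)%N ->
  \sum_(j < Q) zeta Q j x * conjc (zeta Q j y) = if x == y then Q%:R else 0.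
Proof.
move=> xQ yQ; have Q0 : (0 < Q)%N by apply: leq_ltn_trans xQ.
have QR : (Q%:R : R) != 0 by rewrite pnatr_eq0 -lt0n.
have e (j : 'I_Q) : zeta Q j x * conjc (zeta Q j y) = ex ((x%:R - y%:R) / Q%:R) ^+ j.
  by rewrite -exB -exMn /zeta; congr ex; rewrite -[_ *+ j]mulr_natr; ring.
rewrite (eq_bigr _ (fun j _ => e j)).
have [->|xy] := eqVneq x y.
  rewrite subrr mul0r ex0; under eq_bigr do rewrite expr1n.
  by rewrite sumr_const card_ord.
set z := ex _.
have z1 : z != 1.
  apply/eqP => /ex_eq1/intrP[m hm].
  have hm' : x%:R - y%:R = m%:~R * Q%:R :> R by rewrite -hm divfK.
  have {}hm' : (x%:Z - y%:Z)%R = m * Q%:Z.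
    by apply: (@intr_inj R); rewrite rmorphB rmorphM.
  have : (`|x%:Z - y%:Z| < Q%:Z)%R by lia.
  rewrite hm' normrM (ger0_norm (_ : 0 <= Q%:Z)) //.
  have [m0|m0] := eqVneq m 0; first by move: hm'; rewrite m0 mul0r; lia.
  have : (1 <= `|m|)%R by lia.
  nia.
have := subrX1 z Q; rewrite -exMn -[_ *+ Q]mulr_natr divfK // exB.
rewrite (ex_int (natr_int _ _)) (ex_int (natr_int _ _)) unim_mulJ ?cab1 // subrr.
by move/esym/eqP; rewrite mulf_eq0 subr_eq0 (negbTE z1) => /eqP.
Qed.

Lemma circle_cluster (th : nat -> R) : (forall n, 0 <= th n <= 1) ->
  exists l, cab l = 1 /\ forall (e : R) n0, 0 < e ->
    exists2 n, (n0 <= n)%N & cab (ex (th n) - l) <= e.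
Proof.
move=> h01.
have [|t [_ ht]] := @segment_compact R 0 1 (th @ \oo) (fmap_proper_filter _ _).
  by exists 0%N => // n _ /=; rewrite in_itv /=; apply: h01.
exists (ex t); split=> [|e n0 e0]; first exact: cab_ex.
have e2 : 0 < e / 2 by rewrite divr_gt0.
have hn : nbhs t [set x | cab (ex x - ex t) <= e].
  have cc : {for t, continuous (fun x : R => cos (pi *+ 2 * x))}.
    by apply: continuous_comp; [apply: mulrl_continuous|apply: continuous_cos].
  have cs : {for t, continuous (fun x : R => sin (pi *+ 2 * x))}.
    by apply: continuous_comp; [apply: mulrl_continuous|apply: continuous_sin].
  move/cvgrPdist_le: cc => /(_ _ e2) cc; move/cvgrPdist_le: cs => /(_ _ e2) cs.
  near=> x; apply: le_trans (cab_le_ReIm _) _; rewrite [e]splitr; apply: lerD.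
    by rewrite /= distrC; near: x.
  by rewrite /= distrC; near: x.
have hA : (th @ \oo) [set th n | n in [set n | (n0 <= n)%N]].
  by exists n0 => // n hn' /=; exists n.
by have [_ [[n hn0 <-] hx]] := ht _ _ hA hn; exists n.
Unshelve. all: by end_near.
Qed.

End RootsOfUnity.

Section Inverse.
Variables (R : realType) (S : system R).
Implicit Types (f g F : S).

Definition nrm f := Num.sqrt (n2 f).

Lemma nrmD f g : nrm (f + g) <= nrm f + nrm g.
Proof.
have s0 : 0 <= nrm f + nrm g by rewrite addr_ge0 ?sqrtr_ge0.
rewrite -(@ler_pXn2r _ 2) ?nnegrE ?sqrtr_ge0 // sqr_sqrtr ?n2_ge0 //.
have h : complex.Re (E (f * cj g)) <= nrm f * nrm g.
  apply: le_trans (Re_le _) _.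
  rewrite -(@ler_pXn2r _ 2) ?nnegrE ?cab_ge0 ?mulr_ge0 ?sqrtr_ge0 //.
  by rewrite exprMn /nrm (sqr_sqrtr (n2_ge0 f)) (sqr_sqrtr (n2_ge0 g)); apply: cauchy_schwarz.
rewrite n2D sqrrD !sqr_sqrtr ?n2_ge0 // -[_ *+ 2]mulr_natr.
by move: h; move: (nrm f * nrm g) => z h; lra.
Qed.

Lemma nrm_T a f : nrm (T a f) = nrm f. Proof. by rewrite /nrm n2_T. Qed.

Lemma nrmN f : nrm (- f) = nrm f. Proof. by rewrite /nrm n2N. Qed.

Lemma nrmZ c f : nrm (cst c * f) = cab c * nrm f.
Proof. by rewrite /nrm n2_cst sqrtrM ?sqr_ge0 // sqrtr_sqr ger0_norm ?cab_ge0. Qed.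

Lemma nrm_bd M f : bd M f -> nrm f <= M.
Proof.
move=> h; rewrite -(ger0_norm (bd_ge0 h)) -sqrtr_sqr ler_wsqrtr //; exact: n2_le.
Qed.

Lemma nrm_sum I (r : seq I) (h : I -> S) :
  nrm (\sum_(i <- r) h i) <= \sum_(i <- r) nrm (h i).
Proof.
elim/big_rec2: _ => [|i y x _ H]; first by rewrite /nrm n2_0 sqrtr0.
by apply: le_trans (nrmD _ _) _; rewrite lerD2l.
Qed.

Definition tw (l : R[i]) f (m : nat) : S := cst (l ^+ m) * T (Posz m) f.

Lemma bd_tw l f m : cab l = 1 -> bd 1 f -> bd 1 (tw l f m).
Proof.
move=> l1 bf; apply: bd1M; last exact: bd_T.
by apply: bd_cstle; rewrite cabX l1 expr1n.
Qed.

Lemma twD l f m n : tw l f (m + n) = cst (l ^+ n) * T (Posz n) (tw l f m).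
Proof. by rewrite /tw rmorphM /= T_cst -TD PoszD mulrA -rmorphM -exprD addnC [n%:Z + _]addrC. Qed.

(** Parseval on a cyclic group: if the correlations of [f] with its translates
    are large on average then some twisted average of [f] is large. *)
Lemma spectral_peak f (eta : R) H0 : 0 < eta -> bd 1 f ->
  eta <= mean (fun h => cab (E (f * T (Posz h) (cj f))) ^+ 2) ->
  exists M (t : R), [/\ (H0 <= M)%N, (0 < M)%N, 0 <= t <= 1 &
    eta / 32 * M%:R ^+ 2 <= n2 (\sum_(m < M) tw (ex t) f m)].
Proof.
move=> e0 bf hm; pose a (k : int) := E (f * T k (cj f)).
have ba k : cab (a k) <= 1 by apply: cab_E; apply: bd1_diff.
have [|H [hH Hp hH2]] := @meanP1 R (fun h => cab (a (Posz h)) ^+ 2) (eta / 2) H0 _ (divr_gt0 e0 (ltr0n _ 2)).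
  by move=> n; rewrite normrX exprn_ile1 // ger0_norm ?cab_ge0.
pose s := \sum_(h < H) cab (a (Posz h)) ^+ 2.
have HR : (0 : R) < H%:R by rewrite ltr0n.
have hs : eta / 2 * H%:R <= s.
  move: hH2; rewrite ler_norml -/s => /andP[h1 _].
  have : eta * H%:R <= mean (fun h => cab (E (f * T (Posz h) (cj f))) ^+ 2) * H%:R.
    by rewrite ler_pM2r.
  rewrite -/(a _); move: h1; rewrite /a; lra.
have s0 : 0 < s by apply: lt_le_trans hs; rewrite mulr_gt0 // divr_gt0.
(* frequencies are taken modulo [Q]; the window [M] is twice the range [H] of the
   correlations and [Q >= M + H] prevents wrap-around *)
pose M := (2 * H)%N; pose Q := (3 * H)%N.
have QR : (0 : R) < Q%:R by rewrite ltr0n muln_gt0.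
pose N (j : nat) := n2 (\sum_(m < M) tw (zeta R Q j 1) f m).
pose G (j : nat) := \sum_(k < H) conjc (a (Posz k)) * zeta R Q j k.
have NE j : (N j)%:C = \sum_(m < M) \sum_(m' < M) zeta R Q j m * conjc (zeta R Q j m') *
    a (m'%:Z - m%:Z).
  have := E_real (\sum_(m < M) tw (zeta R Q j 1) f m); rewrite -/(N j) => <-.
  rewrite rmorph_sum mulr_suml E_sum.
  apply: eq_bigr => m _; rewrite mulr_sumr E_sum; apply: eq_bigr => m' _.
  rewrite /tw rmorphM cj_cst -mulrA E_cst mulrCA E_cst mulrA -!zetaX; congr (_ * _).
  by rewrite -(E_T (- m%:Z)) rmorphM T_N -T_cj -TD addrC.
have sumN : \sum_(j < Q) N j <= Q%:R * M%:R.
  rewrite -lecR rmorph_sum (eq_bigr _ (fun (j : 'I_Q) _ => NE j)).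
  rewrite exchange_big /=; under eq_bigr do rewrite exchange_big /=.
  have -> : \sum_(m < M) \sum_(m' < M) \sum_(j < Q)
      zeta R Q j m * conjc (zeta R Q j m') * a (m'%:Z - m%:Z) =
      \sum_(m < M) (Q%:R * a 0).
    apply: eq_bigr => m _; rewrite (bigD1 m) //= [X in _ + X]big1 ?addr0 => [|m' m'm].
      rewrite -mulr_suml zeta_sum ?eqxx ?subrr //; have := ltn_ord m; rewrite /M /Q; lia.
    rewrite -mulr_suml zeta_sum; first by rewrite eq_sym (negbTE m'm : (m' == m :> nat) = false) mul0r.
      have := ltn_ord m; rewrite /M /Q; lia.
    have := ltn_ord m'; rewrite /M /Q; lia.
  rewrite sumr_const card_ord -[X in X <= _]mulr_natr /a T0 E_real.
  have -> : Q%:R * (n2 f)%:C * M%:R = (Q%:R * n2 f * M%:R)%:C by rewrite !rmorphM !rmorph_nat.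
  rewrite lecR mulrAC ler_piMr ?mulr_ge0 //.
  by have := n2_le bf; rewrite expr1n.
have sumG : \sum_(j < Q) cab (G j) ^+ 2 = Q%:R * s.
  apply: (@complexI R); rewrite rmorph_sum.
  have -> : \sum_(j < Q) (cab (G j) ^+ 2)%:C = \sum_(k < H) \sum_(k' < H)
     conjc (a (Posz k)) * a (Posz k') * \sum_(j < Q) zeta R Q j k * conjc (zeta R Q j k').
    under eq_bigr do rewrite -mulJc /G conj_sum mulr_suml.
    rewrite exchange_big; apply: eq_bigr => k _.
    under eq_bigr do rewrite mulr_sumr.
    rewrite exchange_big; apply: eq_bigr => k' _; rewrite mulr_sumr.
    by apply: eq_bigr => j _; rewrite conjM conjcK; ring.
  rewrite rmorphM /s rmorph_sum mulr_sumr; apply: eq_bigr => k _.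
  rewrite (bigD1 k) //= [X in _ + X]big1 ?addr0 => [|k' kk'].
    rewrite zeta_sum ?eqxx; first by rewrite Jmulc rmorph_nat mulrC.
    - have := ltn_ord k; rewrite /Q; lia.
    - have := ltn_ord k; rewrite /Q; lia.
  rewrite zeta_sum; first by rewrite eq_sym (negbTE kk' : (k' == k :> nat) = false) mulr0.
    have := ltn_ord k; rewrite /Q; lia.
  have := ltn_ord k'; rewrite /Q; lia.
have sumNG : Q%:R * (H%:R * s) <= cab (\sum_(j < Q) (N j)%:C * G j).
  have -> : \sum_(j < Q) (N j)%:C * G j = (\sum_(m < M) \sum_(k < H)
      (if (m + k < M)%N then Q%:R * cab (a (Posz k)) ^+ 2 else 0))%:C.
    rewrite rmorph_sum.
    under eq_bigr => j _ do rewrite NE mulr_suml.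
    rewrite exchange_big; apply: eq_bigr => m _; rewrite rmorph_sum.
    under eq_bigr => j _ do rewrite /G mulr_sumr.
    rewrite exchange_big; apply: eq_bigr => k _.
    under eq_bigr => j _ do rewrite mulr_suml.
    rewrite exchange_big /=.
    have hmk : (m + k < Q)%N.
      by have := ltn_ord m; have := ltn_ord k; rewrite /M /Q; lia.
    have e (m' : 'I_M) : \sum_(j < Q) zeta R Q j m * conjc (zeta R Q j m') *
        a (m'%:Z - m%:Z) * (conjc (a (Posz k)) * zeta R Q j k) =
      a (m'%:Z - m%:Z) * conjc (a (Posz k)) * (if (m + k == m')%N then Q%:R else 0).
      rewrite -zeta_sum //; last by have := ltn_ord m'; rewrite /M /Q; lia.
      rewrite mulr_sumr; apply: eq_bigr => j _.
      rewrite (zetaX _ _ _ (m + k)) exprD -!zetaX; ring.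
    rewrite (eq_bigr _ (fun m' _ => e m')); case: ifP => mk.
      rewrite (bigD1 (Ordinal mk)) //= [X in _ + X]big1 ?addr0 => [|m' h].
        by rewrite eqxx PoszD addrAC subrr add0r mulJc (rmorphM _ Q%:R) rmorph_nat mulrC.
      by rewrite eq_sym (negbTE h : (m' == m + k :> nat)%N = false) mulr0.
    rewrite big1 // => m' _; case: eqP => [h|]; last by rewrite mulr0.
    by have := ltn_ord m'; rewrite -h mk.
  rewrite cab_real; apply: le_trans (ler_norm _).
  have -> : Q%:R * (H%:R * s) = \sum_(m < H) \sum_(k < H) Q%:R * cab (a (Posz k)) ^+ 2.
    by rewrite sumr_const card_ord -[RHS]mulr_natl -mulr_sumr mulrCA.
  have MH : M = (H + H)%N by rewrite /M; lia.
  rewrite MH big_split_ord /= ler_wpDr //.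
    by apply: sumr_ge0 => m _; apply: sumr_ge0 => k _; case: ifP => // _; rewrite mulr_ge0 ?sqr_ge0.
  apply: ler_sum => m _; apply: ler_sum => k _.
  by rewrite (_ : m + k < H + H)%N // ; have := ltn_ord m; have := ltn_ord k; lia.
have : exists j : 'I_Q, eta / 8 * H%:R ^+ 2 <= N j.
  apply: contrapT => hn.
  have hN (j : 'I_Q) : N j <= eta / 8 * H%:R ^+ 2.
    by rewrite ltW // ltNge; apply/negP => h; apply: hn; exists j.
  have N0 j : 0 <= N j by apply: n2_ge0.
  have h1 : cab (\sum_(j < Q) (N j)%:C * G j) <= \sum_(j < Q) N j * cab (G j).
    apply: le_trans (cab_sum _ _ _) _; apply: ler_sum => j _.
    by rewrite cabM cab_real ger0_norm.
  have h2 := @cauchy_sum _ _ (index_enum 'I_Q) predT (fun j => N j) (fun j => cab (G j)) (fun j _ => N0 j).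
  have h3 : \sum_(j < Q) N j * cab (G j) ^+ 2 <= eta / 8 * H%:R ^+ 2 * (Q%:R * s).
    by rewrite -sumG mulr_sumr; apply: ler_sum => j _; rewrite ler_wpM2r ?sqr_ge0.
  have h4 : (Q%:R * (H%:R * s)) ^+ 2 <= Q%:R * M%:R * (eta / 8 * H%:R ^+ 2 * (Q%:R * s)).
    apply: le_trans (_ : (\sum_(j < Q) N j * cab (G j)) ^+ 2 <= _).
      apply: lerXn2r; rewrite ?nnegrE ?(le_trans sumNG) //.
        by rewrite mulr_ge0 ?mulr_ge0 ?(ltW s0).
      by apply: le_trans h1; apply: cab_ge0.
    apply: le_trans h2 _; apply: ler_pM => //; apply: sumr_ge0 => // j _.
    by rewrite mulr_ge0 ?sqr_ge0.
  have h5 : (Q%:R * H%:R) ^+ 2 * s * s <= (Q%:R * H%:R) ^+ 2 * s * (eta / 4 * H%:R).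
    have -> : (Q%:R * H%:R) ^+ 2 * s * s = (Q%:R * (H%:R * s)) ^+ 2 by ring.
    apply: le_trans h4 _; rewrite le_eqVlt; apply/orP; left; apply/eqP.
    by rewrite /M natrM; field.
  move: h5; rewrite ler_pM2l; last by rewrite mulr_gt0 // exprn_gt0 // mulr_gt0.
  move=> h5; have : 0 < eta * H%:R by rewrite mulr_gt0.
  lra.
move=> [j hj]; exists M, (j%:R / Q%:R); split.
- by rewrite /M; apply: leq_trans hH _; lia.
- by rewrite muln_gt0.
- rewrite divr_ge0 //= ler_pdivrMr // mul1r ler_nat ltnW //.
- have -> : ex (j%:R / Q%:R) = zeta R Q j 1 by rewrite /zeta mulr1.
  by apply: le_trans hj; rewrite /M natrM; lra.
Qed.

Definition hull (W : seq (R * nat)) l f : S :=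
  \sum_(x <- W) cst x.1%:C * tw l f x.2.

Definition convex_wt (K : nat) (W : seq (R * nat)) :=
  (forall x, List.In x W -> 0 <= x.1 /\ (x.2 <= K)%N) /\ \sum_(x <- W) x.1 = 1.

Lemma sum_cst1 (W : seq (R * nat)) : \sum_(x <- W) x.1 = 1 ->
  \sum_(x <- W) cst x.1%:C = 1 :> S.
Proof. by move=> h; rewrite -(rmorph1 cst) -(rmorph1 (real_complex R)) -h !rmorph_sum. Qed.

Lemma tw_sum_shift l f M s : cab l = 1 -> bd 1 f ->
  bd (2 * s%:R) (\sum_(m < M) tw l f (m + s) - \sum_(m < M) tw l f m).
Proof.
move=> l1 bf; elim: s => [|s IH].
  under eq_bigr do rewrite addn0.
  by rewrite subrr mulr0; apply: bd0.
rewrite -[s.+1%:R]natr1 mulrDr mulr1 addrC.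
have -> : \sum_(m < M) tw l f (m + s.+1) - \sum_(m < M) tw l f m =
  (tw l f (M + s) - tw l f s) + (\sum_(m < M) tw l f (m + s) - \sum_(m < M) tw l f m).
  have -> : \sum_(m < M) tw l f (m + s.+1) =
      \sum_(m < M) tw l f (m + s) + tw l f (M + s) - tw l f s.
    elim: M {IH} => [|M IH]; first by rewrite !big_ord0 add0r add0n subrr.
    rewrite !big_ord_recr /= IH addnS -addSn.
    ring.
  ring.
apply: bdD IH; rewrite (_ : 2 = 1 + 1) //; apply: bdB; exact: bd_tw.
Qed.

(** A convex combination of boundedly many translates of a long average is close
    to that average. *)
Lemma hull_ge l f W K M : cab l = 1 -> bd 1 f -> convex_wt K W ->
  nrm (\sum_(m < M) tw l f m) <= M%:R * nrm (hull W l f) + 2 * K%:R.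
Proof.
move=> l1 bf [hW W1].
have e : \sum_(m < M) cst (l ^+ m) * T (Posz m) (hull W l f) =
   \sum_(x <- W) cst x.1%:C * \sum_(m < M) tw l f (m + x.2).
  rewrite [RHS](eq_bigr (fun x => \sum_(m < M) cst x.1%:C * tw l f (m + x.2))); last first.
    by move=> x _; rewrite mulr_sumr.
  rewrite exchange_big; apply: eq_bigr => m _.
  rewrite rmorph_sum mulr_sumr; apply: eq_bigr => x _.
  by rewrite addnC twD rmorphM /= T_cst mulrCA.
have h1 : nrm (\sum_(m < M) cst (l ^+ m) * T (Posz m) (hull W l f)) <= M%:R * nrm (hull W l f).
  apply: le_trans (nrm_sum _ _) _.
  under eq_bigr do rewrite nrmZ nrm_T cabX l1 expr1n mul1r.
  by rewrite sumr_const card_ord -[X in X <= _]mulr_natl.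
have h2 : bd (2 * K%:R) (\sum_(m < M) cst (l ^+ m) * T (Posz m) (hull W l f) -
    \sum_(m < M) tw l f m).
  have -> : \sum_(m < M) tw l f m = \sum_(x <- W) cst x.1%:C * \sum_(m < M) tw l f m.
    by rewrite -mulr_suml sum_cst1 // mul1r.
  rewrite e -sumrB; set KK := 2 * K%:R; rewrite -[KK]mul1r -W1 mulr_suml /KK.
  elim: W hW {W1 e h1} => [|x W IH] hW; first by rewrite !big_nil; apply: bd0.
  rewrite !big_cons; apply: bdD; last by apply: IH => y hy; apply: hW; right.
  have [x0 xK] := hW x (or_introl erefl).
  rewrite -mulrBr; apply: bdM.
    by have := bd_cst S x.1%:C; rewrite cab_real ger0_norm.
  by apply: bd_le (tw_sum_shift _ _ l1 bf); rewrite ler_wpM2l // ler_nat.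
rewrite -(subrK (\sum_(m < M) cst (l ^+ m) * T (Posz m) (hull W l f)) (\sum_(m < M) tw l f m)).
rewrite addrC; apply: le_trans (nrmD _ _) _; apply: lerD h1 _.
by rewrite -nrmN opprB; apply: nrm_bd.
Qed.

(** Only boundedly many powers of [l] occur, which lets the twist pass to the
    limit. *)
Lemma hull_cont l l' f W K : cab l = 1 -> cab l' = 1 -> bd 1 f -> convex_wt K W ->
  bd (K%:R * cab (l' - l)) (hull W l' f - hull W l f).
Proof.
move=> l1 l1' bf [hW W1].
rewrite -sumrB; set KK := K%:R * _; rewrite -[KK]mul1r -W1 mulr_suml /KK.
elim: W hW {W1} => [|x W IH] hW; first by rewrite !big_nil; apply: bd0.
rewrite !big_cons; apply: bdD; last by apply: IH => y hy; apply: hW; right.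
have [x0 xK] := hW x (or_introl erefl).
rewrite -mulrBr; apply: bdM.
  by have := bd_cst S x.1%:C; rewrite cab_real ger0_norm.
rewrite /tw -mulrBl -rmorphB -[K%:R * _]mulr1.
apply: bdM; last exact: bd_T.
apply: bd_le (bd_cst _ _); rewrite subrXX cabM mulrC ler_wpM2r ?cab_ge0 //.
apply: le_trans (cab_sum _ _ _) _.
under eq_bigr do rewrite cabM !cabX l1 l1' !expr1n mulr1.
by rewrite sumr_const card_ord ler_nat.
Qed.

Definition ergodic_system := forall f, sim (T 1 f) f -> exists c, sim f (cst c).

(** An almost everywhere unimodular function has bound 1; the interface does not
    know that its bounds are essential ones. *)
Definition unimodular_bounded := forall x : S, sim (x * cj x) 1 -> bd 1 x.

Hypothesis hC : complete_system S.
Hypothesis hE : ergodic_system.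
Hypothesis hU : unimodular_bounded.

(** The element of least norm in the closed convex hull of the twisted iterates
    is fixed by the twisted operator, and is not small when all twisted averages
    are not. *)
Theorem inverse_theorem f (eta : R) : 0 < eta -> bd 1 f ->
  eta <= mean (fun h => cab (E (f * T (Posz h) (cj f))) ^+ 2) ->
  exists l x, eig l x /\ eta / 32 <= cab (E (f * cj x)) ^+ 2.
Proof.
move=> e0 bf hm; set c := eta / 32; have c0 : 0 < c by rewrite divr_gt0.
have /choice[Mt hMt] : forall n, exists Mt : nat * R, [/\ (n <= Mt.1)%N, (0 < Mt.1)%N,
    0 <= Mt.2 <= 1 & c * Mt.1%:R ^+ 2 <= n2 (\sum_(m < Mt.1) tw (ex Mt.2) f m)].
  by move=> n; have [M [t h]] := spectral_peak n e0 bf hm; exists (M, t).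
have [|l [l1 hl]] := @circle_cluster R (fun n => (Mt n).2); first by move=> n; case: (hMt n).
(* the frequencies of the peaks accumulate at some [l]; no element of the hull for
   [l] can be small *)
have low W K : convex_wt K W -> Num.sqrt c <= nrm (hull W l f).
  move=> hW; apply/ler_addgt0Pr => e e_gt0.
  have e2 : 0 < e / 2 by rewrite divr_gt0.
  have eK : 0 < e / 2 / K.+1%:R by rewrite divr_gt0.
  have [n hn hcl] := hl _ (Num.truncn (2 * K%:R / (e / 2))).+1 eK.
  have [nM Mp _ hbig] := hMt n; set M := (Mt n).1 in nM Mp hbig.
  have MR : (0 : R) < M%:R by rewrite ltr0n.
  have u1 := cab_ex (Mt n).2.
  have k1 := hull_ge M u1 bf hW.
  have k2 : Num.sqrt c * M%:R <= nrm (\sum_(m < M) tw (ex (Mt n).2) f m).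
    by rewrite -(ger0_norm (ltW MR)) -sqrtr_sqr -sqrtrM ?(ltW c0) // ler_wsqrtr.
  have k3 : 2 * K%:R <= e / 2 * M%:R.
    rewrite -ler_pdivrMl // mulrC; apply: le_trans (ltW (truncnS_gt _)) _.
    by rewrite ler_nat; apply: leq_trans nM.
  have k4 : nrm (hull W (ex (Mt n).2) f) <= nrm (hull W l f) + e / 2.
    rewrite -(subrK (hull W l f) (hull W (ex (Mt n).2) f)) addrC.
    apply: le_trans (nrmD _ _) _; rewrite lerD2l.
    apply: le_trans (nrm_bd (hull_cont l1 u1 bf hW)) _.
    apply: le_trans (_ : K%:R * (e / 2 / K.+1%:R) <= _); first by rewrite ler_wpM2l.
    rewrite mulrCA ler_piMr ?(ltW e2) // ler_pdivrMr // mul1r ler_nat //.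
  rewrite -(ler_pM2r MR); apply: le_trans k2 _; apply: le_trans k1 _.
  have := ler_wpM2l (ltW MR) k4; lra.
pose C (j : nat) (G : S) := exists K W, convex_wt K W /\ G = hull W l f.
have [F [bF hF hmin]] : exists F, [/\ bd 1 F,
    forall e j, 0 < e -> exists2 G, C j G & n2 (F - G) <= e &
    forall G, (forall j, C j G) -> n2 (0 - F) <= n2 (0 - G)].
  apply: closest_point => //.
  - move=> j; exists f, 0%N, [:: (1, 0%N)]; split; last first.
      by rewrite /hull big_seq1 /tw expr0 !rmorph1 !mul1r T0.
    by split; [move=> x [<-|//]|rewrite big_seq1].
  - move=> j G G' [K [W [[hW W1] ->]]] [K' [W' [[hW' W1'] ->]]].
    exists (maxn K K'), ([seq (2^-1 * x.1, x.2) | x <- W] ++ [seq (2^-1 * x.1, x.2) | x <- W']).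
    split; last first.
      rewrite /hull big_cat !big_map mulrDr !mulr_sumr.
      by congr (_ + _); apply: eq_bigr => x _; rewrite mulrA -rmorphM -rmorphM.
    split; last by rewrite big_cat !big_map /= -!mulr_sumr W1 W1'; lra.
    move=> x /List.in_app_iff[] /List.in_map_iff[y [<- hy]] /=.
      by have [y0 yK] := hW y hy; rewrite mulr_ge0 ?invr_ge0 // leq_max yK.
    by have [y0 yK] := hW' y hy; rewrite mulr_ge0 ?invr_ge0 // leq_max yK orbT.
  - move=> j G [K [W [[hW W1] ->]]]; rewrite -W1 /hull.
    elim: W hW {W1} => [|x W IH] hW; first by rewrite !big_nil; apply: bd0.
    rewrite !big_cons; apply: bdD; last by apply: IH => y hy; apply: hW; right.
    have [x0 xK] := hW x (or_introl erefl).
    rewrite -[x.1]mulr1; apply: bdM; last exact: bd_tw.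
    by have := bd_cst S x.1%:C; rewrite mulr1 cab_real ger0_norm.
have cF : c <= n2 F.
  rewrite -[n2 F]sqr_sqrtr ?n2_ge0 // -[c]sqr_sqrtr ?(ltW c0) //.
  apply: lerXn2r; rewrite ?nnegrE ?sqrtr_ge0 // -/(nrm F).
  apply/ler_addgt0Pr => e e_gt0.
  have [G [K [W [hW ->]]] nG] := hF (e ^+ 2) 0%N (exprn_gt0 2 e_gt0).
  apply: le_trans (low _ _ hW) _.
  rewrite -(subrK F (hull W l f)) addrC; apply: le_trans (nrmD _ _) _; rewrite lerD2l.
  by rewrite -nrmN opprB -(ger0_norm (ltW e_gt0)) -sqrtr_sqr ler_wsqrtr.
pose U g := cst l * T 1 g.
have UB g h : U g - U h = U (g - h) by rewrite /U rmorphB mulrBr.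
have nU g : nrm (U g) = nrm g by rewrite nrmZ nrm_T l1 mul1r.
have n2U g : n2 (U g) = n2 g by rewrite n2_cst n2_T l1 expr1n mul1r.
have Utw m : U (tw l f m) = tw l f m.+1 by rewrite -addn1 twD expr1.
(* an element almost of least norm is almost fixed, since its midpoint with its
   image is still in the hull *)
have fix_F : n2 (F - U F) = 0.
  have n0 : nrm (F - U F) <= 0.
    apply/ler_addgt0Pr => e e_gt0; rewrite add0r.
    pose d := Num.min 1 (e / 7).
    have dp : 0 < d by rewrite lt_min ltr01 divr_gt0.
    have d1 : d <= 1 by rewrite ge_min lexx.
    have de : d <= e / 7 by rewrite ge_min lexx orbT.
    have d2 : 0 < (d ^+ 2) ^+ 2 by rewrite !exprn_gt0.
    have [G CG nG] := hF _ 0%N d2; have [K [W [[hW W1] eG]]] := CG.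
    have NG : nrm (F - G) <= d ^+ 2.
      by rewrite -(ger0_norm (sqr_ge0 d)) -sqrtr_sqr ler_wsqrtr.
    have mid : n2 F <= n2 (cst (2^-1)%:C * (G + U G)).
      rewrite -(n2N F) -(n2N (cst _ * _)) -[- F]add0r -[- (cst _ * _)]add0r.
      apply: hmin => j; exists K.+1, ([seq (2^-1 * x.1, x.2) | x <- W] ++ [seq (2^-1 * x.1, x.2.+1) | x <- W]).
      split; last first.
        rewrite eG /hull big_cat !big_map mulrDr /U rmorph_sum !mulr_sumr.
        congr (_ + _); apply: eq_bigr => x _; first by rewrite mulrA -!rmorphM.
        by rewrite -Utw /U rmorphM /= T_cst rmorphM rmorphM; ring.
      split; last by rewrite big_cat !big_map /= -!mulr_sumr W1; lra.
      move=> x /List.in_app_iff[] /List.in_map_iff[y [<- hy]] /=;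
        have [y0 yK] := hW y hy; rewrite mulr_ge0 ?invr_ge0 //; split=> //; exact: leq_trans yK _.
    have par : n2 (G - U G) + 4 * n2 (cst (2^-1)%:C * (G + U G)) = 4 * n2 G.
      rewrite n2_cst cab_real ger0_norm ?invr_ge0 // exprVn n2B n2D n2U; by field.
    have GF : nrm G <= nrm F + d ^+ 2.
      rewrite -(subrK F G) addrC; apply: le_trans (nrmD _ _) _.
      by rewrite lerD2l -nrmN opprB.
    have F1 := nrm_bd bF.
    have GUG : n2 (G - U G) <= 12 * d ^+ 2.
      have : n2 G <= (nrm F + d ^+ 2) ^+ 2.
        rewrite -[n2 G]sqr_sqrtr ?n2_ge0 //; apply: lerXn2r GF; rewrite nnegrE ?sqrtr_ge0 //.
        by rewrite addr_ge0 ?sqrtr_ge0 ?sqr_ge0.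
      have : nrm F ^+ 2 = n2 F by rewrite sqr_sqrtr ?n2_ge0.
      have F0 : 0 <= nrm F by apply: sqrtr_ge0.
      move: mid par F1 F0; move: (nrm F) => x.
      have dd : d ^+ 2 <= 1 by rewrite exprn_ile1 // ltW.
      have : 0 <= d ^+ 2 by apply: sqr_ge0.
      move: (d ^+ 2) dd => y y1 y0 mid par x1 x0.
      rewrite sqrrD -mulr_natr => hx hG.
      have : x * y <= y by rewrite ler_piMl.
      have : y ^+ 2 <= y by rewrite expr2 ler_piMl.
      lra.
    have NGU : nrm (G - U G) <= 4 * d.
      have d4 : 0 <= 4 * d by rewrite mulr_ge0 // ltW.
      rewrite -(ger0_norm d4) -sqrtr_sqr ler_wsqrtr // exprMn; apply: le_trans GUG _.
      by rewrite ler_wpM2r ?sqr_ge0 // -natrX ler_nat.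
    have -> : F - U F = (F - G) + ((G - U G) + U (G - F)) by rewrite -UB; ring.
    apply: le_trans (nrmD _ _) _; apply: le_trans (lerD NG (nrmD _ _)) _.
    rewrite nU -(opprB F G) nrmN.
    have : d ^+ 2 <= d by rewrite expr2 ler_piMl // ltW.
    lra.
  have : nrm (F - U F) == 0 by rewrite eq_le n0 sqrtr_ge0.
  by rewrite sqrtr_eq0 => h; apply/eqP; rewrite eq_le h n2_ge0.
have simF : sim F (U F) by apply: n2_sim.
have TF : sim (T 1 F) (cst (conjc l) * F).
  apply: sim_sym; have := simM (sim_refl (cst (conjc l))) simF.
  by rewrite /U mulrA -rmorphM Jmulc l1 expr1n !rmorph1 mul1r.
have [k hk] : exists k, sim (F * cj F) (cst k).
  apply: hE; rewrite rmorphM /= T_cj.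
  have := simM TF (sim_cj TF).
  by rewrite rmorphM cj_cst conjcK mulrACA -rmorphM Jmulc l1 expr1n !rmorph1 mul1r.
have kE : k = (n2 F)%:C by rewrite -E_real (sim_E hk) E_cstr.
pose r := (nrm F)^-1.
have F0 : 0 < nrm F by rewrite sqrtr_gt0; apply: lt_le_trans cF.
have r0 : 0 < r by rewrite invr_gt0.
have rF : r ^+ 2 * n2 F = 1.
  by rewrite /r -[n2 F]sqr_sqrtr ?n2_ge0 // -exprMn mulVf ?expr1n // gt_eqF.
pose x := cst r%:C * F.
have xx : sim (x * cj x) 1.
  have -> : x * cj x = cst (r ^+ 2)%:C * (F * cj F).
    by rewrite /x rmorphM cj_cst conj_real !rmorphXn /=; ring.
  apply: sim_trans (simM (sim_refl _) hk) _.
  by rewrite kE -rmorphM -rmorphM rF !rmorph1.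
(* all twisted iterates have the same correlation with the fixed [F] *)
have EfF : E (f * cj F) = E (F * cj F).
  have Etw m : E (tw l f m * cj F) = E (f * cj F).
    elim: m => [|m <-]; first by rewrite /tw expr0 rmorph1 mul1r T0.
    rewrite -Utw mulrC (sim_cj simF) /U rmorphM cj_cst /= -T_cj.
    have -> : cst (conjc l) * T 1 (cj F) * (cst l * T 1 (tw l f m)) =
       cst (conjc l * l) * T 1 (tw l f m * cj F) by rewrite !rmorphM /=; ring.
    by rewrite E_cst E_T Jmulc l1 expr1n mul1r.
  apply/eqP; rewrite -subr_eq0 -cab_eq0 eq_le cab_ge0 andbT.
  apply/ler_addgt0Pr => e e_gt0; rewrite add0r.
  have [G [K [W [[hW W1] ->]]] nG] := hF (e ^+ 2) 0%N (exprn_gt0 2 e_gt0).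
  have -> : E (f * cj F) = E (hull W l f * cj F).
    rewrite /hull mulr_suml E_sum; under [RHS]eq_bigr do rewrite -mulrA E_cst Etw.
    by rewrite -mulr_suml -rmorph_sum W1 rmorph1 mul1r.
  rewrite -E_B -mulrBl -(@ler_pXn2r _ 2) ?nnegrE ?cab_ge0 ?(ltW e_gt0) //.
  apply: le_trans (cs_bd _ (bd_cj bF)) _.
  by rewrite -n2N opprB.
exists (conjc l), x; split.
  split=> //; [by rewrite cabJ|exact: hU|].
  rewrite /x rmorphM /= T_cst mulrCA; exact: simM.
rewrite /x rmorphM cj_cst conj_real mulrCA E_cst EfF E_real -rmorphM cab_real.
rewrite real_normK ?num_real //.
have -> : (r * n2 F) ^+ 2 = r ^+ 2 * n2 F * n2 F by ring.
by rewrite rF mul1r.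
Qed.

(** The quotient of two eigenfunctions of the same eigenvalue is invariant. *)
Lemma eig_simple l (x y : S) : eig l x -> eig l y ->
  exists u, cab u = 1 /\ sim x (cst u * y).
Proof.
move=> [l1 bx ex ux] [_ by_ ey uy].
have [u hu] : exists u, sim (x * cj y) (cst u).
  apply: hE; rewrite rmorphM /= T_cj.
  have := simM ex (sim_cj ey).
  by rewrite rmorphM cj_cst mulrACA -rmorphM mulJc l1 expr1n !rmorph1 mul1r.
have hx : sim x (cst u * y).
  have h1 : sim (x * cj y * y) (cst u * y) by apply: simM.
  apply: sim_trans h1; rewrite -mulrA [cj y * y]mulrC -{1}[x]mulr1.
  by apply: simM => //; apply: sim_sym.
exists u; split=> //.
have h := simM hx (sim_cj hx).
have : E (cst u * y * cj (cst u * y)) = 1.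
  by rewrite -(sim_E h) (sim_E ux) E1.
rewrite E_real n2_cst.
have -> : n2 y = 1 by rewrite /n2 (sim_E uy) E1.
rewrite mulr1 => /eqP; rewrite -(rmorph1 (real_complex R)) (inj_eq (@complexI R)).
by rewrite sqrf_eq1 => /orP[/eqP//|/eqP h']; have := cab_ge0 u; rewrite h' ler0N1.
Qed.

End Inverse.

(** * Lowering the degree of difference means *)

(** In the square of a system the integral of [f] tensor its conjugate is the
    squared modulus of the integral of [f]: phases in front of correlations become
    invisible, and squared means become means. *)
Record square (R : realType) (S S2 : system R) := Square {
  tens : S -> S -> S2;
  tensM : forall f f' g g', tens (f * f') (g * g') = tens f g * tens f' g';
  tens1 : tens 1 1 = 1;
  tens_T : forall a f g, T a (tens f g) = tens (T a f) (T a g);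
  tens_cj : forall f g, cj (tens f g) = tens (cj f) (cj g);
  tens_E : forall f g, E (tens f g) = E f * E g;
  tens_bd : forall f g, bd 1 f -> bd 1 g -> bd 1 (tens f g)
}.

Section SquareTheory.
Variables (R : realType) (S S2 : system R) (sq : square S S2).
Implicit Types (f g : S).
Local Notation "f \ox g" := (tens sq f g) (at level 40).

Lemma Dl_tens hs f g : Dl hs (f \ox g) = Dl hs f \ox Dl hs g.
Proof. by elim: hs f g => [|h hs IH] f g //=; rewrite tens_cj tens_T -tensM IH. Qed.

Lemma Dp_tens hs hs' f g : Dp hs hs' (f \ox g) = Dp hs hs' f \ox Dp hs hs' g.
Proof.
by elim: hs hs' f g => [|h hs IH] [|h' hs'] f g //=; rewrite tens_cj !tens_T -tensM IH.
Qed.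

Lemma Xp_tens hs hs' (X Y : seq nat -> S) :
  Xp hs hs' (fun k => X k \ox Y k) = Xp hs hs' X \ox Xp hs hs' Y.
Proof.
elim: hs hs' X Y => [|h hs IH] [|h' hs'] X Y //=; rewrite -IH; congr Xp.
by apply/funext => k; rewrite tens_cj -tensM.
Qed.

Lemma Low_tens n (A B : seq nat -> S) : Low n A -> Low n B ->
  Low n (fun hs => A hs \ox B hs).
Proof.
elim: n A B => [|n IH] A B /=; first by move=> -> ->; rewrite tens1.
move=> [g [A' [bg hA eA]]] [k [B' [bk hB eB]]].
exists (fun hs => g hs \ox k hs), (fun h hs => A' h hs \ox B' h hs); split.
- by move=> hs; apply: tens_bd.
- by move=> h; apply: IH.
- by move=> h hs; rewrite eA eB tensM.
Qed.

Lemma tens_abs f : E (f \ox cj f) = (cab (E f) ^+ 2)%:C.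
Proof. by rewrite tens_E E_cj mulJc. Qed.

End SquareTheory.

Section Lowering.
Variables (R : realType) (S S2 : system R) (sq : square S S2).
Implicit Types (f g F x : S).
Hypothesis hC : complete_system S.
Hypothesis hE : ergodic_system S.
Hypothesis hU : unimodular_bounded S.

Definition Vs t F : R := mavg t (fun hs => cab (E (Dl hs F)) ^+ 2).

Lemma Vs_Us t F : Vs t F = Us t (tens sq F (cj F)).
Proof.
rewrite Us_mavg /Vs; congr mavg; apply/funext => hs.
by rewrite Dl_tens Dl_cj tens_abs cab_real ger0_norm ?sqr_ge0.
Qed.

Lemma Xp_cst (b : seq nat -> R[i]) hs hs' : (forall k, cab (b k) <= 1) ->
  exists2 be, cab be <= 1 & Xp hs hs' (fun k => cst (b k) : S) = cst be.
Proof.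
elim: hs hs' b => [|h hs IH] [|h' hs'] b hb /=; try by exists (b [::]).
have [|be be1 e] := IH hs' (fun k => b (h :: k) * conjc (b (h' :: k))).
  by move=> k; rewrite cabM cabJ mulr_ile1 ?cab_ge0.
exists be => //; rewrite -e; congr Xp; apply/funext => k.
by rewrite cj_cst -rmorphM.
Qed.

Lemma Xp_eig (x : seq nat -> S) hs hs' : (forall k, exists l, eig l (x k)) ->
  exists l, eig l (Xp hs hs' x).
Proof.
elim: hs hs' x => [|h hs IH] [|h' hs'] x hx //=; apply: IH => k.
have [l hl] := hx (h :: k); have [l' hl'] := hx (h' :: k).
by exists (l * conjc l'); apply: eigM => //; apply: eig_cj.
Qed.

Lemma Xp_unim (Y : S) hs hs' : hs != [::] -> size hs = size hs' ->
  sim (Y * cj Y) 1 -> sim (Xp hs hs' (fun=> Y)) 1.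
Proof.
case: hs hs' => [|h hs] [|h' hs'] //= _ _; move: (Y * cj Y) => Z.
elim: hs hs' Z => [|k hs IH] [|k' hs'] Z hZ //=; apply: IH.
by have := simM hZ (sim_cj hZ); rewrite rmorph1 mulr1.
Qed.

Lemma root_ex (O : nat) (l : R[i]) : (0 < O)%N -> cab l = 1 -> l ^+ O = 1 ->
  exists j : 'I_O, l = ex (j%:R / O%:R).
Proof.
move=> O0 l1 lO; have OR : (O%:R : R) != 0 by rewrite pnatr_eq0 -lt0n.
have [y hy0] := ex_surj l1.
have /intrP[k hk] : y * O%:R \is a Num.int.
  by apply: ex_eq1; rewrite mulr_natr exMn hy0.
have Oz : O%:Z != 0 by rewrite eqz_nat -lt0n.
have k0 := modz_ge0 k Oz; have k1 := ltz_pmod k (_ : 0 < O%:Z).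
have jO : (`|(k %% O%:Z)%Z| < O)%N by have := k1 O0; lia.
exists (Ordinal jO) => /=.
have -> : (`|(k %% O%:Z)%Z|%N)%:R = (k %% O%:Z)%Z%:~R :> R.
  by rewrite -{2}(gez0_abs k0).
have hy : y = (k %% O%:Z)%Z%:~R / O%:R + (k %/ O%:Z)%Z%:~R.
  apply: (mulIf OR); rewrite hk mulrDl divfK // {1}(divz_eq k O%:Z).
  by rewrite addrC rmorphD rmorphM.
by rewrite -hy0 {1}hy exD (ex_int (intr_int _ _)) mulr1.
Qed.

Variables (I : finType) (q : I -> {poly R}).

Definition prodT (A : {set I}) (f : I -> S) n : S :=
  \prod_(j in A) T (poly_val (q j) n) (f j).

(** The averages of these are the dual functions of the average over [A] and [m],
    seen from the function with index [m]. *)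
Definition dual_weight A m (c : nat -> R[i]) (f : I -> S) n : S :=
  cst (c n) * T (- poly_val (q m) n) (prodT A f n).

Lemma bd_prodT A (f : I -> S) n : (forall j, bd 1 (f j)) -> bd 1 (prodT A f n).
Proof. by move=> bf; apply: bd1_prod => j _; apply: bd_T. Qed.

Lemma bd_dual_weight A m c (f : I -> S) n : (forall n, cab (c n) = 1) ->
  (forall j, bd 1 (f j)) -> bd 1 (dual_weight A m c f n).
Proof.
move=> c1 bf; apply: bd1M; last by apply/bd_T/bd_prodT.
by apply: bd_cstle; rewrite c1.
Qed.

(** The arithmetic input of degree lowering.  It holds when the polynomials of [A]
    and [q m] are independent: the eigenvalue is then seen at frequencies that the
    other functions cannot cancel, unless it is a root of unity. *)
Definition order_bound (A : {set I}) (m : I) := forall e : R, 0 < e ->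
  exists2 O : nat, (0 < O)%N & forall l x (g : I -> S), eig l x ->
    (forall j, bd 1 (g j)) ->
    ~ Ub (fun n => l ^ poly_val (q m) n * E (x * prodT A g n)) e -> l ^+ O = 1.

Definition approximable (F : S) (w : nat -> S) := forall kappa L0, 0 < kappa ->
  exists W, [/\ probability_wt W, long L0 W & n2 (F - combination W w) <= kappa].

Lemma lerX_nneg (a b : R) n : 0 <= a -> a <= b -> a ^+ n <= b ^+ n.
Proof. by move=> a0 ab; apply: lerXn2r; rewrite ?nnegrE // (le_trans a0 ab). Qed.

Lemma cab_sqr_le1 g : bd 1 g -> 0 <= cab (E g) ^+ 2 <= 1.
Proof. by move=> bg; rewrite sqr_ge0 exprn_ile1 ?cab_ge0 ?cab_E. Qed.

Lemma Vs_succ t F : Vs t.+1 F =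
  mavg t (fun hs => mean (fun h => cab (E (Dl hs F * T (Posz h) (cj (Dl hs F)))) ^+ 2)).
Proof.
rewrite /Vs mavg_rcons; congr mavg; apply/funext => hs; congr mean.
by apply/funext => h; rewrite Dl_rcons.
Qed.

(** If the differences of [F] correlate with eigenfunctions then, [F] being a
    limit of averages of the conjugate weights, the Cauchy-Schwarz inequality
    on the box shows that most of these eigenvalues may be taken to be roots of
    unity of bounded order, up to lower factors. *)
Lemma structured_eigenfunctions A m (O t : nat) Hs c (f : I -> S) F (b : seq nat -> R[i])
    (x : seq nat -> S) (e1 : R) : all (ltn 0) Hs -> size Hs = t.+1 ->
  (forall n, cab (c n) = 1) -> (forall j, bd 1 (f j)) -> bd 1 F ->
  approximable F (dual_weight A m c f) -> 0 < e1 ->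
  (forall l x (g : I -> S), eig l x -> (forall j, bd 1 (g j)) ->
    ~ Ub (fun n => l ^ poly_val (q m) n * E (x * prodT A g n)) ((e1 / 2) ^+ (2 ^ t.+1) / 2) ->
    l ^+ O = 1) ->
  (forall hs, cab (b hs) <= 1) -> (forall hs, exists l, eig l (x hs)) ->
  e1 <= bavg Hs (fun hs => complex.Re (E (Dl hs F * (cst (b hs) * x hs)))) ->
  exists2 hs', size hs' = t.+1 & (e1 / 2) ^+ (2 ^ t.+1) / 4 <
    bavg Hs (fun hs => (`[< b hs <> 0 /\
        exists2 l, eig l (Xp hs hs' x) & l ^+ O = 1 >])%:R).
Proof.
move=> Hs0 sHs c1 bf bF hF e0 hO b1 ex_ he1.
set e2 := (e1 / 2) ^+ (2 ^ t.+1) in hO *.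
have e20 : 0 < e2 by rewrite exprn_gt0 // divr_gt0.
pose X hs := cst (b hs) * x hs.
have bx hs : bd 1 (x hs) by have [l []] := ex_ hs.
have bX hs : bd 1 (X hs) by apply: bd1M => //; apply: bd_cstle.
pose good hs hs' := b hs <> 0 /\ exists2 l, eig l (Xp hs hs' x) & l ^+ O = 1.
pose z hs hs' n := E (T (- poly_val (q m) n)
   (prodT A (fun j => Dp hs hs' (cj (f j))) n) * Xp hs hs' X).
(* after the Cauchy-Schwarz inequality each pair of points carries an average over
   [A] twisted by a product of eigenfunctions; when it is not small, the
   hypothesis on orders applies *)
have zU hs hs' : inbox Hs hs -> inbox Hs hs' -> ~ Ub (z hs hs') (e2 / 2) -> good hs hs'.
  move=> /size_inbox s1 /size_inbox s2 nU.
  have [be be1 eb] := @Xp_cst b hs hs' b1.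
  have [l hl] := @Xp_eig x hs hs' ex_.
  have eX : Xp hs hs' X = cst be * Xp hs hs' x by rewrite /X XpM eb.
  split.
    move=> b0; apply: nU; apply: Ub_ext (_ : Ub (fun=> 0) _) => [n|]; last first.
      by apply: Ub_cst; rewrite cab0 divr_ge0 // ltW.
    have [Th _ hTh] := Xp_low hs' bX.
    by rewrite /z hTh ?s1 ?s2 // /X b0 rmorph0 !mul0r mulr0 E_0.
  exists l => //; apply: (hO _ _ (fun j => Dp hs hs' (cj (f j))) hl).
    by move=> j; apply/bd_Dp/bd_cj.
  move=> hUb; apply: nU; apply: Ub_ext (UbM be1 hUb) => n.
  rewrite /z eX [in RHS]mulrCA E_cst; congr (_ * _).
  rewrite -[in RHS](E_T (poly_val (q m) n)) rmorphM /= -TD subrr T0 [in RHS]mulrC.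
  by rewrite (eig_Tn _ hl) -mulrA E_cst.
have [L0 hL0] : exists L0, forall hs hs', inbox Hs hs -> inbox Hs hs' -> ~ good hs hs' ->
    forall M L, (L0 <= L)%N -> cab (\sum_(i < L) z hs hs' (M + i)%N) <= e2 / 2 * L%:R.
  pose bdd hs hs' N := inbox Hs hs -> inbox Hs hs' -> ~ good hs hs' ->
    forall M L, (N <= L)%N -> cab (\sum_(i < L) z hs hs' (M + i)%N) <= e2 / 2 * L%:R.
  have h1 hs : exists f1 : seq nat -> nat, forall hs', bdd hs hs' (f1 hs').
    suff /choice[f1 hf1] : forall hs', exists N, bdd hs hs' N by exists f1.
    move=> hs'.
    have [[h1 [h2 h3]]|h] := pselect (inbox Hs hs /\ inbox Hs hs' /\ ~ good hs hs'); last first.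
      by exists 0%N => k1 k2 k3; case: h; split.
    have [L1 hL1] : Ub (z hs hs') (e2 / 2).
      by apply: contrapT => nU; apply: h3; apply: zU.
    by exists L1 => _ _ _.
  have /choice[f2 hf2] := h1.
  have /choice[N hN] := fun hs => inbox_bound Hs (f2 hs).
  have [L0 hL0] := inbox_bound Hs N.
  exists L0 => hs hs' i1 i2 ng M L hL; apply: (hf2 hs hs') => //.
  by apply: leq_trans (hN hs _ i2) _; apply: leq_trans (hL0 _ i1) hL.
have k0 : 0 < (e1 / 2) ^+ 2 by rewrite exprn_gt0 // divr_gt0.
have [W [[W0 W1] lW nW]] := hF _ L0 k0.
set G := combination _ _ in nW.
pose om (y : R * (R[i] * nat)) := `|y.1|.
pose u (y : R * (R[i] * nat)) := cst y.2.1 * cj (dual_weight A m c f y.2.2).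
have omW y : List.In y W -> om y = y.1.
  by move=> hy; have [y0 _] := W0 y hy; rewrite /om ger0_norm.
have om1 : \sum_(y <- W) om y = 1 by rewrite (big_In _ _ omW).
have GE : G = \sum_(y <- W) cst (om y)%:C * u y.
  by apply: big_In => y hy; rewrite omW // /u mulrA -rmorphM.
(* replacing one of the factors [F] in each derivative by its approximation costs
   half of [e1] *)
have eG : e1 / 2 <= bavg Hs (fun hs => \sum_(y <- W) om y *
    complex.Re (E (Dt hs F (u y) * 1 * X hs))).
  have -> : bavg Hs (fun hs => \sum_(y <- W) om y *
    complex.Re (E (Dt hs F (u y) * 1 * X hs))) =
    bavg Hs (fun hs => complex.Re (E (Dt hs F G * X hs))).
    apply: eq_bavg => hs; rewrite GE Dt_sum mulr_suml E_sum Re_sum.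
    by apply: eq_bigr => y _; rewrite mulr1 -mulrA E_cst ReZ.
  have h1 : bavg Hs (fun hs => complex.Re (E (Dl hs F * X hs))) <=
      bavg Hs (fun hs => complex.Re (E (Dt hs F G * X hs)) + e1 / 2).
    apply: bavg_le => hs _; rewrite -lerBlDl; apply: le_trans (_ : cab (E ((Dt hs F F - Dt hs F G) * X hs)) <= _).
      by rewrite -Dtt -ReN -ReD -E_N -E_D -mulrBl; apply: Re_le.
    rewrite -(@ler_pXn2r _ 2) ?nnegrE ?cab_ge0 ?divr_ge0 ?(ltW e0) //.
    apply: le_trans (cs_bd _ (bX hs)) _; apply: le_trans (n2_Dt hs _ _ bF) nW.
  move: h1; rewrite bavgD bavg_cst //; move: he1; rewrite -/X; lra.
have lowT : Low (size Hs) (fun=> 1 : S) by apply: Low1.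
have := @box_cauchy_schwarz R S _ W om u F Hs X (fun=> 1) (fun y => normr_ge0 _) om1 bF lowT.
rewrite sHs => gcs.
have le2 : e2 <= pavg Hs (fun hs hs' => e2 / 2 + (`[< good hs hs' >])%:R).
  apply: le_trans (_ : _ <= pavg Hs (fun hs hs' => cab (\sum_(y <- W) (om y)%:C *
     E (Dp hs hs' (u y) * Xp hs hs' X)))) _.
    by apply: le_trans gcs; apply: lerX_nneg eG; rewrite divr_ge0 // ltW.
  apply: pavg_le => hs hs' i1 i2.
  have s1 := size_inbox i1; have s2 := size_inbox i2.
  have nz : hs != [::] by rewrite -size_eq0 s1 sHs.
  have ss : size hs = size hs' by rewrite s1 s2.
  have uE y : List.In y W -> (om y)%:C * E (Dp hs hs' (u y) * Xp hs hs' X) =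
      y.1%:C * z hs hs' y.2.2.
    move=> hy; rewrite omW //; have [_ y1] := W0 y hy; congr (_ * _).
    rewrite /u /dual_weight rmorphM cj_cst mulrA -rmorphM DpM Dp_cst //; last first.
      by rewrite cabM cabJ c1 y1 mulr1.
    rewrite mul1r /z /prodT -T_cj Dp_T rmorph_prod Dp_prod.
    congr (E (T _ _ * _)); apply: eq_bigr => j _.
    by rewrite -T_cj Dp_T.
  rewrite (big_In _ _ uE).
  have [g|ng] := pselect (good hs hs').
    rewrite (asboolT g) /=; apply: ler_wpDl; first by rewrite divr_ge0 // ltW.
    apply: le_trans (cab_sum _ _ _) _; rewrite -[X in _ <= X]om1.
    apply: ler_sum => y _; rewrite cabM cab_real ler_piMr ?normr_ge0 //; apply: cab_E.
    apply: bd1M; first by apply/bd_T/bd_prodT => j; apply/bd_Dp/bd_cj.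
    exact: bd_Xp.
  rewrite (asboolF ng) addr0; apply: (proj1 (lW _ _ _)) => M L hL; exact: hL0.
have le3 : e2 / 2 <= bavg Hs (fun hs' => bavg Hs (fun hs => (`[< good hs hs' >])%:R)).
  move: le2; rewrite pavg_bavg; under eq_bavg do rewrite bavgD bavg_cst //.
  rewrite bavgD bavg_cst //; lra.
have [||hs' i' h] := @bavg_gt R Hs (fun hs' => bavg Hs (fun hs => (`[< good hs hs' >])%:R)) (e2 / 4).
- by rewrite divr_ge0 // ltW.
- by apply: lt_le_trans le3; lra.
by exists hs' => //; rewrite (size_inbox i') sHs.
Qed.

(** Bounded order leaves boundedly many candidate eigenvalues, and eigenvalues
    are simple: a single eigenfunction serves for many points of the box, and
    the lower factors disappear in one more Cauchy-Schwarz inequality. *)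
Theorem degree_lowering A m t (eta : R) : 0 < eta -> order_bound A m ->
  exists2 eta', 0 < eta' & forall c (f : I -> S) F, (forall n, cab (c n) = 1) ->
    (forall j, bd 1 (f j)) -> bd 1 F -> approximable F (dual_weight A m c f) ->
    eta <= Vs t.+2 F -> eta' <= Vs t.+1 F.
Proof.
move=> e0 hOB.
pose c0 := eta / 4 / 32; have c00 : 0 < c0 by rewrite !divr_gt0.
pose e1 := c0 * (eta / 2); have e10 : 0 < e1 by rewrite mulr_gt0 // divr_gt0.
pose e2 := (e1 / 2) ^+ (2 ^ t.+1); have e20 : 0 < e2 by rewrite exprn_gt0 // divr_gt0.
have [Q Q0 hQ] := hOB _ (divr_gt0 e20 (ltr0n _ 2)).
have QR : (0 : R) < Q%:R by rewrite ltr0n.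
pose e3 := e2 / 4 / Q%:R; have e30 : 0 < e3 by rewrite !divr_gt0.
pose e4 := (e3 * c0) ^+ (2 ^ t.+1); have e40 : 0 < e4 by rewrite exprn_gt0 // mulr_gt0.
pose K : R := 2 ^+ t.+1; have K0 : 0 < K by rewrite exprn_gt0.
exists (e4 / K / 2); first by rewrite !divr_gt0.
move=> c f F c1 bf bF hF hV.
have bD hs : bd 1 (Dl hs F) by apply: bd_Dl.
pose psi hs := mean (fun h => cab (E (Dl hs F * T (Posz h) (cj (Dl hs F)))) ^+ 2).
have sq01 (g : S) : bd 1 g -> `|cab (E g) ^+ 2| <= 1.
  by move=> /cab_sqr_le1/andP[h1 h2]; rewrite ger0_norm.
have psi1 hs : `|psi hs| <= 1 by apply: mean_norm => n; apply/sq01/bd1_diff.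
pose d := Num.min (eta / 4) (e4 / K / 2).
have d0 : 0 < d by rewrite lt_min !divr_gt0.
have [|Hs [sHs Hs0 hHs]] := @box_approx R bool t.+1
    (fun i hs => if i then psi hs else cab (E (Dl hs F)) ^+ 2) d _ d0.
  by case=> hs //; apply: sq01.
have hpsi : eta / 4 * 3 <= bavg Hs psi.
  have hV' : eta <= mavg t.+1 psi by rewrite -Vs_succ.
  have : `|bavg Hs psi - mavg t.+1 psi| <= d := hHs true.
  rewrite ler_norml => /andP[h1 _].
  have : d <= eta / 4 by rewrite ge_min lexx.
  lra.
(* the inverse theorem gives an eigenfunction for each derivative that is not
   small; the coefficients [b] align the phases and vanish elsewhere *)
have /choice[y hy] : forall hs, exists y : S, (exists l, eig l y) /\
    (eta / 4 <= psi hs -> c0 <= cab (E (Dl hs F * y)) ^+ 2).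
  move=> hs; have [h|h] := lerP (eta / 4) (psi hs); last first.
    by exists 1; split=> [|h']; [exists 1; apply: eig1|].
  have [l [y [hy1 hy2]]] := inverse_theorem hC hE hU (divr_gt0 e0 (ltr0n R 4)) (bD hs) h.
  by exists (cj y); split=> //; exists (conjc l); apply: eig_cj.
pose b hs := if eta / 4 <= psi hs then conjc (E (Dl hs F * y hs)) else 0.
have by_ hs : bd 1 (y hs) by have [[l []]] := hy hs.
have b1 hs : cab (b hs) <= 1.
  by rewrite /b; case: ifP => _; rewrite ?cab0 ?ler01 // cabJ cab_E //; apply: bd1M.
have bE hs : b hs <> 0 -> c0 <= cab (E (Dl hs F * y hs)) ^+ 2.
  by rewrite /b; case: ifP => // h _; apply: (proj2 (hy hs)).
have he1 : e1 <= bavg Hs (fun hs => complex.Re (E (Dl hs F * (cst (b hs) * y hs)))).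
  apply: le_trans (_ : bavg Hs (fun hs => c0 * psi hs + - (c0 * (eta / 4))) <= _).
    rewrite bavgD bavg_cst // bavgZ /e1; have := ler_wpM2l (ltW c00) hpsi; lra.
  apply: bavg_le => hs _; rewrite [Dl hs F * _]mulrCA E_cst /b; case: ifP => [h|/negbT].
    rewrite Jmulc /=; apply: le_trans (proj2 (hy hs) h).
    rewrite -mulrBr ler_piMr ?(ltW c00) //.
    have := ler_norm (psi hs); have := psi1 hs; lra.
  rewrite -ltNge mul0r /= => h; rewrite -mulrBr pmulr_rle0 //; lra.
have [hs' s' hgood] := structured_eigenfunctions Hs0 sHs c1 bf bF hF e10 hQ b1 (fun hs => (hy hs).1) he1.
have [Th lTh eTh] := Xp_low hs' by_.
pose P j hs := `[< b hs <> 0 /\ eig (ex (j%:R / Q%:R)) (Xp hs hs' y) >].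
(* pigeonhole over the roots of unity of order [Q] *)
have [j hj] : exists j : 'I_Q, e3 < bavg Hs (fun hs => (P j hs)%:R : R).
  apply: contrapT => hn.
  have h1 : bavg Hs (fun hs => (`[< b hs <> 0 /\
        exists2 l, eig l (Xp hs hs' y) & l ^+ Q = 1 >])%:R : R) <=
      \sum_(j < Q) bavg Hs (fun hs => (P j hs)%:R : R).
    rewrite -bavg_sum; apply: bavg_le => hs _.
    have S0 : 0 <= \sum_(j < Q) ((P j hs)%:R : R) by apply: sumr_ge0.
    case: asboolP => //= -[bh [l hl lO]].
    have [j hj] := root_ex Q0 (let: And4 h _ _ _ := hl in h) lO.
    rewrite (bigD1 j) //= /P asboolT ?lerDl ?sumr_ge0 //.
    by split=> //; rewrite -hj.
  have h2 : \sum_(j < Q) bavg Hs (fun hs => (P j hs)%:R : R) <= \sum_(j < Q) e3.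
    by apply: ler_sum => j _; rewrite leNgt; apply/negP => h; apply: hn; exists j.
  move: h2; rewrite sumr_const card_ord -[e3 *+ Q]mulr_natr /e3 divfK ?gt_eqF // => h2.
  by have := lt_le_trans hgood (le_trans h1 h2); rewrite -/e2 ltxx.
have [hs0 i0 P0] := bavg_gt (ltW e30) hj.
have {P0} [_ eY] : b hs0 <> 0 /\ eig (ex (j%:R / Q%:R)) (Xp hs0 hs' y).
  by move: P0; rewrite /P; case: asboolP => //= _; rewrite ltNge (ltW e30).
set Y := Xp hs0 hs' y in eY.
have h4 : e3 * c0 <= bavg Hs (fun hs => cab (E (Dl hs F * cj (Th hs) * Y)) ^+ 2).
  apply: le_trans (_ : bavg Hs (fun hs => c0 * (P j hs)%:R) <= _).
    by rewrite bavgZ mulrC ler_wpM2l ?(ltW c00) // ltW.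
  apply: bavg_le => hs hi; rewrite /P.
  case: asboolP => [[bh eh]|_]; last by rewrite mulr0 sqr_ge0.
  rewrite mulr1; apply: le_trans (bE hs bh) _.
  have [u [u1 hu]] := eig_simple hE eh eY.
  rewrite eTh ?(size_inbox hi) ?s' // in hu.
  have [l [l1 _ _ uy]] := (hy hs).1.
  have [_ _ _ uY] := eY.
  have hT : sim (cst (conjc u) * y hs) (cj (Th hs) * Y).
    have k1 : sim (cj (y hs * Th hs) * (y hs * Y)) (cj (cst u * Y) * (y hs * Y)).
      by apply: simM => //; apply: sim_cj.
    have k2 : sim (cj (y hs * Th hs) * (y hs * Y)) (cj (Th hs) * Y).
      have -> : cj (y hs * Th hs) * (y hs * Y) = (y hs * cj (y hs)) * (cj (Th hs) * Y).
        by rewrite rmorphM; ring.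
      by have := simM uy (sim_refl (cj (Th hs) * Y)); rewrite mul1r.
    have k3 : sim (cj (cst u * Y) * (y hs * Y)) (cst (conjc u) * y hs).
      have -> : cj (cst u * Y) * (y hs * Y) = (Y * cj Y) * (cst (conjc u) * y hs).
        by rewrite rmorphM cj_cst; ring.
      by have := simM uY (sim_refl (cst (conjc u) * y hs)); rewrite mul1r.
    exact: sim_trans (sim_sym k3) (sim_trans (sim_sym k1) k2).
  have -> : E (Dl hs F * cj (Th hs) * Y) = conjc u * E (Dl hs F * y hs).
    by rewrite -mulrA mulrC -hT -mulrA E_cst [y hs * _]mulrC.
  by rewrite cabM cabJ u1 mul1r.
(* one eigenfunction [Y] now serves all good points; the Cauchy-Schwarz inequality
   in the square removes the factors [Th], and [Y] cancels in its own
   derivatives *)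
pose F2 := tens sq F (cj F).
pose Th2 hs := tens sq (cj (Th hs)) (cj (cj (Th hs))).
pose X2 := fun _ : seq nat => tens sq Y (cj Y).
have lTh2 : Low (size Hs) Th2.
  by rewrite sHs -s'; apply: Low_tens; do ?[apply: Low_cj].
have bF2 : bd 1 F2 by apply: tens_bd => //; apply: bd_cj.
have := @box_cauchy_schwarz R S2 unit [:: tt] (fun=> 1) (fun=> F2) F2 Hs X2 Th2
  (fun _ => ler01) (big_seq1 _ _ _) bF2 lTh2.
have -> : bavg Hs (fun hs => \sum_(y <- [:: tt]) 1 * complex.Re (E (Dt hs F2 F2 * Th2 hs * X2 hs))) =
    bavg Hs (fun hs => cab (E (Dl hs F * cj (Th hs) * Y)) ^+ 2).
  apply: eq_bavg => hs; rewrite big_seq1 mul1r Dtt Dl_tens -!tensM Dl_cj -!rmorphM.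
  by rewrite tens_abs.
have -> : pavg Hs (fun hs hs' => cab (\sum_(y <- [:: tt]) 1%:C * E (Dp hs hs' F2 * Xp hs hs' X2))) =
    pavg Hs (fun hs hs' => cab (E (Dp hs hs' F * Xp hs hs' (fun=> Y))) ^+ 2).
  congr pavg; apply/funext => k; apply/funext => k'.
  rewrite big_seq1 rmorph1 mul1r Dp_tens Xp_tens -tensM Dp_cj Xp_cj -rmorphM.
  by rewrite tens_abs cab_real ger0_norm ?sqr_ge0.
have hle : pavg Hs (fun hs hs' => cab (E (Dp hs hs' F * Xp hs hs' (fun=> Y))) ^+ 2) <=
    pavg Hs (fun hs hs' => cab (E (Dp hs hs' F)) ^+ 2).
  apply: pavg_le => k k' /size_inbox s1 /size_inbox s2; have [_ _ _ uY] := eY.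
  rewrite mulrC (Xp_unim _ _ uY) ?mul1r // ?s1 ?s2 //.
  by rewrite -size_eq0 s1 sHs.
move=> /le_trans/(_ hle); rewrite sHs.
have h5 := pavg_Dp Hs F (F := fun u : S => cab (E u) ^+ 2) (fun _ => sqr_ge0 _)
  (fun a u => congr1 (fun z => cab z ^+ 2) (E_T a u)).
move=> /le_trans/(_ (h5 _)) h6.
have h7 : e4 <= K * bavg Hs (fun hs => cab (E (Dl hs F)) ^+ 2).
  rewrite /K -sHs; apply: le_trans (h6 _) => [|u]; last by rewrite E_cj cabJ.
  by apply: lerX_nneg h4; rewrite mulr_ge0 ?(ltW e30) ?(ltW c00).
have h8 : e4 / K <= bavg Hs (fun hs => cab (E (Dl hs F)) ^+ 2).
  by rewrite ler_pdivrMr // mulrC.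
have h9' : `|bavg Hs (fun hs => cab (E (Dl hs F)) ^+ 2) - Vs t.+1 F| <= d := hHs false.
move: h9'; rewrite ler_norml => /andP[_ h9].
have : d <= e4 / K / 2 by rewrite ge_min lexx orbT.
have : 0 < e4 / K by rewrite divr_gt0.
by move: h8 h9; set v := e4 / K; set B := bavg _ _; set V := Vs _ _; lra.
Qed.

End Lowering.

(** * Characteristic factors *)

Section IntegerElimination.
Variables (R : realType) (I : eqType).

(** Real relations with integer values, over a family of linearly independent
    integer sequences, have coefficients of bounded denominator: eliminate one
    sequence at a time. *)
Lemma integer_elimination (s : seq I) (r : I -> nat -> int) : uniq s ->
  (forall c : I -> int, (forall n, \sum_(j <- s) c j * r j n = 0) ->
     forall j, j \in s -> c j = 0) ->
  exists2 N : nat, (0 < N)%N & forall be : I -> R,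
    (forall n, \sum_(j <- s) be j * (r j n)%:~R \is a Num.int) ->
    forall j, j \in s -> be j * N%:R \is a Num.int.
Proof.
elim: s r => [|j0 s IH] r /=; first by exists 1%N.
move=> /andP[j0s us] ind.
have [n0 hd] : exists n0, r j0 n0 != 0.
  apply: contrapT => hn.
  have h0 n : r j0 n = 0 by apply/eqP/negbNE/negP => h; apply: hn; exists n.
  suff : (1 : int) = 0 by [].
  have := ind (fun j => (j == j0)%:R) _ j0; rewrite eqxx mem_head; apply=> //.
  move=> n; rewrite big_cons h0 mulr0 add0r big_seq big1 // => j js.
  by case: eqP => [e|_]; [move: j0s; rewrite -e js|rewrite mul0r].
set d := r j0 n0 in hd.
(* eliminate the sequence of [j0] at a place where it does not vanish *)
pose r' j n := d * r j n - r j n0 * r j0 n.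
have [|N' N0 hN] := IH r' us.
  move=> c hc j js; pose c' k := if k == j0 then - \sum_(i <- s) c i * r i n0 else d * c k.
  have cs k : k \in s -> c' k = d * c k.
    by move=> ks; rewrite /c'; case: eqP => // e; move: j0s; rewrite -e ks.
  have : c' j = 0.
    apply: ind; last by rewrite inE js orbT.
    move=> n; rewrite big_cons {1}/c' eqxx.
    have -> : \sum_(k <- s) c' k * r k n = \sum_(k <- s) d * c k * r k n.
      by apply: eq_big_seq => k ks; rewrite (cs k ks).
    rewrite -[RHS](hc n) /r' mulNr mulr_suml addrC -sumrB.
    by apply: eq_bigr => k _; ring.
  by rewrite cs // => /eqP; rewrite mulf_eq0 (negbTE hd) => /eqP.
exists (N' * `|d|)%N; first by rewrite muln_gt0 N0 absz_gt0.
move=> be hbe.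
have hs j : j \in s -> be j * N'%:R \is a Num.int.
  apply: hN => n.
  have -> : \sum_(k <- s) be k * (r' k n)%:~R =
     d%:~R * (\sum_(k <- j0 :: s) be k * (r k n)%:~R) -
     (r j0 n)%:~R * (\sum_(k <- j0 :: s) be k * (r k n0)%:~R).
    rewrite !big_cons -/d.
    have -> : \sum_(k <- s) be k * (r' k n)%:~R =
       d%:~R * \sum_(k <- s) be k * (r k n)%:~R -
       (r j0 n)%:~R * \sum_(k <- s) be k * (r k n0)%:~R.
      rewrite !mulr_sumr -sumrB; apply: eq_bigr => k _.
      by rewrite /r' rmorphB !rmorphM /=; ring.
    ring.
  by rewrite rpredB // int_mulr // intr_int.
have ad : `|d|%:R = d%:~R * (sgz d)%:~R :> R by rewrite -rmorphM /= mulrC -abszEsg.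
move=> j; rewrite inE => /orP[/eqP->|js]; last first.
  by rewrite natrM mulrA int_mulr ?hs ?natr_int.
have -> : be j0 * (N' * `|d|)%:R = ((\sum_(k <- j0 :: s) be k * (r k n0)%:~R) * N'%:R -
   \sum_(k <- s) (be k * N'%:R) * (r k n0)%:~R) * (sgz d)%:~R.
  rewrite big_cons -/d natrM ad.
  have -> : \sum_(k <- s) (be k * N'%:R) * (r k n0)%:~R =
     (\sum_(k <- s) be k * (r k n0)%:~R) * N'%:R.
    by rewrite mulr_suml; apply: eq_bigr => k _; ring.
  ring.
rewrite int_mulr ?intr_int // rpredB ?int_mulr ?natr_int //.
rewrite big_seq rpred_sum // => k ks; rewrite int_mulr ?intr_int //; exact: hs.
Qed.

End IntegerElimination.

Section Characteristic.
Variables (R : realType) (S S2 : system R) (sq : square S S2).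
Implicit Types (g F x : S).
Hypothesis hC : complete_system S.
Hypothesis hE : ergodic_system S.
Hypothesis hU : unimodular_bounded S.
Variables (I : finType) (q : I -> {poly R}).
Hypothesis hq : forall i, integer_polynomial (q i).
Implicit Types (A : {set I}) (m i j : I) (f : I -> S) (c : nat -> R[i]).

Local Notation prodT := (prodT q).
Local Notation dual_weight := (dual_weight q).

(** Relations are restricted to total weight 0 because a common polynomial can be
    subtracted by invariance of the integral. *)
Definition affinely_independent A := forall r : I -> int,
  \sum_(j in A) r j = 0 -> (exists y : R, \sum_(j in A) q j *~ r j = y%:P) ->
  forall j, j \in A -> r j = 0.

Lemma affinely_independentS (A B : {set I}) : B \subset A ->
  affinely_independent A -> affinely_independent B.
Proof.
move=> BA hA r r0 [c hc] j jB.
have e (V : zmodType) (h : I -> int -> V) : (forall i, h i 0 = 0) ->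
    \sum_(k in A) h k (if k \in B then r k else 0) = \sum_(k in B) h k (r k).
  move=> h0; rewrite [RHS]big_mkcond [LHS]big_mkcond; apply: eq_bigr => k _.
  case kB: (k \in B); last by rewrite h0; case: ifP.
  by rewrite (fintype.subsetP BA _ kB).
have := hA (fun k => if k \in B then r k else 0).
rewrite (e _ (fun _ z => z)) // (e _ (fun i z => q i *~ z)) => [|i]; last exact: mulr0z.
by move=> /(_ r0 (ex_intro _ c hc) j (fintype.subsetP BA _ jB)); rewrite jB.
Qed.

Lemma independent_size A i j : affinely_independent A -> i \in A -> j \in A ->
  i != j -> (1 < size (q i - q j)%R)%N.
Proof.
move=> hA iA jA ij; rewrite ltnNge; apply/negP => /size1_polyC h.
suff : (1 : int) = 0 by [].
have := hA (fun k => (k == i)%:R - (k == j)%:R); move=> /(_ _ _ i iA).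
rewrite eqxx (negbTE ij) subr0; apply.
  rewrite sumrB (bigD1 i) //= eqxx big1 => [|k /andP[_ /negbTE->]] //.
  by rewrite (bigD1 j) //= eqxx big1 => [|k /andP[_ /negbTE->]] //; rewrite !addr0 subrr.
exists (q i - q j)`_0; rewrite -h.
under eq_bigr do rewrite mulrzBr.
rewrite sumrB (bigD1 i) //= eqxx big1 => [|k /andP[_ /negbTE->]]; last exact: mulr0z.
rewrite (bigD1 j) //= eqxx big1 => [|k /andP[_ /negbTE->]]; last exact: mulr0z.
by rewrite !addr0 !mulr1z.
Qed.

Definition upd f i x : I -> S := fun j => if j == i then x else f j.

Lemma prodT_D1 A f i n : i \in A ->
  prodT A f n = T (poly_val (q i) n) (f i) * prodT (A :\ i) f n.
Proof. by move=> iA; rewrite /prodT (big_setD1 i iA). Qed.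

Lemma prodT_upd A f i x n : i \in A ->
  prodT A (upd f i x) n = T (poly_val (q i) n) x * prodT (A :\ i) f n.
Proof.
move=> iA; rewrite (prodT_D1 _ _ iA) /upd eqxx; congr (_ * _).
by apply: eq_bigr => j; rewrite !inE => /andP[/negbTE->].
Qed.

Lemma bd_upd f i x : (forall j, bd 1 (f j)) -> bd 1 x -> forall j, bd 1 (upd f i x j).
Proof. by move=> bf bx j; rewrite /upd; case: ifP. Qed.

Lemma E_dual_weight A m c f g n : E (g * dual_weight A m c f n) =
  c n * E (T (poly_val (q m) n) g * prodT A f n).
Proof.
rewrite mulrCA E_cst -(E_T (poly_val (q m) n)) rmorphM /= -TD subrr T0 //.
Qed.

(** The quantitative form of the characteristic factor statement; the bound [d] is
    uniform in the functions and in the phases, which induction on [A] needs. *)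
Definition correlates A := forall e : R, 0 < e -> exists2 d : R, 0 < d &
  forall c f, (forall n, cab (c n) = 1) -> (forall j, bd 1 (f j)) ->
    ~ Ub (fun n => c n * E (prodT A f n)) e ->
    forall i, i \in A -> exists l x, eig l x /\ d <= cab (E (f i * x)).

(** A function of a large average may be replaced by its dual function, and then by
    anything that correlates with the dual function. *)
Lemma dual_prod A m c f (e : R) : m \in A -> 0 < e -> (forall n, cab (c n) = 1) ->
  (forall j, bd 1 (f j)) -> ~ Ub (fun n => c n * E (prodT A f n)) e ->
  exists F, [/\ bd 1 F, approximable F (dual_weight (A :\ m) m c f),
    ~ Ub (fun n => c n * E (prodT A (upd f m F) n)) (e ^+ 2 / 2) &
    forall g d, d < cab (E (g * cj F)) ->
      ~ Ub (fun n => c n * E (prodT A (upd f m g) n)) d].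
Proof.
move=> mA e0 c1 bf nU.
have eE g n : E (g * dual_weight (A :\ m) m c f n) = c n * E (prodT A (upd f m g) n).
  by rewrite E_dual_weight prodT_upd.
have bw n : bd 1 (dual_weight (A :\ m) m c f n) by apply: bd_dual_weight.
have nU' : ~ Ub (fun n => E (f m * dual_weight (A :\ m) m c f n)) e.
  move=> H; apply: nU; apply: Ub_ext H => n; rewrite E_dual_weight.
  by rewrite -prodT_D1.
have [F [bF hF apF dF]] := dual_function hC e0 (bf m) bw nU'.
have low g d : d < cab (E (g * cj F)) ->
    ~ Ub (fun n => c n * E (prodT A (upd f m g) n)) d.
  move=> hd H; have := dF g d (Ub_ext (fun n => esym (eE g n)) H).
  by rewrite leNgt hd.
exists F; split=> //; apply: low.
have nF : e ^+ 2 <= n2 F.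
  rewrite -(n2_cj F); apply: le_trans (cs_bd (cj F) (bf m)); rewrite mulrC.
  by apply: lerX_nneg (ltW e0) _; apply: le_trans hF (Re_le _).
apply: lt_le_trans (Re_le _); apply: lt_le_trans nF.
have : 0 < e ^+ 2 by rewrite exprn_gt0.
lra.
Qed.

(** Dual functions correlate with eigenfunctions, so the functions of a large
    average may be replaced by eigenfunctions, one at a time. *)
Lemma replace_by_eigenfunctions A (s : seq I) (e : R) : correlates A -> 0 < e ->
  exists2 e' : R, 0 < e' & forall c f, (forall n, cab (c n) = 1) ->
    (forall j, bd 1 (f j)) -> ~ Ub (fun n => c n * E (prodT A f n)) e ->
    exists f', [/\ forall j, bd 1 (f' j),
      forall j, j \in A -> j \in s -> exists l, eig l (f' j) &
      ~ Ub (fun n => c n * E (prodT A f' n)) e'].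
Proof.
move=> hA e0; elim: s => [|i s [e1 e10 IH]]; first by exists e => // c f *; exists f.
have [d d0 hd] := hA _ (divr_gt0 (exprn_gt0 2 e10) (ltr0n _ 2)).
exists (Num.min e1 (d / 2)); first by rewrite lt_min e10 divr_gt0.
move=> c f c1 bf nU; have [f' [bf' ef' nU']] := IH c f c1 bf nU.
have [iA|iA] := boolP (i \in A); last first.
  exists f'; split=> // [j jA|H]; last by apply: nU'; apply: Ub_le H; rewrite ge_min lexx.
  by rewrite inE => /orP[/eqP e2|]; [move: iA; rewrite -e2 jA|apply: ef'].
have [F [bF _ nF lowF]] := dual_prod iA e10 c1 bf' nU'.
have [l [x [ex_ hx]]] := hd c (upd f' i F) c1 (bd_upd i bf' bF) nF i iA.
rewrite /upd eqxx in hx.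
have ex' := eig_cj ex_; have [_ bx' _ _] := ex'.
exists (upd f' i (cj x)); split.
- exact: bd_upd.
- move=> j jA; rewrite /upd inE; case: eqP => [_ _|_ /=]; first by exists (conjc l).
  exact: ef'.
- have : d / 2 < cab (E (cj x * cj F)).
    rewrite -rmorphM E_cj cabJ [x * F]mulrC; apply: lt_le_trans hx; lra.
  by move=> /lowF H H'; apply: H; apply: Ub_le H'; rewrite ge_min lexx orbT.
Qed.

Lemma eventually_const (P : {poly R}) : (forall n : nat, P.[n%:R] = P.[0]) ->
  P = (P.[0])%:P.
Proof.
move=> h; apply/eqP; rewrite -subr_eq0; apply/eqP.
set Q := P - _; pose rs := [seq (k%:R : R) | k <- iota 0 (size Q).+1].
apply: (roots_geq_poly_eq0 (rs := rs)).
- apply/allP => _ /mapP[k _ ->]; rewrite /root /Q hornerD hornerN hornerC h.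
  by rewrite subrr.
- by rewrite map_inj_uniq ?iota_uniq // => k l /eqP; rewrite eqr_nat => /eqP.
- by rewrite size_map size_iota.
Qed.

Lemma hornerMz (P : {poly R}) (z : int) (y : R) : (P *~ z).[y] = P.[y] *~ z.
Proof. exact: (raddfMz (horner_eval y)). Qed.

(** Replacing all functions by eigenfunctions leaves a pure polynomial phase, whose
    mean is only large if its coefficients are rational with bounded denominator;
    independence isolates the contribution of the eigenvalue of [x]. *)
Lemma order_bound_of_correlates A m : m \notin A -> A != finset.set0 ->
  affinely_independent (m |: A) -> correlates A -> order_bound S q A m.
Proof.
move=> mA /set0Pn[i0 i0A] hind hA e e0.
have [e1 e10 he1] := replace_by_eigenfunctions (enum A) hA e0.
pose d := (\max_j size (q j))%N.
have [W W0 hW] := @weyl_full R S d 1 e1 isT e10.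
pose rho j n := poly_val (q j) n - poly_val (q j) 0.
pose s := enum (m |: A :\ i0).
have us : uniq s by apply: enum_uniq.
have i0m : i0 != m by apply: contraNneq mA => <-.
have ms : m \in m |: A :\ i0 by rewrite !inE eqxx.
have rhoE j n : (rho j n)%:~R = (q j).[n%:R] - (q j).[0] :> R.
  by rewrite rmorphB /= !tvE.
have [|N N0 hN] := @integer_elimination R I s (fun j n => rho j n - rho i0 n) us.
  move=> c hc.
  pose r j := if j == i0 then - \sum_(k in m |: A :\ i0) c k else c j.
  have mAE : (m |: A) :\ i0 = m |: A :\ i0.
    by apply/setP => k; rewrite !inE; case: (eqVneq k i0) => // ->; rewrite (negbTE i0m).
  have rE (V : zmodType) (h : I -> int -> V) : \sum_(j in m |: A) h j (r j) =
      h i0 (r i0) + \sum_(j in m |: A :\ i0) h j (c j).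
    rewrite (big_setD1 i0) /=; last by rewrite !inE i0A orbT.
    rewrite mAE; congr (_ + _); apply: eq_bigr => j.
    by rewrite -mAE !inE /r => /andP[/negbTE->].
  have H : forall j, j \in m |: A -> r j = 0.
    apply: hind; first by rewrite (rE _ (fun _ z => z)) /r eqxx addrC subrr.
    set P := \sum_(j in _) _.
    exists P.[0]; apply: eventually_const => n; apply/eqP; rewrite -subr_eq0; apply/eqP.
    rewrite /P (rE _ (fun j z => q j *~ z)) !hornerD !horner_sum !hornerMz.
    under eq_bigr do rewrite hornerMz; under [X in _ - (_ + X)]eq_bigr do rewrite hornerMz.
    have := congr1 (fun z : int => z%:~R : R) (hc n).
    rewrite big_enum rmorph_sum /= => h0; rewrite -[RHS]h0 {h0}.
    under [RHS]eq_bigr do rewrite rmorphM rmorphB /= !rhoE.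
    rewrite /r eqxx -[_.[n%:R] *~ _]mulrzr -[_.[0] *~ _]mulrzr rmorphN rmorph_sum.
    rewrite opprD addrACA -mulrBl mulrN mulr_sumr -sumrN -sumrB -big_split /=.
    apply: eq_bigr => j _; rewrite -[_.[n%:R] *~ _]mulrzr -[_.[0] *~ _]mulrzr.
    by move: (c j)%:~R (_.[n%:R]) (_.[0]) (_.[n%:R]) (_.[0]) => *; ring.
  move=> j; rewrite mem_enum => js; have := H j; rewrite /r.
  have -> : j == i0 = false by apply/negbTE; move: js; rewrite -mAE !inE => /andP[].
  apply; move: js; rewrite -mAE !inE => /andP[_ //].
exists (W * N)%N; first by rewrite muln_gt0 W0.
move=> l x g ex_ bg nU; have [l1 bx _ ux] := ex_.
have l0 : l != 0 by rewrite -cab_eq0 l1 oner_eq0.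
pose c n := l ^ (poly_val (q m) n - poly_val (q i0) n).
have cabz (z : R[i]) (k : int) : cab z = 1 -> cab (z ^ k) = 1.
  by move=> z1; case: k => k; rewrite ?NegzE ?cabX ?cabV ?cabX ?z1 ?expr1n ?invr1.
have [|||f [bf ef nU1]] := he1 c (upd g i0 (g i0 * x)).
- by move=> n; apply: cabz.
- by apply: bd_upd => //; apply: bd1M.
- move=> H; apply: nU; apply: Ub_ext H => n.
  rewrite (prodT_upd _ _ _ i0A) rmorphM /= [_ * T _ x]mulrC -mulrA -prodT_D1 //.
  rewrite (eig_Tn _ ex_) -mulrA E_cst mulrA /c -expfzDr //.
  by rewrite subrK.
have /choice[mu hmu] : forall j, exists l, j \in A -> eig l (f j).
  move=> j; have [jA|jA] := boolP (j \in A); last by exists 1.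
  by have [|l' hl'] := ef j jA; [rewrite mem_enum|exists l'].
have mu1 j : j \in A -> cab (mu j) = 1 by move=> /hmu[].
have /choice[a ha] : forall j, exists a, j \in A -> mu j = ex a.
  move=> j; have [jA|jA] := boolP (j \in A); last by exists 0.
  by have [a ha] := ex_surj (mu1 j jA); exists a.
have [al hal] := ex_surj l1.
set E0 := E (\prod_(j in A) f j).
have eE n : E (prodT A f n) = \prod_(j in A) (mu j ^ poly_val (q j) n) * E0.
  have h : sim (prodT A f n) (cst (\prod_(j in A) mu j ^ poly_val (q j) n) * \prod_(j in A) f j).
    rewrite rmorph_prod -big_split; apply: sim_prod => j jA; apply: eig_Tn; exact: hmu.
  by rewrite (sim_E h) E_cst.
have bE0 : cab E0 <= 1 by apply: cab_E; apply: bd1_prod.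
(* otherwise the product of the eigenfunctions has integral 0 *)
have mup : \prod_(j in A) mu j = 1.
  apply/eqP/negbNE/negP => h.
  have E00 : E0 = 0 by apply: eig_E0 h; apply: eig_prod.
  apply: nU1; apply: Ub_ext (Ub_cst (c := 0) _) => [n|]; last by rewrite cab0 ltW.
  by rewrite eE E00 !mulr0.
pose z := \sum_(j in A) a j.
have zint : z \is a Num.int.
  apply: ex_eq1; rewrite -mup.
  rewrite (big_morph (@ex R) (@exD R) (ex0 R)).
  by apply: eq_bigr => j /ha->.
(* the exponent of the phase; subtracting [z *: q i0], an integer multiple, does not
   change it and makes the weights sum to 0 *)
pose P := \sum_(j in A) a j *: q j + al *: (q m - q i0) - z *: q i0.
have exz (y : R) (p : {poly R}) n : integer_polynomial p ->
    ex (y * p.[n%:R]) = ex y ^ poly_val p n.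
  by move=> ip; rewrite -exMz tvE.
have hP n : c n * \prod_(j in A) (mu j ^ poly_val (q j) n) = ex P.[n%:R].
  rewrite /P !hornerD hornerN !hornerZ horner_sum exB exD.
  rewrite (exz _ _ _ (ipB (hq m) (hq i0))) tvB // hal -/(c n).
  rewrite [X in conjc X]ex_int ?int_mulr ?ip_nat // conjc1 mulr1 mulrC; congr (_ * _).
  rewrite (big_morph (@ex R) (@exD R) (ex0 R)); apply: eq_bigr => j jA.
  by rewrite hornerZ exz // ha.
have sP : (size P <= d.+1)%N.
  have sq_ j : (size (q j) <= d.+1)%N by apply: leqW; apply: (leq_bigmax j).
  rewrite /P; apply: leq_trans (size_polyD _ _) _; rewrite geq_max size_polyN.
  rewrite (leq_trans (size_scale_leq _ _) (sq_ _)) andbT.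
  apply: leq_trans (size_polyD _ _) _; rewrite geq_max.
  rewrite (leq_trans (size_scale_leq _ _) (size_sub_le (sq_ _) (sq_ _))) andbT.
  apply: leq_trans (size_sum _ _ _) _; apply/bigmax_leqP => j _.
  exact: leq_trans (size_scale_leq _ _) (sq_ _).
have hint k : (0 < k)%N -> P`_k * W%:R \is a Num.int.
  apply: (hW P (fun=> 1)) => // [n|H]; first by rewrite cab1.
  apply: nU1; apply: Ub_ext (UbM bE0 H) => n.
  by rewrite mulr1 eE [RHS]mulrA hP mulrC.
have hPn n : (P.[n%:R] - P.[0]) * W%:R \is a Num.int.
  rewrite (horner_coef_wide _ sP) (horner_coef_wide _ sP) -sumrB mulr_suml rpred_sum //.
  move=> k _; case: (posnP k) => [->|k0]; first by rewrite !expr0 subrr mul0r rpred0.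
  by rewrite expr0n gtn_eqF // mulr0 subr0 mulrAC int_mulr ?hint // rpredX ?natr_int.
pose be j := W%:R * (if j == m then al else a j).
have : be m * N%:R \is a Num.int.
  apply: hN; last by rewrite mem_enum.
  move=> n; rewrite big_enum /=.
  suff -> : \sum_(j in m |: A :\ i0) be j * (rho j n - rho i0 n)%:~R =
     (P.[n%:R] - P.[0]) * W%:R by [].
  rewrite big_setU1 /=; last by rewrite !inE (negbTE mA) andbF.
  have -> : P.[n%:R] - P.[0] = al * (rho m n - rho i0 n)%:~R +
     \sum_(j in A) a j * (rho j n - rho i0 n)%:~R.
    rewrite /P !hornerD !hornerN !hornerZ !horner_sum !hornerD !hornerN.
    have -> : \sum_(j in A) a j * (rho j n - rho i0 n)%:~R =
       \sum_(j in A) a j * (q j).[n%:R] - \sum_(j in A) a j * (q j).[0] - z * (rho i0 n)%:~R.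
      rewrite /z mulr_suml -!sumrB; apply: eq_bigr => j _.
      by rewrite rmorphB /= !rhoE; ring.
    under eq_bigr do rewrite hornerZ; under [X in _ - (X + _ - _)]eq_bigr do rewrite hornerZ.
    by rewrite rmorphB /= !rhoE; ring.
  rewrite mulrDl; congr (_ + _); first by rewrite /be eqxx; ring.
  rewrite (big_setD1 i0 i0A) /= subrr mulr0 add0r mulr_suml; apply: eq_bigr => j.
  rewrite !inE /be => /andP[_ jA]; rewrite (_ : j == m = false); first by ring.
  by apply/negbTE; apply: contraNneq mA => <-.
rewrite /be eqxx => /ex_int h.
by rewrite -hal -exMn -h; congr ex; rewrite -[_ *+ _]mulr_natl natrM; ring.
Qed.

Lemma Ub_sqr (a : nat -> R[i]) c (e : R) : 0 < e -> (forall n, cab (c n) = 1) ->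
  Ub (fun n => (cab (a n) ^+ 2)%:C) (e ^+ 2) -> Ub (fun n => c n * a n) e.
Proof.
move=> e0 c1 [L0 h]; exists L0 => M L hL.
rewrite -(@ler_pXn2r _ 2) ?nnegrE ?cab_ge0 ?mulr_ge0 ?(ltW e0) //.
apply: le_trans (_ : (\sum_(i < L) cab (a (M + i)%N)) ^+ 2 <= _).
  apply: lerX_nneg (cab_ge0 _) _; apply: le_trans (cab_sum _ _ _) _.
  by apply: ler_sum => i _; rewrite cabM c1 mul1r.
apply: le_trans (sqr_sum_le _) _; rewrite exprMn.
have -> : e ^+ 2 * L%:R ^+ 2 = L%:R * (e ^+ 2 * L%:R) by ring.
rewrite ler_wpM2l //; apply: le_trans (h M L hL); rewrite -rmorph_sum cab_real.
exact: ler_norm.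
Qed.

Lemma tens_prod (s : seq I) (u v : I -> S) :
  \prod_(j <- s) tens sq (u j) (v j) = tens sq (\prod_(j <- s) u j) (\prod_(j <- s) v j).
Proof.
by elim: s => [|j s IH]; rewrite ?big_nil ?tens1 // !big_cons IH tensM.
Qed.

(** Control of the square system by difference means, applied to tensor
    squares, makes the phases irrelevant. *)
Lemma seminorm_control_square A m (e : R) : m \in A -> A :\ m != finset.set0 ->
  affinely_independent A -> 0 < e ->
  exists (s : nat) (d : R), 0 < d /\ forall c f F, (forall n, cab (c n) = 1) ->
    (forall j, bd 1 (f j)) -> bd 1 F -> (forall s', (s' <= s)%N -> Vs s' F <= d) ->
    Ub (fun n => c n * E (prodT A (upd f m F) n)) e.
Proof.
move=> mA /set0Pn[b0 hb0] hind e0.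
(* subtracting the polynomial farthest from [q m] makes the family nice *)
pose b := [arg max_(b > b0 in A :\ m) size (q m - q b)%R].
have [bA bmax] : b \in A :\ m /\ forall j, j \in A :\ m ->
    (size (q m - q j)%R <= size (q m - q b)%R)%N.
  by rewrite /b; case: arg_maxnP => // b1 h1 h2; split=> // j jA; apply: h2.
have [bm bA'] : b != m /\ b \in A by move: bA; rewrite !inE => /andP[].
pose B := A :\ m :\ b.
have hB j : j \in B -> [/\ j != b, j != m & j \in A].
  by rewrite !inE => /and3P[].
pose P := q m - q b; pose Qs := [seq q j - q b | j <- enum B].
have nP : nice P Qs.
  split.
  - exact: ipB.
  - by move=> Q /mapP[j _ ->]; apply: ipB.
  - by apply: independent_size hind mA bA' _; rewrite eq_sym.
  move=> Q /mapP[j]; rewrite mem_enum => /hB[jb jm jA] ->.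
  have -> : P - (q j - q b) = q m - q j by rewrite /P; ring.
  rewrite (independent_size hind mA jA) 1?eq_sym // andbT.
  have -> : q j - q b = P - (q m - q j) by rewrite /P; ring.
  by apply: size_sub_le => //; apply: bmax; rewrite !inE jm.
have [s [d [d0 hd]]] := @control R S2 P Qs nP _ (exprn_gt0 2 e0).
exists s, d; split=> // c f F c1 bf bF hF; apply: Ub_sqr => //.
pose L := [seq (q j - q b, tens sq (f j) (cj (f j))) | j <- enum B].
have bt g : bd 1 g -> bd 1 (tens sq g (cj g)).
  by move=> bg; apply: tens_bd => //; apply: bd_cj.
have bL : bdL L by rewrite /L; elim: (enum B) => //= j s' IH; split=> //; apply: bt.
have := hd (tens sq (f b) (cj (f b))) (tens sq F (cj F)) L _ (bt _ (bf b)) (bt _ bF) bL.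
have -> : map fst L = Qs by rewrite /L /Qs -map_comp.
move=> /(_ erefl); have hF' s' : (s' <= s)%N -> Us s' (tens sq F (cj F)) <= d.
  by move=> hs; rewrite -Vs_Us; apply: hF.
move=> /(_ hF'); apply: Ub_ext => n.
rewrite /L big_map.
have -> : \prod_(j <- enum B) T (poly_val (q j - q b, tens sq (f j) (cj (f j))).1 n)
    (q j - q b, tens sq (f j) (cj (f j))).2 =
  tens sq (\prod_(j <- enum B) T (poly_val (q j - q b) n) (f j))
    (cj (\prod_(j <- enum B) T (poly_val (q j - q b) n) (f j))).
  rewrite rmorph_prod -tens_prod; apply: eq_bigr => j _ /=.
  by rewrite tens_T T_cj.
rewrite tens_T T_cj -!tensM -!rmorphM tens_abs; congr ((cab _ ^+ 2)%:C).
rewrite (prodT_upd _ _ _ mA) (prodT_D1 _ _ bA) -(E_T (poly_val (q b) n)) !rmorphM /=.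
rewrite -TD tvB // addrC subrK mulrCA; congr (E (_ * (_ * _))).
rewrite big_enum rmorph_prod /prodT; apply: eq_bigr => j _.
by rewrite -TD tvB // addrC subrK.
Qed.

(** Descending from difference means of order [s] to correlation with an
    eigenfunction. *)
Lemma descend A m (s : nat) (d : R) : 0 < d -> order_bound S q A m ->
  exists2 d' : R, 0 < d' & forall c f F s', (forall n, cab (c n) = 1) ->
    (forall j, bd 1 (f j)) -> bd 1 F -> approximable F (dual_weight A m c f) ->
    (s' <= s)%N -> d <= Vs s' F -> exists l x, eig l x /\ d' <= cab (E (F * x)).
Proof.
move=> d0 hOB.
have le1 g : bd 1 g -> cab (E g) ^+ 2 <= cab (E g).
  by move=> bg; rewrite expr2 ler_piMl ?cab_ge0 // cab_E.
have one s1 (d1 : R) : 0 < d1 -> exists2 d' : R, 0 < d' & forall c f F,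
    (forall n, cab (c n) = 1) ->
    (forall j, bd 1 (f j)) -> bd 1 F -> approximable F (dual_weight A m c f) ->
    d1 <= Vs s1 F -> exists l x, eig l x /\ d' <= cab (E (F * x)).
  elim: s1 d1 => [|[|s1] IH] d1 d10.
  - exists d1 => // c f F c1 bf bF aF h; exists 1, 1; split; first exact: eig1.
    by rewrite mulr1; apply: le_trans h (le1 _ bF).
  - exists (d1 / 32); first by rewrite divr_gt0.
    move=> c f F c1 bf bF aF h.
    have [l [x [ex_ hx]]] := inverse_theorem hC hE hU d10 bF h.
    exists (conjc l), (cj x); split; first exact: eig_cj.
    by have [_ bx _ _] := eig_cj ex_; apply: le_trans hx (le1 _ (bd1M bF bx)).
  - have [d2 d20 h2] := degree_lowering sq hC hE hU s1 d10 hOB.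
    have [d' d'0 h'] := IH _ d20; exists d' => // c f F c1 bf bF aF h.
    exact: (h' c f F c1 bf bF aF (h2 c f F c1 bf bF aF h)).
elim: s => [|s [d1 d10 IH]].
  have [d' d'0 h'] := one 0%N d d0; exists d' => // c f F s' c1 bf bF aF.
  by rewrite leqn0 => /eqP-> h; exact: (h' c f F c1 bf bF aF h).
have [d2 d20 h2] := one s.+1 d d0.
exists (Num.min d1 d2); first by rewrite lt_min d10.
move=> c f F s' c1 bf bF aF; rewrite leq_eqVlt => /orP[/eqP->|hs] h.
  have [l [x [ex_ hx]]] := h2 _ _ _ c1 bf bF aF h.
  by exists l, x; split=> //; apply: le_trans hx; rewrite ge_min lexx orbT.
have [l [x [ex_ hx]]] := IH _ _ _ _ c1 bf bF aF hs h.
by exists l, x; split=> //; apply: le_trans hx; rewrite ge_min lexx.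
Qed.

(** Induction on the number of functions.  To see that [f i] correlates with an
    eigenfunction, replace another function [f m] by its dual function [F]: it has
    large difference means, hence, descending, correlates with an eigenfunction,
    which can be moved onto [f i]; one function less remains. *)
Theorem eigenfunctions_characteristic A : affinely_independent A -> correlates A.
Proof.
elim: {A}#|A| {-2}A (erefl #|A|) => [|n IH] A cA hind e e0.
  exists 1 => // c f _ _ _ i iA; move: cA; rewrite (cardD1 i) iA //.
have [An|An] := boolP (n == 0)%N.
  exists e => // c f c1 bf nU i iA; exists 1, 1; split; first exact: eig1.
  rewrite mulr1; rewrite leNgt; apply/negP => h; apply: nU; apply: Ub_bd => k.
  have -> : prodT A f k = T (poly_val (q i) k) (f i).
    rewrite (prodT_D1 _ _ iA) /prodT big_pred0 ?mulr1 // => j.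
    have : #|A :\ i| == 0%N by move: cA; rewrite (cardsD1 i) iA (eqP An) add1n => /eqP; rewrite eqSS.
    by rewrite cards_eq0 => /eqP->; rewrite inE.
  by rewrite E_T cabM c1 mul1r ltW.
have hDn i : i \in A -> #|A :\ i| = n by move=> iA; move: cA; rewrite (cardsD1 i) iA => -[].
have hD0 i : i \in A -> A :\ i != finset.set0 by move=> iA; rewrite -cards_eq0 hDn.
have hDi i : affinely_independent (A :\ i) by apply: affinely_independentS hind; apply: subsetDl.
have one i : i \in A -> exists2 d : R, 0 < d &
    forall c f, (forall n, cab (c n) = 1) -> (forall j, bd 1 (f j)) ->
      ~ Ub (fun n => c n * E (prodT A f n)) e ->
      exists l x, eig l x /\ d <= cab (E (f i * x)).
  move=> iA; have /set0Pn[m hm] := hD0 i iA.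
  have [mi mA] : m != i /\ m \in A by move: hm; rewrite !inE => /andP[].
  have iAm : i \in A :\ m by rewrite !inE eq_sym mi.
  have cor := IH _ (hDn m mA) (hDi m).
  have hOB : order_bound S q (A :\ m) m.
    apply: order_bound_of_correlates => //; rewrite ?inE ?eqxx ?hD0 //.
    by rewrite finset.setD1K.
  have e20 : 0 < e ^+ 2 / 2 by rewrite divr_gt0 // exprn_gt0.
  have [s [d [d0 hd]]] := seminorm_control_square mA (hD0 m mA) hind e20.
  have [d1 d10 hd1] := descend s d0 hOB.
  have [d2 d20 hd2] := cor _ (divr_gt0 d10 (ltr0n _ 2)).
  exists d2 => // c f c1 bf nU.
  have [F [bF aF nF lowF]] := dual_prod mA e0 c1 bf nU.
  have [s' [hs' hV]] : exists s', (s' <= s)%N /\ d <= Vs s' F.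
    apply: contrapT => hn; apply: nF; apply: hd => // s' hs'.
    by rewrite leNgt; apply/negP => h; apply: hn; exists s'; split=> //; apply: ltW.
  have [l [x [ex_ hx]]] := hd1 _ _ _ _ c1 bf bF aF hs' hV.
  have ex' := eig_cj ex_; have [l1 bx' _ _] := ex'.
  have l0 : conjc l != 0 by rewrite -cab_eq0 l1 oner_eq0.
  have hx' : d1 / 2 < cab (E (cj x * cj F)).
    rewrite -rmorphM E_cj cabJ [x * F]mulrC; apply: lt_le_trans hx; lra.
  pose c' n := c n * conjc l ^ (poly_val (q m) n - poly_val (q i) n).
  have [|||l' [x' [ex2 hx2]]] := hd2 c' (upd f i (f i * cj x)) _ _ _ i iAm.
  - move=> k; rewrite cabM c1 mul1r; case: (poly_val _ _ - _) => z;
      by rewrite ?NegzE ?cabX ?cabV ?cabX ?l1 ?expr1n ?invr1.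
  - by apply: bd_upd => //; apply: bd1M.
  - move=> H; apply: (lowF _ _ hx'); apply: Ub_ext H => k.
    rewrite (prodT_upd _ _ _ iAm) rmorphM /= [T _ (f i) * _]mulrC.
    rewrite -(mulrA (T _ (cj x))) -(prodT_D1 f k iAm).
    rewrite (eig_Tn _ ex') -(mulrA (cst _)) E_cst /c' -mulrA [X in _ * X]mulrA -expfzDr // subrK.
    by rewrite (prodT_upd _ _ _ mA) (eig_Tn _ ex') -(mulrA (cst _)) E_cst.
  exists (conjc l * l'), (cj x * x'); split; first exact: eigM.
  by move: hx2; rewrite /upd eqxx mulrA.
have /choice[d hd] : forall i, exists d : R, 0 < d /\ (i \in A ->
    forall c f, (forall n, cab (c n) = 1) -> (forall j, bd 1 (f j)) ->
      ~ Ub (fun n => c n * E (prodT A f n)) e ->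
      exists l x, eig l x /\ d <= cab (E (f i * x))).
  move=> i; have [iA|_] := boolP (i \in A); last by exists 1.
  by have [d d0 h] := one i iA; exists d.
exists (\big[Num.min/1]_i d i); first by apply: lt_bigmin => // i _; case: (hd i).
move=> c f c1 bf nU i iA; have [l [x [ex_ hx]]] := (hd i).2 iA c f c1 bf nU.
exists l, x; split=> //; by apply: le_trans hx; apply: bigmin_le_cond.
Qed.

End Characteristic.

(** * Projection on the almost periodic functions *)

Section AlmostPeriodic.
Variables (R : realType) (S : system R).
Implicit Types (f g F u x : S).
Hypothesis hC : complete_system S.

(** Trigonometric polynomials, as a predicate: eigenfunctions are not chosen in
    advance. *)
Inductive trig : S -> Prop :=
| trig0 : trig 0
| trigS c l x g : eig l x -> trig g -> trig (cst c * x + g).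

Lemma trigD f g : trig f -> trig g -> trig (f + g).
Proof.
move=> hf hg; elim: hf => [|c l x h ex_ _ IH]; first by rewrite add0r.
by rewrite -addrA; apply: trigS ex_ IH.
Qed.

Lemma trigZ c f : trig f -> trig (cst c * f).
Proof.
elim=> [|c' l x g ex_ _ IH]; first by rewrite mulr0; apply: trig0.
by rewrite mulrDr mulrA -rmorphM; apply: trigS ex_ IH.
Qed.

Lemma trig_eig l x : eig l x -> trig x.
Proof.
by move=> ex_; have := trigS 1 ex_ trig0; rewrite rmorph1 mul1r addr0.
Qed.

Lemma trig_cj f : trig f -> trig (cj f).
Proof.
elim=> [|c l x g ex_ _ IH]; first by rewrite rmorph0; apply: trig0.
by rewrite rmorphD rmorphM cj_cst; apply: trigS (eig_cj ex_) IH.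
Qed.

Lemma trigM f g : trig f -> trig g -> trig (f * g).
Proof.
move=> hf hg; elim: hf => [|c l x h ex_ _ IH]; first by rewrite mul0r; apply: trig0.
rewrite mulrDl; apply: trigD IH; rewrite -mulrA; apply: trigZ.
elim: hg => [|c' l' x' g' ex' _ IH']; first by rewrite mulr0; apply: trig0.
by rewrite mulrDr mulrCA; apply: trigS (eigM ex_ ex') IH'.
Qed.

Definition almost_periodic f := forall e : R, 0 < e ->
  exists2 t, trig t & nrm (f - t) <= e.

Lemma ap_trig f : trig f -> almost_periodic f.
Proof. by move=> hf e e0; exists f; rewrite // subrr /nrm n2_0 sqrtr0 ltW. Qed.

Lemma apD f g : almost_periodic f -> almost_periodic g -> almost_periodic (f + g).
Proof.
move=> hf hg e e0; have e2 : 0 < e / 2 by rewrite divr_gt0.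
have [s hs ns] := hf _ e2; have [t ht nt] := hg _ e2.
exists (s + t); first exact: trigD.
have -> : f + g - (s + t) = (f - s) + (g - t) by ring.
by apply: le_trans (nrmD _ _) _; rewrite [e]splitr lerD.
Qed.

Lemma nrmM_bd M f g : bd M f -> nrm (f * g) <= M * nrm g.
Proof.
move=> bf; have M0 := bd_ge0 bf.
rewrite -[X in _ <= X * _](ger0_norm M0) -sqrtr_sqr -sqrtrM ?sqr_ge0 // ler_wsqrtr //.
exact: n2_bd.
Qed.

Lemma apM f g : almost_periodic f -> almost_periodic g -> almost_periodic (f * g).
Proof.
move=> hf hg e e0; have [M hM] := bd_ex g; have M0 := bd_ge0 hM.
have e1 : 0 < e / 2 / (M + 1) by rewrite !divr_gt0 // ltr_wpDl.
have [s hs ns] := hf _ e1; have [K hK] := bd_ex s; have K0 := bd_ge0 hK.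
have e2 : 0 < e / 2 / (K + 1) by rewrite !divr_gt0 // ltr_wpDl.
have [t ht nt] := hg _ e2.
exists (s * t); first exact: trigM.
have -> : f * g - s * t = g * (f - s) + s * (g - t) by ring.
have h (k y : R) : 0 <= k -> y <= e / 2 / (k + 1) -> k * y <= e / 2.
  move=> k0 hy; have k1 : 0 < k + 1 by rewrite ltr_wpDl.
  apply: le_trans (ler_wpM2l k0 hy) _.
  rewrite mulrCA ler_piMr ?divr_ge0 ?(ltW e0) // ler_pdivrMr // mul1r lerDl //.
apply: le_trans (nrmD _ _) _; rewrite [e]splitr; apply: lerD.
  exact: le_trans (nrmM_bd _ hM) (h _ _ M0 ns).
exact: le_trans (nrmM_bd _ hK) (h _ _ K0 nt).
Qed.

Lemma ap_cst c : almost_periodic (cst c).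
Proof.
by apply: ap_trig; have := trigZ c (trig_eig (@eig1 R S)); rewrite mulr1.
Qed.

Lemma apZ c f : almost_periodic f -> almost_periodic (cst c * f).
Proof. exact: apM (ap_cst c). Qed.

Lemma ap_cj f : almost_periodic f -> almost_periodic (cj f).
Proof.
move=> hf e e0; have [s hs ns] := hf e e0; exists (cj s); first exact: trig_cj.
by rewrite -rmorphB /nrm n2_cj.
Qed.

Lemma apX f n : almost_periodic f -> almost_periodic (f ^+ n).
Proof.
move=> hf; elim: n => [|n IH]; last by rewrite exprS; apply: apM.
by rewrite expr0 -(rmorph1 cst); apply: ap_cst.
Qed.

Lemma ap_sum (I : Type) (r : seq I) (h : I -> S) :
  (forall i, almost_periodic (h i)) -> almost_periodic (\sum_(i <- r) h i).
Proof.
move=> hh; elim: r => [|i r IH]; first by rewrite big_nil; apply: ap_trig trig0.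
by rewrite big_cons; apply: apD.
Qed.

(** Two facts about the unit disc that hold pointwise for functions but do not
    follow from the algebraic interface. *)
Definition disc_bounds :=
  (forall F u, bd 1 F -> bd 1 u -> bd 1 (F + cst (2^-1)%:C * (u * (1 - F * cj F)))) /\
  (forall F, bd 1 F -> bd 1 (1 - F * cj F)).

Hypothesis hD : disc_bounds.

Lemma bdX f n : bd 1 f -> bd 1 (f ^+ n).
Proof.
by move=> bf; elim: n => [|n IH]; [exact: bd_one|rewrite exprS; apply: bd1M].
Qed.

(** The projection is the closest point [F] among the almost periodic functions
    of modulus at most 1.  Moving [F] inside the disc, with an amplitude
    vanishing on the unit circle, shows that [f - F] is orthogonal to the
    eigenfunctions away from the circle; and the powers of [F] tend to zero
    because moving [F] towards 0 where its modulus exceeds that of [f] would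
    bring it closer to [f]. *)
Theorem projection f : bd 2^-1 f -> exists F, [/\ bd 1 F, almost_periodic F &
  forall l x, eig l x -> E ((f - F) * x) = 0].
Proof.
move=> bf; have h2 : (0 : R) < 2^-1 by rewrite invr_gt0.
pose C (j : nat) g := bd 1 g /\ exists2 t, trig t & nrm (g - t) <= j.+1%:R^-1.
have CI g : bd 1 g -> almost_periodic g -> forall j, C j g.
  by move=> bg hg j; split=> //; apply: hg; rewrite invr_gt0.
have half (a b : S) (r : R) : nrm a <= r -> nrm b <= r -> nrm (cst (2^-1)%:C * (a + b)) <= r.
  move=> ha hb; rewrite nrmZ cab_real gtr0_norm // mulrC ler_pdivrMr //.
  apply: le_trans (nrmD _ _) _; lra.
have bhalf (a b : S) : bd 1 a -> bd 1 b -> bd 1 (cst (2^-1)%:C * (a + b)).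
  move=> ha hb; have := bdM (bd_cst S (2^-1)%:C) (bdD ha hb).
  by apply: bd_le; rewrite cab_real gtr0_norm //; lra.
have [F [bF hF hmin]] : exists F, [/\ bd 1 F,
    forall e j, 0 < e -> exists2 G, C j G & n2 (F - G) <= e &
    forall G, (forall j, C j G) -> n2 (f - F) <= n2 (f - G)].
  apply: (@closest_point R S hC f C).
  - move=> j k g jk [bg [t ht nt]]; split=> //; exists t => //; apply: le_trans nt _.
    by rewrite lef_pV2 ?posrE ?ltr0n // ler_nat.
  - by move=> j; exists 1; apply: CI; [exact: bd_one|rewrite -(rmorph1 cst); apply: ap_cst].
  - move=> j g g' [bg [t ht nt]] [bg' [t' ht' nt']]; split; first exact: bhalf.
    exists (cst (2^-1)%:C * (t + t')); first by apply/trigZ/trigD.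
    rewrite -mulrBr.
    have -> : g + g' - (t + t') = (g - t) + (g' - t') by ring.
    exact: half.
  - by move=> j g [].
have aF : almost_periodic F.
  move=> e e0; have e2 : 0 < e / 2 by rewrite divr_gt0.
  have [G [_ [t ht nt]] nG] := hF _ (Num.truncn (e / 2)^-1) (exprn_gt0 2 e2).
  exists t => //; have -> : F - t = (F - G) + (G - t) by ring.
  apply: le_trans (nrmD _ _) _; rewrite [e]splitr; apply: lerD.
    by rewrite -(ger0_norm (ltW e2)) -sqrtr_sqr ler_wsqrtr.
  apply: le_trans nt _; rewrite -[X in _ <= X]invrK lef_pV2 ?posrE ?invr_gt0 ?ltr0n //.
  exact: ltW (truncnS_gt _).
(* first variation at the closest point, in the direction of [G] *)
have var G : bd 1 G -> almost_periodic G -> complex.Re (E ((f - F) * cj (G - F))) <= 0.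
  move=> bG aG; apply/ler_addgt0Pr => e e0; rewrite add0r.
  have [K0 KK] : 0 <= n2 (G - F) /\ 0 < n2 (G - F) + 1.
    by have h := n2_ge0 (G - F); split=> //; rewrite ltr_wpDl.
  pose t := Num.min 1 (e / (n2 (G - F) + 1)).
  have t0 : 0 < t by rewrite lt_min ltr01 divr_gt0.
  have t1 : t <= 1 by rewrite ge_min lexx.
  have te : t * n2 (G - F) <= e.
    apply: le_trans (_ : e / (n2 (G - F) + 1) * n2 (G - F) <= _).
      by rewrite ler_wpM2r // ge_min lexx orbT.
    by rewrite mulrAC ler_pdivrMr // ler_wpM2l ?(ltW e0) // lerDl.
  pose H := F + cst t%:C * (G - F).
  have HE : H = cst (1 - t)%:C * F + cst t%:C * G.
    by rewrite /H rmorphB rmorphB !rmorph1; ring.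
  have bH : bd 1 H.
    rewrite HE.
    have h1 := bdM (bd_cst S (1 - t)%:C) bF; have h3 := bdM (bd_cst S t%:C) bG.
    apply: bd_le (bdD h1 h3); rewrite !cab_real !mulr1 (gtr0_norm t0) ger0_norm; lra.
  have aH : almost_periodic H by rewrite HE; apply: apD; apply: apZ.
  have := hmin H (CI H bH aH).
  have -> : f - H = (f - F) - cst t%:C * (G - F) by rewrite /H; ring.
  rewrite (n2B (f - F)) n2_cst rmorphM cj_cst conj_real.
  rewrite [(f - F) * _]mulrCA E_cst ReZ cab_real real_normK ?num_real //.
  set r := complex.Re _; move=> h.
  have : t * (2 * r) <= t * (t * n2 (G - F)) by move: h; rewrite expr2; lra.
  rewrite ler_pM2l // => h'; have : 2 * r <= e by apply: le_trans te.
  lra.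
pose rho := F * cj F.
have rhoX n : rho ^+ n = F ^+ n * cj (F ^+ n) by rewrite /rho exprMn rmorphXn.
(* variation towards [F * (1 - rho ^+ n)]; as [f] is at most 1/2, the powers of
   [F] decay geometrically *)
have decay n : n2 (F ^+ n.+1) <= 4^-1 * n2 (F ^+ n).
  pose G := F * (1 - rho ^+ n).
  have bG : bd 1 G.
    by apply: bd1M => //; rewrite rhoX; apply: (proj2 hD); apply: bdX.
  have aG : almost_periodic G.
    apply: apM => //; apply: apD; first by rewrite -(rmorph1 cst); apply: ap_cst.
    by rewrite -mulN1r -(rmorph1 cst) -rmorphN; apply/apZ/apX/apM => //; apply: ap_cj.
  have := var G bG aG.
  have -> : (f - F) * cj (G - F) =
      F ^+ n.+1 * cj (F ^+ n.+1) - (f * F ^+ n) * cj (F ^+ n.+1).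
    rewrite /G rhoX !exprS !(rmorphM, rmorphB, rmorph1) cjK; ring.
  rewrite E_B ReD ReN -/(n2 (F ^+ n.+1)).
  have := n2_ge0 (f * F ^+ n - F ^+ n.+1); rewrite n2B.
  have := n2_bd (F ^+ n) bf.
  set a := n2 (F ^+ n); set b := n2 (F ^+ n.+1); set z := n2 (f * _).
  have -> : (2^-1 : R) ^+ 2 = 4^-1 by field.
  lra.
have small n : n2 (F ^+ n) <= 4^-1 ^+ n.
  elim: n => [|n IH]; first by rewrite !expr0 n2_1.
  apply: le_trans (decay n) _; rewrite exprS ler_wpM2l //.
exists F; split=> // l x ex_.
have [_ bx _ _] := ex_.
(* variation in the direction of [x], damped by [1 - rho ^+ n.+1], which vanishes
   where [F] has modulus 1 *)
have orth n : E ((f - F) * x * (1 - rho ^+ n.+1)) = 0.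
  pose h := cst n.+1%:R^-1%:C * \sum_(j < n.+1) rho ^+ j.
  have nR : (0 : R) < n.+1%:R by [].
  have brho : bd 1 rho by apply: bd1M => //; apply: bd_cj.
  have bh : bd 1 h.
    have := bdM (bd_cst S n.+1%:R^-1%:C) (bd_sum (index_enum _) (fun (j : 'I_n.+1) (_ : true) => bdX j brho)).
    by rewrite sumr_const card_ord cab_real ger0_norm ?invr_ge0 // mulVf.
  have ah : almost_periodic h.
    by apply/apZ/ap_sum => j; apply/apX/apM => //; apply: ap_cj.
  set z := E _; pose u := cst (conjc (phase z)) * cj x * h.
  have bu : bd 1 u.
    apply: bd1M => //; apply: bd1M; last exact: bd_cj.
    by apply: bd_cstle; rewrite cabJ cab_phase.
  have au : almost_periodic u.
    apply: apM => //; apply: apZ; apply: ap_cj; apply: ap_trig; exact: trig_eig ex_.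
  have ap1 : almost_periodic (1 - F * cj F).
    apply: apD; first by rewrite -(rmorph1 cst); apply: ap_cst.
    by rewrite -mulN1r -(rmorph1 cst) -rmorphN; apply/apZ/apM => //; apply: ap_cj.
  have := var _ (proj1 hD F u bF bu) (apD aF (apZ _ (apM au ap1))).
  rewrite [F + _]addrC addrK.
  have hrho : h * (1 - rho) = cst n.+1%:R^-1%:C * (1 - rho ^+ n.+1).
    by rewrite /h -mulrA -(opprB (rho ^+ _) 1) subrX1; ring.
  have crho k : cj (1 - rho ^+ k) = 1 - rho ^+ k.
    by rewrite rhoX rmorphB rmorphM cjK rmorph1 mulrC.
  have -> : (f - F) * cj (cst (2^-1)%:C * (u * (1 - F * cj F))) =
     cst ((2^-1 * n.+1%:R^-1)%:C * phase z) * ((f - F) * x * (1 - rho ^+ n.+1)).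
    have -> : u * (1 - F * cj F) = cst (conjc (phase z)) * cj x *
       (cst n.+1%:R^-1%:C * (1 - rho ^+ n.+1)) by rewrite -hrho /u -/rho; ring.
    rewrite !(rmorphM cj) /= crho cjK !cj_cst !conj_real conjcK !rmorphM; ring.
  rewrite E_cst -/z -mulrA phaseM -rmorphM /= => hz.
  have : cab z <= 0 by move: hz; rewrite pmulr_rle0 // mulr_gt0 // invr_gt0.
  by move=> hz'; apply/eqP; rewrite -cab_eq0 eq_le hz' cab_ge0.
apply/eqP; rewrite -cab_eq0 eq_le cab_ge0 andbT; apply/ler_addgt0Pr => e e0; rewrite add0r.
have [n hn] : exists n : nat, 2 * 2^-1 ^+ n.+1 <= e.
  exists (Num.truncn (2 / e)).
  rewrite exprVn ler_pdivrMr ?exprn_gt0 // -ler_pdivrMl // mulrC.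
  apply: le_trans (ltW (truncnS_gt _)) _; rewrite -natrX ler_nat ltnW //.
  exact: ltn_expl.
apply: le_trans hn.
have -> : E ((f - F) * x) = E (rho ^+ n.+1 * ((f - F) * x)).
  by have := orth n; rewrite mulrBr mulr1 E_B => /eqP; rewrite subr_eq0 [_ * rho ^+ _]mulrC => /eqP.
have bfx : bd 2 ((f - F) * x).
  rewrite -[2 : R]mulr1; apply: bdM bx; apply: bd_le (bdB bf bF).
  rewrite -lerBrDr; lra.
have h := cauchy_schwarz ((f - F) * x * cj (F ^+ n.+1)) (cj (F ^+ n.+1)).
rewrite -(@ler_pXn2r _ 2) ?nnegrE ?cab_ge0 ?mulr_ge0 ?exprn_ge0 ?(ltW h2) //.
have -> : rho ^+ n.+1 * ((f - F) * x) =
    (f - F) * x * cj (F ^+ n.+1) * cj (cj (F ^+ n.+1)) by rewrite rhoX cjK; ring.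
apply: le_trans h _; rewrite n2_cj.
have k1 : n2 ((f - F) * x * cj (F ^+ n.+1)) <= 4 * n2 (F ^+ n.+1).
  by apply: le_trans (n2_bd _ bfx) _; rewrite n2_cj -natrX.
have -> : (2 * 2^-1 ^+ n.+1) ^+ 2 = 4 * (4^-1 ^+ n.+1) :> R.
  rewrite exprMn -exprM mulnC exprM; congr (_ * _ ^+ _); first by rewrite -natrX.
  by field.
apply: le_trans (ler_wpM2r (n2_ge0 _) k1) _; rewrite -mulrA ler_wpM2l //.
have := small n.+1; have := n2_ge0 (F ^+ n.+1).
have : (4^-1 : R) ^+ n.+1 <= 1 by rewrite exprn_ile1 // ?invr_ge0 // invf_le1 // ler1n.
move: (n2 _) (4^-1 ^+ _) => a b b1 a0 ab.
exact: le_trans (ler_piMr a0 (le_trans ab b1)) ab.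
Qed.

End AlmostPeriodic.

Section Decomposition.
Variables (R : realType) (S S2 : system R) (sq : square S S2).
Implicit Types (f g x : S).
Hypothesis hC : complete_system S.
Hypothesis hE : ergodic_system S.
Hypothesis hU : unimodular_bounded S.
Hypothesis hD : disc_bounds S.
Variables (k : nat) (p : 'I_k -> {poly R}).
Hypothesis hp : forall i, integer_polynomial (p i).
Hypothesis hind : rationally_independent p.
Variable f0 : S.
Implicit Types (h : 'I_k -> S).

Definition corr h n : R[i] := E (f0 * \prod_i T (poly_val (p i) n) (h i)).

Definition phase_sum (L : seq (R[i] * ('I_k -> R))) (n : nat) : R[i] :=
  \sum_(y <- L) y.1 * ex (\sum_i y.2 i * (p i).[n%:R]).

Lemma corr_upd h i f n : corr (upd h i f) n =
  E (f0 * (T (poly_val (p i) n) f * \prod_(j | j != i) T (poly_val (p j) n) (h j))).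
Proof.
rewrite /corr (bigD1 i) //= {1}/upd eqxx; congr (E (_ * (_ * _))).
by apply: eq_bigr => j /negbTE ij; rewrite /upd ij.
Qed.

Lemma corr_updD h i f g n :
  corr (upd h i (f + g)) n = corr (upd h i f) n + corr (upd h i g) n.
Proof. by rewrite !corr_upd -E_D -mulrDr rmorphD mulrDl. Qed.

Lemma corr_updZ h i c f n : corr (upd h i (cst c * f)) n = c * corr (upd h i f) n.
Proof. by rewrite !corr_upd -E_cst rmorphM /= T_cst -(mulrA (cst c)) mulrCA. Qed.

Lemma upd_id h i : upd h i (h i) = h.
Proof. by apply/funext => j; rewrite /upd; case: eqP => // ->. Qed.

Lemma corr_eig h : (forall i, exists l, eig l (h i)) ->
  exists L, forall n, corr h n = phase_sum L n.
Proof.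
move=> /choice[l hl].
have /choice[a ha] : forall i, exists a, ex a = l i.
  by move=> i; apply: ex_surj; case: (hl i).
exists [:: (E (f0 * \prod_i h i), a)] => n; rewrite /phase_sum big_seq1 /corr /=.
have hs : sim (\prod_i T (poly_val (p i) n) (h i))
    (cst (\prod_i l i ^ poly_val (p i) n) * \prod_i h i).
  by rewrite rmorph_prod -big_split; apply: sim_prod => i _; apply: eig_Tn.
rewrite mulrC hs -mulrA E_cst [RHS]mulrC [_ * f0]mulrC; congr (_ * _).
rewrite (big_morph (@ex R) (@exD R) (ex0 R)); apply: eq_bigr => i _.
by rewrite -ha -exMz tvE.
Qed.

Lemma corr_trig (s : seq 'I_k) h : (forall i, trig (h i)) ->
  (forall i, i \notin s -> exists l, eig l (h i)) ->
  exists L, forall n, corr h n = phase_sum L n.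
Proof.
elim: s h => [|j s IH] h th eh; first by apply: corr_eig => i; apply: eh.
rewrite -(upd_id h j); elim: (th j) => [|c l x g ex_ tg [L hL]].
  exists [::] => n; rewrite /phase_sum big_nil -(mul0r (0 : S)) -(rmorph0 cst).
  by rewrite corr_updZ mul0r.
have [||L' hL'] := IH (upd h j x).
- by move=> i; rewrite /upd; case: eqP => // _; apply: trig_eig ex_.
- move=> i si; rewrite /upd; case: eqP => [_|/eqP ij]; first by exists l.
  by apply: eh; rewrite inE negb_or ij.
exists ([seq (c * y.1, y.2) | y <- L'] ++ L) => n.
rewrite corr_updD corr_updZ hL hL' /phase_sum big_cat big_map mulr_sumr.
by congr (_ + _); apply: eq_bigr => y _; rewrite mulrA.
Qed.

Lemma bd_prodM (r : seq 'I_k) (P : pred 'I_k) (M : 'I_k -> R) (F : 'I_k -> S) :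
  (forall i, bd (M i) (F i)) -> bd (\prod_(i <- r | P i) M i) (\prod_(i <- r | P i) F i).
Proof.
move=> hM; elim/big_rec2: _ => [|i y x _ H]; first exact: bd_one.
exact: bdM.
Qed.

(** Telescoping: the functions are replaced one at a time. *)
Lemma corr_approx (s : seq 'I_k) h (e : R) : 0 < e ->
  (forall i, almost_periodic (h i)) -> (forall i, i \notin s -> trig (h i)) ->
  exists2 h', (forall i, trig (h' i)) & forall n, cab (corr h n - corr h' n) <= e.
Proof.
elim: s h e => [|j s IH] h e e0 ah th.
  by exists h => [i|n]; [apply: th|rewrite subrr cab0 ltW].
have e2 : 0 < e / 2 by rewrite divr_gt0.
have /choice[M hM] := fun i => bd_ex (h i).
have [M0 hM0] := bd_ex f0.
pose K := M0 * \prod_(i | i != j) M i.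
have bK n : bd K (f0 * \prod_(i | i != j) T (poly_val (p i) n) (h i)).
  by apply: bdM => //; apply: bd_prodM => i; apply: bd_T.
have K0 : 0 <= K := bd_ge0 (bK 0%N).
have eK : 0 < e / 2 / (K + 1) by rewrite divr_gt0 // ltr_wpDl.
have [t ht nt] := ah j _ eK.
have [||h' th' hh'] := IH (upd h j t) _ e2.
- by move=> i; rewrite /upd; case: eqP => // _; apply: ap_trig.
- move=> i si; rewrite /upd; case: eqP => // /eqP ij; apply: th.
  by rewrite inE negb_or ij.
exists h' => // n; rewrite -(subrKA (corr (upd h j t) n)) [e]splitr.
apply: le_trans (cabD _ _) _; apply: lerD (hh' n).
have -> : corr h n - corr (upd h j t) n =
    E (f0 * \prod_(i | i != j) T (poly_val (p i) n) (h i) * T (poly_val (p j) n) (h j - t)).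
  rewrite -{1}(upd_id h j) !corr_upd -E_B -mulrBr -mulrBl -rmorphB.
  by congr (E _); ring.
set G := f0 * _; apply: le_trans (_ : nrm (G * T (poly_val (p j) n) (h j - t)) <= _).
  have h1 := cs_bd (G * T (poly_val (p j) n) (h j - t)) (bd_one S); rewrite mulr1 in h1.
  by rewrite -(@ler_pXn2r _ 2) ?nnegrE ?cab_ge0 ?sqrtr_ge0 // [X in _ <= X]sqr_sqrtr ?n2_ge0.
apply: le_trans (nrmM_bd _ (bK n)) _; rewrite nrm_T.
apply: le_trans (ler_wpM2l K0 nt) _.
by rewrite mulrCA ler_piMr ?(ltW e2) // ler_pdivrMr ?mul1r ?lerDl // ltr_wpDl.
Qed.

(** The function [f0] is carried by the polynomial 0; adjoining it turns rational
    independence into affine independence. *)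
Definition extp (i : 'I_k.+1) : {poly R} := oapp p 0 (unlift ord0 i).

Lemma extp_independent : affinely_independent extp [set: 'I_k.+1]%SET.
Proof.
have sT (V : zmodType) (F : 'I_k.+1 -> V) : \sum_(j in [set: 'I_k.+1]%SET) F j = \sum_j F j.
  by apply: eq_bigl => j; rewrite inE.
move=> r; rewrite !sT => r0 [c hc].
have e0 : extp ord0 = 0 by rewrite /extp unlift_none.
have eS (i : 'I_k) : extp (lift ord0 i) = p i by rewrite /extp liftK.
have rS i : r (lift ord0 i) = 0.
  apply/eqP/negbNE/negP => ri.
  apply: (hind (c := fun i => r (lift ord0 i))); first by exists i.
  exists c; rewrite -hc big_ord_recl e0 mul0rz add0r.
  by apply: eq_bigr => j _; rewrite eS.
move=> j _; case: (unliftP ord0 j) => [i ->|->] //.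
by move: r0; rewrite big_ord_recl big1 ?addr0.
Qed.

(** Averages of the phases times a correlation vanish when one of the functions
    is orthogonal to the eigenfunctions. *)
Lemma corr_orthogonal h j (e : R) : 0 < e -> bd 1 f0 -> (forall i, bd 1 (h i)) ->
  (forall l x, eig l x -> E (h j * x) = 0) ->
  Ub (fun n => (cab (corr h n))%:C) e.
Proof.
move=> e0 bf0 bh orth.
pose q := extp; pose F (i : 'I_k.+1) := oapp h f0 (unlift ord0 i).
have hq i : integer_polynomial (q i).
  rewrite /q /extp; case: (unlift _ _) => [i'|] /=; first exact: hp.
  by move=> z; rewrite horner0 rpred0.
have [d d0 hd] := eigenfunctions_characteristic sq hC hE hU hq extp_independent e0.
pose c n := phase (corr h n).
have cE n : c n * E (prodT q [set: 'I_k.+1]%SET F n) = (cab (corr h n))%:C.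
  rewrite -phaseM; congr (_ * E _).
  rewrite /prodT (eq_bigl predT) => [|i]; last by rewrite inE.
  rewrite big_ord_recl /q /extp /F unlift_none /=; congr (_ * _).
    by rewrite /poly_val horner0 floor0 T0.
  by apply: eq_bigr => i _; rewrite liftK.
apply: contrapT => nU.
have [||| l [x [ex_ hx]]] := hd c F _ _ _ (lift ord0 j) (finset.in_setT _).
- by move=> n; apply: cab_phase.
- by move=> i; rewrite /F; case: (unlift _ _) => [i'|] /=.
- by move=> H; apply: nU; apply: Ub_ext H.
by move: hx; rewrite /F liftK /= (orth _ _ ex_) cab0 leNgt d0.
Qed.

(** Replacing each function by its projection changes the correlation by one with a
    function orthogonal to the eigenfunctions. *)
Theorem decomposition h : bd 1 f0 -> (forall i, bd 2^-1 (h i)) ->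
  exists b : nat -> R[i], [/\ forall n, cab (b n) <= 1,
    forall e, 0 < e -> Ub (fun n => (cab (corr h n - b n))%:C) e &
    forall e, 0 < e -> exists L, forall n, cab (b n - phase_sum L n) <= e].
Proof.
move=> bf0 bh.
have bh1 i : bd 1 (h i) by apply: bd_le (bh i); rewrite invf_le1 // ler1n.
have /choice[g hg] := fun i => projection hC hD (bh i).
have bg i : bd 1 (g i) by case: (hg i).
exists (corr g); split.
- move=> n; apply: cab_E; apply: bd1M => //; apply: bd1_prod => i _; exact: bd_T.
- move=> e e0.
  pose mix (s : seq 'I_k) i := if i \in s then g i else h i.
  suff H (s : seq 'I_k) : uniq s -> forall e : R, 0 < e ->
      Ub (fun n => (cab (corr h n - corr (mix s) n))%:C) e.
    have -> : g = mix (enum 'I_k) by apply/funext => i; rewrite /mix mem_enum.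
    by apply: H => //; apply: enum_uniq.
  elim: s => [_ e1 e10|j s IH /= /andP[js us] e1 e10].
    have -> : mix [::] = h by [].
    by apply: Ub_ext (Ub_cst (c := 0) _) => [n|]; rewrite ?subrr cab0 // ltW.
  have e3 : 0 < e1 / 4 by rewrite divr_gt0.
  pose u := upd (mix s) j (cst (2^-1)%:C * (h j - g j)).
  have bmix i : bd 1 (mix s i) by rewrite /mix; case: ifP.
  have bu i : bd 1 (u i).
    rewrite /u /upd; case: eqP => // _.
    have := bdM (bd_cst S (2^-1)%:C) (bdB (bh1 j) (bg j)).
    by apply: bd_le; rewrite cab_real ger0_norm ?invr_ge0 //; lra.
  have ou l x : eig l x -> E (u j * x) = 0.
    by move=> ex_; rewrite /u /upd eqxx -mulrA E_cst; case: (hg j) => _ _ /(_ l x ex_) ->; rewrite mulr0.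
  have h1 := corr_orthogonal e3 bf0 bu ou.
  have h2 := IH us _ (divr_gt0 e10 (ltr0n R 2)).
  have mixj : mix (j :: s) = upd (mix s) j (g j).
    by apply/funext => i; rewrite /mix /upd inE; case: eqP => [->|].
  have hmj : mix s j = h j by rewrite /mix (negbTE js).
  have dE n : corr h n - corr (mix (j :: s)) n =
      (corr h n - corr (mix s) n) + 2 * corr u n.
    have : corr (mix s) n = corr (upd (mix s) j (g j)) n + 2 * corr u n.
      rewrite /u corr_updZ mulrA (_ : 2 * (2^-1)%:C = 1); last first.
        rewrite -(rmorph_nat (real_complex R)) -rmorphM divff ?rmorph1 //.
      rewrite mul1r -corr_updD addrC subrK -hmj upd_id //.
    by rewrite mixj => ->; ring.
  have [L1 hL1] := h1; have [L2 hL2] := h2.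
  exists (maxn L1 L2) => M L; rewrite geq_max => /andP[l1 l2].
  have cre (a : nat -> R[i]) : cab (\sum_(i < L) (cab (a (M + i)%N))%:C) = \sum_(i < L) cab (a (M + i)%N).
    by rewrite -rmorph_sum cab_real ger0_norm // sumr_ge0 // => i _; apply: cab_ge0.
  have := hL1 M L l1; have := hL2 M L l2.
  rewrite (cre (corr u)) (cre (fun n => corr h n - corr (mix s) n)).
  rewrite (cre (fun n => corr h n - corr (mix (j :: s)) n)) => k2 k1.
  apply: le_trans (_ : \sum_(i < L) (cab (corr h (M + i) - corr (mix s) (M + i)) +
      2 * cab (corr u (M + i))) <= _).
    apply: ler_sum => i _; rewrite dE; apply: le_trans (cabD _ _) _.
    by rewrite lerD2l cabM cab_nat.
  by rewrite big_split -mulr_sumr /=; lra.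
- move=> e e0; have e2 : 0 < e / 2 by rewrite divr_gt0.
  have [||h' th' hh'] := @corr_approx (enum 'I_k) g _ e0.
  + by move=> i; case: (hg i).
  + by move=> i; rewrite mem_enum.
  have [|L hL] := @corr_trig (enum 'I_k) h' th'.
    by move=> i; rewrite mem_enum.
  by exists L => n; rewrite -hL.
Qed.

End Decomposition.

(** * The system of bounded measurable functions *)

Section RealIntegrals.
Context {d : measure_display} {Y : measurableType d} {R : realType}.
Variable mu : probability Y R.
Implicit Types (u v : Y -> R).

Definition bmeas u := measurable_fun [set: Y] u /\ exists M, forall x, `|u x| <= M.

Definition Int u : R := \int[mu]_x u x.

Lemma bmeas_integrable u : bmeas u -> mu.-integrable [set: Y] (EFin \o u).
Proof.
move=> [mf [M hM]].
apply: (le_integrable measurableT (g := EFin \o (fun=> M))).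
- exact/measurable_EFinP.
- by move=> x _ /=; rewrite lee_fin; apply: le_trans (hM x) (ler_norm _).
- exact: finite_measure_integrable_cst.
Qed.

Lemma bmeas_cst (c : R) : bmeas (fun=> c).
Proof. by split; [exact: measurable_cst|exists `|c|]. Qed.

Lemma bmeasD u v : bmeas u -> bmeas v -> bmeas (fun x => u x + v x).
Proof.
move=> [mf [M hM]] [mg [N hN]]; split; first exact: measurable_funD.
by exists (M + N) => x; apply: le_trans (ler_normD _ _) (lerD _ _).
Qed.

Lemma bmeasM u v : bmeas u -> bmeas v -> bmeas (fun x => u x * v x).
Proof.
move=> [mf [M hM]] [mg [N hN]]; split; first exact: measurable_funM.
by exists (M * N) => x; rewrite normrM ler_pM.
Qed.

Lemma bmeasZ (c : R) u : bmeas u -> bmeas (fun x => c * u x).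
Proof. exact: bmeasM (bmeas_cst c). Qed.

Lemma bmeasN u : bmeas u -> bmeas (fun x => - u x).
Proof.
by move=> hu; rewrite (_ : (fun x => _) = fun x => (-1) * u x);
  [exact: bmeasZ|apply/funext => x; rewrite mulN1r].
Qed.

Lemma bmeasB u v : bmeas u -> bmeas v -> bmeas (fun x => u x - v x).
Proof. by move=> hu hv; apply: bmeasD => //; apply: bmeasN. Qed.

Lemma IntD u v : bmeas u -> bmeas v -> Int (fun x => u x + v x) = Int u + Int v.
Proof. by move=> hu hv; apply: RintegralD => //; apply: bmeas_integrable. Qed.

Lemma IntZ (c : R) u : bmeas u -> Int (fun x => c * u x) = c * Int u.
Proof. by move=> hu; apply: RintegralZl => //; apply: bmeas_integrable. Qed.

Lemma IntN u : bmeas u -> Int (fun x => - u x) = - Int u.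
Proof.
move=> hu; rewrite -mulN1r -IntZ //; congr Int.
by apply/funext => x; rewrite mulN1r.
Qed.

Lemma IntB u v : bmeas u -> bmeas v -> Int (fun x => u x - v x) = Int u - Int v.
Proof. by move=> hu hv; rewrite IntD ?IntN //; apply: bmeasN. Qed.

Lemma Int_cst (c : R) : Int (fun=> c) = c.
Proof.
rewrite /Int Rintegral_cst // [X in fine X](_ : _ = 1%E) ?mulr1 //.
exact: (probability_setT mu).
Qed.

Lemma Int_ae u v : bmeas u -> bmeas v -> {ae mu, forall x, u x = v x} -> Int u = Int v.
Proof.
move=> [mu_ _] [mv _] h; rewrite /Int /Rintegral; congr fine.
apply: ae_eq_integral => //; [exact/measurable_EFinP|exact/measurable_EFinP|].
by apply: filterS h => x -> .
Qed.

Lemma Int_le u v : bmeas u -> bmeas v -> {ae mu, forall x, u x <= v x} -> Int u <= Int v.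
Proof.
move=> hu hv h.
have [mf [M hM]] := hu; have [mg [N hN]] := hv.
have hw : bmeas (fun x => Num.max (u x) (v x)).
  split; first exact: measurable_maxr.
  by exists (Num.max M N) => x; rewrite /Num.max; case: ifP => _; rewrite le_max ?hM ?hN ?orbT.
rewrite -(Int_ae hw hv); last by apply: filterS h => x /max_idPr.
apply: le_Rintegral => //; try exact: bmeas_integrable.
by move=> x _; rewrite le_max lexx.
Qed.

Lemma Int_ge0 u : (forall x, 0 <= u x) -> 0 <= Int u.
Proof. by move=> h; apply: Rintegral_ge0 => x _; apply: h. Qed.

Lemma Int_eq0 u : bmeas u -> (forall x, 0 <= u x) -> Int u = 0 ->
  {ae mu, forall x, u x = 0}.
Proof.
move=> hu u0 h; have [mf _] := hu.
have : ae_eq mu [set: Y] (EFin \o u) (fun=> 0%E).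
  apply/ae_eq_integral_abs => //; first exact/measurable_EFinP.
  under eq_integral => x _ do rewrite /= ger0_norm //.
  have := integrable_fin_num measurableT (bmeas_integrable hu).
  by move=> /fineK <-; rewrite -[fine _]/(Int u) h.
by apply: filterS => x /(_ I) /= [].
Qed.

Lemma EFin_Int u : bmeas u -> (\int[mu]_x (u x)%:E)%E = (Int u)%:E.
Proof.
by move=> hu; rewrite /Int /Rintegral fineK //; apply: integrable_fin_num (bmeas_integrable hu).
Qed.

End RealIntegrals.

Section Transport.
Context {d d' : measure_display} {Y : measurableType d} {Z : measurableType d'} {R : realType}.
Variables (mu : probability Y R) (nu : probability Z R) (s : Y -> Z).
Hypothesis ms : measurable_fun [set: Y] s.
Hypothesis ps : forall A, measurable A -> mu (s @^-1` A) = nu A.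

Lemma bmeas_comp (u : Z -> R) : bmeas u -> bmeas (u \o s).
Proof.
by move=> [mf [M hM]]; split; [exact: measurableT_comp|exists M => x; apply: hM].
Qed.

Lemma Int_comp (u : Z -> R) : bmeas u -> Int mu (u \o s) = Int nu u.
Proof.
move=> hu; have [mf _] := hu; rewrite /Int /Rintegral; congr fine.
rewrite -(@eq_measure_integral _ _ _ _ nu (pushforward mu s)); last by move=> A mA _; apply: ps.
rewrite integral_pushforward ?preimage_setT //; first exact/measurable_EFinP.
exact: bmeas_integrable (bmeas_comp hu).
Qed.

Lemma ae_comp (P : Z -> Prop) : {ae nu, forall x, P x} -> {ae mu, forall x, P (s x)}.
Proof.
move=> [N [mN N0 hN]]; exists (s @^-1` N); split; first by rewrite -[X in measurable X]setTI; apply: ms.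
  by rewrite ps.
by move=> x /= h; apply: hN.
Qed.

End Transport.

Section BoundedFunctions.
Context {d : measure_display} {Y : measurableType d} {R : realType}.

Definition bcmeas (f : Y -> R[i]) : Prop :=
  bmeas (fun x => complex.Re (f x)) /\ bmeas (fun x => complex.Im (f x)).

Definition bounded_measurable : {pred Y -> R[i]} := mem [set f | bcmeas f].

Lemma bcmeasB f g : bcmeas f -> bcmeas g -> bcmeas (f - g).
Proof.
move=> [hf hf'] [hg hg']; split.
  rewrite (_ : (fun x => _) = fun x => complex.Re (f x) - complex.Re (g x)); first exact: bmeasB.
  by apply/funext => x /=; rewrite -ReN -ReD.
rewrite (_ : (fun x => _) = fun x => complex.Im (f x) - complex.Im (g x)); first exact: bmeasB.
by apply/funext => x; rewrite -[(f - g) x]/(f x - g x); case: (f x) => ? ?; case: (g x).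
Qed.

Lemma bcmeasM f g : bcmeas f -> bcmeas g -> bcmeas (f * g).
Proof.
move=> [hf hf'] [hg hg']; split.
  rewrite (_ : (fun x => _) = fun x => complex.Re (f x) * complex.Re (g x) -
    complex.Im (f x) * complex.Im (g x)); first by apply: bmeasB; apply: bmeasM.
  by apply/funext => x /=; rewrite -Re_mul.
rewrite (_ : (fun x => _) = fun x => complex.Re (f x) * complex.Im (g x) +
    complex.Im (f x) * complex.Re (g x)); first by apply: bmeasD; apply: bmeasM.
by apply/funext => x /=; rewrite -Im_mul.
Qed.

Lemma bcmeas_cst (c : R[i]) : bcmeas (fun=> c).
Proof. by split; apply: bmeas_cst. Qed.

Lemma bcmeas_subring : subring_closed bounded_measurable.
Proof.
split=> [|f g|f g]; rewrite !inE /=.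
- exact: bcmeas_cst.
- exact: bcmeasB.
- exact: bcmeasM.
Qed.

HB.instance Definition _ := GRing.isSubringClosed.Build _ bounded_measurable bcmeas_subring.

(** Bounded functions rather than classes: products, iterates and values are then
    defined pointwise, and equality almost everywhere is left to [sim]. *)
Record bfun := BFun { bval :> Y -> R[i]; bval_in : bval \in bounded_measurable }.

HB.instance Definition _ := [isSub for bval].
HB.instance Definition _ := [Choice of bfun by <:].
HB.instance Definition _ :=
  GRing.SubChoice_isSubComPzRing.Build (Y -> R[i]) bounded_measurable bfun bcmeas_subring.

Lemma bfunP (f : bfun) : bcmeas f.
Proof. by have := bval_in f; rewrite inE. Qed.

Definition mkbfun (f : Y -> R[i]) (hf : bcmeas f) : bfun := BFun (mem_set hf).

Lemma bfun_eq (f g : bfun) : (forall x, f x = g x) -> f = g.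
Proof. by move=> h; apply/val_inj/funext. Qed.

Lemma bcmeas_cj f : bcmeas f -> bcmeas (fun x => conjc (f x)).
Proof.
move=> [hf hf']; split.
  by rewrite (_ : (fun x => _) = fun x => complex.Re (f x)) //; apply/funext => x; rewrite ReJ.
rewrite (_ : (fun x => _) = fun x => - complex.Im (f x)); first exact: bmeasN.
by apply/funext => x; case: (f x).
Qed.

Lemma bmeas_cab2 f : bcmeas f -> bmeas (fun x => cab (f x) ^+ 2).
Proof.
move=> [h1 h2]; rewrite (_ : (fun x => _) = fun x => complex.Re (f x) * complex.Re (f x) +
  complex.Im (f x) * complex.Im (f x)); first by apply: bmeasD; apply: bmeasM.
by apply/funext => x; rewrite cab_sqr !expr2.
Qed.

Lemma bcmeas_bound f : bcmeas f -> exists2 M : R, 0 <= M & forall x, cab (f x) <= M.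
Proof.
move=> [[_ [M hM]] [_ [N hN]]]; exists (Num.max 0 (M + N)); first by rewrite le_max lexx.
move=> x; apply: le_trans (cab_le_ReIm _) _; rewrite le_max; apply/orP; right.
exact: lerD.
Qed.

Definition bcst (c : R[i]) : bfun := mkbfun (bcmeas_cst c).
Definition bcj (f : bfun) : bfun := mkbfun (bcmeas_cj (bfunP f)).

Lemma bcst_zmod : zmod_morphism bcst.
Proof. by move=> c c'; apply: bfun_eq. Qed.
Lemma bcst_monoid : monoid_morphism bcst.
Proof. by split=> [|c c']; apply: bfun_eq. Qed.
HB.instance Definition _ := GRing.isZmodMorphism.Build _ _ bcst bcst_zmod.
HB.instance Definition _ := GRing.isMonoidMorphism.Build _ _ bcst bcst_monoid.

Lemma bcj_zmod : zmod_morphism bcj.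
Proof. by move=> f g; apply: bfun_eq => x /=; apply: (rmorphB (@conjc R)). Qed.
Lemma bcj_monoid : monoid_morphism bcj.
Proof. by split=> [|f g]; apply: bfun_eq => x /=; [exact: conjc1|exact: conjM]. Qed.
HB.instance Definition _ := GRing.isZmodMorphism.Build _ _ bcj bcj_zmod.
HB.instance Definition _ := GRing.isMonoidMorphism.Build _ _ bcj bcj_monoid.

End BoundedFunctions.

Arguments bfun {d} Y R.

Section Iterates.
Variables (Y : Type) (s sinv : Y -> Y).
Hypotheses (K : cancel s sinv) (K' : cancel sinv s).

Lemma iterzS z x : iterz s sinv (z + 1) x = s (iterz s sinv z x).
Proof.
case: z => n; first by rewrite -PoszD addn1.
case: n => [|n]; first by rewrite (_ : Negz 0 + 1 = 0) //= K'.
by rewrite (_ : Negz n.+1 + 1 = Negz n) /= ?K' // !NegzE; lia.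
Qed.

Lemma iterzP z x : iterz s sinv (z - 1) x = sinv (iterz s sinv z x).
Proof. by rewrite -{2}(subrK 1 z) iterzS K. Qed.

Lemma iterzD a b x : iterz s sinv (a + b) x = iterz s sinv a (iterz s sinv b x).
Proof.
have pos (n : nat) c y : iterz s sinv (n%:Z + c) y = iterz s sinv n (iterz s sinv c y).
  elim: n => [|n IH]; first by rewrite add0r.
  by rewrite -addn1 PoszD addrAC iterzS IH -PoszD addn1.
case: a => n; first exact: pos.
elim: n => [|n IH].
  by rewrite (_ : Negz 0 + b = b - 1) ?iterzP // NegzE addrC.
rewrite (_ : Negz n.+1 + b = Negz n + b - 1); last by rewrite !NegzE; lia.
by rewrite iterzP IH.
Qed.

End Iterates.

Section MeasureSystem.
Context {d : measure_display} {Y : measurableType d} {R : realType}.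
Variables (mu : probability Y R) (s sinv : Y -> Y).
Hypothesis hs : invertible_system mu s sinv.
Local Notation bfun := (bfun Y R).
Implicit Types (f g h : bfun).

Lemma iterz_preserving a : measure_preserving mu (iterz s sinv a).
Proof.
have [[ms ps] mi K K'] := hs.
have pi A : measurable A -> mu (sinv @^-1` A) = mu A.
  move=> mA; rewrite -ps; last by rewrite -[X in measurable X]setTI; apply: mi.
  congr (mu _); apply/funext => x /=; by rewrite K.
have it (t : Y -> Y) n : measure_preserving mu t -> measure_preserving mu (iter n t).
  move=> [mt pt]; elim: n => [|n [mn pn]]; first by split=> //; exact: measurable_id.
  split; first exact: measurableT_comp.
  move=> A mA; rewrite -(pt A mA) -(pn (t @^-1` A)) //.
  by rewrite -[X in measurable X]setTI; apply: mt.
by case: a => n; apply: it.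
Qed.

Lemma bcmeas_T a (f : bfun) : bcmeas (fun x => f (iterz s sinv a x)).
Proof.
have [m _] := iterz_preserving a; have [h1 h2] := bfunP f.
split; [exact: (bmeas_comp m h1)|exact: (bmeas_comp m h2)].
Qed.

Definition bT a f : bfun := mkbfun (bcmeas_T a f).

Lemma bT_zmod a : zmod_morphism (bT a).
Proof. by move=> f g; apply: bfun_eq. Qed.
Lemma bT_monoid a : monoid_morphism (bT a).
Proof. by split=> [|f g]; apply: bfun_eq. Qed.
HB.instance Definition _ a := GRing.isZmodMorphism.Build _ _ (bT a) (bT_zmod a).
HB.instance Definition _ a := GRing.isMonoidMorphism.Build _ _ (bT a) (bT_monoid a).

Definition bE (f : bfun) : R[i] := complex_integral mu f.

Lemma bE_zmod : zmod_morphism bE.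
Proof.
move=> f g; have [h1 h2] := bfunP f; have [k1 k2] := bfunP g.
rewrite /bE /complex_integral.
have e1 : (fun x => complex.Re ((f - g) x)) = fun x => complex.Re (f x) - complex.Re (g x).
  by apply/funext => x /=; rewrite -ReN -ReD.
have e2 : (fun x => complex.Im ((f - g) x)) = fun x => complex.Im (f x) - complex.Im (g x).
  by apply/funext => x; rewrite -[(f - g) x]/(f x - g x); case: (f x) => ? ?; case: (g x).
rewrite -!/(Int mu _) e1 e2 !IntB //.
Qed.
HB.instance Definition _ := GRing.isZmodMorphism.Build _ _ bE bE_zmod.

Lemma bE_ae f g : {ae mu, forall x, f x = g x} -> bE f = bE g.
Proof.
move=> h; have [h1 h2] := bfunP f; have [k1 k2] := bfunP g.
congr (_ +i* _); apply: (@Int_ae _ _ _ mu); first exact: h1.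
- exact: k1.
- by apply: filterS h => x ->.
- exact: h2.
- exact: k2.
- by apply: filterS h => x ->.
Qed.

(** Essential bounds, so that unimodular functions almost everywhere are bounded by
    1. *)
Definition bbd (M : R) f := 0 <= M /\ {ae mu, forall x, cab (f x) <= M}.

Lemma bE_cst c f : bE (bcst c * f) = c * bE f.
Proof.
have [h1 h2] := bfunP f; rewrite /bE /complex_integral.
have e1 : (fun x => complex.Re ((bcst c * f) x)) =
    fun x => complex.Re c * complex.Re (f x) - complex.Im c * complex.Im (f x).
  by apply/funext => x; rewrite -Re_mul.
have e2 : (fun x => complex.Im ((bcst c * f) x)) =
    fun x => complex.Re c * complex.Im (f x) + complex.Im c * complex.Re (f x).
  by apply/funext => x; rewrite -Im_mul.
rewrite -!/(Int mu _) e1 e2 IntB ?IntD ?IntZ //; try exact: bmeasZ.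
by case: c {e1 e2}.
Qed.

Lemma bE1 : bE 1 = 1.
Proof. by rewrite /bE /complex_integral -!/(Int mu _) !Int_cst. Qed.

Lemma bE_cj f : bE (bcj f) = conjc (bE f).
Proof.
have [h1 h2] := bfunP f; rewrite /bE /complex_integral -!/(Int mu _) /=.
rewrite -IntN //; congr (Int mu _ +i* Int mu _); apply/funext => x; first by rewrite ReJ.
by case: (f x).
Qed.

Lemma bE_T a f : bE (bT a f) = bE f.
Proof.
have [m p] := iterz_preserving a; have [h1 h2] := bfunP f.
rewrite /bE /complex_integral -!/(Int mu _).
by rewrite (Int_comp m p h1) (Int_comp m p h2).
Qed.

Lemma bE_n2 f : complex.Re (bE (f * bcj f)) = Int mu (fun x => cab (f x) ^+ 2).
Proof.
rewrite /bE /complex_integral -!/(Int mu _) /=; congr Int; apply/funext => x.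
by transitivity (complex.Re (f x * conjc (f x))) => //; rewrite mulJc.
Qed.

Lemma bE_pos f : 0 <= complex.Re (bE (f * bcj f)).
Proof. by rewrite bE_n2; apply: Int_ge0 => x; rewrite sqr_ge0. Qed.

Lemma bbd_cst c : bbd (cab c) (bcst c).
Proof. by split; [exact: cab_ge0|exact: aeW]. Qed.

Lemma bbdD a b f g : bbd a f -> bbd b g -> bbd (a + b) (f + g).
Proof.
move=> [a0 ha] [b0 hb]; split; first exact: addr_ge0.
by apply: filterS2 ha hb => x h1 h2; apply: le_trans (cabD _ _) (lerD _ _).
Qed.

Lemma bbdM a b f g : bbd a f -> bbd b g -> bbd (a * b) (f * g).
Proof.
move=> [a0 ha] [b0 hb]; split; first exact: mulr_ge0.
apply: filterS2 ha hb => x h1 h2; rewrite -[(f * g) x]/(f x * g x) cabM.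
by rewrite ler_pM ?cab_ge0.
Qed.

Lemma bbd_le a b f : a <= b -> bbd a f -> bbd b f.
Proof.
move=> ab [a0 ha]; split; first exact: le_trans ab.
by apply: filterS ha => x h; apply: le_trans ab.
Qed.

Lemma bbd_cj a f : bbd a f -> bbd a (bcj f).
Proof. by move=> [a0 ha]; split=> //; apply: filterS ha => x h; rewrite cabJ. Qed.

Lemma bbd_T a n f : bbd a f -> bbd a (bT n f).
Proof.
move=> [a0 ha]; split=> //; have [m p] := iterz_preserving n.
exact: (ae_comp m p ha).
Qed.

Lemma bbd_ex f : exists a, bbd a f.
Proof. by have [M M0 hM] := bcmeas_bound (bfunP f); exists M; split=> //; apply: aeW. Qed.

Lemma bE_bd M f g : bbd M f -> complex.Re (bE (f * g * bcj (f * g))) <=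
  M ^+ 2 * complex.Re (bE (g * bcj g)).
Proof.
move=> [M0 hM]; rewrite !bE_n2 -IntZ; last exact/bmeas_cab2/bfunP.
apply: Int_le; [exact/bmeas_cab2/bfunP|exact/bmeasZ/bmeas_cab2/bfunP|].
apply: filterS hM => x h; rewrite -[(f * g) x]/(f x * g x) cabM exprMn.
by rewrite ler_wpM2r ?sqr_ge0 // lerXn2r ?nnegrE ?cab_ge0.
Qed.

Definition measure_system : system R.
Proof.
refine (@System R bfun bcst bcj bT bE bbd _ _ _ _ _ _ bE_cst bE1 bE_cj bE_T bE_pos _
  bbd_cst bbdD bbdM bbd_le bbd_cj bbd_T bbd_ex bE_bd).
- by move=> f; apply: bfun_eq => x; apply: conjcK.
- by move=> c; apply: bfun_eq.
- by move=> f; apply: bfun_eq.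
- move=> a b f; apply: bfun_eq => x /=; have [_ _ K K'] := hs.
  by rewrite addrC (iterzD K K').
- by move=> a c; apply: bfun_eq.
- by move=> a f; apply: bfun_eq.
- by move=> M f [].
Defined.

Local Notation S := measure_system.

Lemma ae_n2 (f : S) : n2 f = 0 -> {ae mu, forall x, (f : bfun) x = 0}.
Proof.
move=> h0; have h : Int mu (fun x => cab ((f : bfun) x) ^+ 2) = 0 by rewrite -bE_n2.
have := Int_eq0 (bmeas_cab2 (bfunP f)) (fun x => sqr_ge0 _) h.
by apply: filterS => x /eqP; rewrite sqrf_eq0 cab_eq0 => /eqP.
Qed.

Lemma sim_ae (f g : S) : sim f g <-> {ae mu, forall x, (f : bfun) x = (g : bfun) x}.
Proof.
split=> [h|h].
  have : n2 (f - g) = 0.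
    by rewrite /n2 mulrBl E_B (h (cj (f - g))) subrr.
  by move=> /ae_n2; apply: filterS => x; rewrite -[bval _ _]/((f : bfun) x - (g : bfun) x) => /eqP; rewrite subr_eq0 => /eqP.
move=> k; apply: (bE_ae (f := (f : bfun) * (k : bfun)) (g := (g : bfun) * (k : bfun))).
by apply: filterS h => x; apply: (congr1 (fun z => z * (k : bfun) x)).
Qed.

Lemma measure_system_ergodic : ergodic mu s -> ergodic_system S.
Proof.
move=> hE f /sim_ae hf.
have [|c hc] := hE (f : bfun) _ hf.
  have [[m1 _] [m2 _]] := bfunP f; split=> //.
  have [M M0 hM] := bcmeas_bound (bfunP f).
  by exists M; apply: aeW => x; rewrite normcab lecR.
by exists c; apply/sim_ae; apply: filterS hc.
Qed.

Lemma measure_system_unimodular : unimodular_bounded S.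
Proof.
move=> x /sim_ae h; split; first exact: ler01.
apply: filterS h => y; rewrite -[bval _ _]/((x : bfun) y * conjc ((x : bfun) y)) mulJc.
move=> /(congr1 (@complex.Re R)) /= h; rewrite -(@ler_pXn2r _ 2) ?nnegrE ?cab_ge0 //.
by rewrite h expr1n.
Qed.

(** The displacement is at most half of [1 - |F|^2], hence at most [1 - |F|]. *)
Lemma disc_move (F u : R[i]) : cab F <= 1 -> cab u <= 1 ->
  cab (F + (2^-1)%:C * (u * (1 - F * conjc F))) <= 1.
Proof.
move=> hF hu; apply: le_trans (cabD _ _) _.
have F0 := cab_ge0 F.
have -> : 1 - F * conjc F = (1 - cab F ^+ 2)%:C by rewrite mulJc rmorphB rmorph1.
rewrite !cabM !cab_real ger0_norm ?invr_ge0 // ger0_norm; last first.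
  by rewrite subr_ge0 exprn_ile1.
have : cab u * (1 - cab F ^+ 2) <= 1 - cab F ^+ 2.
  by rewrite ler_piMl // subr_ge0 exprn_ile1.
move: (cab F) (cab u) hF F0 => a b a1 a0 h; nra.
Qed.

Lemma measure_system_disc : disc_bounds S.
Proof.
split=> [F u [_ hF] [_ hu]|F [_ hF]]; split; try exact: ler01.
  by apply: filterS2 hF hu => x; apply: disc_move.
apply: filterS hF => x hF; rewrite -[bval _ _]/(1 - (F : bfun) x * conjc ((F : bfun) x)).
rewrite mulJc -(rmorph1 (real_complex R)) -rmorphB cab_real ger0_norm.
  by rewrite gerBl sqr_ge0.
by rewrite subr_ge0 exprn_ile1 ?cab_ge0.
Qed.

End MeasureSystem.

(** * Completeness *)

Section Completeness.
Context {d : measure_display} {Y : measurableType d} {R : realType}.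
Variable mu : probability Y R.
Implicit Types (f : bfun Y R).

Lemma fast_cvg (a : nat -> R) (C : R) :
  (forall k, `|a k.+1 - a k| <= C * 2^-1 ^+ k) -> cvgn a.
Proof.
move=> h; have h1 : cvgn (series (telescope a)).
  apply: normed_cvg; apply: (@series_le_cvg _ _ (geometric C 2^-1)).
  - by move=> n /=.
  - by move=> n; apply: le_trans (normr_ge0 _) (h n).
  - by move=> n; apply: h.
  - apply: is_cvg_geometric_series; rewrite ger0_norm ?invr_ge0 //.
    by rewrite invf_lt1 // ltr1n.
have -> : a = (fun n => series (telescope a) n + a 0%N).
  by apply/funext => n; rewrite telescopeK /= subrK.
apply: is_cvgD h1 _; exact: is_cvg_cst.
Qed.

Lemma measurable_cab2 (F : Y -> R[i]) :
  measurable_fun [set: Y] (fun x => complex.Re (F x)) ->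
  measurable_fun [set: Y] (fun x => complex.Im (F x)) ->
  measurable_fun [set: Y] (fun x => cab (F x) ^+ 2).
Proof.
move=> h1 h2; rewrite (_ : (fun x => _) = fun x => complex.Re (F x) ^+ 2 + complex.Im (F x) ^+ 2).
  by apply: measurable_funD; apply: measurable_funX.
by apply/funext => x; rewrite cab_sqr.
Qed.

(** Truncation keeps measurability and repairs an essential bound everywhere. *)
Definition clip (M : R) (F : Y -> R[i]) x : R[i] :=
  if cab (F x) ^+ 2 <= M ^+ 2 then F x else 0.

Lemma cab_clip M F x : 0 <= M -> cab (clip M F x) <= M.
Proof.
by move=> M0; rewrite /clip; case: ifP => [|_]; rewrite ?cab0 // ler_pXn2r ?nnegrE ?cab_ge0.
Qed.

Lemma bcmeas_clip M F : 0 <= M ->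
  measurable_fun [set: Y] (fun x => complex.Re (F x)) ->
  measurable_fun [set: Y] (fun x => complex.Im (F x)) -> bcmeas (clip M F).
Proof.
move=> M0 h1 h2.
have mt : measurable_fun [set: Y] (fun x => cab (F x) ^+ 2 <= M ^+ 2).
  by apply: measurable_fun_ler; [exact: measurable_cab2|exact: measurable_cst].
split; split.
- rewrite (_ : (fun x => _) = fun x => if cab (F x) ^+ 2 <= M ^+ 2 then complex.Re (F x) else 0).
    by apply: measurable_fun_ifT => //; exact: measurable_cst.
  by apply/funext => x; rewrite /clip; case: ifP.
- by exists M => x; apply: le_trans (cab_Re _) (cab_clip F x M0).
- rewrite (_ : (fun x => _) = fun x => if cab (F x) ^+ 2 <= M ^+ 2 then complex.Im (F x) else 0).
    by apply: measurable_fun_ifT => //; exact: measurable_cst.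
  by apply/funext => x; rewrite /clip; case: ifP.
- by exists M => x; apply: le_trans (cab_Im _) (cab_clip F x M0).
Qed.

Lemma clip_id M F x : cab (F x) <= M -> clip M F x = F x.
Proof. by move=> h; rewrite /clip ifT // lerXn2r ?nnegrE ?cab_ge0 // (le_trans (cab_ge0 _) h). Qed.

(** Monotone convergence: the sum of the functions is integrable, hence finite
    almost everywhere. *)
Lemma ae_bounded_series (h : nat -> Y -> R) : (forall k, bmeas (h k)) ->
  (forall k x, 0 <= h k x) -> (forall k, Int mu (h k) <= 2^-1 ^+ k) ->
  {ae mu, forall x, exists C : R, forall k, h k x <= C}.
Proof.
move=> mh h0 hI.
pose F x := (\sum_(k <oo) (h k x)%:E)%E.
have mF : measurable_fun [set: Y] F.
  apply: ge0_emeasurable_sum => k; last by move=> _; apply/measurable_EFinP; case: (mh k).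
  by move=> x _ _; rewrite lee_fin.
have F0 x : (0 <= F x)%E by apply: nneseries_ge0 => k _ _; rewrite lee_fin.
have iF : mu.-integrable [set: Y] F.
  apply/integrableP; split=> //.
  under eq_integral => x _ do rewrite gee0_abs //.
  rewrite integral_nneseries //; first last.
  - by move=> k x _; rewrite lee_fin.
  - by move=> k; apply/measurable_EFinP; case: (mh k).
  apply: (@le_lt_trans _ _ (\sum_(k <oo) (2 / (2 ^ (k + 1))%:R)%:E)%E).
    apply: lee_nneseries => k _; first by rewrite integral_ge0 // => x _; rewrite lee_fin.
    rewrite (EFin_Int mu (mh k)) lee_fin; apply: le_trans (hI k) _.
    by rewrite exprVn expnD natrM invfM mulrCA divff // mulr1 natrX.
  have /cvg_lim -> // := @cvg_geometric_eseries_half R 2 0.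
  by rewrite ltry.
have := integrable_ae measurableT iF; apply: filterS => x /(_ I) fx.
exists (fine (F x)) => k; rewrite -lee_fin fineK //.
apply: le_trans (nneseries_lim_ge k.+1 _); last by move=> n _ _; rewrite lee_fin.
rewrite big_nat_recr //= -[X in (X <= _)%E]add0e leeD2r //.
by apply: sume_ge0 => i _; rewrite lee_fin.
Qed.

(** A rapidly Cauchy subsequence converges almost everywhere, and its limit is
    the limit in the mean by dominated convergence. *)
Lemma bounded_complete (f : nat -> bfun Y R) :
  (forall n, {ae mu, forall x, cab (f n x) <= 1}) ->
  (forall e : R, 0 < e -> exists N : nat, forall m n, (N <= m)%N -> (N <= n)%N ->
     Int mu (fun x => cab (f m x - f n x) ^+ 2) <= e) ->
  exists2 g : bfun Y R, {ae mu, forall x, cab (g x) <= 1} &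
    forall e : R, 0 < e -> exists N : nat, forall n, (N <= n)%N ->
     Int mu (fun x => cab (f n x - g x) ^+ 2) <= e.
Proof.
move=> f1 fC.
have mB (a b : bfun Y R) : bmeas (fun x => cab (a x - b x) ^+ 2).
  by apply: bmeas_cab2; apply: (bfunP (a - b)).
have e8 k : 0 < (8^-1 : R) ^+ k by rewrite exprn_gt0 // invr_gt0.
have /choice[N hN] := fun k => fC _ (e8 k).
pose nk k := (\max_(i < k.+1) N i + k)%N.
have nkN k j : (k <= j)%N -> (N k <= nk j)%N.
  move=> kj; rewrite /nk; apply: leq_trans (leq_addr _ _).
  by apply: (leq_bigmax (Ordinal (kj : (k < j.+1)%N))).
pose h k x : R := 4 ^+ k * cab (f (nk k.+1) x - f (nk k) x) ^+ 2.
have Ch : {ae mu, forall x, exists C : R, forall k, h k x <= C}.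
  apply: ae_bounded_series.
  - by move=> k; apply: bmeasZ.
  - by move=> k x; apply: mulr_ge0; [exact: exprn_ge0|exact: sqr_ge0].
  - move=> k; rewrite IntZ //.
    have hk : Int mu (fun x => cab (f (nk k.+1) x - f (nk k) x) ^+ 2) <= 8^-1 ^+ k.
      by apply: hN; apply: nkN.
    apply: le_trans (ler_wpM2l (exprn_ge0 _ _) hk) _ => //.
    rewrite -exprMn; apply: lerXn2r; rewrite ?nnegrE ?mulr_ge0 ?invr_ge0 //; lra.
have f1' : {ae mu, forall x, forall n, cab (f n x) <= 1} by apply: ae_foralln.
pose a k := clip 1 (f (nk k)).
have ma k : bcmeas (a k).
  by apply: bcmeas_clip => //; have [[m1 _] [m2 _]] := bfunP (f (nk k)).
have ca k x : cab (a k x) <= 1 by apply: cab_clip.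
(* upper limits are measurable and agree with the limit where it exists *)
pose G x : R[i] := limn_sup (fun k => complex.Re (a k x)) +i* limn_sup (fun k => complex.Im (a k x)).
have ub (u : nat -> R) : (forall k, `|u k| <= 1) -> has_ubound (range u).
  by move=> hu; exists 1 => _ [k _ <-]; apply: le_trans (ler_norm _) (hu k).
have lb (u : nat -> R) : (forall k, `|u k| <= 1) -> has_lbound (range u).
  by move=> hu; exists (-1) => _ [k _ <-]; rewrite lerNl; apply: le_trans (hu k); rewrite -normrN ler_norm.
have aR x k : `|complex.Re (a k x)| <= 1 by apply: le_trans (cab_Re _) (ca k x).
have aI x k : `|complex.Im (a k x)| <= 1 by apply: le_trans (cab_Im _) (ca k x).
have mG1 : measurable_fun [set: Y] (fun x => complex.Re (G x)).
  apply: (@measurable_fun_limn_sup _ _ _ _ (fun k x => complex.Re (a k x))) => [x _|x _|k].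
  - exact: ub.
  - exact: lb.
  - by have [[] ] := ma k.
have mG2 : measurable_fun [set: Y] (fun x => complex.Im (G x)).
  apply: (@measurable_fun_limn_sup _ _ _ _ (fun k x => complex.Im (a k x))) => [x _|x _|k].
  - exact: ub.
  - exact: lb.
  - by have [_ [] ] := ma k.
pose g := mkbfun (bcmeas_clip ler01 mG1 mG2).
have cvg_g : {ae mu, forall x, (fun k => complex.Re (f (nk k) x)) @ \oo --> complex.Re (g x) /\
    (fun k => complex.Im (f (nk k) x)) @ \oo --> complex.Im (g x)}.
    apply: filterS2 Ch f1' => x [C hC] hx.
  have C0 : 0 <= C.
    by apply: le_trans (hC 0%N); apply: mulr_ge0; [exact: exprn_ge0|exact: sqr_ge0].
  have dk k : cab (f (nk k.+1) x - f (nk k) x) <= Num.sqrt C * 2^-1 ^+ k.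
    rewrite -(@ler_pXn2r _ 2) ?nnegrE ?cab_ge0 ?mulr_ge0 ?sqrtr_ge0 ?exprn_ge0 ?invr_ge0 //.
    have e4 : (2^-1 ^+ k : R) ^+ 2 = (4 ^+ k)^-1.
      by rewrite -exprVn exprAC; congr (_ ^+ k); field.
    rewrite [leRHS]exprMn e4 (sqr_sqrtr C0) ler_pdivlMr ?exprn_gt0 // mulrC; exact: hC.
  have aE k : a k x = f (nk k) x by apply: clip_id; apply: hx.
  have cR : cvgn (fun k => complex.Re (f (nk k) x)).
    by apply: (@fast_cvg _ (Num.sqrt C)) => k; rewrite -ReN -ReD; apply: le_trans (cab_Re _) (dk k).
  have cI : cvgn (fun k => complex.Im (f (nk k) x)).
    apply: (@fast_cvg _ (Num.sqrt C)) => k; apply: le_trans (dk k).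
    by apply: le_trans (cab_Im _); case: (f (nk k.+1) x) => ? ?; case: (f (nk k) x).
  have GR : complex.Re (G x) = limn (fun k => complex.Re (f (nk k) x)).
    rewrite /G /= -(cvg_limn_supE cR); congr limn_sup; apply/funext => k; by rewrite aE.
  have GI : complex.Im (G x) = limn (fun k => complex.Im (f (nk k) x)).
    rewrite /G /= -(cvg_limn_supE cI); congr limn_sup; apply/funext => k; by rewrite aE.
  have G1 : cab (G x) <= 1.
    rewrite -(@ler_pXn2r _ 2) ?nnegrE ?cab_ge0 // expr1n cab_sqr GR GI.
    have cc : (fun k => cab (f (nk k) x) ^+ 2) @ \oo -->
        limn (fun k => complex.Re (f (nk k) x)) ^+ 2 + limn (fun k => complex.Im (f (nk k) x)) ^+ 2.
      rewrite (_ : (fun k => _) = fun k => complex.Re (f (nk k) x) ^+ 2 + complex.Im (f (nk k) x) ^+ 2).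
        by apply: cvgD; rewrite !expr2; apply: cvgM.
      by apply/funext => k; rewrite cab_sqr.
    rewrite -(cvg_lim _ cc) //; apply: limr_le; first by apply/cvg_ex; eexists; exact: cc.
    by apply: nearW => k; rewrite exprn_ile1 ?cab_ge0.
  have -> : g x = G x by apply: clip_id.
  by rewrite GR GI.
exists g; first by apply: aeW => x; apply: cab_clip.
move=> e e0; have [N1 hN1] := fC e e0; exists N1 => n hn.
have mE k : measurable_fun [set: Y] (fun x => (cab (f n x - f (nk k) x) ^+ 2)%:E).
  by apply/measurable_EFinP; case: (mB (f n) (f (nk k))).
have mE' : measurable_fun [set: Y] (fun x => (cab (f n x - g x) ^+ 2)%:E).
  by apply/measurable_EFinP; case: (mB (f n) g).
have cE : {ae mu, forall x, [set: Y] x -> (fun k => (cab (f n x - f (nk k) x) ^+ 2)%:E) @ \oo -->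
    (cab (f n x - g x) ^+ 2)%:E}.
  apply: filterS cvg_g => x [cR cI] _; apply: cvg_EFin; first by apply: nearW.
  have Im_sub (z w : R[i]) : complex.Im (z - w) = complex.Im z - complex.Im w.
    by case: z w => ? ? [].
  have E2 (w : R[i]) : cab (f n x - w) ^+ 2 =
      (complex.Re (f n x) - complex.Re w) ^+ 2 + (complex.Im (f n x) - complex.Im w) ^+ 2.
    by rewrite cab_sqr ReD ReN Im_sub.
  rewrite E2 (_ : fine \o _ = fun k => (complex.Re (f n x) - complex.Re (f (nk k) x)) ^+ 2 +
     (complex.Im (f n x) - complex.Im (f (nk k) x)) ^+ 2); last by apply/funext => k /=; rewrite E2.
  by apply: cvgD; rewrite !expr2; apply: cvgM; apply: cvgB => //; exact: cvg_cst.
have dE : {ae mu, forall x (k : nat), [set: Y] x -> (`|(cab (f n x - f (nk k) x) ^+ 2)%:E| <= 4%:E)%E}.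
  apply: filterS f1' => x hx k _; rewrite /= lee_fin ger0_norm ?sqr_ge0 //.
  rewrite (_ : 4 = 2 ^+ 2 :> R); last by rewrite -natrX.
  apply: lerXn2r; rewrite ?nnegrE ?cab_ge0 //; apply: le_trans (cabB _ _) _.
  have := hx n; have := hx (nk k); lra.
have iE : mu.-integrable [set: Y] (fun=> (4%:R : R)%:E) by exact: (bmeas_integrable mu (bmeas_cst _)).
have [_ _ H] := dominated_convergence measurableT mE mE' cE iE dE.
rewrite -lee_fin -(EFin_Int mu (mB _ _)).
have <- := cvg_lim _ H => //.
apply: lime_le; first by apply/cvg_ex; eexists; exact: H.
near=> k; rewrite /= (EFin_Int mu (mB (f n) (f (nk k)))) lee_fin; apply: hN1 => //.
apply: leq_trans (_ : k <= nk k)%N; last exact: leq_addl.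
by near: k; exists N1.
Unshelve. all: by end_near.
Qed.

Variables (s sinv : Y -> Y).
Hypothesis hs : invertible_system mu s sinv.

Lemma measure_system_complete : complete_system (measure_system hs).
Proof.
move=> f bf cf.
have n2E (a b : measure_system hs) : n2 (a - b) = Int mu (fun x => cab ((a : bfun Y R) x - (b : bfun Y R) x) ^+ 2).
  exact: bE_n2.
have [||g g1 hg] := @bounded_complete f.
- by move=> n; case: (bf n).
- move=> e e0; have [N hN] := cf e e0; exists N => m n hm hn.
  by have := hN m n hm hn; rewrite n2E.
exists g; first by split; [exact: ler01|].
move=> e e0; have [N hN] := hg e e0; exists N => n hn.
by rewrite n2E; apply: hN.
Qed.

End Completeness.

(** * The product system *)

Section ProductSystem.
Context {d : measure_display} {Y : measurableType d} {R : realType}.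
Variables (mu : probability Y R) (s sinv : Y -> Y).
Hypothesis hs : invertible_system mu s sinv.
Local Notation Y2 := (Y * Y)%type.

Definition mu2 : probability Y2 R := (mu \x mu)%E.

Lemma mu2_rect (A B : set Y) : measurable A -> measurable B ->
  mu2 (A `*` B) = (mu A * mu B)%E.
Proof. exact: product_measure1E. Qed.

Lemma fst_preserving A : measurable A -> mu2 (fst @^-1` A) = mu A.
Proof.
move=> mA; rewrite (_ : fst @^-1` A = A `*` [set: Y]).
  by rewrite mu2_rect // [X in (_ * X)%E](probability_setT mu) mule1.
by apply/seteqP; split=> -[x y] //= [].
Qed.

Lemma snd_preserving A : measurable A -> mu2 (snd @^-1` A) = mu A.
Proof.
move=> mA; rewrite (_ : snd @^-1` A = [set: Y] `*` A).
  by rewrite mu2_rect // [X in (X * _)%E](probability_setT mu) mul1e.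
by apply/seteqP; split=> -[x y] //= [].
Qed.

Definition diag_map (t : Y -> Y) (z : Y2) : Y2 := (t z.1, t z.2).

Lemma measurable_diag t : measurable_fun [set: Y] t -> measurable_fun [set: Y2] (diag_map t).
Proof.
move=> mt; apply/measurable_fun_pairP; split.
- by apply: (measurableT_comp mt); exact: measurable_fst.
- by apply: (measurableT_comp mt); exact: measurable_snd.
Qed.

(** Both the product measure and its image under the diagonal map are measures
    with the same value on rectangles. *)
Lemma diag_preserving t : measure_preserving mu t -> measure_preserving mu2 (diag_map t).
Proof.
move=> [mt pt]; have md := measurable_diag mt; split=> // A mA.
symmetry; apply: (product_measure_unique (m' := pushforward mu2 (diag_map t))) => // B C mB mC.
rewrite -[LHS]/(mu2 ((t @^-1` B) `*` (t @^-1` C))).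
have mp D : measurable D -> measurable (t @^-1` D).
  by move=> mD; rewrite -[X in measurable X]setTI; apply: mt.
by rewrite mu2_rect ?pt //; apply: mp.
Qed.

Lemma diag_invertible : invertible_system mu2 (diag_map s) (diag_map sinv).
Proof.
have [hp mi K K'] := hs; split.
- exact: diag_preserving.
- exact: measurable_diag.
- by case=> x y; rewrite /diag_map /= !K.
- by case=> x y; rewrite /diag_map /= !K'.
Qed.

Lemma Int_tens (u v : Y -> R) : bmeas u -> bmeas v ->
  Int mu2 (fun z => u z.1 * v z.2) = Int mu u * Int mu v.
Proof.
move=> hu hv.
have h2 : bmeas (fun z : Y2 => u z.1 * v z.2).
  apply: bmeasM; [exact: (bmeas_comp measurable_fst hu)|exact: (bmeas_comp measurable_snd hv)].
apply: EFin_inj; rewrite -EFin_Int //.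
have /= <- := integral12_prod_meas1 (bmeas_integrable mu2 h2).
rewrite mulrC -IntZ // -EFin_Int; last exact: bmeasZ.
apply: eq_integral => x _; rewrite /fubini_F.
by rewrite (EFin_Int mu (bmeasZ (u x) hv)) IntZ // mulrC.
Qed.

Lemma bcmeas_tens (f g : bfun Y R) : bcmeas (fun z : Y2 => f z.1 * g z.2).
Proof.
have [f1 f2] := bfunP f; have [g1 g2] := bfunP g.
apply: (@bcmeasM _ _ _ (fun z : Y2 => f z.1) (fun z : Y2 => g z.2)); split.
- exact: (bmeas_comp measurable_fst f1).
- exact: (bmeas_comp measurable_fst f2).
- exact: (bmeas_comp measurable_snd g1).
- exact: (bmeas_comp measurable_snd g2).
Qed.

Definition tensor f g : bfun Y2 R := mkbfun (bcmeas_tens f g).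

Lemma bE_tensor f g : bE mu2 (tensor f g) = bE mu f * bE mu g.
Proof.
have [f1 f2] := bfunP f; have [g1 g2] := bfunP g.
have hM (u v : Y -> R) (hu : bmeas u) (hv : bmeas v) : bmeas (fun z : Y2 => u z.1 * v z.2).
  by apply: bmeasM; [exact: (bmeas_comp measurable_fst hu)|exact: (bmeas_comp measurable_snd hv)].
rewrite /bE /complex_integral -!/(Int _ _).
rewrite (_ : (fun x => complex.Re (tensor f g x)) = fun z : Y2 =>
  complex.Re (f z.1) * complex.Re (g z.2) - complex.Im (f z.1) * complex.Im (g z.2)); last first.
  by apply/funext => z /=; rewrite Re_mul.
rewrite (_ : (fun x => complex.Im (tensor f g x)) = fun z : Y2 =>
  complex.Re (f z.1) * complex.Im (g z.2) + complex.Im (f z.1) * complex.Re (g z.2)); last first.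
  by apply/funext => z /=; rewrite Im_mul.
rewrite IntB; [|exact: (hM _ _ f1 g1)|exact: (hM _ _ f2 g2)].
rewrite IntD; [|exact: (hM _ _ f1 g2)|exact: (hM _ _ f2 g1)].
by rewrite (Int_tens f1 g1) (Int_tens f2 g2) (Int_tens f1 g2) (Int_tens f2 g1).
Qed.

Lemma iterz_diag a z : iterz (diag_map s) (diag_map sinv) a z = diag_map (iterz s sinv a) z.
Proof.
have it (t : Y -> Y) n : iter n (diag_map t) z = diag_map (iter n t) z.
  by elim: n => [|n IH] /=; [case: z|rewrite IH].
by case: a => n; rewrite /iterz it.
Qed.

Lemma bbd_tensor f g : bbd mu 1 f -> bbd mu 1 g -> bbd mu2 1 (tensor f g).
Proof.
move=> [_ hf] [_ hg]; split; first exact: ler01.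
have h1 := ae_comp measurable_fst fst_preserving hf.
have h2 := ae_comp measurable_snd snd_preserving hg.
apply: filterS2 h1 h2 => z h1 h2; rewrite -[bval _ _]/(f z.1 * g z.2) cabM.
by rewrite mulr_ile1 ?cab_ge0.
Qed.

Lemma measure_square : square (measure_system hs) (measure_system diag_invertible).
Proof.
apply: (@Square R (measure_system hs) (measure_system diag_invertible) tensor).
- by move=> f f' g g'; apply: bfun_eq => z; exact: mulrACA.
- by apply: bfun_eq => z; exact: mul1r.
- move=> a f g; apply: bfun_eq => z.
  by rewrite -[LHS]/((tensor f g) (iterz (diag_map s) (diag_map sinv) a z)) iterz_diag.
- by move=> f g; apply: bfun_eq => z; exact: conjM.
- exact: bE_tensor.
- exact: bbd_tensor.
Qed.

End ProductSystem.

(** * Correlations of essentially bounded functions *)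

Section Correlations.
Variable R : realType.

Lemma null_of_Ub (a : nat -> R[i]) (C : R) : (forall n, cab (a n) <= C) ->
  (forall e, 0 < e -> Ub (fun n => (cab (a n))%:C) e) -> null_in_uniform_density a.
Proof.
move=> aC aU; split; first by exists C => n; rewrite normcab lecR.
move=> eps e0; have e2 : 0 < eps / 2 by rewrite divr_gt0.
have [L0 hL] := aU _ e2; exists L0 => M N _ MN hN.
have -> : \sum_(M <= n < N) `|a n| = (\sum_(i < N - M) cab (a (M + i)%N))%:C.
  rewrite rmorph_sum /= -{1}[M]add0n big_addn big_mkord.
  by apply: eq_bigr => i _; rewrite normcab addnC.
have := hL M (N - M)%N hN; rewrite -rmorph_sum cab_real ger0_norm; last first.
  by apply: sumr_ge0 => i _; apply: cab_ge0.
set W := \sum_(i < _) _ => hW.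
have n0 : 0 < (N - M)%:R :> R by rewrite ltr0n subn_gt0.
rewrite -(rmorph_nat (real_complex R)) -fmorphV -rmorphM ltcR mulrC ltr_pdivrMr //.
by apply: le_lt_trans hW _; rewrite ltr_pM2r //; lra.
Qed.

Lemma phase_sumZ k (p : 'I_k -> {poly R}) (c : R[i]) L n :
  phase_sum p [seq (c * y.1, y.2) | y <- L] n = c * phase_sum p L n.
Proof. by rewrite /phase_sum big_map mulr_sumr; apply: eq_bigr => y _; rewrite mulrA. Qed.

Lemma corrZ (S : system R) k (p : 'I_k -> {poly R}) (c0 c1 : R[i]) (g0 : S) (g : 'I_k -> S) n :
  corr p (cst c0 * g0) (fun i => cst c1 * g i) n = c0 * c1 ^+ k * corr p g0 g n.
Proof.
rewrite /corr (eq_bigr (fun i => cst c1 * T (poly_val (p i) n) (g i))); last first.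
  by move=> i _; rewrite rmorphM T_cst.
rewrite big_split /= prodr_const card_ord.
rewrite (_ : _ * _ = cst (c0 * c1 ^+ k) * (g0 * \prod_(i < k) T (poly_val (p i) n) (g i))).
  exact: E_cst.
by rewrite rmorphM rmorphXn mulrACA.
Qed.

End Correlations.

Section MeasureCorrelations.
Context {d : measure_display} {Y : measurableType d} {R : realType}.
Variables (mu : probability Y R) (s sinv : Y -> Y).
Hypothesis hs : invertible_system mu s sinv.
Local Notation S := (measure_system hs).
Variables (k : nat) (p : 'I_k -> {poly R}).

(** Iterates preserve null sets, so representatives may be changed inside them. *)
Lemma correlation_ae (f0 : Y -> R[i]) (f : 'I_k -> Y -> R[i]) (g0 : bfun Y R) (g : 'I_k -> bfun Y R) n :
  complex_Linfty mu f0 -> (forall i, complex_Linfty mu (f i)) ->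
  {ae mu, forall x, g0 x = f0 x} -> (forall i, {ae mu, forall x, g i x = f i x}) ->
  correlation mu s sinv p f0 f n = corr p (g0 : S) (g : 'I_k -> S) n.
Proof.
move=> [mf0 mf0' _] mf h0 h.
pose G : bfun Y R := g0 * \prod_(i < k) bT hs (poly_val (p i) n) (g i).
have GE x : G x = g0 x * \prod_(i < k) g i (iterz s sinv (poly_val (p i) n) x).
  rewrite /G -[LHS]/(g0 x * bval (\prod_(i < k) bT hs (poly_val (p i) n) (g i)) x).
  congr (_ * _); elim/big_rec2: _ => // i y z _ <-.
  by [].
have hi : {ae mu, forall x, forall i, g i (iterz s sinv (poly_val (p i) n) x) =
     f i (iterz s sinv (poly_val (p i) n) x)}.
  have hi i : {ae mu, forall x, g i (iterz s sinv (poly_val (p i) n) x) =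
     f i (iterz s sinv (poly_val (p i) n) x)}.
    by have [m pr] := iterz_preserving hs (poly_val (p i) n); exact: (ae_comp m pr (h i)).
  exact: (filter_forall (f := fun i x => g i (iterz s sinv (poly_val (p i) n) x) =
     f i (iterz s sinv (poly_val (p i) n) x)) _ hi).
have mF : measurable_fun [set: Y] (fun x => complex.Re (f0 x * \prod_(i < k) f i (iterz s sinv (poly_val (p i) n) x))) /\
   measurable_fun [set: Y] (fun x => complex.Im (f0 x * \prod_(i < k) f i (iterz s sinv (poly_val (p i) n) x))).
  have mM (u v : Y -> R[i]) :
     measurable_fun [set: Y] (fun x => complex.Re (u x)) /\ measurable_fun [set: Y] (fun x => complex.Im (u x)) ->
     measurable_fun [set: Y] (fun x => complex.Re (v x)) /\ measurable_fun [set: Y] (fun x => complex.Im (v x)) ->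
     measurable_fun [set: Y] (fun x => complex.Re (u x * v x)) /\ measurable_fun [set: Y] (fun x => complex.Im (u x * v x)).
    move=> [u1 u2] [v1 v2]; split.
    - rewrite (_ : (fun x => _) = fun x => complex.Re (u x) * complex.Re (v x) - complex.Im (u x) * complex.Im (v x)).
        by apply: measurable_funB; apply: measurable_funM.
      by apply/funext => x; rewrite Re_mul.
    - rewrite (_ : (fun x => _) = fun x => complex.Re (u x) * complex.Im (v x) + complex.Im (u x) * complex.Re (v x)).
        by apply: measurable_funD; apply: measurable_funM.
      by apply/funext => x; rewrite Im_mul.
  apply: (mM f0 _) => //.
  elim: (index_enum _) => [|i r IH].
    split.
      rewrite (_ : (fun x => _) = fun=> 1); first exact: measurable_cst.
      by apply/funext => x; rewrite big_nil.
    rewrite (_ : (fun x => _) = fun=> 0); first exact: measurable_cst.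
    by apply/funext => x; rewrite big_nil.
  have [m1 m2 _] := mf i; have [m _] := iterz_preserving hs (poly_val (p i) n).
  have [q1 q2] := mM _ _ (conj (measurableT_comp m1 m) (measurableT_comp m2 m)) IH.
  split.
    rewrite (_ : (fun x => _) = fun x => complex.Re (f i (iterz s sinv (poly_val (p i) n) x) *
      \prod_(i <- r) f i (iterz s sinv (poly_val (p i) n) x))) //.
    by apply/funext => x; rewrite big_cons.
  rewrite (_ : (fun x => _) = fun x => complex.Im (f i (iterz s sinv (poly_val (p i) n) x) *
      \prod_(i <- r) f i (iterz s sinv (poly_val (p i) n) x))) //.
  by apply/funext => x; rewrite big_cons.
have aeG : {ae mu, forall x, f0 x * \prod_(i < k) f i (iterz s sinv (poly_val (p i) n) x) = G x}.
  apply: filterS2 h0 hi => x h1 h2; rewrite GE h1; congr (_ * _).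
  by apply: eq_bigr => i _; rewrite h2.
have [mG1 _] := (bfunP G).1; have [mG2 _] := (bfunP G).2; have [m1 m2] := mF.
rewrite /corr -[RHS]/(complex_integral mu G) /correlation /complex_integral.
congr (_ +i* _); rewrite /Rintegral; congr fine.
- apply: ae_eq_integral => //; [exact/measurable_EFinP|exact/measurable_EFinP|].
  by apply: filterS aeG => x -> .
- apply: ae_eq_integral => //; [exact/measurable_EFinP|exact/measurable_EFinP|].
  by apply: filterS aeG => x -> .
Qed.

Lemma Linfty_clip f : complex_Linfty mu f -> exists M : R, forall M', M <= M' -> 0 <= M' ->
  exists g : bfun Y R, {ae mu, forall x, g x = f x} /\ bbd mu M' g.
Proof.
move=> [m1 m2 [M hM]]; exists M => M' MM M0.
exists (mkbfun (bcmeas_clip M0 m1 m2)); split.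
  by apply: filterS hM => x hx; apply: clip_id; move: hx; rewrite normcab lecR => hx; apply: le_trans MM.
by split=> //; apply: aeW => x; apply: cab_clip.
Qed.

Hypotheses (hE : ergodic mu s) (hp : forall i, integer_polynomial (p i)).
Hypothesis hind : rationally_independent p.

Lemma correlation_decomposition (f0 : Y -> R[i]) (f : 'I_k -> Y -> R[i]) :
  complex_Linfty mu f0 -> (forall i, complex_Linfty mu (f i)) ->
  exists b : nat -> R[i],
    null_in_uniform_density (fun n => correlation mu s sinv p f0 f n - b n) /\
    forall e : R, 0 < e -> exists L, forall n, cab (b n - phase_sum p L n) <= e.
Proof.
move=> hf0 hf; have [M0 hM0] := Linfty_clip hf0.
have /choice[Mi hMi] := fun i => Linfty_clip (hf i).
pose M := 1 + `|M0| + \sum_i `|Mi i|.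
have s0 : 0 <= \sum_i `|Mi i| by apply: sumr_ge0.
have M1 : 1 <= M by rewrite /M -addrA lerDl addr_ge0.
have M00 : 0 < M by apply: lt_le_trans M1.
have [g0 [e0 b0]] : exists g : bfun Y R, {ae mu, forall x, g x = f0 x} /\ bbd mu M g.
  apply: hM0 (ltW M00); apply: le_trans (ler_norm _) _; rewrite /M addrAC lerDr.
  by rewrite addr_ge0.
have /choice[g hg] : forall i, exists g : bfun Y R, {ae mu, forall x, g x = f i x} /\ bbd mu M g.
  move=> i; apply: hMi (ltW M00); apply: le_trans (ler_norm _) _.
  by rewrite /M (bigD1 i) //= addrCA lerDl !addr_ge0 // sumr_ge0.
pose c0 : R := M^-1; pose c1 : R := (2 * M)^-1.
have c00 : 0 < c0 by rewrite invr_gt0.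
have c10 : 0 < c1 by rewrite invr_gt0 mulr_gt0.
have bF0 : bd 1 (cst c0%:C * (g0 : S)).
  have := bdM (bd_cst S c0%:C) (b0 : bd M (g0 : S)).
  by rewrite cab_real (gtr0_norm c00) mulVf ?gt_eqF.
have bF i : bd 2^-1 (cst c1%:C * (g i : S)).
  have := bdM (bd_cst S c1%:C) ((hg i).2 : bd M (g i : S)).
  rewrite cab_real (gtr0_norm c10) (_ : c1 * M = 2^-1) //.
  by rewrite /c1 invfM -mulrA mulVf ?mulr1 ?gt_eqF.
have hC : complete_system S by exact: measure_system_complete.
have hS : ergodic_system S by exact: measure_system_ergodic.
have hU : unimodular_bounded S by exact: measure_system_unimodular.
have [b [b1 bU bL]] := decomposition (measure_square hs) hC hS hU
  (measure_system_disc hs) hp hind bF0 bF.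
(* the functions were scaled into the discs of radius 1 and 1/2 *)
pose c : R := (c0 * c1 ^+ k)^-1.
have cc0 : 0 < c by rewrite invr_gt0 mulr_gt0 // exprn_gt0.
have cE n : correlation mu s sinv p f0 f n =
    c%:C * corr p (cst c0%:C * (g0 : S)) (fun i => cst c1%:C * (g i : S)) n.
  rewrite corrZ (@correlation_ae _ _ g0 g) //; last by move=> i; case: (hg i).
  by rewrite mulrA -rmorphXn -!rmorphM mulVf ?mul1r // gt_eqF // -invr_gt0.
have cab_c : cab c%:C = c by rewrite cab_real gtr0_norm.
exists (fun n => c%:C * b n); split.
- apply: (@null_of_Ub _ _ (c * 2)).
    move=> n; rewrite cE -mulrBr cabM cab_c ler_pM2l //; apply: le_trans (cabB _ _) _.
    have : cab (corr p (cst c0%:C * (g0 : S)) (fun i => cst c1%:C * (g i : S)) n) <= 1.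
      apply: cab_E; apply: bd1M => //; apply: bd1_prod => i _; apply: bd_T.
      by apply: bd_le (bF i); rewrite invf_le1 // ler1n.
    have := b1 n; lra.
  move=> e e0'; have ec : 0 < e / c by rewrite divr_gt0.
  have [L0 hL] := bU _ ec; exists L0 => m L hm.
  have -> : \sum_(i < L) (cab (correlation mu s sinv p f0 f (m + i) - c%:C * b (m + i)%N))%:C =
      c%:C * \sum_(i < L) (cab (corr p (cst c0%:C * (g0 : S)) (fun i => cst c1%:C * (g i : S)) (m + i)%N -
        b (m + i)%N))%:C.
    rewrite mulr_sumr; apply: eq_bigr => i _.
    by rewrite cE -mulrBr cabM cab_c rmorphM.
  by rewrite cabM cab_c -ler_pdivlMl // mulrA [c^-1 * _]mulrC; apply: hL.
- move=> e e0'; have ec : 0 < e / c by rewrite divr_gt0.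
  have [L hL] := bL _ ec; exists [seq (c%:C * y.1, y.2) | y <- L] => n.
  by rewrite phase_sumZ -mulrBr cabM cab_c -ler_pdivlMl // mulrC.
Qed.

End MeasureCorrelations.

(** * Newton expansion of the phases *)

Section Newton.
Variables (R : realType) (d : nat).

(** Differencing lowers the degree, and summing a combination of binomial
    coefficients raises each lower index by one. *)
Lemma newton_expansion m (P : {poly R}) : (size P <= m.+1)%N ->
  exists c : nat -> R, forall n : nat, P.[n%:R] = \sum_(j < m.+1) c j * 'C(n, j)%:R.
Proof.
elim: m P => [|m IH] P sP.
  exists (fun=> P`_0) => n; rewrite (size1_polyC sP) hornerC coefC /=.
  by rewrite big_ord1 bin0 mulr1.
have [c hc] := IH _ (size_shiftB 1 0 sP).
exists (fun j => if j is j'.+1 then c j' else P.[0]) => n.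
rewrite big_ord_recl /= bin0 mulr1; elim: n => [|n IHn].
  by rewrite big1 ?addr0 // => i _; rewrite bin0n mulr0.
have := hc n; rewrite hornerD hornerN !horner_shift addr0 -natr1 => /eqP.
rewrite subr_eq => /eqP ->; rewrite IHn addrCA; congr (_ + _).
rewrite -big_split /=; apply: eq_bigr => j _.
by rewrite /bump /= add1n binS natrD mulrDr addrC.
Qed.

Definition newton_sum (L : seq (R[i] * ('I_d -> R))) (n : nat) : R[i] :=
  \sum_(y <- L) y.1 * ex (\sum_(j < d) y.2 j * 'C(n, j.+1)%:R).

Lemma phase_sum_newton k (p : 'I_k -> {poly R}) L :
  (forall i, (size (p i) <= d.+1)%N) ->
  exists L', forall n, phase_sum p L n = newton_sum L' n.
Proof.
move=> sp; have /choice[c hc] := fun i => newton_expansion (sp i).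
exists [seq (y.1 * ex (\sum_i y.2 i * c i 0%N), fun j : 'I_d => \sum_i y.2 i * c i j.+1) | y <- L] => n.
rewrite /newton_sum big_map; apply: eq_bigr => y _ /=.
rewrite -mulrA -exD; congr (_ * ex _).
rewrite (eq_bigr (fun i => y.2 i * c i 0%N +
    \sum_(j < d) y.2 i * c i j.+1 * 'C(n, j.+1)%:R)); last first.
  move=> i _; rewrite hc big_ord_recl bin0 mulr1 mulrDr mulr_sumr; congr (_ + _).
  by apply: eq_bigr => j _; rewrite mulrA.
rewrite big_split /=; congr (_ + _); rewrite exchange_big /=; apply: eq_bigr => j _.
by rewrite mulr_suml.
Qed.

End Newton.

(** * Continuous extension of rapidly convergent sequences *)

Section Clamp.
Variable R : realType.

Definition clamp (r t : R) := (`|t + r| - `|t - r|) / 2.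

Lemma clamp_le r t : 0 <= r -> `|clamp r t| <= r.
Proof.
move=> r0; rewrite /clamp normrM (ger0_norm (_ : 0 <= 2^-1)) ?invr_ge0 // ler_pdivrMr //.
apply: le_trans (ler_dist_dist _ _) _.
by rewrite (_ : t + r - (t - r) = r * 2) ?ger0_norm ?mulr_ge0 //; ring.
Qed.

Lemma clamp_id r t : `|t| <= r -> clamp r t = t.
Proof.
rewrite ler_norml => /andP[h1 h2]; rewrite /clamp ger0_norm; last by lra.
by rewrite ler0_norm; [field|lra].
Qed.

Lemma clamp_continuous r : continuous (clamp r).
Proof.
move=> t; apply: cvgM; last exact: cvg_cst.
apply: cvgB; apply: cvg_norm.
- by apply: cvgD => //; exact: cvg_cst.
- by apply: cvgB => //; exact: cvg_cst.
Qed.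

(** Clamping each increment to its bound changes nothing where the bound holds
    and makes the sum of the increments converge uniformly everywhere. *)
Lemma clamp_extension (K : topologicalType) (u : nat -> K -> R) (P : set K) :
  (forall m, continuous (u m)) ->
  (forall m x, P x -> `|u m.+1 x - u m x| <= 2^-1 ^+ m) ->
  exists v : K -> R, continuous v /\ forall x, P x -> u ^~ x @ \oo --> v x.
Proof.
move=> cu hu.
pose w := fix w m x := if m is m'.+1 then w m' x + clamp (2^-1 ^+ m') (u m'.+1 x - u m' x)
  else u 0%N x.
have e0 m : 0 <= 2^-1 ^+ m :> R by rewrite exprn_ge0 ?invr_ge0.
have cw m : continuous (w m).
  elim: m => [|m IH]; first exact: cu.
  move=> x; apply: (@cvgD _ _ _ _ _ (w m)); first exact: IH.
  apply: (@continuous_comp _ _ _ (fun x => u m.+1 x - u m x) (clamp _)).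
    by apply: (@cvgB _ _ _ _ _ (u m.+1) (u m)); exact: cu.
  exact: clamp_continuous.
have wS m x : `|w m.+1 x - w m x| <= 2^-1 ^+ m by rewrite /= addrC addKr; apply: clamp_le.
have wc x : cvgn (w ^~ x) by apply: (@fast_cvg _ _ 1) => m; rewrite mul1r.
have wk m k x : `|w (m + k)%N x - w m x| <= 2 * 2^-1 ^+ m - 2 * 2^-1 ^+ (m + k).
  elim: k => [|k IH]; first by rewrite addn0 !subrr normr0.
  rewrite addnS; apply: le_trans (ler_distD (w (m + k)%N x) _ _) _.
  apply: le_trans (lerD (wS _ _) IH) _; rewrite exprS; lra.
pose v x := limn (w ^~ x).
have vw m x : `|w m x - v x| <= 2 * 2^-1 ^+ m.
  have c : (fun k => `|w m x - w k x|) @ \oo --> `|w m x - v x|.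
    by apply: cvg_norm; apply: cvgB; [exact: cvg_cst|exact: wc].
  rewrite -(cvg_lim _ c) //; apply: limr_le; first by apply/cvg_ex; eexists; exact: c.
  exists m => // k /= mk; rewrite distrC -(subnKC mk); apply: le_trans (wk _ _ _) _.
  by rewrite gerBl mulr_ge0.
exists v; split.
  move=> x; apply/cvgrPdist_lt => e epos.
  have [m hm] : exists m, 2 * 2^-1 ^+ m < e / 3.
    have /cvgrPdist_lt/(_ (e / 6)) : (fun n => 2^-1 ^+ n : R) @ \oo --> (0 : R).
      by apply: cvg_expr; rewrite ger0_norm ?invr_ge0 // invf_lt1 // ltr1n.
    case=> [|m _ hm]; first by rewrite divr_gt0.
    exists m; have := hm m (leqnn m); rewrite /= sub0r normrN ger0_norm //; lra.
  have e3 : 0 < e / 3 by rewrite divr_gt0.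
  have := cw m x => /cvgrPdist_lt/(_ _ e3); apply: filterS => y hy.
  have h1 := vw m x; have h2 := vw m y.
  rewrite (_ : v x - v y = (w m x - w m y) - (w m x - v x) + (w m y - v y)); last by ring.
  apply: le_lt_trans (ler_normD _ _) _.
  have := ler_normB (w m x - w m y) (w m x - v x); lra.
move=> x Px; rewrite (_ : u ^~ x = w ^~ x); first exact: wc.
have uw m : u m x = w m x.
  elim: m => [//|m IH].
  rewrite [RHS]/(w m x + clamp (2^-1 ^+ m) (u m.+1 x - u m x)) -IH.
  by rewrite (clamp_id (hu m x Px)) [RHS]addrC subrK.
by apply/funext => m; apply: uw.
Qed.

End Clamp.

(** * Continuity for complex valued maps *)

Section ComplexContinuity.
Variables (R : realType).

Lemma Re_continuous : continuous (@complex.Re R : R[i]^o -> R).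
Proof.
move=> z; apply/(@cvgrPdist_lt _ _ _ _ (nbhs_filter z)) => e e0.
have e0' : 0 < e%:C :> R[i] by rewrite ltcR.
have := @cvg_id _ (nbhs (z : R[i]^o)).
move=> /(@cvgrPdist_lt _ _ _ _ (nbhs_filter z))/(_ _ e0').
apply: (@filterS _ _ (nbhs_filter z)) => y.
rewrite normcab ltcR; apply: le_lt_trans; rewrite -ReN -ReD; exact: cab_Re.
Qed.

Lemma Im_continuous : continuous (@complex.Im R : R[i]^o -> R).
Proof.
move=> z; apply/(@cvgrPdist_lt _ _ _ _ (nbhs_filter z)) => e e0.
have e0' : 0 < e%:C :> R[i] by rewrite ltcR.
have := @cvg_id _ (nbhs (z : R[i]^o)).
move=> /(@cvgrPdist_lt _ _ _ _ (nbhs_filter z))/(_ _ e0').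
apply: (@filterS _ _ (nbhs_filter z)) => y.
rewrite normcab ltcR; apply: le_lt_trans; apply: le_trans (cab_Im _).
by case: z => ? ?; case: y.
Qed.

Lemma complex_continuous (K : topologicalType) (f : K -> R[i]) :
  continuous (fun x => complex.Re (f x)) -> continuous (fun x => complex.Im (f x)) ->
  continuous (f : K -> R[i]^o).
Proof.
move=> h1 h2 x; apply/cvgrPdist_lt => e e0.
have -> : e = (complex.Re e)%:C by case: e e0 => a b; rewrite ltcE /= => /andP[/eqP -> _].
have {}e0 : 0 < complex.Re e by case: e e0 => a b; rewrite ltcE /= => /andP[_].
have e2 : 0 < complex.Re e / 2 by rewrite divr_gt0.
have := h1 x => /cvgrPdist_lt/(_ _ e2) H1.
have := h2 x => /cvgrPdist_lt/(_ _ e2) H2.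
apply: filterS2 H1 H2 => y H1 H2; rewrite normcab ltcR.
apply: le_lt_trans (cab_le_ReIm _) _.
have -> : complex.Re (f x - f y) = complex.Re (f x) - complex.Re (f y) by rewrite ReD ReN.
have -> : complex.Im (f x - f y) = complex.Im (f x) - complex.Im (f y).
  by case: (f x) => ? ?; case: (f y).
lra.
Qed.

Lemma ex_continuous : continuous (@ex R : R -> R[i]^o).
Proof.
apply: complex_continuous => x.
- apply: (@continuous_comp _ _ _ (fun x => pi *+ 2 * x) (@cos R)); last exact: continuous_cos.
  by apply: cvgM => //; exact: cvg_cst.
- apply: (@continuous_comp _ _ _ (fun x => pi *+ 2 * x) (@sin R)); last exact: continuous_sin.
  by apply: cvgM => //; exact: cvg_cst.
Qed.

End ComplexContinuity.

(** * Unipotent maps *)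

Section UnipotentMaps.
Variables (V : zmodType) (N : V -> V) (m : nat).
Hypothesis ND : {morph N : x y / x + y}.
Hypothesis N0 : forall x, iter m N x = 0.

Definition umap x := x + N x.
Definition uinv x := \sum_(j < m) iter j (fun y => - N y) x.

Lemma shift_zero : N 0 = 0.
Proof. by apply: (addrI (N 0)); rewrite -ND !addr0. Qed.

Lemma shiftN x : N (- x) = - N x.
Proof. by apply/eqP; rewrite -addr_eq0 -ND addNr shift_zero. Qed.

Lemma iter_oppN j x : iter j (fun y => - N y) x = (if odd j then - iter j N x else iter j N x).
Proof. by elim: j => //= j ->; case: odd; rewrite //= shiftN opprK. Qed.

Lemma iter_oppN0 x : iter m (fun y => - N y) x = 0.
Proof. by rewrite iter_oppN N0 oppr0 if_same. Qed.

(** The Neumann series of a nilpotent perturbation of the identity. *)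
Lemma uinvK : cancel uinv umap.
Proof.
move=> x; rewrite /umap /uinv.
have -> : N (\sum_(j < m) iter j (fun y => - N y) x) = \sum_(j < m) - iter j.+1 (fun y => - N y) x.
  by rewrite (big_morph N ND shift_zero); apply: eq_bigr => j _ /=; rewrite opprK.
rewrite -big_split /= (eq_bigr (fun j : 'I_m => - (iter j.+1 (fun y => - N y) x - iter j (fun y => - N y) x))).
  rewrite sumrN -(big_mkord xpredT (fun j => iter j.+1 (fun y => - N y) x - iter j (fun y => - N y) x)).
  by rewrite telescope_sumr // iter_oppN0 sub0r opprK.
by move=> j _; rewrite opprB.
Qed.

Lemma umapD : {morph umap : x y / x + y}.
Proof. by move=> x y; rewrite /umap ND addrACA. Qed.

(** A nilpotent map has no nonzero eigenvector of eigenvalue [-1]. *)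
Lemma umapK : cancel umap uinv.
Proof.
suff I x : umap x = 0 -> x = 0.
  move=> x; apply/eqP; rewrite -subr_eq0; apply/eqP; apply: I.
  have uN y : umap (- y) = - umap y by rewrite /umap shiftN opprD.
  by rewrite umapD uN uinvK subrr.
move=> /eqP; rewrite addr_eq0 => /eqP h.
have H j : x = iter j (fun y => - N y) x.
  elim: j => // j IH; rewrite iterS -IH {1}h //.
by rewrite (H m) iter_oppN0.
Qed.

End UnipotentMaps.

Section ContinuousSums.
Variables (K : topologicalType) (V : topologicalZmodType).

Lemma continuous_addz (f g : K -> V) : continuous f -> continuous g ->
  continuous (fun x => f x + g x).
Proof.
move=> cf cg x; apply: (@continuous_comp _ _ _ (fun x => (f x, g x)) (fun y : V * V => y.1 + y.2)).
  by apply: cvg_pair; [exact: cf|exact: cg].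
exact: add_continuous.
Qed.

Lemma continuous_subz (f g : K -> V) : continuous f -> continuous g ->
  continuous (fun x => f x - g x).
Proof.
move=> cf cg x; apply: (@continuous_comp _ _ _ (fun x => (f x, g x)) (fun y : V * V => y.1 - y.2)).
  by apply: cvg_pair; [exact: cf|exact: cg].
exact: sub_continuous.
Qed.

Lemma continuous_sumz I (r : seq I) (P : pred I) (f : I -> K -> V) :
  (forall i, continuous (f i)) -> continuous (fun x => \sum_(i <- r | P i) f i x).
Proof.
move=> cf; elim: r => [|i r IH].
  by under eq_fun => x do rewrite big_nil; move=> x; exact: cvg_cst.
under eq_fun => x do rewrite big_cons.
by case: (P i) => //; apply: continuous_addz.
Qed.

End ContinuousSums.

Lemma continuous_uinv (V : topologicalZmodType) (N : V -> V) m : continuous N ->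
  continuous (uinv N m).
Proof.
move=> cN; apply: continuous_sumz => j; elim: {j}(j : nat) => [|j IH] x; first exact: cvg_id.
apply: (@continuous_comp _ _ _ (iter j (fun y => - N y)) (fun y => - N y)); first exact: IH.
under eq_fun => y do rewrite -sub0r.
by apply: continuous_subz => //; move=> y; exact: cvg_cst.
Qed.

(** * The circle group and its powers *)

Section Circle.
Variable R : realType.

Record circle := Circle { cval : R[i]; circleP : cab cval == 1 }.

HB.instance Definition _ := [isSub for cval].
HB.instance Definition _ := [Choice of circle by <:].

Lemma circle_eq (x y : circle) : cval x = cval y -> x = y.
Proof. exact: val_inj. Qed.

Lemma circle_mul (x y : circle) : cab (cval x * cval y) == 1.
Proof. by rewrite cabM (eqP (circleP x)) (eqP (circleP y)) mulr1. Qed.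
Lemma circle_conj (x : circle) : cab (conjc (cval x)) == 1.
Proof. by rewrite cabJ (circleP x). Qed.
Lemma circle_one : cab (1 : R[i]) == 1.
Proof. by rewrite cab1. Qed.

Definition cadd x y := Circle (circle_mul x y).
Definition copp x := Circle (circle_conj x).
Definition czero := Circle circle_one.

Lemma caddA : associative cadd.
Proof. by move=> x y z; apply: circle_eq; exact: mulrA. Qed.
Lemma caddC : commutative cadd.
Proof. by move=> x y; apply: circle_eq; exact: mulrC. Qed.
Lemma cadd0 : left_id czero cadd.
Proof. by move=> x; apply: circle_eq; exact: mul1r. Qed.
Lemma caddN : left_inverse czero copp cadd.
Proof.
by move=> x; apply: circle_eq; rewrite /= mulrC mulJc (eqP (circleP x)) expr1n.
Qed.

HB.instance Definition _ := GRing.isZmodule.Build circle caddA caddC cadd0 caddN.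

Definition cvalo (x : circle) : R[i]^o := cval x.

HB.instance Definition _ := Topological.copy circle (initial_topology cvalo).

Lemma continuous_to_circle (K : topologicalType) (f : K -> circle) :
  continuous (fun x => cvalo (f x)) -> continuous f.
Proof.
move=> /continuousP cf; apply/(@continuousP _ (initial_topology cvalo)).
by move=> _ [B oB <-]; exact: cf.
Qed.

Lemma cval_continuous : continuous (cvalo : circle -> R[i]^o).
Proof. exact: (@initial_continuous _ _ cvalo). Qed.

Lemma cvalRe_continuous : continuous (fun x : circle => complex.Re (cval x)).
Proof.
move=> x; apply: (@continuous_comp _ _ _ cvalo (@complex.Re R)); first exact: cval_continuous.
exact: Re_continuous.
Qed.

Lemma cvalIm_continuous : continuous (fun x : circle => complex.Im (cval x)).
Proof.
move=> x; apply: (@continuous_comp _ _ _ cvalo (@complex.Im R)); first exact: cval_continuous.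
exact: Im_continuous.
Qed.

Lemma cprod_continuous (f : circle -> R) (g : circle -> R) : continuous f -> continuous g ->
  continuous (fun x : circle * circle => f x.1 * g x.2).
Proof.
move=> cf cg x; apply: cvgM.
- by apply: (@continuous_comp _ _ _ fst f); [exact: cvg_fst|exact: cf].
- by apply: (@continuous_comp _ _ _ snd g); [exact: cvg_snd|exact: cg].
Qed.

Lemma circle_sub_continuous : continuous (fun x : circle * circle => x.1 - x.2).
Proof.
have cR := cvalRe_continuous; have cI := cvalIm_continuous.
apply: continuous_to_circle; apply: complex_continuous => /=.
- rewrite (_ : (fun x => _) = fun x : circle * circle =>
    complex.Re (cval x.1) * complex.Re (cval x.2) + complex.Im (cval x.1) * complex.Im (cval x.2)).
    by move=> x; apply: cvgD; [exact: (cprod_continuous cR cR)|exact: (cprod_continuous cI cI)].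
  by apply/funext => -[[[a b] p] [[a' b'] p']] /=; rewrite mulrN opprK.
- rewrite (_ : (fun x => _) = fun x : circle * circle =>
    complex.Im (cval x.1) * complex.Re (cval x.2) - complex.Re (cval x.1) * complex.Im (cval x.2)).
    by move=> x; apply: cvgB; [exact: (cprod_continuous cI cR)|exact: (cprod_continuous cR cI)].
  by apply/funext => -[[[a b] p] [[a' b'] p']] /=; rewrite mulrN addrC.
Qed.

HB.instance Definition _ :=
  PreTopologicalNmodule_isTopologicalZmodule.Build circle circle_sub_continuous.

Lemma cab_ex1 x : cab (@ex R x) == 1. Proof. by rewrite cab_ex. Qed.
Definition cex (x : R) : circle := Circle (cab_ex1 x).

Lemma circle_compact : compact [set: circle].
Proof.
rewrite (_ : [set: circle] = cex @` `[0, 1]).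
  apply: continuous_compact; last exact: segment_compact.
  apply: continuous_subspaceT; apply: continuous_to_circle; exact: ex_continuous.
apply/seteqP; split=> // z _; have [x hx] := ex_surj (eqP (circleP z)).
exists (x - (Num.floor x)%:~R).
  rewrite /= in_itv /= subr_ge0 floor_le_tmp /= lerBlDl ltW //.
  by have := lt_succ_floor x; rewrite intrD addrC.
by apply: circle_eq => /=; rewrite exB (ex_int (intr_int _ _)) conjc1 mulr1.
Qed.

Lemma circle_hausdorff : hausdorff_space circle.
Proof.
move=> x y h; apply: circle_eq.
have : hausdorff_space R[i]^o by exact: norm_hausdorff.
apply => A B nA nB.
have [z [zA zB]] := h _ _ (cval_continuous nA) (cval_continuous nB).
by exists (cvalo z).
Qed.

(** One coordinate for each real frequency, so that a single group serves all
    phases. *)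
Definition torus : Type := prod_topology (fun _ : R => circle).

HB.instance Definition _ := Topological.copy torus (prod_topology (fun _ : R => circle)).
HB.instance Definition _ := GRing.Zmodule.copy torus (R -> circle).

Lemma torus_proj_continuous a : continuous (fun x : torus => x a).
Proof. exact: (@proj_continuous _ (fun _ : R => circle) a). Qed.

Lemma continuous_to_torus (K : topologicalType) (f : K -> torus) :
  (forall a, continuous (fun x => f x a)) -> continuous f.
Proof.
move=> cf x; apply/cvg_sup => a; move: x.
apply/(@continuousP _ (initial_topology (fun f : R -> circle => f a))).
by move=> _ [B oB <-]; have /continuousP/(_ _ oB) := cf a.
Qed.

Lemma torus_sub_continuous : continuous (fun x : torus * torus => x.1 - x.2).
Proof.
apply: continuous_to_torus => a.
apply: (@continuous_subz _ circle (fun x : torus * torus => x.1 a) (fun x => x.2 a)) => x.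
- by apply: (@continuous_comp _ _ _ fst (fun f : torus => f a));
    [exact: cvg_fst|exact: torus_proj_continuous].
- by apply: (@continuous_comp _ _ _ snd (fun f : torus => f a));
    [exact: cvg_snd|exact: torus_proj_continuous].
Qed.

HB.instance Definition _ :=
  PreTopologicalNmodule_isTopologicalZmodule.Build torus torus_sub_continuous.

Lemma torus_compact : compact [set: torus].
Proof.
have := @tychonoff R (fun=> circle) (fun=> [set: circle]) (fun=> circle_compact).
by congr compact; apply/seteqP; split.
Qed.

Lemma torus_hausdorff : hausdorff_space torus.
Proof. apply: (@hausdorff_product R (fun=> circle)) => _; exact: circle_hausdorff. Qed.

End Circle.

(** * Realization by a unipotent affine transformation *)

Lemma continuous_const (Z U : topologicalType) (c : U) : continuous (fun _ : Z => c).
Proof. by move=> x; exact: cvg_cst. Qed.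

Section ShiftMap.
Variables (V : zmodType) (d : nat).

(** The sum has at most one term; this form avoids a case distinction at the first
    coordinate. *)
Definition shift (x : 'I_d -> V) (i : 'I_d) : V := \sum_(j < d | j.+1 == i :> nat) x j.

Lemma shiftD (x y : 'I_d -> V) : shift (fun i => x i + y i) = (fun i => shift x i + shift y i).
Proof. by apply/funext => i; rewrite /shift big_split. Qed.

Lemma shift_iter m (x : 'I_d -> V) (i : 'I_d) : (i < m)%N -> iter m shift x i = 0.
Proof.
elim: m i => // m IH i im; rewrite iterS /shift big1 // => j /eqP ji.
by apply: IH; rewrite -ltnS ji.
Qed.

End ShiftMap.

Section AffineRealization.
Variables (R : realType) (d : nat).
Local Notation G := (torus R).
Local Notation K := (power_group G d).

Definition Kshift (x : K) : K := @shift G d x.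

Lemma KshiftD : {morph Kshift : x y / x + y}.
Proof. exact: shiftD. Qed.

Lemma Kshift_nil (x : K) : iter d Kshift x = 0.
Proof. by apply/funext => i; exact: shift_iter. Qed.

Lemma continuous_to_K (Z : topologicalType) (f : Z -> K) :
  (forall i, continuous (fun x => f x i)) -> continuous f.
Proof.
move=> cf x; apply/cvg_sup => i; move: x.
apply/(@continuousP _ (initial_topology (fun f : 'I_d -> G => f i))).
by move=> _ [B oB <-]; have /continuousP/(_ _ oB) := cf i.
Qed.

Lemma K_proj_continuous i : continuous (fun x : K => x i).
Proof. exact: (@proj_continuous _ (fun _ : 'I_d => G) i). Qed.

Lemma Kshift_continuous : continuous Kshift.
Proof.
apply: continuous_to_K => i; apply: (@continuous_sumz K G _ _ _ (fun j (x : K) => x j)) => j.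
exact: K_proj_continuous.
Qed.

(** The tuple of all phases at time one; its multiples run through the phases at
    all times. *)
Definition generic : G := @cex R.
Definition Kstep : K := fun i => if i == 0%N :> nat then generic else 0.
Definition Kaffine (x : K) : K := umap Kshift x + Kstep.

Lemma Kaffine_unipotent : unipotent_affine Kaffine.
Proof.
exists (umap Kshift), Kstep; split=> //.
- split.
  + exact: umapD KshiftD.
  + apply: (@continuous_addz _ K id Kshift); first by move=> x; exact: cvg_id.
    exact: Kshift_continuous.
  + exists (uinv Kshift d); split.
    * exact: umapK KshiftD Kshift_nil.
    * exact: uinvK KshiftD Kshift_nil.
    * exact: continuous_uinv Kshift_continuous.
- exists d.+1 => // x.
  have -> : (fun y => umap Kshift y - y) = Kshift by apply/funext => y; rewrite /umap addrAC subrr add0r.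
  by rewrite iterS Kshift_nil (shift_zero KshiftD).
Qed.

(** The orbit of the identity runs through the binomial multiples of the
    element whose coordinate at a frequency [a] is [ex a]. *)
Lemma Kaffine_orbit n (i : 'I_d) : iter n Kaffine 0 i = generic *+ 'C(n, i.+1).
Proof.
elim: n i => [|n IH] i; first by rewrite bin0n.
rewrite iterS -[LHS]/(iter n Kaffine 0 i + Kshift (iter n Kaffine 0) i + Kstep i).
rewrite IH -addrA binS mulrnDr; congr (_ + _).
rewrite /Kstep /Kshift /shift; case: i => -[|i] hi /=.
  by rewrite big1 ?add0r ?bin0.
rewrite addr0 (bigD1 (Ordinal (ltnW hi))) //= IH /= big1 ?addr0 // => j /andP[/eqP[ji] /negP []].
by apply/eqP/val_inj.
Qed.

Definition Kphase (L : seq (R[i] * ('I_d -> R))) (x : K) : R[i] :=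
  \sum_(y <- L) y.1 * \prod_(j < d) cval ((x j : G) (y.2 j)).

Lemma cval_natmul (x : circle R) n : cval (x *+ n) = cval x ^+ n.
Proof. by elim: n => // n IH; rewrite mulrS exprS -IH. Qed.

Lemma torus_natmul (x : G) n a : (x *+ n) a = x a *+ n :> circle R.
Proof. by elim: n => // n IH; rewrite !mulrS -IH. Qed.

Lemma Kphase_orbit L n : Kphase L (iter n Kaffine 0) = newton_sum L n.
Proof.
apply: eq_bigr => y _; congr (_ * _).
rewrite (big_morph _ (@exD R) (@ex0 R)); apply: eq_bigr => j _.
by rewrite Kaffine_orbit torus_natmul cval_natmul mulr_natr exMn.
Qed.

Lemma continuous_mulC (Z : topologicalType) (f g : Z -> R[i]^o) :
  continuous f -> continuous g -> continuous (fun x => (f x * g x : R[i]^o)).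
Proof.
have cR (h : Z -> R[i]^o) : continuous h -> continuous (fun x => complex.Re (h x)).
  move=> ch x; apply: (@continuous_comp _ _ _ h (@complex.Re R)); [exact: ch|exact: Re_continuous].
have cI (h : Z -> R[i]^o) : continuous h -> continuous (fun x => complex.Im (h x)).
  move=> ch x; apply: (@continuous_comp _ _ _ h (@complex.Im R)); [exact: ch|exact: Im_continuous].
move=> cf cg; apply: complex_continuous.
- rewrite (_ : (fun x => _) = fun x => complex.Re (f x) * complex.Re (g x) - complex.Im (f x) * complex.Im (g x)).
    move=> x; apply: cvgB; apply: cvgM; [exact: cR|exact: cR|exact: cI|exact: cI].
  by apply/funext => x; rewrite -Re_mul.
- rewrite (_ : (fun x => _) = fun x => complex.Re (f x) * complex.Im (g x) + complex.Im (f x) * complex.Re (g x)).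
    move=> x; apply: cvgD; apply: cvgM; [exact: cR|exact: cI|exact: cI|exact: cR].
  by apply/funext => x; rewrite -Im_mul.
Qed.

Lemma Kphase_continuous L : continuous (Kphase L : K -> R[i]^o).
Proof.
apply: (@continuous_sumz K R[i]^o _ L xpredT (fun y x => y.1 * \prod_(j < d) cval ((x j : G) (y.2 j)))) => y.
apply: (@continuous_mulC K (fun=> (y.1 : R[i]^o)) (fun x => \prod_(j < d) cval ((x j : G) (y.2 j)) : R[i]^o)).
  exact: continuous_const.
elim: (index_enum _) => [|j r IH].
  by under eq_fun => x do rewrite big_nil; exact: continuous_const.
under eq_fun => x do rewrite big_cons.
apply: continuous_mulC IH => x.
apply: (@continuous_comp _ _ _ (fun x : K => (x j : G) (y.2 j)) (@cvalo R)); last exact: cval_continuous.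
apply: (@continuous_comp _ _ _ (fun x : K => x j : G) (fun f : G => f (y.2 j))).
  exact: K_proj_continuous.
exact: torus_proj_continuous.
Qed.

(** The approximating sums are continuous functions of the point of [G ^ d], uniformly
    convergent along the orbit; clamped increments extend the limit. *)
Lemma affine_realization (b : nat -> R[i]) :
  (forall e : R, 0 < e -> exists L : seq (R[i] * ('I_d -> R)),
    forall n, cab (b n - newton_sum L n) <= e) ->
  exists phi : K -> R[i], continuous (phi : K -> R[i]^o) /\
    forall n, b n = phi (iter n Kaffine 0).
Proof.
move=> hb.
have e0 m : 0 < 2^-1 ^+ m / 4 :> R by rewrite divr_gt0 // exprn_gt0 // invr_gt0.
have /choice[L hL] := fun m => hb _ (e0 m).
pose P := [set iter n Kaffine 0 | n in [set: nat]].
have step m n : cab (newton_sum (L m.+1) n - newton_sum (L m) n) <= 2^-1 ^+ m.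
  have -> : newton_sum (L m.+1) n - newton_sum (L m) n =
    (b n - newton_sum (L m) n) - (b n - newton_sum (L m.+1) n) by ring.
  apply: le_trans (cabB _ _) _; have := hL m n; have := hL m.+1 n; rewrite exprS.
  have := e0 m; move: (2^-1 ^+ m) => t; lra.
have lim (g : R[i] -> R) (gB : forall z w, g (z - w) = g z - g w) (gC : forall z, `|g z| <= cab z) n :
    (fun m => g (newton_sum (L m) n)) @ \oo --> g (b n).
  apply/cvgrPdist_le => e epos.
  have /cvgrPdist_lt/(_ e epos) : (fun n => 2^-1 ^+ n : R) @ \oo --> (0 : R).
    by apply: cvg_expr; rewrite ger0_norm ?invr_ge0 // invf_lt1 // ltr1n.
  apply: filterS => m; rewrite sub0r normrN ger0_norm ?exprn_ge0 ?invr_ge0 // => hm.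
  rewrite -gB; apply: le_trans (gC _) _; apply: le_trans (hL m n) _.
  by have := e0 m; move: (2^-1 ^+ m) hm => t; lra.
have ext (g : R[i] -> R) (gB : forall z w, g (z - w) = g z - g w) (gC : forall z, `|g z| <= cab z) :
    continuous (g : R[i]^o -> R) ->
    exists v : K -> R, continuous v /\ forall n, v (iter n Kaffine 0) = g (b n).
  move=> cg; have [||v [cv hv]] := @clamp_extension R K (fun m x => g (Kphase (L m) x)) P.
  - move=> m x; apply: (@continuous_comp _ _ _ (Kphase (L m) : K -> R[i]^o) g); last exact: cg.
    exact: Kphase_continuous.
  - by move=> m _ [n _ <-]; rewrite -gB !Kphase_orbit; apply: le_trans (gC _) (step m n).
  exists v; split=> // n; have h := hv (iter n Kaffine 0); have {}h := h (ex_intro2 _ _ n I erefl).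
  have E : (fun m => g (Kphase (L m) (iter n Kaffine 0))) = fun m => g (newton_sum (L m) n).
    by apply/funext => m; rewrite Kphase_orbit.
  rewrite E in h; apply: (cvg_unique _ h (lim g gB gC n)); exact: norm_hausdorff.
have [|//||v [cv hv]] := ext (@complex.Re R).
- by move=> z w; rewrite ReD ReN.
- exact: cab_Re.
- exact: Re_continuous.
have [|//||w [cw hw]] := ext (@complex.Im R).
- by move=> z w; case: z; case: w.
- exact: cab_Im.
- exact: Im_continuous.
exists (fun x => v x +i* w x); split; first exact: complex_continuous.
by move=> n; rewrite hv hw; case: (b n).
Qed.

End AffineRealization.

(** * Linear maps of row vectors *)

Section LinearMaps.
Variable R : realType.

Lemma continuous_to_rV (Z : topologicalType) n (f : Z -> 'rV[R]_n) :
  (forall j, continuous (fun x => f x 0 j)) -> continuous f.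
Proof.
move=> cf x; apply/cvg_ballP => e e0.
have H : \forall y \near x, forall j, ball (f x 0 j) e (f y 0 j).
  apply: (filter_forall (f := fun j y => ball (f x 0 j) e (f y 0 j))) => j.
  by have /cvg_ballP := cf j x; apply.
by apply: filterS H => y H; split=> // i j; rewrite !ord1.
Qed.

Lemma continuous_mulmx m n (A : 'M[R]_(m, n)) : continuous (fun v : 'rV[R]_m => v *m A).
Proof.
apply: continuous_to_rV => j.
under eq_fun => v do rewrite mxE.
apply: (@continuous_sumz _ R^o _ _ _ (fun i (v : 'rV[R]_m) => v 0 i * A i j)) => i v.
have h := @coord_continuous R 1 m 0 i v.
exact: (cvgM h (cvg_cst (A i j))).
Qed.

Lemma Ck_cst m n k (U : set 'rV[R]_m) (c : 'rV[R]_n) : Ck_on k U (fun=> c).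
Proof.
have cc (x : 'rV[R]_m) : U x -> {for x, continuous (fun=> c)} by move=> _; exact: continuous_const.
elim: k c cc => [|k IH] c cc; first by split.
split=> // i; split=> [x _|]; first exact: derivable_cst.
rewrite (_ : 'D_(delta_mx 0 i) _ = fun=> 0); last by apply/funext => x; rewrite derive_cst.
by apply: IH => x _; exact: continuous_const.
Qed.

(** The partial derivatives of a linear map are constant. *)
Lemma smooth_mulmx m n (U : set 'rV[R]_m) (A : 'M[R]_(m, n)) :
  smooth_on U (fun v => v *m A).
Proof.
have cA : continuous (fun v : 'rV[R]_m => v *m A) by exact: continuous_mulmx.
have dA x : differentiable (mulmxr A : 'rV[R]_m -> 'rV[R]_n) x.
  exact: linear_differentiable.
have cA' x : U x -> {for x, continuous (fun v : 'rV[R]_m => v *m A)} by move=> _; exact: cA.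
case=> [|k]; split=> // i; split=> [x _|]; first exact: diff_derivable.
rewrite (_ : 'D_(delta_mx 0 i) _ = fun=> delta_mx 0 i *m A); first exact: Ck_cst.
by apply/funext => x; rewrite (deriveE _ (dA x)) diff_lin.
Qed.

Lemma smooth_linear m n (U : set 'rV[R]_m) (f : 'rV[R]_m -> 'rV[R]_n) (A : 'M[R]_(m, n)) :
  (forall v, f v = v *m A) -> smooth_on U f.
Proof. by move=> h; rewrite (_ : f = fun v => v *m A); [exact: smooth_mulmx|apply/funext]. Qed.

(** Linearity with an explicit matrix, from which smoothness follows. *)
Definition matrix_map n (f : 'rV[R]_n -> 'rV[R]_n) := exists A, forall v, f v = v *m A.

Lemma matrix_map_id n : matrix_map (@id 'rV[R]_n).
Proof. by exists 1%:M => v; rewrite mulmx1. Qed.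

Lemma matrix_map_comp n (f g : 'rV[R]_n -> 'rV[R]_n) :
  matrix_map f -> matrix_map g -> matrix_map (fun v => f (g v)).
Proof. by move=> [A hA] [B hB]; exists (B *m A) => v; rewrite hA hB mulmxA. Qed.

Lemma matrix_mapD n (f g : 'rV[R]_n -> 'rV[R]_n) :
  matrix_map f -> matrix_map g -> matrix_map (fun v => f v + g v).
Proof. by move=> [A hA] [B hB]; exists (A + B) => v; rewrite hA hB mulmxDr. Qed.

Lemma matrix_mapN n (f : 'rV[R]_n -> 'rV[R]_n) :
  matrix_map f -> matrix_map (fun v => - f v).
Proof. by move=> [A hA]; exists (- A) => v; rewrite hA mulmxN. Qed.

Lemma matrix_map_iter n (f : 'rV[R]_n -> 'rV[R]_n) m : matrix_map f -> matrix_map (iter m f).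
Proof.
move=> hf; elim: m => [|m IH]; first exact: matrix_map_id.
exact: matrix_map_comp hf IH.
Qed.

Lemma matrix_map_sum n m (f : 'I_m -> 'rV[R]_n -> 'rV[R]_n) :
  (forall j, matrix_map (f j)) -> matrix_map (fun v => \sum_j f j v).
Proof.
by move=> /choice[A hA]; exists (\sum_j A j) => v; rewrite mulmx_sumr; apply: eq_bigr.
Qed.

Definition integral n (v : 'rV[R]_n) := [forall j, v 0 j \is a Num.int].

Lemma integralP n (v : 'rV[R]_n) : reflect (forall j, v 0 j \is a Num.int) (integral v).
Proof. exact: forallP. Qed.

Lemma integralD n (v w : 'rV[R]_n) : integral v -> integral w -> integral (v + w).
Proof. by move=> /integralP hv /integralP hw; apply/integralP => j; rewrite mxE rpredD. Qed.

Lemma integralN n (v : 'rV[R]_n) : integral v -> integral (- v).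
Proof. by move=> /integralP hv; apply/integralP => j; rewrite mxE rpredN. Qed.

Lemma integral0 n : integral (0 : 'rV[R]_n).
Proof. by apply/integralP => j; rewrite mxE. Qed.

End LinearMaps.

Section DiscreteFactor.
Variable I : choiceType.
Local Notation D := (discrete_topology I).

Lemma nbhs_discrete (a : D) : nbhs a [set a].
Proof. exact: discrete_set1. Qed.

Lemma continuous_discrete (V Z : topologicalType) (f : D * V -> Z) :
  (forall a, continuous (fun v => f (a, v))) -> continuous f.
Proof.
move=> cf [a v] B nB; have nV := cf a v B nB.
exists ([set a], [set w | B (f (a, w))]); first by split=> //; exact: nbhs_discrete.
by case=> b w [/= -> ].
Qed.

Lemma continuous_discrete2 (V Z : topologicalType) (f : (D * V) * (D * V) -> Z) :
  (forall a b, continuous (fun v : V * V => f ((a, v.1), (b, v.2)))) -> continuous f.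
Proof.
move=> cf [[a v] [b w]] B nB.
have [[V1 V2] /= [n1 n2] hV] := cf a b (v, w) B nB.
exists ([set a] `*` V1, [set b] `*` V2).
  split; first by exists ([set a], V1); [split=> //; exact: nbhs_discrete|].
  by exists ([set b], V2); [split=> //; exact: nbhs_discrete|].
by case=> [[a' v'] [b' w']] [[/= -> h1] [-> h2]]; apply: (hV (v', w')).
Qed.

End DiscreteFactor.

(** * A nilpotent extension of the integers *)

(** A unipotent integral automorphism [1 + nmx] of the vector space: its inverse,
    the Neumann series, is integral as well, so it preserves the lattice. *)
Record nilpotent_matrix (R : realType) (n d : nat) := NilpotentMatrix {
  nmx : 'M[R]_n;
  nmx_nil : forall v : 'rV[R]_n, iter d (fun w => w *m nmx) v = 0;
  nmx_int : forall v : 'rV[R]_n, integral v -> integral (v *m nmx)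
}.

Section ZAction.
Variables (R : realType) (n d : nat) (A : nilpotent_matrix R n d).
Implicit Types (v w : 'rV[R]_n) (a b : int).

Definition nact v := v *m nmx A.
Definition zact a v := iterz (umap nact) (uinv nact d) a v.

Lemma nactD : {morph nact : v w / v + w}.
Proof. by move=> v w; rewrite /nact mulmxDl. Qed.

Lemma iter_nactD m : {morph iter m nact : v w / v + w}.
Proof. by elim: m => // m IH v w; rewrite !iterS IH nactD. Qed.

Lemma nact_nil v : iter d nact v = 0. Proof. exact: nmx_nil. Qed.

Lemma umap_nactK : cancel (umap nact) (uinv nact d).
Proof. exact: umapK nactD nact_nil. Qed.

Lemma uinv_nactK : cancel (uinv nact d) (umap nact).
Proof. exact: uinvK nactD nact_nil. Qed.

Lemma zactA a b v : zact (a + b) v = zact a (zact b v).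
Proof. exact: iterzD umap_nactK uinv_nactK _ _ _. Qed.

Lemma zact0 v : zact 0 v = v. Proof. by []. Qed.

Lemma zactNK a v : zact a (zact (- a) v) = v.
Proof. by rewrite -zactA subrr. Qed.

Lemma iterz_ind (P : ('rV[R]_n -> 'rV[R]_n) -> Prop) :
  P id -> (forall f, P f -> P (fun v => umap nact (f v))) ->
  (forall f, P f -> P (fun v => uinv nact d (f v))) -> forall a, P (zact a).
Proof.
move=> P0 P1 P2.
have it (f : 'rV[R]_n -> 'rV[R]_n) : (forall g, P g -> P (fun v => f (g v))) -> forall m, P (iter m f).
  by move=> h; elim=> // m IH; exact: (h _ IH).
by case=> m; apply: it.
Qed.

Lemma zact_mx a : matrix_map (zact a).
Proof.
have nm : matrix_map nact by exists (nmx A).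
apply: iterz_ind => [|f hf|f hf]; first exact: matrix_map_id.
- by apply: (matrix_mapD hf); exact: matrix_map_comp nm hf.
- apply: (matrix_map_comp (f := uinv nact d)) hf.
  by apply: matrix_map_sum => j; apply: matrix_map_iter; exact: matrix_mapN.
Qed.

Lemma zactD a : {morph zact a : v w / v + w}.
Proof. by move=> v w; have [B hB] := zact_mx a; rewrite !hB mulmxDl. Qed.

Lemma zactN a v : zact a (- v) = - zact a v.
Proof. by have [B hB] := zact_mx a; rewrite !hB mulNmx. Qed.

Lemma zact_cont a : continuous (zact a).
Proof.
have [B hB] := zact_mx a; rewrite (_ : zact a = fun v => v *m B); last exact/funext.
exact: continuous_mulmx.
Qed.

Lemma zact_integral a v : integral v -> integral (zact a v).
Proof.
move=> iv; suff H : forall w, integral w -> integral (zact a w) by apply: H.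
move: a; apply: (iterz_ind (P := fun f => forall w, integral w -> integral (f w))) => [//|f hf|f hf] w iw.
- by apply: integralD; [exact: hf|apply: nmx_int; exact: hf].
- have {}iw := hf _ iw; move: (f w) iw => x ix; rewrite /uinv.
  elim/big_rec: _ => [|j y _ iy]; first exact: integral0.
  apply: integralD iy; elim: (j : nat) => //= m IH.
  by apply: integralN; exact: nmx_int.
Qed.

Lemma zact_fixed a v : nact v = 0 -> zact a v = v.
Proof.
move=> h; have u : umap nact v = v by rewrite /umap h addr0.
have u' : uinv nact d v = v by rewrite -{1}u umap_nactK.
have it (f : 'rV[R]_n -> 'rV[R]_n) m : f v = v -> iter m f v = v.
  by move=> e; elim: m => // m IH; rewrite iterS IH.
by case: a => m; apply: it.
Qed.

Lemma nact_zact a v : nact (zact a v) = zact a (nact v).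
Proof.
suff H : forall w, nact (zact a w) = zact a (nact w) by apply: H.
move: a; apply: (iterz_ind (P := fun f => forall w, nact (f w) = f (nact w))) => [//|f hf|f hf] w.
  by rewrite /umap nactD hf.
rewrite -hf; apply: (can_inj umap_nactK); rewrite uinv_nactK.
by rewrite /umap -nactD -/(umap nact _) uinv_nactK.
Qed.

Lemma iter_nact_zact m a v : iter m nact (zact a v) = zact a (iter m nact v).
Proof. by elim: m => // m IH; rewrite !iterS IH nact_zact. Qed.

End ZAction.

(** The semidirect product of the integers, acting by powers of the automorphism,
    with the vector space; [A] determines the group law. *)
Definition semi (R : realType) (n d : nat) (A : nilpotent_matrix R n d) : Type :=
  (discrete_topology int * 'rV[R]_n)%type.

Section Semidirect.
Variables (R : realType) (n d : nat) (A : nilpotent_matrix R n d).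
Implicit Types (v w : 'rV[R]_n) (a b : int).
Local Notation D := (discrete_topology int).
Local Notation V := ('rV[R]_n).

Local Notation semi := (semi A).

HB.instance Definition _ := Topological.copy semi (D * V)%type.

Definition smul (x y : semi) : semi := ((x.1 : int) + (y.1 : int), x.2 + zact A x.1 y.2).
Definition sinvg (x : semi) : semi := (- (x.1 : int), - zact A (- (x.1 : int)) x.2).
Definition sone : semi := (0 : int, 0).

Lemma smulA : associative smul.
Proof.
move=> [a u] [b v] [c w]; rewrite /smul /=; congr (_, _); first exact: addrA.
by rewrite zactD zactA addrA.
Qed.

Lemma smul1 : left_id sone smul.
Proof. by move=> [a u]; rewrite /smul /= !add0r. Qed.

Lemma smulr1 : right_id sone smul.
Proof.
move=> [a u]; rewrite /smul /=; congr (_, _); first exact: addr0.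
by rewrite -(subrr 0) zactD zactN subrr addr0.
Qed.

Lemma smulV : left_inverse sone sinvg smul.
Proof. by move=> [a u]; rewrite /smul /=; congr (_, _); [exact: addNr|rewrite addNr]. Qed.

Lemma smulrV : right_inverse sone sinvg smul.
Proof.
move=> [a u]; rewrite /smul /=; congr (_, _); first exact: subrr.
by rewrite zactN zactNK subrr.
Qed.

HB.instance Definition _ := isGroup.Build semi smulA smul1 smulr1 smulV smulrV.

Lemma semi_mul (x y : semi) : (x * y)%g = ((x.1 : int) + (y.1 : int), x.2 + zact A x.1 y.2).
Proof. by []. Qed.

Lemma semi_inv (x : semi) : (x^-1)%g = (- (x.1 : int), - zact A (- (x.1 : int)) x.2).
Proof. by []. Qed.

Lemma continuous_pair (Z Z1 Z2 : topologicalType) (f : Z -> Z1) (g : Z -> Z2) :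
  continuous f -> continuous g -> continuous (fun x => (f x, g x)).
Proof. by move=> cf cg x; apply: cvg_pair; [exact: cf|exact: cg]. Qed.

Lemma continuous_to_semi (Z : topologicalType) a (f : Z -> V) : continuous f ->
  continuous (fun x => ((a, f x) : semi)).
Proof. by move=> cf; apply: (@continuous_pair Z D V) cf; exact: continuous_const. Qed.

Lemma semi_mul_continuous : continuous (fun x : semi * semi => (x.1 * x.2)%g).
Proof.
apply: (@continuous_discrete2 int V semi) => a b.
apply: (@continuous_to_semi (V * V)%type (((a : int) + (b : int)) : D) (fun x => x.1 + zact A a x.2)) => x.
apply: cvgD => /=; first exact: cvg_fst.
apply: (@continuous_comp _ _ _ snd (zact A a)); first exact: cvg_snd.
exact: zact_cont.
Qed.

Lemma semi_inv_continuous : continuous (fun x : semi => (x^-1)%g).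
Proof.
apply: (@continuous_discrete int V semi) => a.
apply: (@continuous_to_semi V _ (fun x => - zact A (- (a : int)) x)) => x.
have h := @zact_cont R n d A (- (a : int)) x; exact: (cvgN h).
Qed.

HB.instance Definition _ := isTopologicalGroup.Build semi semi_mul_continuous semi_inv_continuous.

Lemma semi_fst_continuous : continuous (fst : semi -> D).
Proof. by move=> x; exact: cvg_fst. Qed.

Lemma semi_snd_continuous : continuous (snd : semi -> V).
Proof. by move=> x; exact: cvg_snd. Qed.

Lemma semi_hausdorff : hausdorff_space semi.
Proof.
move=> x y h.
have e1 : x.1 = y.1.
  have : hausdorff_space D by exact: discrete_hausdorff.
  apply => B C nB nC.
  have [z [zB zC]] := h _ _ (semi_fst_continuous nB) (semi_fst_continuous nC).
  by exists z.1.
have e2 : x.2 = y.2.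
  have : hausdorff_space V by exact: norm_hausdorff.
  apply => B C nB nC.
  have [z [zB zC]] := h _ _ (semi_snd_continuous nB) (semi_snd_continuous nC).
  by exists z.2.
by case: x y e1 e2 {h} => ? ? [? ?] /= -> ->.
Qed.

Lemma open_semi (B : set D) (C : set V) : open C -> open ([set x | B x.1 /\ C x.2] : set semi).
Proof.
move=> oC; apply: openI.
  have /continuousP := semi_fst_continuous; apply; exact: discrete_open.
by have /continuousP := semi_snd_continuous; apply.
Qed.

(** Balls with rational centres and radii [1 / k.+1] in each sheet. *)
Lemma semi_second_countable : @second_countable semi.
Proof.
pose U (i : int * 'rV[rat]_n * nat) : set semi :=
  [set x | [set i.1.1] x.1 /\ ball (map_mx ratr i.1.2 : V) i.2.+1%:R^-1 x.2].
exists (range U).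
  exact: sub_countable (card_image_le U [set: _]) (countableP _).
split.
  by move=> _ [i _ <-]; apply: open_semi; exact: ball_open.
move=> [a v] B [[B1 B2] /= [n1 n2] hB].
have /nbhs_ballP[e e0 he] := n2.
have [k _ hk] : \forall k \near \oo, k.+1%:R^-1 < e / 2.
  have := @cvg_harmonic R => /cvgrPdist_lt/(_ (e / 2)) [|k _ hk]; first by rewrite divr_gt0.
  exists k => // m /= km; have := hk m km; rewrite /harmonic /= sub0r normrN.
  exact: le_lt_trans (ler_norm _).
have {hk} := hk k (leqnn k) => hk.
have k0 : 0 < k.+1%:R^-1 :> R by rewrite invr_gt0.
have /choice[q hq] : forall j, exists q : rat, ball (v 0 j) k.+1%:R^-1 (ratr q : R).
  move=> j; have := @dense_rat R (ball (v 0 j) k.+1%:R^-1).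
  case.
  - by exists (v 0 j); exact: ballxx.
  - exact: ball_open.
  - by move=> z [hb [q _ qz]]; exists q; rewrite qz.
have bq : ball (map_mx ratr (\row_j q j) : V) k.+1%:R^-1 v.
  by split=> // i j; rewrite !mxE !ord1; apply: ball_sym; exact: hq.
exists (U (a, \row_j q j, k)).
  by split; first by exists (a, \row_j q j, k).
move=> [b w] [/= -> hw]; apply: hB; split=> /=; first exact: nbhs_singleton n1.
apply: he.
have := ball_triangle (ball_sym bq) hw => hh; apply: le_ball hh.
by rewrite (splitr e) lerD // ltW.
Qed.

End Semidirect.

(** * The nilmanifold *)

Section LieStructure.
Variables (R : realType) (n d : nat) (A : nilpotent_matrix R n d).
Local Notation D := (discrete_topology int).
Local Notation V := ('rV[R]_n).
Local Notation G := (semi A).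

(** The group is a disjoint union of copies of the vector space, indexed by the
    integers; in these charts all operations are linear. *)
Definition sheet (a : D) : chart R G n :=
  @Chart R G n [set x : G | x.1 = a] (fun x : G => x.2) (fun v => ((a, v) : G)).

Lemma sheet_img a : chart_img (sheet a) = [set: V].
Proof. by apply/seteqP; split=> // v _; exists ((a, v) : G). Qed.

Lemma sheet_chart a : is_chart (sheet a).
Proof.
split.
- have := @open_semi R n d A [set a] [set: V] openT.
  by congr open; apply/seteqP; split=> x //= [].
- by rewrite sheet_img; exact: openT.
- by case=> b v /= ->.
- by move=> x _; exact: semi_snd_continuous.
- by move=> y _; exact: (@continuous_to_semi R n d A V a id (fun x => cvg_id)).
Qed.

Lemma semi_lie : is_lie_group R G.
Proof.
split; [exact: semi_hausdorff|exact: semi_second_countable|].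
exists n, (range sheet); split.
- split.
  + by move=> _ [a _ <-]; exact: sheet_chart.
  + by move=> x; exists (sheet x.1).
  + move=> _ _ [a _ <-] [b _ <-]; apply: (@smooth_linear R n n _ _ 1%:M) => v /=.
    by rewrite mulmx1.
- move=> _ _ _ [a _ <-] [b _ <-] [c _ <-] /=; have [B hB] := zact_mx A a.
  apply: (@smooth_linear R (n + n) n _ _ (col_mx 1%:M B)) => z /=.
  by rewrite -{3}(hsubmxK z) mul_row_col mulmx1 hB.
- move=> _ _ [a _ <-] [b _ <-] /=; have [B hB] := zact_mx A (- (a : int)).
  by apply: (@smooth_linear R n n _ _ (- B)) => z /=; rewrite hB mulmxN.
Qed.

(** The kernels of the powers of the nilpotent part.  Elements of one term differ
    from their conjugates by elements of the next, since the action fixes the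
    kernel of the nilpotent part. *)
Definition filtration (j : nat) : {pred G} :=
  [pred x : G | ((x.1 : int) == 0) && (iter (d - j) (nact A) x.2 == 0)].

Lemma filtrationP j (x : G) : reflect ((x.1 : int) = 0 /\ iter (d - j) (nact A) x.2 = 0)
  (x \in filtration j).
Proof. by apply: (iffP andP) => -[/eqP h1 /eqP h2]. Qed.

Lemma iter_nactN m v : iter m (nact A) (- v) = - iter m (nact A) v.
Proof. by elim: m => // m IH; rewrite !iterS IH (shiftN (@nactD _ _ _ A)). Qed.

Lemma filtrationM j : mulg_closed (filtration j).
Proof.
move=> x y /filtrationP[x1 x2] /filtrationP[y1 y2]; apply/filtrationP.
by rewrite semi_mul /= x1 y1 zact0 iter_nactD x2 y2 !addr0.
Qed.

Lemma filtration1 j : 1%g \in filtration j.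
Proof.
apply/filtrationP; split=> //=; elim: (d - j)%N => // m IH.
by rewrite iterS IH (shift_zero (@nactD _ _ _ A)).
Qed.

Lemma filtrationV j : invg_closed (filtration j).
Proof.
move=> x /filtrationP[x1 x2]; apply/filtrationP.
by rewrite semi_inv /= x1 oppr0 zact0 iter_nactN x2 oppr0.
Qed.

HB.instance Definition _ j := isMulClosed.Build G (filtration j) (@filtrationM j).
HB.instance Definition _ j := isMul1Closed.Build G (filtration j) (@filtration1 j).
HB.instance Definition _ j := isInvClosed.Build G (filtration j) (@filtrationV j).

(** Only differences of points of the same orbit of the action remain. *)
Lemma commg_semi (x y : G) : commg x y = (0 : int,
  (zact A (- (x.1 : int) - (y.1 : int)) x.2 - zact A (- (x.1 : int)) x.2) +
  (zact A (- (y.1 : int)) y.2 - zact A (- (x.1 : int) - (y.1 : int)) y.2)) :> G.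
Proof.
case: x y => [a v] [b w]; rewrite /commg /conjg !semi_mul !semi_inv /=.
rewrite -[LHS]/(_, _); congr (_, _).
  by rewrite -[LHS]/((- (a : int)) + (- (b : int) + ((a : int) + (b : int)))); lia.
rewrite !zactD !zactN -!zactA.
rewrite (_ : - (a : int) - (b : int) + (a : int) = - (b : int)); last by lia.
rewrite addrCA [- zact A (- (a : int)) v + _]addrA [- zact A (- (a : int)) v + _]addrC.
by rewrite addrCA [- _ + zact A (- (b : int)) w]addrC.
Qed.

Lemma lower_central_filtration j (x : G) : (j < d)%N -> lower_central j.+1 x ->
  x \in filtration j.+1.
Proof.
have fixd i a v : (i < d)%N -> iter (d - i) (nact A) v = 0 ->
    iter (d - i.+1) (nact A) (zact A a v) = iter (d - i.+1) (nact A) v.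
  move=> lid h; rewrite iter_nact_zact zact_fixed // -iterS.
  by have -> : (d - i.+1).+1 = (d - i)%N by lia.
have iB m v w : iter m (nact A) (v - w) = iter m (nact A) v - iter m (nact A) w.
  by rewrite iter_nactD iter_nactN.
elim: j x => [|j IH] x jd hx; apply: hx => _ [[y z] /= [hy _] <-].
  apply/filtrationP; rewrite commg_semi; split=> //=.
  have n0 (v : V) : iter (d - 0) (nact A) v = 0 by rewrite subn0; exact: nact_nil.
  by rewrite iter_nactD !iB !(fixd 0%N) // !subrr addr0.
have /filtrationP[y1 y2] := IH _ (ltnW jd) hy.
apply/filtrationP; rewrite commg_semi; split=> //=.
rewrite y1 oppr0 !add0r [X in _ + X]subrr addr0 zact0 iB (fixd j.+1) // subrr //.
Qed.

Lemma semi_nilpotent : (0 < d)%N -> nilpotent_of_step G d.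
Proof.
move=> d0; apply/seteqP; split=> x.
  move=> hx; have : x \in filtration d.-1.+1.
    by apply: lower_central_filtration; rewrite ?prednK.
  by move=> /filtrationP[]; rewrite prednK // subnn /=; case: x {hx} => a v /= -> ->.
have L j : (0 < j)%N -> lower_central j (1%g : G) by case: j => // j _ H _; exact: gpred1.
by move=> ->; exact: L.
Qed.

Definition lattice : {pred G} := [pred x : G | integral x.2].

Lemma latticeM : mulg_closed lattice.
Proof.
move=> x y; rewrite !inE => ix iy; rewrite semi_mul /=.
by apply: integralD => //; exact: zact_integral.
Qed.

Lemma lattice1 : 1%g \in lattice.
Proof. by rewrite inE; exact: integral0. Qed.

Lemma latticeV : invg_closed lattice.
Proof. by move=> x; rewrite !inE => ix; apply: integralN; exact: zact_integral. Qed.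

HB.instance Definition _ := isMulClosed.Build G lattice latticeM.
HB.instance Definition _ := isMul1Closed.Build G lattice lattice1.
HB.instance Definition _ := isInvClosed.Build G lattice latticeV.

Definition Gamma : groupClosed G := lattice.

Lemma int_norm_lt1 (x : R) : x \is a Num.int -> `|x| < 1 -> x = 0.
Proof.
move=> /intrP[m ->]; rewrite -intr_norm (ltr_int R _ 1) => h.
by have -> : m = 0 by lia.
Qed.

Lemma Gamma_discrete : discrete_subgroup Gamma.
Proof.
move=> g ig; exists [set x : G | [set g.1] x.1 /\ ball g.2 1 x.2].
  by apply: open_semi; exact: ball_open.
apply/seteqP; split=> x /=.
  move=> [[x1 [_ bx]] ix]; case: x g x1 bx ix ig => a v [b w] /= -> bx.
  move=> /integralP iv /integralP iw; congr (_, _); apply/rowP => j.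
  have := int_norm_lt1 (rpredB (iw j) (iv j)) (bx 0 j).
  by move=> /eqP; rewrite subr_eq0 => /eqP ->.
by move=> ->; split=> //; split=> //; exact: ballxx.
Qed.

Local Open Scope quotient_scope.

Definition to_coset (x : G) : coset_space Gamma := \pi_({eq_quot (same_coset_equiv_rel Gamma)}) x.

Lemma to_coset_continuous : continuous to_coset.
Proof. exact: (@pi_continuous G {eq_quot (same_coset_equiv_rel Gamma)}). Qed.

Lemma to_coset_eq (x y : G) : (x^-1 * y)%g \in lattice -> to_coset x = to_coset y.
Proof. by move=> h; apply/eqmodP. Qed.

(** The unit cube meets every coset. *)
Lemma coset_compact : compact [set: coset_space Gamma].
Proof.
pose box := [set v : V | forall i, `[0, 1]%classic (v ord0 i)].
have cb : compact box by apply: (@rV_compact R n (fun=> `[0, 1]%classic)) => _; exact: segment_compact.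
rewrite (_ : [set: _] = (fun v : V => to_coset ((0 : int, v) : G)) @` box).
  apply: continuous_compact => //; apply: continuous_subspaceT.
  move=> v; apply: (@continuous_comp _ _ _ (fun v : V => (((0 : int) : D), v) : G) to_coset).
    exact: (@continuous_to_semi R n d A V ((0 : int) : D) id (fun x => cvg_id)).
  exact: to_coset_continuous.
apply/seteqP; split=> // x _.
pose g : G := repr (x : {eq_quot (same_coset_equiv_rel Gamma)}).
have -> : x = to_coset g by rewrite /to_coset /g reprK.
exists (\row_j (g.2 0 j - (Num.floor (g.2 0 j))%:~R)).
  move=> i /=; rewrite mxE in_itv /= subr_ge0 floor_le_tmp /= lerBlDl ltW //.
  by have := lt_succ_floor (g.2 0 i); rewrite intrD addrC.
apply: to_coset_eq; set v := \row_j _.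
suff : integral (- v + g.2) by [].
apply/integralP => j; rewrite /v !mxE opprB subrK; exact: intr_int.
Qed.

Lemma semi_nilmanifold : (0 < d)%N -> is_nilmanifold Gamma R d.
Proof.
move=> d0; split.
- exact: semi_lie.
- exact: semi_nilpotent.
- exact: Gamma_discrete.
- exact: coset_compact.
Qed.

Lemma coset_function (F : G -> R[i]) : continuous (F : G -> R[i]^o) ->
  (forall x y, y \in lattice -> F (x * y)%g = F x) ->
  exists phi : coset_space Gamma -> R[i], continuous (phi : _ -> R[i]^o) /\
    forall x, phi (to_coset x) = F x.
Proof.
move=> cF inv; have hF (x y : G) : to_coset x = to_coset y -> F x = F y.
  by move=> /eqmodP h; have := inv x _ h; rewrite mulgA mulgV mul1g.
exists (fun z => F (repr (z : {eq_quot (same_coset_equiv_rel Gamma)}))); split.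
  apply: (@repr_comp_continuous G {eq_quot (same_coset_equiv_rel Gamma)} R[i]^o F) => //.
  by move=> x y /eqP h; apply/eqP; exact: hF.
by move=> x; apply: hF; rewrite /to_coset reprK.
Qed.

End LieStructure.

(** * Sums of polynomial phases as nilsequences *)

Section PhaseNilsequence.
Variables (R : realType) (d : nat) (L : seq (R[i] * ('I_d -> R))).
Local Notation J := (size L).
Local Notation n := (J * d)%N.
Implicit Types (t : 'M[R]_(J, d)).

Definition shift_mx : 'M[R]_d := \matrix_(i, j) (i == j.+1 :> nat)%:R.

Lemma shift_mxE t r j : (t *m shift_mx) r j = \sum_(i < d | i == j.+1 :> nat) t r i.
Proof.
rewrite mxE [RHS]big_mkcond; apply: eq_bigr => i _; rewrite mxE.
by case: eqP => _; rewrite ?mulr1 ?mulr0.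
Qed.

Lemma shift_mx_nil m t r (j : 'I_d) : (d <= j + m)%N -> iter m (fun u => u *m shift_mx) t r j = 0.
Proof.
elim: m j => [|m IH] j h; first by have := ltn_ord j; lia.
rewrite iterS shift_mxE big1 // => i /eqP ij; apply: IH; lia.
Qed.

(** One row for each phase; rows are shifted independently. *)
Definition vec_shift : 'M[R]_n := lin_mx (mulmxr shift_mx).

Lemma vec_shiftE t : mxvec t *m vec_shift = mxvec (t *m shift_mx).
Proof. exact: (mul_vec_lin (mulmxr shift_mx)). Qed.

Lemma vec_shift_nil (v : 'rV[R]_n) : iter d (fun w => w *m vec_shift) v = 0.
Proof.
rewrite -(vec_mxK v); have -> m : iter m (fun w => w *m vec_shift) (mxvec (vec_mx v)) =
    mxvec (iter m (fun u => u *m shift_mx) (vec_mx v)).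
  by elim: m => // m IH; rewrite !iterS IH vec_shiftE.
rewrite -[RHS](linear0 mxvec); congr mxvec; apply/matrixP => r j.
by rewrite shift_mx_nil ?mxE // leq_addl.
Qed.

Lemma integral_mxvec t : (forall r j, t r j \is a Num.int) -> integral (mxvec t).
Proof. by move=> h; apply/integralP => k; case/mxvec_indexP: k => r j; rewrite mxvecE. Qed.

Lemma vec_shift_int (v : 'rV[R]_n) : integral v -> integral (v *m vec_shift).
Proof.
move=> /integralP iv; rewrite -(vec_mxK v) vec_shiftE; apply: integral_mxvec => r j.
rewrite shift_mxE; apply: rpred_sum => i _; rewrite mxE; exact: iv.
Qed.

Definition phase_matrix : nilpotent_matrix R n d := NilpotentMatrix vec_shift_nil vec_shift_int.
Local Notation G := (semi phase_matrix).

Definition coef (r : 'I_J) (i : 'I_d) : R := (tnth (in_tuple L) r).2 i.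

(** Row [r], column [j] of the [m]th orbit point: each column is the running
    sum of the next one, and column [0] carries the phase. *)
Definition orbit_mx (m : nat) : 'M[R]_(J, d) :=
  \matrix_(r, j) \sum_(i < d | (j <= i)%N) coef r i * 'C(m, (i - j).+1)%:R.

Definition phase_elt : G := ((1 : int), mxvec (\matrix_(r, j) coef r j)).

Lemma phase_orbit m : (phase_elt ^+ m)%g = ((m : int), mxvec (orbit_mx m)) :> G.
Proof.
elim: m => [|m IH].
  rewrite -[LHS]/((0 : int), 0); congr (_, _); rewrite -[LHS](linear0 mxvec); congr mxvec.
  by apply/matrixP => r j; rewrite !mxE big1 // => i _; rewrite bin0n mulr0.
rewrite expgS IH semi_mul -[LHS]/((1 : int) + (m : int), _ + umap (nact phase_matrix) (mxvec (orbit_mx m))).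
congr (_, _); rewrite /umap /nact vec_shiftE -!linearD; congr mxvec.
apply/matrixP => r j; rewrite mxE [X in _ + X]mxE shift_mxE !mxE addrCA.
under [RHS]eq_bigr => i _ do rewrite binS natrD mulrDr.
rewrite big_split /=; congr (_ + _).
rewrite [RHS](bigD1 j) //= subnn bin0 mulr1; congr (_ + _).
have [jd|jd] := ltnP j.+1 d.
  rewrite (big_pred1 (Ordinal jd)) => [|i]; last by [].
  rewrite mxE; apply: eq_big => i; first by rewrite ltn_neqAle andbC -val_eqE eq_sym.
  by move=> ji; congr (_ * 'C(_, _)%:R); rewrite subnSK.
rewrite !big1 // => i; last by move=> /eqP e; have := ltn_ord i; lia.
by move=> /andP[h /negP[]]; apply/eqP/val_inj => /=; have := ltn_ord i; lia.
Qed.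

Hypothesis d0 : (0 < d)%N.

Definition phase_fun (x : G) : R[i] :=
  \sum_(r < J) (tnth (in_tuple L) r).1 * ex (vec_mx (x.2 : 'rV[R]_n) r (Ordinal d0)).

Lemma phase_fun_continuous : continuous (phase_fun : G -> R[i]^o).
Proof.
apply: (@continuous_sumz G R[i]^o _ _ xpredT (fun r (x : G) =>
  (tnth (in_tuple L) r).1 * ex (vec_mx (x.2 : 'rV[R]_n) r (Ordinal d0)))) => r.
apply: (@continuous_mulC R G (fun=> (_ : R[i]^o)) (fun x => ex (vec_mx (x.2 : 'rV[R]_n) r (Ordinal d0)) : R[i]^o)).
  exact: continuous_const.
move=> x; apply: (@continuous_comp _ _ _ (fun x : G => vec_mx (x.2 : 'rV[R]_n) r (Ordinal d0)) (@ex R : R -> R[i]^o)); last exact: ex_continuous.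
have -> : (fun x : G => vec_mx (x.2 : 'rV[R]_n) r (Ordinal d0)) =
    fun x : G => (x.2 : 'rV[R]_n) 0 (mxvec_index r (Ordinal d0)).
  by apply/funext => y; rewrite mxE.
apply: (@continuous_comp _ _ _ (snd : G -> 'rV[R]_n) (fun v : 'rV[R]_n => v 0 (mxvec_index r (Ordinal d0)))).
  exact: semi_snd_continuous.
exact: coord_continuous.
Qed.

Lemma phase_fun_lattice (x y : G) : y \in @lattice R n d phase_matrix ->
  phase_fun (x * y)%g = phase_fun x.
Proof.
rewrite inE => iy; apply: eq_bigr => r _; congr (_ * _).
have /integralP i2 := @zact_integral R n d phase_matrix x.1 _ iy.
rewrite semi_mul /= linearD mxE exD; rewrite [X in _ * X]ex_int ?mulr1 //.
by rewrite mxE; exact: i2.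
Qed.

Lemma phase_fun_orbit m : phase_fun (phase_elt ^+ m)%g = newton_sum L m.
Proof.
rewrite /newton_sum big_tnth; apply: eq_bigr => r _; congr (_ * ex _).
rewrite phase_orbit /= mxvecK mxE; apply: eq_big => [//|i _].
by rewrite subn0.
Qed.

(** The value of [phase_fun] only depends on the vector modulo integers, that is on
    the coset. *)
Lemma newton_sum_basic : basic_nilsequence d (newton_sum L).
Proof.
have [phi [cphi hphi]] := coset_function phase_fun_continuous phase_fun_lattice.
exists G, (Gamma phase_matrix), phi, phase_elt, (to_coset (1%g : G)); split.
- exact: semi_nilmanifold.
- exact: cphi.
- move=> m _; rewrite /to_coset coset_actE mulg1.
  by rewrite -phase_fun_orbit -hphi.
Qed.

End PhaseNilsequence.

Lemma uniform_nilsequence (R : realType) d (b : nat -> R[i]) : (0 < d)%N ->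
  (forall e : R, 0 < e -> exists L : seq (R[i] * ('I_d -> R)),
    forall n, cab (b n - newton_sum L n) <= e) -> nilsequence d b.
Proof.
move=> d0 hb.
have e0 (m : nat) : 0 < m.+1%:R^-1 :> R by rewrite invr_gt0.
have /choice[L hL] := fun m => hb _ (e0 m).
exists (fun m => newton_sum (L m)); split; first by move=> m; exact: newton_sum_basic.
move=> e epos; have /cvgrPdist_lt/(_ e epos) := @cvg_harmonic R.
apply: filterS => m; rewrite sub0r normrN => hm n _.
rewrite normcab ltcR; apply: le_lt_trans (hL m n) _.
exact: le_lt_trans (ler_norm _) hm.
Qed.

(** * The decomposition theorem *)

Lemma size_highest_degree (R : realType) k (p : 'I_k -> {poly R}) i :
  (size (p i) <= (highest_degree p).+1)%N.
Proof.
apply: leq_trans (leqSpred _) _; rewrite ltnS.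
exact: (leq_bigmax (F := fun i => (size (p i)).-1) i).
Qed.

Lemma highest_degree_gt0 (R : realType) k (p : 'I_k -> {poly R}) : (0 < k)%N ->
  rationally_independent p -> (0 < highest_degree p)%N.
Proof.
move=> k0 hind; rewrite lt0n; apply/eqP => h0.
pose i0 := Ordinal k0.
apply: (hind (fun i => (i == i0)%:Z)); first by exists i0; rewrite eqxx.
exists (p i0)`_0; rewrite (bigD1 i0) //= mulr1z big1 ?addr0.
  by apply: size1_polyC; have := size_highest_degree p i0; rewrite h0.
by move=> i /negPf ->; rewrite mulr0z.
Qed.

Theorem theorem1p2 (R : realType) (disp : measure_display)
    (X : measurableType disp) (mu : probability X R) (T Tinv : X -> X)
    (hT : invertible_system mu T Tinv) (hE : ergodic mu T)
    (k : nat) (hk : (0 < k)%N) (p : 'I_k -> {poly R})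
    (hp : forall i, integer_polynomial (p i))
    (hind : rationally_independent p)
    (d : nat) (hd : d = highest_degree p)
    (f0 : X -> R[i]) (f : 'I_k -> X -> R[i])
    (hf0 : complex_Linfty mu f0) (hf : forall i, complex_Linfty mu (f i)) :
  exists b c : nat -> R[i],
    [/\ forall n, (1 <= n)%N -> correlation mu T Tinv p f0 f n = b n + c n,
        nilsequence d b,
        null_in_uniform_density c &
        exists (G : topologicalZmodType) (S : power_group G d -> power_group G d)
               (phi : power_group G d -> R[i]),
          [/\ compact [set: G], hausdorff_space G, unipotent_affine S,
              continuous (phi : _ -> R[i]^o) &
              forall n, (1 <= n)%N -> b n = phi (iter n S 0)]].
Proof.
have [b [hnull hL]] := correlation_decomposition hT hE hp hind hf0 hf.
have d0 : (0 < d)%N by rewrite hd; exact: highest_degree_gt0.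
have hN (e : R) : 0 < e -> exists L : seq (R[i] * ('I_d -> R)),
    forall n, cab (b n - newton_sum L n) <= e.
  move=> e0; have [L hLe] := hL e e0.
  have [|L' hL'] := @phase_sum_newton R d k p L.
    by move=> i; rewrite hd; exact: size_highest_degree.
  by exists L' => n; rewrite -hL'; exact: hLe.
have [phi [cphi hphi]] := affine_realization hN.
exists b, (fun n => correlation mu T Tinv p f0 f n - b n); split.
- by move=> n _; rewrite addrC subrK.
- exact: uniform_nilsequence.
- exact: hnull.
- exists (torus R), (@Kaffine R d), phi; split.
  + exact: torus_compact.
  + exact: torus_hausdorff.
  + exact: Kaffine_unipotent.
  + exact: cphi.
  + by move=> n _; exact: hphi.
Qed.
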